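(* Let $\mathcal A$ be a finite alphabet with $d\ge2$ elements and $(\pi_0,\pi_1)$ admissible combinatorial data. Then for Lebesgue-almost every $\lambda\in(0,\infty)^{\mathcal A}$, the interval exchange map with combinatorial data $(\pi_0,\pi_1)$ and length data $\lambda$ is of Roth type.
   Context: Interval exchange maps. Combinatorial data are two bijections $\pi_0,\pi_1:\mathcal A\to\{1,\dots,d\}$, admissible if for every $k\in\{1,\dots,d-1\}$, $\pi_0^{-1}(\{1,\dots,k\})\neq\pi_1^{-1}(\{1,\dots,k\})$. For $\lambda\in(0,\infty)^{\mathcal A}$ put $\lambda^*=\sum_\alpha\lambda_\alpha$, $I=[0,\lambda^* )$, $I_\alpha=[0,\lambda_\alpha)\times\{\alpha\}$, $j_\varepsilon(x,\alpha)=x+\sum_{\pi_\varepsilon(\beta)<\pi_\varepsilon(\alpha)}\lambda_\beta$ ($\varepsilon\in\{0,1\}$), and $T=j_1\circ j_0^{-1}:I\to I$. $T$ has the Keane property if there is no triple $(\alpha,\beta,m)$ with $\pi_0(\beta)>1$, $m\ge1$ and $T^m(j_0(0,\alpha))=j_0(0,\beta)$. Rauzy–Veech step: with $\pi_0(\alpha_0)=\pi_1(\alpha_1)=d$ and $\lambda_{\alpha_\varepsilon}>\lambda_{\alpha_{1-\varepsilon}}$, the first return map of $T$ to $[0,\lambda^*-\lambda_{\alpha_{1-\varepsilon}})$ is the i.e.m. with lengths $\hat\lambda_\alpha=\lambda_\alpha$ ($\alpha\neq\alpha_\varepsilon$), $\hat\lambda_{\alpha_\varepsilon}=\lambda_{\alpha_\varepsilon}-\lambda_{\alpha_{1-\varepsilon}}$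 and combinatorial data $\hat\pi_\varepsilon=\pi_\varepsilon$, $\hat\pi_{1-\varepsilon}(\alpha)=\pi_{1-\varepsilon}(\alpha)$ if $\pi_{1-\varepsilon}(\alpha)\le\pi_{1-\varepsilon}(\alpha_\varepsilon)$, $=\pi_{1-\varepsilon}(\alpha)+1$ if $\pi_{1-\varepsilon}(\alpha_\varepsilon)<\pi_{1-\varepsilon}(\alpha)<d$, $=\pi_{1-\varepsilon}(\alpha_\varepsilon)+1$ if $\pi_{1-\varepsilon}(\alpha)=d$. The step has name $\alpha_\varepsilon$ and matrix $V=\mathbf I+E_{\alpha_\varepsilon\alpha_{1-\varepsilon}}$ ($\lambda=V\hat\lambda$). Under the Keane property it iterates forever, giving matrices $V^{[n]}$, $n\ge1$, and every letter is the name of infinitely many steps. Accelerated algorithm: $n(0)=0$, $n(k+1)$ the largest integer such that the steps $n(k)<n\le n(k+1)$ have at most $d-1$ distinct names; $Z(k)=V^{[n(k-1)+1]}\cdots V^{[n(k)]}$, $Q(k,l)=Z(k+1)\cdots Z(l)$ ($0\le k\le l$), $Q(l)=Q(0,l)$; $\|M\|$ = sum of absolute values of entries; $S(k,l)$ the linear map of $\mathbb R^{\mathcal A}$ with matrix ${}^tQ(k,l)$, $S(l)=S(0,l)$. Roth type: Keane property and (a) for all $\varepsilon>0$ there is $C_\varepsilon$ with $\|Z(k+1)\|\le C_\varepsilon\|Q(k)\|^\varepsilon$ for all $k\ge0$; (b) with $\Gamma_*=\{v:\sum_\alpha\lambda_\alpha v_\alpha=0\}$, there exist $\theta>0,C>0$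 with $\|S(k)|_{\Gamma_*}\|\le C\|Q(k)\|^{1-\theta}$ for all $k$; (c) letting $\Gamma^{(k)}_s$ be the subspace of $v$ for which there are $\sigma,C>0$ with $\|S(k,l)v\|\le C\|S(k,l)\|^{-\sigma}\|v\|$ for all $l\ge k$ (so $S(k,l)\Gamma^{(k)}_s=\Gamma^{(l)}_s$) and $S_\flat(k,l)$ the induced isomorphism $\mathbb R^{\mathcal A}/\Gamma^{(k)}_s\to\mathbb R^{\mathcal A}/\Gamma^{(l)}_s$: for every $\varepsilon>0$ there is $C_\varepsilon$ with $\|S_\flat(k,l)^{-1}\|\le C_\varepsilon\|Q(l)\|^\varepsilon$ and $\|S(k,l)|_{\Gamma_s^{(k)}}\|\le C_\varepsilon\|Q(l)\|^\varepsilon$ for all $0\le k\le l$. *)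

(* Defs.v *)
From HB Require Import structures.
From mathcomp Require Import all_boot all_order all_algebra.
From mathcomp Require Import all_classical all_reals all_analysis.

Set Implicit Arguments.
Unset Strict Implicit.
Unset Printing Implicit Defensive.

Import Order.TTheory GRing.Theory Num.Theory.
Local Open Scope classical_set_scope.
Local Open Scope ring_scope.

Section IEM.
Variables (R : realType) (A : finType).
Local Notation d := #|A|.

(* Positions are 0-based: a letter at (paper) position j has position j-1 here. *)

Definition admissible (pi0 pi1 : A -> 'I_d) : Prop :=
  forall k : nat, (1 <= k)%N -> (k <= d.-1)%N ->
    [set a | (pi0 a < k)%N] != [set a | (pi1 a < k)%N].

Definition start (p : A -> nat) (lam : A -> R) (a : A) : R :=
  \sum_(b | (p b < p a)%N) lam b.

(** The interval exchange map T = j1 o j0^-1 on I = [0, lam_total)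
    (identity outside I, irrelevant). *)
Definition iem (p0 p1 : A -> nat) (lam : A -> R) (x : R) : R :=
  match [pick a | (start p0 lam a <= x) && (x < start p0 lam a + lam a)] with
  | Some a => x - start p0 lam a + start p1 lam a
  | None => x
  end.

Definition keane (p0 p1 : A -> nat) (lam : A -> R) : Prop :=
  ~ (exists (a b : A) (m : nat), (0 < p0 b)%N /\ (1 <= m)%N /\
       iter m (iem p0 p1 lam) (start p0 lam a) = start p0 lam b).

Record rvstate := RV { rp0 : A -> nat; rp1 : A -> nat; rlam : A -> R }.

Definition newpos (p : A -> nat) (w : A) : A -> nat := fun a =>
  if (p a <= p w)%N then p a
  else if (p a < d.-1)%N then (p a).+1
  else (p w).+1.

(* one step: new state and (name alpha_eps, loser alpha_{1-eps}).
   The tie lam_{alpha_0} = lam_{alpha_1} (never occurring under Keane)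
   is arbitrarily treated as eps = 1. *)
Definition rv_step (s : rvstate) : rvstate * option (A * A) :=
  let: RV p0 p1 lam := s in
  match [pick a | p0 a == d.-1], [pick a | p1 a == d.-1] with
  | Some a0, Some a1 =>
    if lam a1 < lam a0 then
      (RV p0 (newpos p1 a0) (fun a => if a == a0 then lam a0 - lam a1 else lam a),
       Some (a0, a1))
    else
      (RV (newpos p0 a1) p1 (fun a => if a == a1 then lam a1 - lam a0 else lam a),
       Some (a1, a0))
  | _, _ => (s, None)
  end.

Section Orbit.
Variables (pi0 pi1 : A -> 'I_d) (lam : A -> R).

Definition s0 : rvstate := RV (fun a => nat_of_ord (pi0 a)) (fun a => nat_of_ord (pi1 a)) lam.

Definition rv_state (n : nat) : rvstate := iter n (fun s => (rv_step s).1) s0.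

Definition rv_data (n : nat) : option (A * A) := (rv_step (rv_state n.-1)).2.

Definition rv_name (n : nat) : option A := omap fst (rv_data n).

Definition Vmx (n : nat) : 'M[R]_d :=
  1%:M + match rv_data n with
         | Some (w, l) => delta_mx (enum_rank w) (enum_rank l)
         | None => 0
         end.

Definition names_between (m N : nat) : {set A} :=
  [set a | [exists i : 'I_N.+1, (m < i)%N && (rv_name i == Some a)]].

Definition few_names (m : nat) : pred nat := fun N => (#|names_between m N| <= d.-1)%N.

Lemma few_names_m (m : nat) : exists N, few_names m N.
Proof.
exists m; rewrite /few_names; suff -> : names_between m m = finset.set0 by rewrite cards0.
apply/setP=> a; rewrite !inE; apply/negbTE; rewrite negb_exists.
apply/forallP=> i; by rewrite negb_and -leqNgt -ltnS ltn_ord.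
Qed.

(* n(k+1) = largest N such that the steps n(k) < n <= N have at most d-1
   distinct names (classical choice; its existence follows from Keane). *)
Definition next_n (m : nat) : nat :=
  match pselect (exists B, forall N, few_names m N -> (N <= B)%N) with
  | left H => let: exist B HB := cid H in ex_maxn (few_names_m m) HB
  | right _ => 0%N
  end.

Definition n_acc (k : nat) : nat := iter k next_n 0%N.

Definition prodmx (s : seq 'M[R]_d) : 'M[R]_d := foldr mulmx 1%:M s.

Definition Zmx (k : nat) : 'M[R]_d :=
  prodmx [seq Vmx i | i <- iota (n_acc k.-1).+1 (n_acc k - n_acc k.-1)].

Definition Qmx (k l : nat) : 'M[R]_d :=
  prodmx [seq Zmx i | i <- iota k.+1 (l - k)].

Definition mnorm (M : 'M[R]_d) : R := \sum_i \sum_j `|M i j|.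

Definition vnorm (v : A -> R) : R := \sum_a `|v a|.

Definition Sop (k l : nat) (v : A -> R) : A -> R :=
  fun a => \sum_b Qmx k l (enum_rank b) (enum_rank a) * v b.

Definition opnorm (P : set (A -> R)) (f : (A -> R) -> (A -> R)) : R :=
  sup [set vnorm (f v) | v in [set v | P v /\ vnorm v <= 1]].

Definition Gamma_star : set (A -> R) := [set v | \sum_a lam a * v a = 0].

Definition Gamma_s (k : nat) : set (A -> R) :=
  [set v | exists sigma C : R, 0 < sigma /\ 0 < C /\
     forall l, (k <= l)%N ->
       vnorm (Sop k l v) <= C * (opnorm setT (Sop k l)) `^ (- sigma) * vnorm v].

Definition qnorm (G : set (A -> R)) (v : A -> R) : R :=
  inf [set vnorm (fun a => v a + w a) | w in G].

(* ||S_flat(k,l)^{-1}||: S_flat(k,l) maps the class [v] to [S(k,l) v], so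
   its inverse maps [S(k,l) v] to [v]. *)
Definition flat_inv_norm (k l : nat) : R :=
  sup [set qnorm (Gamma_s k) v |
        v in [set v | qnorm (Gamma_s l) (Sop k l v) <= 1]].

Definition roth_type : Prop :=
  keane (fun a => nat_of_ord (pi0 a)) (fun a => nat_of_ord (pi1 a)) lam /\
  (forall eps : R, 0 < eps -> exists C : R, forall k : nat,
      mnorm (Zmx k.+1) <= C * (mnorm (Qmx 0 k)) `^ eps) /\
  (exists theta C : R, 0 < theta /\ 0 < C /\ forall k : nat,
      opnorm Gamma_star (Sop 0 k) <= C * (mnorm (Qmx 0 k)) `^ (1 - theta)) /\
  (forall eps : R, 0 < eps -> exists C : R, forall k l : nat, (k <= l)%N ->
      flat_inv_norm k l <= C * (mnorm (Qmx 0 l)) `^ eps /\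
      opnorm (Gamma_s k) (Sop k l) <= C * (mnorm (Qmx 0 l)) `^ eps).

End Orbit.

Definition box_vol (a b : A -> R) : R := \prod_x (b x - a x).

Definition lebesgue_null (N : set (A -> R)) : Prop :=
  forall eps : R, 0 < eps -> exists a b : nat -> A -> R,
    (forall n x, a n x <= b n x) /\
    N `<=` \bigcup_n [set v | forall x, a n x <= v x <= b n x] /\
    forall M : nat, \sum_(n < M) box_vol (a n) (b n) <= eps.

End IEM.

(* Main.v *)
(** Idea. The length data following a given Rauzy path form the cone M R_+^A, M
    being the product of the matrices; its volume in a bounded region is at most
    a constant times vol q = prod_a 1/q_a, q the row of column sums of M, and the
    two successors of a state share this mass exactly. As in Kerckhoff's argument,
    a small letter is unlikely to beat only small letters for long: whatever the
    past, q becomes balanced, and then a fixed loop gam with positive matrix is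
    followed, with probability bounded below and bounded growth of q. So almost
    every path is a concatenation of words ending with gam; they are independent
    up to bounded factors and the norms of their matrices have a finite moment.

    Let f be the logarithm of the sum of the absolute p x p minors, which is
    subadditive, and chi_p its growth rate. Exponential moments and
    Borel-Cantelli give f(k,l) <= (chi_p + e)(l - k) + e l + C for all k <= l, and
    a Pliss-type argument with restarts gives f(k,k+n) >= (chi_p - e) n for some k
    and all n. If p is the last point where chi_p is maximal, Cramer's rule and
    Schur complements turn these bounds into projections Psi_k with
    subexponential norms, whose kernels are the stable spaces and along which
    the cocycle has subexponential inverse: this is (c). An accelerated step
    meets at most two words, whence (a). If sum_a lam_a v_a = 0 then 0 lies in
    the range of the ratios (v Q)_a / (1 Q)_a, whose oscillation contracts along
    each occurrence of gam, whence (b). Rational independence of the lengths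
    gives the Keane property. *)

(* Volumes of cylinders are only bounded above, through an outer volume that is countably
   subadditive and not increased by shears; lower bounds concern only the combinatorial masses
   [vol], which split exactly. Near independence comes from [gam]: it makes the row q balanced up to
   a constant whatever the past, and balanced rows give comparable masses to all futures. Hence
   every estimate is uniform over balanced q.

   Heuristically chi_p is the sum of the p largest exponents. At its last maximum (order p + 1 in
   the code) the exponents used so far are nonnegative and all later ones negative: zero exponents
   stay with the expanding block, where only the inverse has to be subexponential. Passing from
   words to accelerated times costs subexponential factors, and since norms grow at least like 2 to
   the number of words, such factors are small powers of the norm. *)
Require Import Defs.
From HB Require Import structures.
From mathcomp Require Import all_boot all_order all_algebra.
From mathcomp Require Import all_classical all_reals all_analysis.
From mathcomp Require Import fingroup perm.
From mathcomp Require Import ring lra zify.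
Set Implicit Arguments.
Unset Strict Implicit.
Unset Printing Implicit Defensive.
Import Order.TTheory GRing.Theory Num.Theory.
Local Open Scope classical_set_scope.
Local Open Scope ring_scope.

(** * Rauzy moves and fair paths *)

Section Combinatorics.
Local Open Scope nat_scope.
Variables (A : finType) (x0 : A).
Local Notation d := #|A|.

(* Positions live in 'I_d.+1 rather than 'I_d so that inord applies; vrow below
   selects the genuine rows of combinatorial data. *)
Definition posmap := {ffun A -> 'I_d.+1}.
Definition cst := (posmap * posmap)%type.

Definition lastl (p : posmap) : A := odflt x0 [pick a | p a == d.-1 :> nat].
Definition updr (p : posmap) (w : A) : posmap :=
  [ffun a => inord (newpos (fun c => p c : nat) w a)].
Definition winner (b : bool) (s : cst) : A := if b then lastl s.1 else lastl s.2.
Definition loser (b : bool) (s : cst) : A := winner (~~ b) s.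
Definition cstep (b : bool) (s : cst) : cst :=
  if b then (s.1, updr s.2 (lastl s.1)) else (updr s.1 (lastl s.2), s.2).
Definition crun (s : cst) (h : seq bool) : cst := foldl (fun s b => cstep b s) s h.

Definition vrow (p : posmap) : bool := injectiveb p && [forall a, p a < d].
Definition irr (s : cst) : bool :=
  [forall k : 'I_d, (0 < k) ==> ~~ [forall a, (s.1 a < k) == (s.2 a < k)]].
Definition good (s : cst) : bool := [&& vrow s.1, vrow s.2 & irr s].

Lemma vrow_inj p : vrow p -> forall a b, p a = p b :> nat -> a = b.
Proof. by case/andP=> /injectiveP pI _ a b /val_inj/pI. Qed.

Lemma vrow_lt p : vrow p -> forall a, p a < d.
Proof. by case/andP=> _ /forallP. Qed.

Lemma vrow_surj p : vrow p -> forall k, k < d -> exists a, p a = k :> nat.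
Proof.
move=> vp k kd.
pose f a : 'I_d := Ordinal (vrow_lt vp a).
have fI : injective f by move=> a b /(congr1 val) /=; exact: vrow_inj.
have : Ordinal kd \in codom f.
  by apply: inj_card_onto => //; rewrite card_ord.
by case/codomP=> a /(congr1 val) /= ->; exists a.
Qed.

Lemma card_pos : 0 < d. Proof. by apply/card_gt0P; exists x0. Qed.

Lemma lastlE p : vrow p -> p (lastl p) = d.-1 :> nat.
Proof.
move=> vp; rewrite /lastl; case: pickP => [a /eqP //|H].
have [|a pa] := vrow_surj vp (k := d.-1); first by rewrite ltn_predL card_pos.
by have := H a; rewrite pa eqxx.
Qed.

Lemma lastl_uniq p a : vrow p -> p a = d.-1 :> nat -> a = lastl p.
Proof. by move=> vp pa; apply: (vrow_inj vp); rewrite pa lastlE. Qed.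

Lemma updrE p w a : vrow p -> updr p w a = newpos (fun c => p c : nat) w a :> nat.
Proof.
move=> vp; rewrite ffunE inordK // /newpos.
have := vrow_lt vp a; have := vrow_lt vp w; do ?[case: ifP => ?]; lia.
Qed.

Lemma vrow_updr p w : vrow p -> vrow (updr p w).
Proof.
move=> vp; apply/andP; split.
  apply/injectiveP => a b /(congr1 val) /=; rewrite !updrE // /newpos => E.
  apply: (vrow_inj vp); move: E.
  have := vrow_lt vp a; have := vrow_lt vp b; have := vrow_lt vp w.
  do ?[case: ifP => ?]; lia.
apply/forallP=> a; rewrite updrE // /newpos.
have := vrow_lt vp a; have := vrow_lt vp w; do ?[case: ifP => ?]; lia.
Qed.

Lemma good_step b s : good s -> good (cstep b s).
Proof.
case/and3P=> v1 v2 /forallP irs.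
(* Since [k < d], the last letter [w] of [p] is outside the common initial segment, so [p' w >= k].
   As [newpos] leaves positions up to that of [w] alone, the first [k] letters were already the same
   before the move. *)
have key (p p' : posmap) (w : A) (k : 'I_d) : vrow p -> vrow p' -> p w = d.-1 :> nat ->
    0 < k -> (forall a, (p a < k) = (updr p' w a < k)) -> (forall a, (p a < k) = (p' a < k)).
  move=> vp vp' pw k0 H a; rewrite H updrE // /newpos.
  have := H w; rewrite pw updrE // /newpos leqnn.
  have := ltn_ord k; have := vrow_lt vp' a.
  do ?[case: ifP => ?]; lia.
rewrite /good /cstep; case: b => /=.
- rewrite v1 vrow_updr //=; apply/forallP=> k; apply/implyP=> k0.
  apply/negP=> /forallP H; have := irs k; rewrite k0 /= => /negP; apply.
  apply/forallP=> a; apply/eqP; apply: (key _ _ (lastl s.1)) => //.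
    exact: lastlE.
  by move=> c; move/eqP: (H c).
- rewrite vrow_updr // v2 /=; apply/forallP=> k; apply/implyP=> k0.
  apply/negP=> /forallP H; have := irs k; rewrite k0 /= => /negP; apply.
  apply/forallP=> a; rewrite eq_sym; apply/eqP; apply: (key _ _ (lastl s.2)) => //.
    exact: lastlE.
  by move=> c; move/eqP: (H c) => /= ->.
Qed.

Lemma good_run h s : good s -> good (crun s h).
Proof. by elim: h s => //= b h IH s gs; apply: IH; apply: good_step. Qed.

Lemma updr_inj p p' w : vrow p -> vrow p' -> updr p w = updr p' w -> p = p'.
Proof.
move=> vp vp' E; apply/ffunP=> a; apply: ord_inj.
have Ew : p w = p' w :> nat.
  have := congr1 (fun r : posmap => r w : nat) E.
  by rewrite !updrE // /newpos !leqnn.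
have := congr1 (fun r : posmap => r a : nat) E; rewrite !updrE // /newpos Ew.
have := vrow_lt vp a; have := vrow_lt vp' a.
do ?[case: ifP => ?]; lia.
Qed.

Lemma cstep_inj b s s' : good s -> good s' -> cstep b s = cstep b s' -> s = s'.
Proof.
case/and3P=> v1 v2 _ /and3P [v1' v2' _]; rewrite /cstep.
case: s v1 v2 => s1 s2 /= v1 v2; case: s' v1' v2' => s1' s2' /= v1' v2'.
case: b => -[]; [move=> <- /updr_inj -> // | move=> H E; subst s2'].
by rewrite (updr_inj v1 v1' H).
Qed.

Lemma crun_cat s h h' : crun s (h ++ h') = crun (crun s h) h'.
Proof. exact: foldl_cat. Qed.

Lemma crun_rcons s h b : crun s (rcons h b) = cstep b (crun s h).
Proof. by rewrite -cats1 crun_cat. Qed.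

(* On the finite set of irreducible data each of the two moves is a
   permutation, hence a positive power of it inverts it. *)
Lemma crun_return s h : good s -> exists h', crun (crun s h) h' = s.
Proof.
elim: h s => [|b h IH] s gs /=; first by exists [::].
have [h1 E1] := IH _ (good_step b gs).
pose f s := if good s then cstep b s else s.
have fI : injective f.
  move=> u v; rewrite /f; case: ifP => gu; case: ifP => gv //.
  - exact: cstep_inj.
  - by move=> E; have := good_step b gu; rewrite E gv.
  - by move=> E; have := good_step b gv; rewrite -E gu.
have C : fconnect f (cstep b s) s.
  rewrite fconnect_sym //; have -> : cstep b s = f s by rewrite /f gs.
  exact: fconnect1.
have [n En] : exists n, iter n f (cstep b s) = s.
  by exists (findex f (cstep b s) s); apply: iter_findex.
exists (h1 ++ nseq n b); rewrite crun_cat E1 -{}[RHS]En.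
elim: n (cstep b s) (good_step b gs) => //= n IHn u gu.
by rewrite -iterS iterSr {2}/f gu IHn //; apply: good_step.
Qed.

Lemma card_vrow_lt p k : vrow p -> k <= d -> #|[pred a | p a < k]| = k.
Proof.
move=> vp kd; pose f a : 'I_d := Ordinal (vrow_lt vp a).
have fI : injective f by move=> a b /(congr1 val) /=; exact: vrow_inj.
have fB : bijective f by apply: inj_card_bij => //; rewrite card_ord.
rewrite (eq_card (B := f @^-1: [set i : 'I_d | i < k]%SET)); last by move=> a; rewrite !inE.
rewrite (on_card_preimset (onW_bij _ fB)) -sum1_card (eq_bigl (fun i : 'I_d => i < k)).
  by rewrite -(big_ord_widen _ (fun=> 1)) // sum1_card card_ord.
by move=> i; rewrite inE.
Qed.

Lemma vrow_initial p (D : pred A) : vrow p ->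
  (forall x a, D x -> ~~ D a -> p x < p a) -> forall a, (p a < #|D|) = D a.
Proof.
move=> vp H a; have pd := vrow_lt vp a.
case Da: (D a).
  apply/idP; rewrite -[X in X <= _](card_vrow_lt vp (k := (p a).+1)) //.
  apply: subset_leq_card; apply/fintype.subsetP=> y; rewrite !inE ltnS => pya.
  rewrite unfold_in; apply: contraT => nDy; have := H _ _ Da nDy; lia.
suff H2 : #|D| <= p a by rewrite ltnNge H2.
rewrite -[X in _ <= X](card_vrow_lt vp (ltnW pd)).
apply: subset_leq_card; apply/fintype.subsetP=> y; rewrite !inE => Dy.
by apply: H => //; rewrite Da.
Qed.

(** A letter that is last in both rows would make the first [d - 1] letters a common initial
    segment. *)
Lemma winner_neq_loser b s : good s -> irr s -> 1 < d -> winner b s != loser b s.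
Proof.
case/and3P=> v1 v2 _ /forallP irs d1; apply/eqP => E.
have E' : lastl s.1 = lastl s.2 by move: E; rewrite /loser /winner; case: b.
have kd : d.-1 < d by rewrite ltn_predL card_pos.
have := irs (Ordinal kd); rewrite /= -subn1 subn_gt0 d1 /= => /negP; apply.
apply/forallP => a; apply/eqP.
have := vrow_lt v1 a; have := vrow_lt v2 a => l2 l1.
have [->|na] := eqVneq a (lastl s.1); first by rewrite lastlE // E' lastlE.
have n1 : (s.1 a : nat) != d.-1.
  by apply: contra na => /eqP /(lastl_uniq v1) ->.
have n2 : (s.2 a : nat) != d.-1.
  by apply: contra na => /eqP /(lastl_uniq v2) ->; rewrite E'.
have {}n1 : s.1 a < d.-1 by rewrite ltn_neqAle n1 -ltnS prednK ?card_pos.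
have {}n2 : s.2 a < d.-1 by rewrite ltn_neqAle n2 -ltnS prednK ?card_pos.
by rewrite subn1 n1 n2.
Qed.

Lemma evconst (f : nat -> nat) N B : (forall n, N <= n -> f n <= f n.+1) ->
  (forall n, f n <= B) -> exists2 M, N <= M & forall n, M <= n -> f n = f M.
Proof.
move=> fh fB.
have mono n m : N <= n -> n <= m -> f n <= f m.
  move=> Nn; elim: m => [|m IH]; first by rewrite leqn0 => /eqP <-.
  rewrite leq_eqVlt => /orP [/eqP -> //|]; rewrite ltnS => nm.
  by apply: leq_trans (IH nm) (fh _ _); apply: leq_trans nm.
have [k] := ubnP (B - f N); elim: k N fh mono => // k IH N fh mono.
have [[n [Nn fn]]|H] := pselect (exists n, N <= n /\ f N < f n).
  move=> Bk; have [||| M nM HM] := IH n.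
  - by move=> m nm; apply: fh; apply: leq_trans nm.
  - by move=> m m' nm; apply: mono; apply: leq_trans nm.
  - by have := fB n; lia.
  by exists M => //; apply: leq_trans nM.
move=> _; exists N => // n Nn; apply/eqP; rewrite eqn_leq (mono N n) // andbT leqNgt.
by apply/negP=> lt; apply: H; exists n.
Qed.

Lemma evfin (Q : A -> nat -> Prop) : (forall a, exists N, forall n, N <= n -> Q a n) ->
  exists N, forall n a, N <= n -> Q a n.
Proof.
move=> /choice [f Hf]; exists (\max_a f a) => n a le.
by apply: Hf; apply: leq_trans le; apply: leq_bigmax.
Qed.

(** * A fair path, along which every letter wins infinitely often *)

Section Fair.
Variables (s : cst) (gs : good s) (d2 : 1 < d).

(** The second component counts past wins; of the two last letters, the one with fewer wins is made
    to win. *)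
Definition fstep (x : cst * (A -> nat)) : cst * (A -> nat) :=
  let b := x.2 (lastl x.1.1) <= x.2 (lastl x.1.2) in
  (cstep b x.1, fun a => x.2 a + (a == winner b x.1)).
Definition fs n := iter n fstep (s, fun=> 0).
Definition fbit n := (fs n).2 (lastl (fs n).1.1) <= (fs n).2 (lastl (fs n).1.2).
Definition fw n := winner (fbit n) (fs n).1.
Definition fl n := loser (fbit n) (fs n).1.

Lemma fsS n : (fs n.+1).1 = cstep (fbit n) (fs n).1.
Proof. by []. Qed.

Lemma fs_run n : (fs n).1 = crun s (mkseq fbit n).
Proof. by elim: n => // n IH; rewrite mkseqS crun_rcons -IH fsS. Qed.

Lemma fs_good n : good (fs n).1.
Proof. by rewrite fs_run good_run. Qed.

Lemma fcS n a : (fs n.+1).2 a = (fs n).2 a + (a == fw n).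
Proof. by []. Qed.

Lemma fc_mono n m a : n <= m -> (fs n).2 a <= (fs m).2 a.
Proof.
elim: m => [|m IH]; first by rewrite leqn0 => /eqP ->.
rewrite leq_eqVlt => /orP [/eqP -> //|]; rewrite ltnS => /IH le.
by rewrite fcS; apply: leq_trans le (leq_addr _ _).
Qed.

Lemma fc_le n : (fs n).2 (fw n) <= (fs n).2 (fl n).
Proof.
rewrite /fw /fl /loser /winner; have : fbit n = ((fs n).2 (lastl (fs n).1.1) <= (fs n).2 (lastl (fs n).1.2)) by [].
by case: (fbit n) => //= /esym /negbT; rewrite -ltnNge => /ltnW.
Qed.

Definition io a := forall N, exists2 n, N <= n & fw n = a.

Lemma io_unbounded a : io a -> forall K, exists N, K <= (fs N).2 a.
Proof.
move=> Pa; elim=> [|K [N HN]]; first by exists 0.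
have [n Nn wna] := Pa N; exists n.+1; rewrite fcS -wna eqxx addn1 ltnS.
by rewrite wna; apply: leq_trans HN (fc_mono _ Nn).
Qed.

(** By [fc_le] a loser has won at least as often as its winner. Letters that win finitely often have
    bounded counts, which the others eventually exceed, so in the long run such a letter cannot even
    lose. *)
Lemma io_players : exists N, forall n, N <= n -> io (fw n) /\ io (fl n).
Proof.
have [N1 H1] : exists N, forall n a, N <= n -> ~ io a -> fw n <> a.
  apply: (evfin (Q := fun a n => ~ io a -> fw n <> a)) => a.
  have [Pa|nPa] := pselect (io a); first by exists 0.
  have [N HN] : exists N, ~ exists2 n, N <= n & fw n = a by apply/existsNP.
  by exists N => n Nn _ E; apply: HN; exists n.
pose B := \max_a (fs N1).2 a.
have cB a n : ~ io a -> (fs n).2 a <= B.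
  move=> nPa; apply: (@leq_trans ((fs N1).2 a)); last exact: leq_bigmax.
  have [le|/ltnW le] := leqP n N1; first exact: fc_mono.
  rewrite -(subnKC le); elim: (n - N1) => [|m IH]; first by rewrite addn0.
  rewrite addnS fcS; case: eqP => [E|]; last by rewrite addn0.
  by case: (H1 (N1 + m) a _ nPa); rewrite ?leq_addr.
have [N2 H2] : exists N, forall n a, N <= n -> io a -> B < (fs n).2 a.
  apply: (evfin (Q := fun a n => io a -> B < (fs n).2 a)) => a.
  have [Pa|nPa] := pselect (io a); last by exists 0.
  have [N HN] := io_unbounded Pa B.+1.
  by exists N => n Nn _; apply: leq_trans HN (fc_mono _ Nn).
exists (maxn N1 N2) => n; rewrite geq_max => /andP [n1 n2].
have Pw : io (fw n) by apply: contrapT => nP; exact: (H1 n _ n1 nP).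
split=> //; apply: contrapT => nP.
by have := fc_le n; rewrite leqNgt (leq_ltn_trans (cB _ _ nP)) // H2.
Qed.

(** Let [D] be the letters that win only finitely often. Eventually none of them is last in either
    row, so their positions can only increase and become constant. From then on a winner stands to
    the right of all of [D] in both rows, since otherwise it would push a letter of [D]; this
    persists, and every letter outside [D] wins again. So [D] becomes a common initial segment,
    against irreducibility. *)
Lemma fair_io a : io a.
Proof.
apply: contrapT => nPa.
have [N0 H0] := io_players.
pose D := [pred x | ~~ `[< io x >]].
have DP x : ~~ D x -> io x by rewrite /= negbK => /asboolP.
have nD x : D x -> ~ io x by move=> /= /asboolP.
have g n := fs_good n; have v1 n : vrow (fs n).1.1 by case/and3P: (g n).
have v2 n : vrow (fs n).1.2 by case/and3P: (g n).
have notlast x n : D x -> N0 <= n -> (fs n).1.1 x < d.-1 /\ (fs n).1.2 x < d.-1.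
  move=> Dx /H0 [Pw Pl].
  have i1 : io (lastl (fs n).1.1) by move: Pw Pl; rewrite /fw /fl /loser /winner; case: fbit.
  have i2 : io (lastl (fs n).1.2) by move: Pw Pl; rewrite /fw /fl /loser /winner; case: fbit.
  have l1 := vrow_lt (v1 n) x; have l2 := vrow_lt (v2 n) x.
  have n1 : (fs n).1.1 x <> d.-1 :> nat by move/(lastl_uniq (v1 n)) => E; apply: (nD _ Dx); rewrite E.
  have n2 : (fs n).1.2 x <> d.-1 :> nat by move/(lastl_uniq (v2 n)) => E; apply: (nD _ Dx); rewrite E.
  by split; lia.
have step n : (fs n.+1).1.1 = (if fbit n then (fs n).1.1 else updr (fs n).1.1 (fw n)) /\
              (fs n.+1).1.2 = (if fbit n then updr (fs n).1.2 (fw n) else (fs n).1.2).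
  by rewrite fsS /cstep /fw /winner; case: (fbit n).
pose F n := \sum_(x | D x) ((fs n).1.1 x + (fs n).1.2 x).
have Fx x n : D x -> N0 <= n -> (fs n).1.1 x <= (fs n.+1).1.1 x /\ (fs n).1.2 x <= (fs n.+1).1.2 x.
  move=> Dx Nn; have [l1 l2] := notlast x n Dx Nn.
  have [-> ->] := step n; case: (fbit n); rewrite !updrE // /newpos; split => //.
    by rewrite l2; case: ifP.
  by rewrite l1; case: ifP.
have [N3 N03 H3] : exists2 M, N0 <= M & forall n, M <= n -> F n = F M.
  apply: (@evconst F N0 (\sum_(x | D x) (d + d))).
    move=> n Nn; apply: leq_sum => x Dx; have [? ?] := Fx x n Dx Nn.
    exact: leq_add.
  by move=> n; apply: leq_sum => x _; apply: leq_add; apply: ltnW; apply: vrow_lt.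
have Fc x n : D x -> N3 <= n -> (fs n.+1).1.1 x = (fs n).1.1 x /\ (fs n.+1).1.2 x = (fs n).1.2 x.
  move=> Dx Nn; have E : F n.+1 = F n by rewrite H3 ?(leq_trans Nn) // H3.
  have N0n := leq_trans N03 Nn.
  have G y : D y -> (fs n).1.1 y + (fs n).1.2 y <= (fs n.+1).1.1 y + (fs n.+1).1.2 y.
    by move=> Dy; have [? ?] := Fx y n Dy N0n; apply: leq_add.
  have Ex : (fs n.+1).1.1 x + (fs n.+1).1.2 x <= (fs n).1.1 x + (fs n).1.2 x.
    have FE m : F m = ((fs m).1.1 x + (fs m).1.2 x) +
        \sum_(i | D i && (i != x)) ((fs m).1.1 i + (fs m).1.2 i).
      by rewrite /F (bigD1 x).
    move: E; rewrite !FE.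
    have : \sum_(i | D i && (i != x)) ((fs n).1.1 i + (fs n).1.2 i) <=
      \sum_(i | D i && (i != x)) ((fs n.+1).1.1 i + (fs n.+1).1.2 i).
      by apply: leq_sum => y /andP [Dy _]; apply: G.
    lia.
  have [? ?] := Fx x n Dx N0n; split; apply: ord_inj; lia.
pose Rt n c := forall x, D x -> (fs n).1.1 x < (fs n).1.1 c /\ (fs n).1.2 x < (fs n).1.2 c.
have Rw n : N3 <= n -> Rt n (fw n).
  move=> Nn x Dx; have N0n := leq_trans N03 Nn.
  have [l1 l2] := notlast x n Dx N0n; have [c1 c2] := Fc x n Dx Nn.
  have xw : x <> fw n by move=> E; apply: (nD x Dx); rewrite E; case: (H0 n N0n).
  have w1 := lastlE (v1 n); have w2 := lastlE (v2 n).
  have [e1 e2] := step n; move: c1 c2; rewrite e1 e2 => c1 c2.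
  have m1 : (fs n).1.1 x <> (fs n).1.1 (fw n) :> nat by move/(vrow_inj (v1 n)).
  have m2 : (fs n).1.2 x <> (fs n).1.2 (fw n) :> nat by move/(vrow_inj (v2 n)).
  move: c1 c2 m1 m2; rewrite /fw /winner; case: (fbit n) => c1 c2 m1 m2.
    split; first by rewrite w1.
    have := updrE (lastl (fs n).1.1) x (v2 n); rewrite c2 /newpos l2; case: ifP => ?; lia.
  split; last by rewrite w2.
  have := updrE (lastl (fs n).1.2) x (v1 n); rewrite c1 /newpos l1; case: ifP => ?; lia.
have RS n c : N3 <= n -> Rt n c -> Rt n.+1 c.
  move=> Nn Rc x Dx; have [c1 c2] := Fc x n Dx Nn; have [r1 r2] := Rc x Dx.
  have [q1 q2] := Rw n Nn x Dx.
  rewrite c1 c2; have [-> ->] := step n.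
  case: (fbit n); split => //; rewrite updrE // /newpos; do ?[case: ifP => ?]; lia.
have RM n m c : N3 <= n -> n <= m -> Rt n c -> Rt m c.
  move=> Nn; elim: m => [|m IH]; first by rewrite leqn0 => /eqP ->.
  rewrite leq_eqVlt => /orP [/eqP -> //|]; rewrite ltnS => nm Rc.
  by apply: RS; [apply: leq_trans nm|apply: IH].
have [N4 H4] : exists N, forall n c, N <= n -> ~~ D c -> Rt n c.
  apply: (evfin (Q := fun c n => ~~ D c -> Rt n c)) => c.
  case: (boolP (D c)) => [_|/DP Pc]; first by exists 0.
  have [m Nm E] := Pc N3; exists m => n mn _; apply: (RM m) => //.
  by rewrite -E; apply: Rw.
case/and3P: (g N4) => _ _ /forallP irs.
have Da : D a by rewrite /=; apply/negP=> /asboolP.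
have Dw : ~~ D (fw N0) by rewrite /= negbK; apply/asboolP; case: (H0 N0 (leqnn _)).
have kd : #|D| < d.
  have D0 : 0 < #|[predC D]| by apply/card_gt0P; exists (fw N0); rewrite !inE.
  by rewrite -(cardC D) -[X in X < _]addn0 ltn_add2l; apply: leq_trans D0 _; apply: eq_leq; apply: eq_card.
have := irs (Ordinal kd); have -> /= : 0 < #|D| by apply/card_gt0P; exists a.
move/negP; apply; apply/forallP=> c; apply/eqP.
rewrite (vrow_initial (v1 N4) (D := D)) ?(vrow_initial (v2 N4) (D := D)) //.
  by move=> x y Dx nDy; have [] := H4 N4 y (leqnn _) nDy x Dx.
by move=> x y Dx nDy; have [] := H4 N4 y (leqnn _) nDy x Dx.
Qed.

(* Support of the row of index a in the matrix products V_1 .. V_n. *)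
Fixpoint fsupp (a : A) (n : nat) : {set A} :=
  if n is m.+1 then
    if fw m \in fsupp a m then fl m |: fsupp a m else fsupp a m
  else [set a]%SET.

Lemma fsupp_sub a n m : n <= m -> fsupp a n \subset fsupp a m.
Proof.
elim: m => [|m IH]; first by rewrite leqn0 => /eqP ->.
rewrite leq_eqVlt => /orP [/eqP -> //|]; rewrite ltnS => /IH sub /=.
by case: ifP => // _; apply: (fintype.subset_trans sub); apply: finset.subsetUr.
Qed.

(** The winner stays at the end of its row, so it plays again in the next step. *)
Lemma fwS n : fw n.+1 = fw n \/ fl n.+1 = fw n.
Proof.
rewrite /fl /loser /fw /winner fsS /cstep; case: (fbit n) => /=; case: (fbit n.+1) => /=; by [left|right].
Qed.

(** The support of row [a] stabilises to a set [S]. If [x] were outside [S], then after a win of [x]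
    all winners would stay outside [S]: each winner plays the next step, and if it lost to a letter
    of [S] it would join [S]. But [a] lies in [S] and wins infinitely often. *)
Lemma fsupp_full : exists N, forall n a, N <= n -> fsupp a n = [set: A]%SET.
Proof.
apply: (evfin (Q := fun a n => fsupp a n = [set: A]%SET)) => a.
have [M _ HM] : exists2 M, 0 <= M & forall n, M <= n -> #|fsupp a n| = #|fsupp a M|.
  apply: (@evconst (fun n => #|fsupp a n|) 0 d).
    by move=> n _; apply: subset_leq_card; apply: fsupp_sub.
  by move=> n; apply: max_card.
have HS n : M <= n -> fsupp a n = fsupp a M.
  move=> Mn; apply/esym/eqP; rewrite eqEcard fsupp_sub //=.
  by rewrite HM.
exists M => n /HS ->; apply/setP=> x; rewrite inE; apply: contraT => xS.
have [n0 Mn0 wx] := fair_io x M.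
have out n1 : n0 <= n1 -> fw n1 \notin fsupp a M.
  move=> le; rewrite -(subnKC le); elim: (n1 - n0) => [|k IH]; first by rewrite addn0 wx.
  rewrite addnS; apply/negP => win.
  have Mk : M <= n0 + k by rewrite (leq_trans Mn0) // leq_addr.
  have [E|E] := fwS (n0 + k); first by rewrite -E win in IH.
  have := HS (n0 + k).+2 (leq_trans Mk (leq_trans (leqnSn _) (leqnSn _))).
  rewrite /= -/(fsupp a (n0 + k).+1) (HS (n0 + k).+1) ?(leq_trans Mk) // win.
  by move/setP/(_ (fl (n0 + k).+1)); rewrite setU11 E (negbTE IH).
have [n1 le wa] := fair_io a n0.
have := out _ le; rewrite wa => /negP; case.
by apply: (fintype.subsetP (fsupp_sub a (leq0n M))); rewrite /= inE.
Qed.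

End Fair.
End Combinatorics.

(** * Volumes of cylinders *)

Section Paths.
Variables (R : realType) (A : finType) (x0 : A).
Hypothesis d2 : (1 < #|A|)%N.
Local Notation d := #|A|.
Local Notation wn := (winner x0).
Local Notation ls := (loser x0).
Local Notation cstep := (cstep x0).
Local Notation crun := (crun x0).
Implicit Types (s : cst A) (q : A -> R) (h g : seq bool) (b : bool).

(* q stands for the row of column sums of V_1 .. V_n; vol q is proportional to
   the measure of the length data following the corresponding path. *)
Definition qstep b s q : A -> R :=
  fun a => if a == ls b s then q a + q (wn b s) else q a.
Fixpoint qrun s q h : A -> R :=
  if h is b :: h' then qrun (cstep b s) (qstep b s q) h' else q.
Definition qpos q := forall a, 0 < q a.
Definition tot q : R := \sum_a q a.
Definition vol q : R := \prod_a (q a)^-1.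

Lemma qrun_cat s q h h' : qrun s q (h ++ h') = qrun (crun s h) (qrun s q h) h'.
Proof. by elim: h s q => //= b h IH s q; rewrite IH. Qed.

Lemma qrun_rcons s q h b : qrun s q (rcons h b) = qstep b (crun s h) (qrun s q h).
Proof. by rewrite -cats1 qrun_cat. Qed.

Lemma qstep_pos b s q : qpos q -> qpos (qstep b s q).
Proof. by move=> qp a; rewrite /qstep; case: ifP => // _; apply: addr_gt0. Qed.

Lemma qrun_pos s q h : qpos q -> qpos (qrun s q h).
Proof. by elim: h s q => //= b h IH s q qp; apply: IH; apply: qstep_pos. Qed.

Lemma qstep_ge b s q a : qpos q -> q a <= qstep b s q a.
Proof. by move=> qp; rewrite /qstep; case: ifP => // _; rewrite lerDl ltW. Qed.

Lemma qrun_ge s q h a : qpos q -> q a <= qrun s q h a.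
Proof.
elim: h s q => //= b h IH s q qp; apply: le_trans (IH _ _ (qstep_pos _ _ qp)).
exact: qstep_ge.
Qed.

Lemma tot_step b s q : tot (qstep b s q) = tot q + q (wn b s).
Proof.
rewrite /tot (bigD1 (ls b s)) //= [in RHS](bigD1 (ls b s)) //= /qstep eqxx.
rewrite (eq_bigr q) => [|a /negbTE -> //]; ring.
Qed.

Lemma tot_ge q a : qpos q -> q a <= tot q.
Proof.
move=> qp; rewrite /tot (bigD1 a) //= lerDl; apply: sumr_ge0 => c _; exact: ltW.
Qed.

Lemma tot_gt0 q : qpos q -> 0 < tot q.
Proof. by move=> qp; apply: lt_le_trans (tot_ge x0 qp). Qed.

Lemma tot_run s q h : qpos q -> tot q <= tot (qrun s q h).
Proof. by move=> qp; apply: ler_sum => a _; apply: qrun_ge. Qed.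

Lemma tot_run_le s q h : qpos q -> tot (qrun s q h) <= 2 ^+ size h * tot q.
Proof.
elim: h s q => [|b h IH] s q qp /=; first by rewrite mul1r.
apply: le_trans (IH _ _ (qstep_pos _ _ qp)) _.
rewrite tot_step exprSr -mulrA ler_pM2l ?exprn_gt0 // mulr2n mulrDl mul1r.
by rewrite lerD2l tot_ge.
Qed.

Lemma vol_gt0 q : qpos q -> 0 < vol q.
Proof. by move=> qp; apply: prodr_gt0 => a _; rewrite invr_gt0. Qed.

Lemma vol_scale q q' t : qpos q -> qpos q' -> (forall a, q' a <= t * q a) ->
  vol q <= t ^+ d * vol q'.
Proof.
move=> qp qp' H; have t0 : 0 < t.
  by have := lt_le_trans (qp' x0) (H x0); rewrite pmulr_lgt0.
rewrite /vol -prodr_const -big_split /=; apply: ler_prod => a _.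
rewrite invr_ge0 ltW //= ler_pdivlMr // mulrC ler_pdivrMr // mulrC.
Qed.

Lemma vol_anti q q' : qpos q -> qpos q' -> (forall a, q a <= q' a) -> vol q' <= vol q.
Proof.
move=> qp qp' H; have := @vol_scale q' q 1 qp' qp; rewrite expr1n mul1r; apply.
by move=> a; rewrite mul1r.
Qed.

Lemma vol_run s q h : qpos q -> vol (qrun s q h) <= vol q.
Proof.
by move=> qp; apply: vol_anti => //; [apply: qrun_pos|move=> a; apply: qrun_ge].
Qed.

Lemma vol_step b s q : good s -> qpos q ->
  vol (qstep b s q) = vol q * (q (ls b s) / (q (ls b s) + q (wn b s))).
Proof.
move=> gs qp; rewrite /vol (bigD1 (ls b s)) //= [in RHS](bigD1 (ls b s)) //=.
rewrite [in LHS](eq_bigr (fun a => (q a)^-1)); last by move=> a /negbTE na; rewrite /qstep na.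
rewrite {1}/qstep eqxx; set P := \prod_(i | _) _.
have := qp (ls b s); have := qp (wn b s); move: (q (ls b s)) (q (wn b s)) => u v v0 u0.
by field; rewrite !lt0r_neq0 // addr_gt0.
Qed.

(* 1/(x(x+y)) + 1/((x+y)y) = 1/(xy): the cones of the two successors of a
   state subdivide its cone. *)
Lemma vol_split s q : good s -> qpos q ->
  vol (qstep true s q) + vol (qstep false s q) = vol q.
Proof.
move=> gs qp; rewrite !vol_step //.
have -> : wn false s = ls true s by [].
have -> : ls false s = wn true s by [].
have := qp (ls true s); have := qp (wn true s).
move: (q (ls true s)) (q (wn true s)) => u v v0 u0.
by field; rewrite addrC !lt0r_neq0 // addr_gt0.
Qed.

Section Base.
Variable s0 : cst A.
Hypothesis gs0 : good s0.

Local Notation St := (crun s0).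
Local Notation Q := (qrun s0).

Lemma St_good h : good (St h).
Proof. exact: good_run. Qed.

(* Mass of the continuations of h that reach G in at most N steps before the
   total exceeds L. *)
Fixpoint hit q (L : R) (G : pred (seq bool)) N h : R :=
  if L < tot (Q q h) then 0 else if G h then vol (Q q h)
  else if N is n.+1 then hit q L G n (rcons h true) + hit q L G n (rcons h false)
  else 0.

Lemma vol_children q h : qpos q ->
  vol (Q q (rcons h true)) + vol (Q q (rcons h false)) = vol (Q q h).
Proof.
by move=> qp; rewrite !qrun_rcons vol_split //; [apply: St_good|apply: qrun_pos].
Qed.

Lemma Qpos q h : qpos q -> qpos (Q q h).
Proof. exact: qrun_pos. Qed.

Lemma hit_ge0 q L G N h : qpos q -> 0 <= hit q L G N h.
Proof.
move=> qp; elim: N h => [|N IH] h /=; do 2 case: ifP => // _.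
- by rewrite ltW // vol_gt0 //; apply: Qpos.
- by rewrite ltW // vol_gt0 //; apply: Qpos.
- by rewrite addr_ge0.
Qed.

Lemma hit_le q L G N h : qpos q -> hit q L G N h <= vol (Q q h).
Proof.
move=> qp; have v0 h' : 0 <= vol (Q q h') by rewrite ltW // vol_gt0 //; apply: Qpos.
elim: N h => [|N IH] h /=; do 2 case: ifP => // _.
by rewrite -vol_children // lerD.
Qed.

Lemma hit_monoN q L G N M h : qpos q -> (N <= M)%N -> hit q L G N h <= hit q L G M h.
Proof.
move=> qp; elim: N M h => [|N IH] [|M] h //= NM; do 2 case: ifP => // _.
- by rewrite addr_ge0 // hit_ge0.
- by rewrite lerD // IH.
Qed.

Lemma hit_monoL q L L' G N h : qpos q -> L <= L' -> hit q L G N h <= hit q L' G N h.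
Proof.
move=> qp LL; elim: N h => [|N IH] h /=; case: ifP => [_|/negbT].
- case: ifP => // _; case: ifP => // _; rewrite ltW // vol_gt0 //; exact: Qpos.
- by rewrite -leNgt => le; rewrite ltNge (le_trans le LL).
- case: ifP => // _; case: ifP => // _; last by rewrite addr_ge0 // hit_ge0.
  by rewrite ltW // vol_gt0 //; apply: Qpos.
- by rewrite -leNgt => le; rewrite ltNge (le_trans le LL) /=; case: ifP => // _; apply: lerD.
Qed.

(** A strong Markov property: each path stopped in [G1] is continued to [G2]. A path that meets [G2]
    earlier counts with its whole mass, which suffices because [c <= 1]. *)
Lemma hit_comp q L1 L2 (G1 G2 : pred (seq bool)) c : qpos q -> L1 <= L2 -> 0 <= c <= 1 ->
  (forall h, G1 h -> tot (Q q h) <= L1 ->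
     exists N, c * vol (Q q h) <= hit q L2 G2 N h) ->
  forall N h, exists M, c * hit q L1 G1 N h <= hit q L2 G2 M h.
Proof.
move=> qp LL /andP [c0 c1] H; elim=> [|N IH] h /=.
  case: ifP => [_|/negbT]; first by exists 0%N; rewrite mulr0 hit_ge0.
  rewrite -leNgt => le; case: ifP => [Gh|_]; first exact: H.
  by exists 0%N; rewrite mulr0 hit_ge0.
case: ifP => [_|/negbT]; first by exists 0%N; rewrite mulr0 hit_ge0.
rewrite -leNgt => le; case: ifP => [Gh|_]; first exact: H.
have [M1 H1] := IH (rcons h true); have [M2 H2] := IH (rcons h false).
exists (maxn M1 M2).+1 => /=; rewrite ltNge (le_trans le LL) /=; case: ifP => _.
  rewrite -vol_children // -[leRHS]mul1r; apply: ler_pM => //.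
    by rewrite addr_ge0 // hit_ge0.
  by rewrite lerD // hit_le.
rewrite mulrDr; apply: lerD.
  by apply: le_trans H1 _; apply: hit_monoN; rewrite // leq_maxl.
by apply: le_trans H2 _; apply: hit_monoN; rewrite // leq_maxr.
Qed.

Lemma hit_follow q L (G : pred (seq bool)) g h : qpos q -> G (h ++ g) ->
  tot (Q q (h ++ g)) <= L -> vol (Q q (h ++ g)) <= hit q L G (size g) h.
Proof.
move=> qp; elim: g h => [|b g IH] h Gg le /=.
  by move: Gg le; rewrite cats0 => -> le; rewrite ltNge le.
have le' : tot (Q q h) <= L.
  by apply: le_trans le; rewrite qrun_cat; apply: tot_run; apply: Qpos.
rewrite ltNge le' /=; case: ifP => _.
  by rewrite qrun_cat; apply: vol_run; apply: Qpos.
have := IH (rcons h b); rewrite cat_rcons => /(_ Gg le) H; apply: le_trans H _.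
by case: b {Gg le}; [rewrite lerDl|rewrite lerDr]; apply: hit_ge0.
Qed.

Definition big (dl : R) q : pred A := [pred a | dl * tot q <= q a].
Definition bigk (dl : R) k q : pred (seq bool) := fun h => (k <= #|big dl (Q q h)|)%N.

Definition smallmatch (B : pred A) s := ~~ B (wn true s) || ~~ B (ls true s).

Lemma smallmatchE B s b : smallmatch B s = ~~ B (wn b s) || ~~ B (ls b s).
Proof. by case: b => //; rewrite /smallmatch orbC. Qed.

Lemma smallmatch_step B s b : ~~ B (wn b s) -> smallmatch B (cstep b s).
Proof.
by move=> nB; rewrite /smallmatch /loser /winner; case: b nB => /= ->; rewrite ?orbT.
Qed.

(* Along a fair path every letter eventually plays, so some letter outside
   B plays; until then the lengths of the letters outside B are unchanged. *)
Lemma path_to_small s (B : pred A) : good s -> ~~ [forall a, B a] ->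
  exists h, smallmatch B (crun s h) /\ forall q a, ~~ B a -> qrun s q h a = q a.
Proof.
move=> gs; rewrite negb_forall => /existsP [a nB].
have [n _ wa] := fair_io x0 gs d2 a 0.
have ex : exists n, smallmatch B (fs x0 s n).1.
  by exists n; rewrite (smallmatchE _ _ (fbit x0 s n)); move: wa; rewrite /fw => ->; rewrite nB.
case: (ex_minnP ex) => m sm Hm; exists (mkseq (fbit x0 s) m).
split; first by rewrite -fs_run.
move=> q c nc; elim: m Hm {sm} => // m IH Hm.
rewrite mkseqS qrun_rcons -fs_run /qstep.
have nsm : ~~ smallmatch B (fs x0 s m).1 by apply/negP=> /Hm; rewrite ltnn.
have -> : (c == ls (fbit x0 s m) (fs x0 s m).1) = false.
  apply/negbTE/eqP=> E; case/negP: nsm.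
  by rewrite (smallmatchE _ _ (fbit x0 s m)) -E nc orbT.
by apply: IH => n' /Hm /ltnW.
Qed.

Lemma path_to_small_bound : exists N, forall s (B : {set A}), good s -> B != [set: A]%SET ->
  exists h, [/\ (size h <= N)%N, smallmatch (mem B) (crun s h) &
    forall q a, a \notin B -> qrun s q h a = q a].
Proof.
have H (x : cst A * {set A}) : exists h, good x.1 -> x.2 != [set: A]%SET ->
    smallmatch (mem x.2) (crun x.1 h) /\ forall q a, a \notin x.2 -> qrun x.1 q h a = q a.
  have [gs|ng] := boolP (good x.1); last by exists [::].
  have [E|nE] := eqVneq x.2 [set: A]%SET; first by exists [::] => _; rewrite E.
  have [|h Hh] := @path_to_small x.1 (mem x.2) gs; last by exists h.
  apply: contra nE => /forallP Bx; apply/eqP/setP => a; rewrite inE; exact: Bx.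
have [f Hf] := choice H.
exists (\max_x size (f x)) => s B gs nB.
have [sm Hq] := Hf (s, B) gs nB; exists (f (s, B)); split => //.
exact: (leq_bigmax (F := fun x => size (f x)) (s, B)).
Qed.

Section SmallPhase.
Variables (q : A -> R) (B : {set A}) (T dl m : R).
Hypotheses (qp : qpos q) (T0 : 0 < T) (dl0 : 0 < dl).
Hypothesis dld : dl * d%:R <= 2^-1.

Let X h := vol (Q q h) * \sum_(a in B) Q q h a.

Lemma bigk_extend h a : a \notin B -> (forall c, c \in B -> 8 * dl * T <= Q q h c) ->
  dl * tot (Q q h) <= Q q h a -> tot (Q q h) <= 8 * T -> bigk dl #|B|.+1 q h.
Proof.
move=> aB HB Ha le; rewrite /bigk.
have -> : #|B|.+1 = #|(a |: B)%SET| by rewrite cardsU1 aB.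
apply: subset_leq_card; apply/fintype.subsetP=> c; rewrite !inE => cB.
case/orP: cB => [/eqP -> //|/HB]; apply: le_trans.
by rewrite [8 * dl]mulrC -mulrA ler_pM2l.
Qed.

(* vol * (total of the large coordinates) is a supermartingale as long as the
   winners are small; so it is unlikely that the total grows by a factor 4
   before a large letter beats a small one. *)
Lemma small_phase N h : smallmatch (mem B) (St h) ->
  (forall c, c \in B -> 8 * dl * T <= Q q h c) -> (forall a, m <= Q q h a) ->
  tot (Q q h) <= 8 * T -> 8 * T < tot (Q q h) + N%:R * m ->
  vol (Q q h) - (2 * T)^-1 * X h <= hit q (8 * T) (bigk dl #|B|.+1 q) N h.
Proof.
have X0 h' : 0 <= X h'.
  apply: mulr_ge0; first by rewrite ltW // vol_gt0 //; apply: Qpos.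
  by apply: sumr_ge0 => a _; rewrite ltW //; apply: Qpos.
have iT : 0 < (2 * T)^-1 by rewrite invr_gt0 mulr_gt0.
(* Each step adds at least [m] to the total, so [N] bounds the number of steps before the total
   exceeds [8 * T]. *)
elim: N h => [|N IH] h sm HB Hm le lt.
  by move: lt; rewrite mul0r addr0 ltNge le.
rewrite /= ltNge le /=; case: ifP => [_|/negbT nG].
  by rewrite lerBlDr lerDl mulr_ge0 // ltW.
(* Beyond [4 * T] the left-hand side is nonpositive: as the target is not reached, each letter
   outside [B] is below [dl] times the total, so by [dld] these letters make up at most half of it
   and the sum over [B] exceeds [2 * T]. *)
have [t4|t4] := ltP (4 * T) (tot (Q q h)).
  apply: (@le_trans _ _ 0); last by rewrite addr_ge0 // hit_ge0.
  rewrite subr_le0 /X mulrCA -[leLHS]mulr1; apply: ler_wpM2l.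
    by rewrite ltW // vol_gt0 //; apply: Qpos.
  rewrite mulrC ler_pdivlMr ?mulr_gt0 // mul1r.
  have totE : tot (Q q h) = \sum_(a in B) Q q h a + \sum_(a in ~: B) Q q h a.
    rewrite /tot (bigID (mem B)) /=; congr (_ + _).
    by apply: eq_bigl => a; rewrite inE.
  have le2 : \sum_(a in ~: B) Q q h a <= \sum_(a in A) dl * tot (Q q h).
    rewrite [leRHS](bigID (mem (~: B))) /=; apply: ler_wpDr.
      by apply: sumr_ge0 => a _; rewrite mulr_ge0 // ltW //; apply: tot_gt0; apply: Qpos.
    apply: ler_sum => a; rewrite inE => aB; rewrite leNgt; apply/negP=> la.
    by case/negP: nG; apply: (bigk_extend aB) => //; apply: ltW.
  have le3 : \sum_(a in A) dl * tot (Q q h) <= 2^-1 * tot (Q q h).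
    rewrite sumr_const -[leLHS]mulr_natr mulrAC ler_pM2r //; apply: tot_gt0; exact: Qpos.
  lra.
have tb b : tot (Q q (rcons h b)) <= 8 * T.
  rewrite qrun_rcons tot_step; have := tot_ge (wn b (St h)) (Qpos h qp); lra.
have HBb b c : c \in B -> 8 * dl * T <= Q q (rcons h b) c.
  by move=> cB; apply: le_trans (HB _ cB) _; rewrite qrun_rcons; apply: qstep_ge; apply: Qpos.
have IHs b : wn b (St h) \notin B ->
    vol (Q q (rcons h b)) - (2 * T)^-1 * X (rcons h b) <=
    hit q (8 * T) (bigk dl #|B|.+1 q) N (rcons h b).
  move=> wB; apply: IH => //.
  - by rewrite crun_rcons; apply: smallmatch_step.
  - by apply: HBb.
  - by move=> a; apply: le_trans (Hm a) _; rewrite qrun_rcons; apply: qstep_ge; apply: Qpos.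
  - rewrite qrun_rcons tot_step; have := Hm (wn b (St h)); move: lt.
    by rewrite -natr1 mulrDl mul1r; lra.
have IHw b : wn b (St h) \in B -> vol (Q q (rcons h b)) <=
    hit q (8 * T) (bigk dl #|B|.+1 q) N (rcons h b).
  move=> wB; have lB : ls b (St h) \notin B.
    by move: sm; rewrite (smallmatchE _ _ b) /= wB.
  have G : bigk dl #|B|.+1 q (rcons h b).
    apply: (bigk_extend lB) => //; first exact: HBb.
    apply: (@le_trans _ _ (8 * dl * T)); first by rewrite [8 * dl]mulrC -mulrA ler_pM2l.
    rewrite qrun_rcons /qstep eqxx; apply: le_trans (HB _ wB) _; rewrite lerDr ltW //.
    exact: Qpos.
  by case: (N) => [|N'] /=; rewrite ltNge tb G.
rewrite -vol_children //.
have step b c : Q q (rcons h b) c = if c == ls b (St h) then Q q h c + Q q h (wn b (St h)) else Q q h c.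
  by rewrite qrun_rcons.
have sumN b : ls b (St h) \notin B -> \sum_(a in B) Q q (rcons h b) a = \sum_(a in B) Q q h a.
  move=> lB; apply: eq_bigr => a aB; rewrite step; case: eqP => // E.
  by rewrite -E aB in lB.
have sumY b : ls b (St h) \in B -> \sum_(a in B) Q q (rcons h b) a =
    \sum_(a in B) Q q h a + Q q h (wn b (St h)).
  move=> lB; rewrite (bigD1 (ls b (St h))) //= [in RHS](bigD1 (ls b (St h))) //= step eqxx.
  rewrite (eq_bigr (Q q h)) => [|a /andP [_ /negbTE na]]; last by rewrite step na.
  by rewrite addrAC.
(* A small winner [w] beating a large [l] multiplies the mass by [l / (l + w)] and raises the sum
   [S] over [B] to [S + w]; since [l <= S] the product does not increase. In the other child [l]
   beats [w], and the target is reached at once. *)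
have Xone b : wn b (St h) \notin B -> ls b (St h) \in B -> X (rcons h b) <= X h.
  move=> wB lB; rewrite /X sumY // qrun_rcons vol_step //; last exact: Qpos.
    rewrite -mulrA; apply: ler_wpM2l; first by rewrite ltW // vol_gt0 //; apply: Qpos.
    have l0 := Qpos h qp (ls b (St h)); have w0 := Qpos h qp (wn b (St h)).
    have ls_le : Q q h (ls b (St h)) <= \sum_(a in B) Q q h a.
      rewrite (bigD1 (ls b (St h))) //= lerDl; apply: sumr_ge0 => a _; rewrite ltW //.
      exact: Qpos.
    rewrite mulrAC ler_pdivrMr ?addr_gt0 // !mulrDr mulrC lerD2l.
    by rewrite ler_pM2r.
  exact: St_good.
have w1 : wn false (St h) = ls true (St h) by [].
have l1 : ls false (St h) = wn true (St h) by [].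
case: (boolP (wn true (St h) \in B)) => wB; case: (boolP (ls true (St h) \in B)) => lB.
- by move: sm; rewrite /smallmatch /= wB lB.
- have := IHw true wB; have := IHs false lB; have := Xone false lB wB.
  by move=> /(ler_wpM2l (ltW iT)); lra.
- have := IHw false lB; have := IHs true wB; have := Xone true wB lB.
  by move=> /(ler_wpM2l (ltW iT)); lra.
- have := IHs true wB; have := IHs false lB.
  have : X (rcons h true) + X (rcons h false) = X h.
    by rewrite /X (sumN true lB) (sumN false wB) -mulrDl vol_children.
  move=> <-; rewrite !mulrDr; lra.
Qed.

End SmallPhase.

(** Uniform over all pasts: [c] and [K] depend neither on [q] nor on [h], which is what allows
    iteration. *)
Definition reach (G : (A -> R) -> pred (seq bool)) := exists c K : R,
  [/\ 0 < c, c <= 1, 1 <= K & forall q h, qpos q ->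
    exists N, c * vol (Q q h) <= hit q (K * tot (Q q h)) (G q) N h].

Lemma reach_comp (G1 G2 : (A -> R) -> pred (seq bool)) : reach G1 ->
  (exists c K : R, [/\ 0 < c, c <= 1, 1 <= K & forall q h, qpos q -> G1 q h ->
    exists N, c * vol (Q q h) <= hit q (K * tot (Q q h)) (G2 q) N h]) -> reach G2.
Proof.
move=> [c1 [K1 [c1p c1l K1l H1]]] [c2 [K2 [c2p c2l K2l H2]]].
exists (c2 * c1), (K1 * K2); split.
- exact: mulr_gt0.
- by rewrite mulr_ile1 // ltW.
- by rewrite -[1]mulr1 ler_pM.
move=> q h qp; have t0 := tot_gt0 (Qpos h qp).
have [N HN] := H1 q h qp.
have [|||M HM] := @hit_comp q (K1 * tot (Q q h)) (K1 * K2 * tot (Q q h)) (G1 q) (G2 q) c2 qp _ _ _ N h.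
- by rewrite ler_pM2r // ler_peMr // (le_trans _ K1l).
- by rewrite ltW.
- move=> g Gg le; have [M HM] := H2 q g qp Gg; exists M; apply: le_trans HM _.
  apply: hit_monoL => //; rewrite mulrAC mulrC ler_pM2r // (lt_le_trans _ K2l) //.
exists M; apply: le_trans HM; rewrite -mulrA ler_pM2l //.
Qed.

Lemma pos_lower q : qpos q -> exists2 m : R, 0 < m & forall a, m <= q a.
Proof.
move=> qp; have ip : qpos (fun a => (q a)^-1) by move=> a; rewrite invr_gt0.
exists (tot (fun a => (q a)^-1))^-1; first by rewrite invr_gt0; apply: tot_gt0.
by move=> a; rewrite -[leRHS]invrK lef_pV2 ?posrE ?invr_gt0 ?tot_gt0 //; apply: (tot_ge _ ip).
Qed.

(** A path of bounded length leads to a comparison with a small letter and leaves the small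
    coordinates unchanged, however tiny they are compared with the total. From there [small_phase],
    with [T] the total reached, produces a new large letter for half of the mass. *)
Lemma grow k (dl : R) : (k < d)%N -> 0 < dl <= 1 -> exists dl' : R, 0 < dl' <= 1 /\
  exists c K : R, [/\ 0 < c, c <= 1, 1 <= K & forall q h, qpos q -> bigk dl k q h ->
    exists N, c * vol (Q q h) <= hit q (K * tot (Q q h)) (bigk dl' k.+1 q) N h].
Proof.
move=> kd /andP [dl0 dl1]; have [N0 HN0] := path_to_small_bound.
have d0 : 0 < d%:R :> R by rewrite ltr0n (leq_trans _ d2).
have d1 : 1 <= d%:R :> R by rewrite ler1n (leq_trans _ d2).
have e0 : 0 < 2 ^+ N0 :> R by rewrite exprn_gt0.
have e1 : 1 <= 2 ^+ N0 :> R by rewrite exprn_ege1 // ler1n.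
have f0 : 0 < dl / 2 ^+ N0 by rewrite divr_gt0.
have f1 : dl / 2 ^+ N0 <= dl by rewrite ler_pdivrMr // ler_peMr // ltW.
have dle : dl / 2 ^+ N0 / (8 * d%:R) <= dl.
  by apply: le_trans f1; rewrite ler_pdivrMr ?mulr_gt0 // ler_peMr ?ltW //; lra.
(* [2 ^+ N0] bounds the growth of the total along the preliminary path; the factor [8 * d] provides
   both conditions of [small_phase]: the lower bound on the letters of [B], and a product with [d]
   of at most 1/2. *)
exists (dl / 2 ^+ N0 / (8 * d%:R)); split.
  by rewrite divr_gt0 ?mulr_gt0 //= (le_trans dle).
exists (2^-1 * (dl / 2 ^+ N0) ^+ d), (8 * 2 ^+ N0).
have c1 : 2^-1 * (dl / 2 ^+ N0) ^+ d <= 1.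
  apply: mulr_ile1; [by rewrite invr_ge0|by rewrite exprn_ge0 // ltW|by rewrite invf_le1 // ler1n|].
  by apply: exprn_ile1; [apply: ltW|apply: le_trans dl1].
split => //; [by rewrite mulr_gt0 ?exprn_gt0| lra|].
move=> q h qp Hk; have t0 := tot_gt0 (Qpos h qp).
have K1 : tot (Q q h) <= 8 * 2 ^+ N0 * tot (Q q h).
  by apply: ler_peMl; [apply: ltW|lra].
have [lt|ge] := ltnP k #|big dl (Q q h)|.
  exists 0%N; rewrite /= ltNge K1 /= ifT; first by rewrite ler_piMl // ltW // vol_gt0 //; apply: Qpos.
  rewrite /bigk (leq_trans lt) //; apply: subset_leq_card; apply/fintype.subsetP=> a.
  by rewrite !inE; apply: le_trans; rewrite ler_pM2r.
pose B := [set a | dl * tot (Q q h) <= Q q h a]%SET.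
have cB : #|B| = k.
  by apply/eqP; rewrite cardsE eqn_leq ge; apply: Hk.
have BT : B != [set: A]%SET by apply: contraL kd => /eqP E; rewrite -cB E cardsT ltnn.
have [g [sg sm Hg]] := HN0 _ _ (St_good h) BT.
set z := h ++ g; set T := tot (Q q z).
have zp := Qpos z qp; have T0 : 0 < T by apply: tot_gt0.
have Tle : T <= 2 ^+ N0 * tot (Q q h).
  rewrite /T /z qrun_cat; apply: le_trans (tot_run_le _ _ (Qpos h qp)) _.
  by rewrite ler_pM2r // ler_eXn2l // ltr1n.
have zB a : a \in B -> 8 * (dl / 2 ^+ N0 / (8 * d%:R)) * T <= Q q z a.
  rewrite inE => aB; apply: (@le_trans _ _ (Q q h a)); last first.
    by rewrite /z qrun_cat; apply: qrun_ge; apply: Qpos.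
  apply: le_trans aB; have -> : 8 * (dl / 2 ^+ N0 / (8 * d%:R)) = dl / 2 ^+ N0 / d%:R.
    by field; rewrite !lt0r_neq0.
  rewrite -2!mulrA ler_pM2l //.
  rewrite ler_pdivrMl // ler_pdivrMl //; apply: le_trans Tle _.
  by rewrite ler_peMl // mulr_ge0 // ltW.
have [m m0 Hm] := pos_lower zp.
have [N HN] : exists N, 8 * T < T + N%:R * m.
  exists (Num.bound (8 * T / m)); rewrite -ltrBlDl -ltr_pdivrMr //.
  apply: le_lt_trans (archi_boundP _); last by rewrite divr_ge0 // ltW // mulr_gt0.
  by rewrite ler_pM2r ?invr_gt0 // gerBl ltW.
have sz : smallmatch (mem B) (St z) by rewrite /z crun_cat.
have dlp : 0 < dl / 2 ^+ N0 / (8 * d%:R) by rewrite divr_gt0 ?mulr_gt0.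
have dld : dl / 2 ^+ N0 / (8 * d%:R) * d%:R <= 2^-1.
  have -> : dl / 2 ^+ N0 / (8 * d%:R) * d%:R = dl / 2 ^+ N0 / 8 by field; rewrite !lt0r_neq0.
  by rewrite ler_pdivrMr //; lra.
have T8 : T <= 8 * T by lra.
have H8 := small_phase qp T0 dlp dld sz zB Hm T8 HN.
have vz := vol_gt0 zp.
have half : 2^-1 * vol (Q q z) <= hit q (8 * T) (bigk (dl / 2 ^+ N0 / (8 * d%:R)) #|B|.+1 q) N z.
  apply: le_trans H8.
  have sB : \sum_(a in B) Q q z a <= T.
    rewrite /T /tot [leRHS](bigID (mem B)) /= lerDl; apply: sumr_ge0 => a _; exact: ltW.
  have : (2 * T)^-1 * (vol (Q q z) * \sum_(a in B) Q q z a) <= (2 * T)^-1 * (vol (Q q z) * T).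
    by rewrite ler_pM2l ?invr_gt0 ?mulr_gt0 // ler_pM2l.
  have -> : (2 * T)^-1 * (vol (Q q z) * T) = 2^-1 * vol (Q q z) by field; rewrite lt0r_neq0.
  lra.
have [|||M HM] := @hit_comp q T (8 * 2 ^+ N0 * tot (Q q h)) (pred1 z)
   (bigk (dl / 2 ^+ N0 / (8 * d%:R)) k.+1 q) 2^-1 qp _ _ _ (size g) h.
- apply: le_trans Tle _; rewrite -mulrA ler_peMl //; first by rewrite mulr_ge0 // ltW.
  by rewrite ler1n.
- by apply/andP; split; lra.
- move=> _ /eqP -> _; exists N; apply: le_trans half _; rewrite cB.
  by apply: hit_monoL => //; rewrite -mulrA ler_pM2l.
exists M; apply: le_trans HM; rewrite -mulrA ler_pM2l ?invr_gt0 //.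
apply: (@le_trans _ _ (vol (Q q z))); last by apply: hit_follow => //=.
rewrite -ler_pdivlMl ?exprn_gt0 //.
have -> : ((dl / 2 ^+ N0) ^+ d)^-1 = (2 ^+ N0 / dl) ^+ d by rewrite -[LHS]exprVn invf_div.
apply: vol_scale => //; first exact: Qpos.
(* Only coordinates in [B] can have grown along [g], and these were at least [dl] times the old
   total: hence the factor [(dl / 2 ^+ N0) ^+ d]. *)
move=> a; have [aB|aB] := boolP (a \in B).
  have {}aB : dl * tot (Q q h) <= Q q h a by move: aB; rewrite inE.
  apply: (@le_trans _ _ T); first exact: tot_ge.
  apply: le_trans Tle _; rewrite mulrAC ler_pdivlMr // -mulrA ler_pM2l //.
  by rewrite mulrC.
rewrite /z qrun_cat Hg // ler_peMl //; first by rewrite ltW //; apply: Qpos.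
by rewrite ler_pdivlMr // mul1r (le_trans dl1).
Qed.

(** Induction on the number of large coordinates, starting from the largest one, which is at least
    the total divided by [d]. *)
Lemma reach_balanced : exists2 dl : R, 0 < dl <= 1 & reach (bigk dl d).
Proof.
have H k : (0 < k <= d)%N -> exists2 dl : R, 0 < dl <= 1 & reach (bigk dl k).
  elim: k => // -[_ _|k IH /= kd].
    have d0 : 0 < d%:R :> R by rewrite ltr0n (leq_trans _ d2).
    exists d%:R^-1; first by rewrite invr_gt0 d0 invf_le1 // ler1n (leq_trans _ d2).
    exists 1, 1; split => // q h qp; exists 0%N; rewrite !mul1r /= ltxx ifT //.
    rewrite /bigk; apply/card_gt0P; apply: contrapT => /forallNP H.
    have : tot (Q q h) < \sum_(a in A) d%:R^-1 * tot (Q q h).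
      apply: ltr_sum; first by apply/hasP; exists x0; rewrite ?mem_index_enum.
      by move=> a _; rewrite ltNge; apply/negP; have := H a; rewrite inE.
    by rewrite sumr_const -[ltRHS]mulr_natr mulrAC mulVf ?lt0r_neq0 // mul1r ltxx.
  have [|dl dl01 Hr] := IH; first by rewrite ltn0Sn /=; apply: ltnW.
  have [dl' [dl'01 Hg]] := grow kd dl01.
  by exists dl' => //; apply: reach_comp Hr Hg.
by apply: H; rewrite leqnn (leq_trans _ d2).
Qed.

Section Loop.
Variable gam : seq bool.
Hypothesis gamE : St gam = s0.

Definition cpl (h : seq bool) : bool :=
  [&& (size gam <= size h)%N, drop (size h - size gam) h == gam &
      St (take (size h - size gam) h) == s0].

Lemma cpl_cat h : St h = s0 -> cpl (h ++ gam).
Proof.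
by move=> Sh; rewrite /cpl size_cat leq_addl addnK drop_size_cat // take_size_cat // Sh !eqxx.
Qed.

Lemma cplP h : cpl h -> exists2 g, h = g ++ gam & St g = s0.
Proof.
case/and3P=> _ /eqP E /eqP F; exists (take (size h - size gam) h) => //.
by rewrite -[in LHS](cat_take_drop (size h - size gam) h) E.
Qed.

Lemma cpl_St h : cpl h -> St h = s0.
Proof. by case/cplP=> g -> Sg; rewrite crun_cat Sg. Qed.

(** Once the row is balanced, a return path to [s0] followed by [gam] multiplies each coordinate by
    a bounded factor, hence costs a bounded factor of mass. Return paths come from [crun_return];
    there are finitely many states, so their lengths are bounded. *)
Lemma reach_cpl : reach (fun=> cpl).
Proof.
have [dl /andP [dl0 dl1] Hr] := reach_balanced; apply: reach_comp Hr _.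
have H (s : cst A) : exists g, (exists h, s = St h) -> crun s g = s0.
  have [[h Eh]|no] := pselect (exists h, s = St h); last by exists [::].
  by have [g Eg] := crun_return x0 h gs0; exists g => _; rewrite Eh.
have [f Hf] := choice H.
pose N := (\max_s size (f s) + size gam)%N.
have e0 : 0 < 2 ^+ N :> R by rewrite exprn_gt0.
have e1 : 1 <= 2 ^+ N :> R by rewrite exprn_ege1 // ler1n.
have f0 : 0 < dl / 2 ^+ N by rewrite divr_gt0.
have f1 : dl / 2 ^+ N <= dl by rewrite ler_pdivrMr // ler_peMr // ltW.
exists ((dl / 2 ^+ N) ^+ d), (2 ^+ N); split => //.
- by rewrite exprn_gt0.
- by apply: exprn_ile1; [apply: ltW|apply: le_trans dl1].
move=> q h qp Hb; exists (size (f (St h) ++ gam)).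
have Eg : St (h ++ f (St h)) = s0 by rewrite crun_cat Hf //; exists h.
have le : tot (Q q (h ++ f (St h) ++ gam)) <= 2 ^+ N * tot (Q q h).
  rewrite qrun_cat; apply: le_trans (tot_run_le _ _ (Qpos h qp)) _.
  rewrite ler_pM2r; last by apply: tot_gt0; apply: Qpos.
  rewrite ler_eXn2l ?ltr1n // size_cat leq_add2r.
  exact: (leq_bigmax (F := fun s => size (f s)) (St h)).
apply: (@le_trans _ _ (vol (Q q (h ++ f (St h) ++ gam)))); last first.
  by apply: hit_follow => //; rewrite catA; apply: cpl_cat.
rewrite -ler_pdivlMl ?exprn_gt0 //.
have -> : ((dl / 2 ^+ N) ^+ d)^-1 = (2 ^+ N / dl) ^+ d by rewrite -[LHS]exprVn invf_div.
apply: vol_scale => //; try exact: Qpos.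
move=> a; apply: (@le_trans _ _ (2 ^+ N * tot (Q q h))).
  by apply: le_trans le; apply: tot_ge; apply: Qpos.
rewrite mulrAC ler_pdivlMr // -mulrA ler_pM2l // mulrC.
rewrite leNgt; apply/negP=> na.
have c0 : (0 < #|[predC big dl (Q q h)]|)%N.
  by apply/card_gt0P; exists a; rewrite !inE -ltNge.
by move: Hb; rewrite /bigk -(cardC (big dl (Q q h))) -[leqRHS]addn0 leq_add2l leqNgt c0.
Qed.

(** The [kap]-th moment of the total at the first completion. Paths still incomplete after [N] steps
    count with their present total, so the same bound also controls the incomplete mass. *)
Fixpoint mom (kap : R) q N h : R :=
  if cpl h then vol (Q q h) * tot (Q q h) `^ kap
  else if N is n.+1 then mom kap q n (rcons h true) + mom kap q n (rcons h false)
  else vol (Q q h) * tot (Q q h) `^ kap.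

(** Before the total grows by a factor [K], a fraction [c] of the mass completes. The rest is
    stopped just beyond, with total at most [2 * K] times the original, and the bound is used
    recursively there. The recursion closes up when [(1 - c) (2 K)^kap < 1], that is, for small
    [kap]. *)
Lemma moment_bound : exists kap H : R, [/\ 0 < kap, 1 <= H & forall q N h, qpos q ->
  mom kap q N h <= H * (vol (Q q h) * tot (Q q h) `^ kap)].
Proof.
have [c [K [c0 c1 K1 Hc]]] := reach_cpl.
(* Halved so that [e < 1] even if [c = 1]; [r] and [kap] are then chosen to give
   [(1 - e) (2 K)^kap = 1 - e / 2]. *)
pose e := c / 2; have e0 : 0 < e by rewrite divr_gt0.
have e1 : e < 1 by rewrite /e; lra.
have K0 : 0 < K by apply: lt_le_trans K1.
pose r := (1 - e / 2) / (1 - e).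
have r1 : 1 < r by rewrite ltr_pdivlMr; lra.
have r0 : 0 < r by apply: lt_trans r1.
have l0 : 0 < ln (2 * K) by rewrite ln_gt0 //; lra.
pose kap := ln r / ln (2 * K).
have kap0 : 0 < kap by rewrite divr_gt0 // ln_gt0.
have KE : (2 * K) `^ kap = r.
  rewrite /powR gt_eqF ?mulr_gt0 // /kap divfK ?lt0r_neq0 // lnK // posrE //.
pose H := Num.max 1 (K `^ kap * (2 / e)).
have H1 : 1 <= H by rewrite le_max lexx.
have HK : K `^ kap <= H * (e / 2).
  have : K `^ kap * (2 / e) <= H by rewrite le_max lexx orbT.
  by rewrite mulrA ler_pdivrMr // => HH; rewrite mulrA ler_pdivlMr.
exists kap, H; split => // q N h qp.
elim/ltn_ind: N h => N IH h.
have t0 := tot_gt0 (Qpos h qp); set L := K * tot (Q q h).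
have L0 : 0 < L by rewrite mulr_gt0.
have pw0 (x : R) : 0 <= x `^ kap by apply: powR_ge0.
have pwM (x y : R) : 0 <= x -> x <= y -> x `^ kap <= y `^ kap.
  move=> x0' xy; have := @ge0_ler_powR R kap (ltW kap0) x y.
  by rewrite !nnegrE => /(_ x0' (le_trans x0' xy) xy).
have [N' HN'] := Hc q h qp.
(* The tree is followed until the total exceeds [L]; one step at most doubles it, hence [2 * L].
   Getting there takes at least one step, so the induction hypothesis on [N] applies. *)
have key n g M : (n <= N)%N -> tot (Q q g) <= 2 * L -> (L < tot (Q q g) -> (n < N)%N) ->
    mom kap q n g <= vol (Q q g) * L `^ kap +
      (vol (Q q g) - hit q L cpl M g) * (H * (2 * L) `^ kap).
  elim: n g M => [|n IHn] g M nN le2 ltN.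
    have vg := vol_gt0 (Qpos g qp).
    have hm : 0 <= (vol (Q q g) - hit q L cpl M g) * (H * (2 * L) `^ kap).
      by rewrite mulr_ge0 ?subr_ge0 ?hit_le // mulr_ge0 // (le_trans _ H1).
    have [lt|le] := ltP L (tot (Q q g)).
      apply: le_trans (IH _ (ltN lt) _) _.
      have -> : hit q L cpl M g = 0 by case: (M) => [|?] /=; rewrite lt.
      rewrite subr0; apply: ler_wpDl; first by rewrite mulr_ge0 // ltW.
      rewrite mulrCA ler_pM2l // ler_pM2l; last by apply: lt_le_trans H1.
      by apply: pwM => //; rewrite ltW // tot_gt0 //; apply: Qpos.
    have -> : mom kap q 0 g = vol (Q q g) * tot (Q q g) `^ kap by rewrite /=; case: ifP.
    apply: ler_wpDr => //; rewrite ler_pM2l //.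
    by apply: pwM => //; rewrite ltW // tot_gt0 //; apply: Qpos.
  have vg := vol_gt0 (Qpos g qp).
  have hm : 0 <= (vol (Q q g) - hit q L cpl M g) * (H * (2 * L) `^ kap).
    by rewrite mulr_ge0 ?subr_ge0 ?hit_le // mulr_ge0 // (le_trans _ H1).
  have [lt|le] := ltP L (tot (Q q g)).
    apply: le_trans (IH _ (ltN lt) _) _.
    have -> : hit q L cpl M g = 0 by case: (M) => [|?] /=; rewrite lt.
    rewrite subr0; apply: ler_wpDl; first by rewrite mulr_ge0 // ltW.
    rewrite mulrCA ler_pM2l // ler_pM2l; last by apply: lt_le_trans H1.
    by apply: pwM => //; rewrite ltW // tot_gt0 //; apply: Qpos.
  rewrite /=; case: ifP => cg.
    apply: ler_wpDr => //; rewrite ler_pM2l //.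
    by apply: pwM => //; rewrite ltW // tot_gt0 //; apply: Qpos.
  have tb b : tot (Q q (rcons g b)) <= 2 * L.
    by rewrite qrun_rcons tot_step; have := tot_ge (wn b (St g)) (Qpos g qp); lra.
  pose M' := M.-1.
  have ch b := IHn (rcons g b) M' (ltnW nN) (tb b) (fun _ => nN).
  apply: le_trans (lerD (ch true) (ch false)) _.
  have hle : hit q L cpl M g <= hit q L cpl M' (rcons g true) + hit q L cpl M' (rcons g false).
    rewrite /M'; case: (M) => [|m]; last by rewrite /= ltNge le /= cg.
    have -> : hit q L cpl 0 g = 0 by rewrite /= ltNge le /= cg.
    by rewrite addr_ge0 // hit_ge0.
  rewrite -(vol_children g qp).
  have : (hit q L cpl M' (rcons g true) + hit q L cpl M' (rcons g false) - hit q L cpl M g) *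
     (H * (2 * L) `^ kap) >= 0.
    by rewrite mulr_ge0 ?subr_ge0 // mulr_ge0 // (le_trans _ H1).
  move: (H * (2 * L) `^ kap) (L `^ kap) => u v; lra.
have := key N h N' (leqnn _); have tL : tot (Q q h) <= L by rewrite ler_peMl // ltW.
have tL2 : tot (Q q h) <= 2 * L by lra.
move=> /(_ tL2); rewrite ltNge tL /= => /(_ (fun e => False_ind _ (notF e))) Hk.
apply: le_trans Hk _.
have -> : (2 * L) `^ kap = r * tot (Q q h) `^ kap.
  by rewrite /L mulrA powRM ?KE // ltW // mulr_gt0.
have -> : L `^ kap = K `^ kap * tot (Q q h) `^ kap by rewrite powRM // ltW.
have vg := vol_gt0 (Qpos h qp); have tk := pw0 (tot (Q q h)).
move: HN'; set v := vol _ in vg *; set u := _ `^ kap in tk *; set w := hit _ _ _ _ _ => HN'.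
have w1 : v - w <= (1 - e) * v by rewrite /e; have : c / 2 * v <= c * v; [rewrite ler_pM2r //; lra|lra].
have E1 : (v - w) * (H * (r * u)) <= (1 - e) * v * (H * (r * u)).
  apply: ler_wpM2r => //; apply: mulr_ge0; first by apply: le_trans H1.
  by apply: mulr_ge0 => //; apply: ltW.
have E2 : (1 - e) * v * (H * (r * u)) = (1 - e / 2) * (H * (v * u)).
  by rewrite /r; field; lra.
have E3 : v * (K `^ kap * u) <= H * (e / 2) * (v * u).
  by rewrite mulrCA ler_wpM2r // mulr_ge0 // ltW.
lra.
Qed.

End Loop.
End Base.
End Paths.

(** * Norms, minors and path matrices *)

Section Norms.
Variable R : realType.

Definition nrm m n (M : 'M[R]_(m, n)) : R := \sum_i \sum_j `|M i j|.

Lemma nrm_ge0 m n (M : 'M[R]_(m, n)) : 0 <= nrm M.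
Proof. by apply: sumr_ge0 => i _; apply: sumr_ge0. Qed.

Lemma nrm_entry m n (M : 'M[R]_(m, n)) i j : `|M i j| <= nrm M.
Proof.
rewrite /nrm (bigD1 i) //= (bigD1 j) //= -addrA lerDl addr_ge0 //.
  by apply: sumr_ge0.
by apply: sumr_ge0 => k _; apply: sumr_ge0.
Qed.

Lemma nrm_bound m n (M : 'M[R]_(m, n)) (b : R) : (forall i j, `|M i j| <= b) ->
  nrm M <= (m * n)%:R * b.
Proof.
move=> H; apply: (@le_trans _ _ (\sum_(i < m) \sum_(j < n) b)).
  by apply: ler_sum => i _; apply: ler_sum => j _.
by rewrite sumr_const card_ord sumr_const card_ord -mulrnA mulnC mulr_natl.
Qed.

Lemma nrmD m n (M N : 'M[R]_(m, n)) : nrm (M + N) <= nrm M + nrm N.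
Proof.
rewrite /nrm -big_split; apply: ler_sum => i _; rewrite -big_split; apply: ler_sum => j _.
by rewrite mxE ler_normD.
Qed.

Lemma nrmN m n (M : 'M[R]_(m, n)) : nrm (- M) = nrm M.
Proof. by apply: eq_bigr => i _; apply: eq_bigr => j _; rewrite mxE normrN. Qed.

Lemma nrmM m n p (M : 'M[R]_(m, n)) (N : 'M[R]_(n, p)) : nrm (M *m N) <= nrm M * nrm N.
Proof.
apply: (@le_trans _ _ (\sum_i \sum_j \sum_k `|M i k| * `|N k j|)).
  apply: ler_sum => i _; apply: ler_sum => j _; rewrite mxE.
  by apply: le_trans (ler_norm_sum _ _ _) _; apply: ler_sum => k _; rewrite normrM.
rewrite /nrm big_distrl; apply: ler_sum => i _ /=.
rewrite exchange_big big_distrl; apply: ler_sum => k _ /=.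
rewrite -big_distrr; apply: ler_wpM2l => //=.
by rewrite [leRHS](bigD1 k) //= lerDl; apply: sumr_ge0 => l _; apply: sumr_ge0.
Qed.

Lemma nrm_tr m n (M : 'M[R]_(m, n)) : nrm M^T = nrm M.
Proof. by rewrite /nrm exchange_big; apply: eq_bigr => i _; apply: eq_bigr => j _; rewrite mxE. Qed.

Lemma det_bound p (X : 'M[R]_p) (b : R) : (forall i j, `|X i j| <= b) ->
  `|\det X| <= (p`!)%:R * b ^+ p.
Proof.
move=> H; apply: le_trans (ler_norm_sum _ _ _) _.
apply: (@le_trans _ _ (\sum_(s : 'S_p) b ^+ p)).
  apply: ler_sum => s _; rewrite normrM normrX normrN1 expr1n mul1r normr_prod.
  rewrite -[X in b ^+ X]card_ord -prodr_const; apply: ler_prod => i _.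
  by rewrite normr_ge0 H.
by rewrite sumr_const card_Sn [leRHS]mulr_natl.
Qed.

End Norms.

Section Minors.
Variable R : realType.

(** All index maps are allowed, not only increasing ones: repeated indices contribute 0, and the
    other minors are repeated once for every reordering of rows and columns. This changes growth by
    a constant factor only. *)
Definition minors p m n (M : 'M[R]_(m, n)) : R :=
  \sum_(f : {ffun 'I_p -> 'I_m}) \sum_(g : {ffun 'I_p -> 'I_n}) `|\det (mxsub f g M)|.

Lemma minors_ge0 p m n (M : 'M[R]_(m, n)) : 0 <= minors p M.
Proof. by apply: sumr_ge0 => f _; apply: sumr_ge0. Qed.

Lemma det_mul_rect p n (X : 'M[R]_(p, n)) (Y : 'M[R]_(n, p)) :
  \det (X *m Y) = \sum_(h : {ffun 'I_p -> 'I_n}) (\prod_i X i (h i)) * \det (rowsub h Y).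
Proof.
rewrite /(\det _) /=.
transitivity (\sum_(s : 'S_p) \sum_(h : {ffun 'I_p -> 'I_n})
   (-1) ^+ s * (\prod_i X i (h i) * \prod_i Y (h i) (s i))).
  apply: eq_bigr => s _; rewrite -big_distrr; congr (_ * _) => /=.
  rewrite (eq_bigr (fun i => \sum_j X i j * Y j (s i))); last by move=> i _; rewrite mxE.
  rewrite bigA_distr_bigA; apply: eq_bigr => h _; by rewrite big_split.
rewrite exchange_big; apply: eq_bigr => h _ /=; rewrite big_distrr; apply: eq_bigr => s _ /=.
by rewrite mulrCA; congr (_ * (_ * _)); apply: eq_bigr => i _; rewrite mxE.
Qed.

(** After expanding the first determinant, replacing [h] by its composite with a permutation shows
    that every permutation contributes the same [\det (X *m Y)]; hence the factorial. *)
Lemma cauchy_binet p n (X : 'M[R]_(p, n)) (Y : 'M[R]_(n, p)) :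
  \sum_(h : {ffun 'I_p -> 'I_n}) \det (colsub h X) * \det (rowsub h Y) =
  (p`!)%:R * \det (X *m Y).
Proof.
transitivity (\sum_(s : 'S_p) \sum_(h : {ffun 'I_p -> 'I_n})
    (-1) ^+ s * (\prod_i X i (h (s i))) * \det (rowsub h Y)).
  rewrite exchange_big; apply: eq_bigr => h _; rewrite big_distrl; apply: eq_bigr => s _ /=.
  by congr (_ * _ * _); apply: eq_bigr => i _; rewrite mxE.
rewrite (eq_bigr (fun=> \det (X *m Y))).
  by rewrite sumr_const card_Sn [RHS]mulr_natl.
move=> s _; rewrite det_mul_rect.
pose c (t : 'S_p) (h : {ffun 'I_p -> 'I_n}) : {ffun 'I_p -> 'I_n} := [ffun i => h (t i)].
rewrite [RHS](reindex_inj (h := c s)); last first.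
  by apply: (can_inj (g := c s^-1%g)) => h; apply/ffunP => i; rewrite !ffunE permKV.
apply: eq_bigr => h _.
have -> : \prod_i X i (c s h i) = \prod_i X i (h (s i)).
  by apply: eq_bigr => i _; rewrite ffunE.
have -> : rowsub (c s h) Y = row_perm s (rowsub h Y).
  by apply/matrixP => i j; rewrite !mxE ffunE.
by rewrite row_permE det_mulmx det_perm mulrCA mulrA.
Qed.

Lemma minors_mul p m n k (M : 'M[R]_(m, n)) (N : 'M[R]_(n, k)) :
  minors p (M *m N) <= minors p M * minors p N.
Proof.
rewrite /minors big_distrl; apply: ler_sum => f _ /=.
apply: (@le_trans _ _ (\sum_(g : {ffun 'I_p -> 'I_k}) \sum_(h : {ffun 'I_p -> 'I_n})
   `|\det (mxsub f h M)| * `|\det (mxsub h g N)|)).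
  apply: ler_sum => g _.
  have -> : mxsub f g (M *m N) = rowsub f M *m colsub g N.
    by apply/matrixP => i j; rewrite !mxE; apply: eq_bigr => l _; rewrite !mxE.
  apply: (@le_trans _ _ `|(p`!)%:R * \det (rowsub f M *m colsub g N)|).
    by rewrite normrM ler_peMl // normr_nat ler1n fact_gt0.
  rewrite -cauchy_binet; apply: le_trans (ler_norm_sum _ _ _) _; apply: ler_sum => h _.
  by rewrite normrM -!mxsub_comp.
rewrite exchange_big big_distrl; apply: ler_sum => h _ /=.
rewrite -big_distrr; apply: ler_wpM2l => //=.
rewrite [leRHS](bigD1 h) //= lerDl; apply: sumr_ge0 => l _; exact: sumr_ge0.
Qed.

Lemma minor_le p m n (M : 'M[R]_(m, n)) (f : 'I_p -> 'I_m) (g : 'I_p -> 'I_n) :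
  `|\det (mxsub f g M)| <= minors p M.
Proof.
have -> : mxsub f g M = mxsub (finfun f) (finfun g) M.
  by apply/matrixP => i j; rewrite !mxE !ffunE.
rewrite /minors (bigD1 (finfun f)) //= (bigD1 (finfun g)) //= -addrA lerDl addr_ge0 //.
  by apply: sumr_ge0.
by apply: sumr_ge0 => h _; apply: sumr_ge0.
Qed.

Lemma minors_tr p m n (M : 'M[R]_(m, n)) : minors p M^T = minors p M.
Proof.
rewrite /minors exchange_big; apply: eq_bigr => f _; apply: eq_bigr => g _.
by rewrite -trmx_mxsub det_tr.
Qed.

Lemma minors_bound p m n : exists2 C : R, 0 < C &
  forall (M : 'M[R]_(m, n)) b, 0 <= b -> (forall i j, `|M i j| <= b) ->
  minors p M <= C * b ^+ p.
Proof.
pose c1 := #|{ffun 'I_p -> 'I_m}|; pose c2 := #|{ffun 'I_p -> 'I_n}|.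
exists ((c2 * c1)%:R * (p`!)%:R + 1); first by rewrite ltr_wpDl // mulr_ge0.
move=> M b b0 Hb.
have H2 (f : 'I_p -> 'I_m) (g : 'I_p -> 'I_n) : `|\det (mxsub f g M)| <= (p`!)%:R * b ^+ p.
  by apply: det_bound => i j; rewrite mxE.
apply: (@le_trans _ _ ((c2 * c1)%:R * ((p`!)%:R * b ^+ p))); last first.
  by rewrite mulrDl mul1r mulrA lerDl exprn_ge0.
apply: (@le_trans _ _ (\sum_(f : {ffun 'I_p -> 'I_m}) \sum_(g : {ffun 'I_p -> 'I_n})
   (p`!)%:R * b ^+ p)).
  by apply: ler_sum => f _; apply: ler_sum => g _.
by rewrite sumr_const sumr_const -mulrnA [X in _ <= X]mulr_natl.
Qed.

Lemma minors_id p n : (p <= n)%N -> 1 <= minors p (1%:M : 'M[R]_n).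
Proof.
move=> pn; pose f := widen_ord pn; apply: le_trans (minor_le _ f f).
have -> : mxsub f f (1%:M : 'M[R]_n) = 1%:M.
  by apply/matrixP => i j; rewrite !mxE.
by rewrite det1 normr1.
Qed.

(** Submultiplicativity against the inverse forces a nonzero minor, and a nonzero integer minor is
    at least 1 in absolute value. This makes the logarithms of minors of path matrices
    nonnegative. *)
Lemma minors_int_ge1 p n (M : 'M[int]_n) : (p <= n)%N ->
  \det (map_mx intr M : 'M[R]_n) = 1 -> 1 <= minors p (map_mx intr M : 'M[R]_n).
Proof.
move=> pn dM; set X := map_mx intr M in dM *.
have uX : X \in unitmx by rewrite unitmxE dM unitr1.
have : 0 < minors p X.
  rewrite lt_neqAle minors_ge0 andbT; apply/negP => /eqP E.
  have := minors_mul p X (invmx X); rewrite -E mul0r mulmxV //.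
  by move=> /(le_trans (minors_id pn)); rewrite ler10.
rewrite /minors => pos; apply: contrapT => /negP; rewrite -ltNge => lt1.
have H (f g : 'I_p -> 'I_n) : `|\det (mxsub f g X)| = 0.
  have le : `|\det (mxsub f g X)| < 1 by apply: le_lt_trans (minor_le _ f g) lt1.
  move: le; rewrite /X -map_mxsub det_map_mx -intr_norm.
  rewrite ltrz1; move: (\det _) => z z1; have -> : `|z| = 0 by lia.
  by [].
move: pos; rewrite big1 ?ltxx // => f _; exact: big1.
Qed.

End Minors.

Section PathMatrices.
Variables (R : realType) (A : finType) (x0 : A).
Hypothesis d2 : (1 < #|A|)%N.
Local Notation d := #|A|.
Local Notation wn := (winner x0).
Local Notation ls := (loser x0).
Local Notation cstep := (cstep x0).
Local Notation crun := (crun x0).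
Local Notation rk := (@enum_rank A).
Implicit Types (s : cst A) (q : A -> R) (h g : seq bool) (b : bool).

(** Over an arbitrary ring, so that an integer copy of the path matrices is available for
    [minors_int_ge1]. *)
Definition stepmx (K : pzRingType) b s : 'M[K]_d :=
  1%:M + delta_mx (rk (wn b s)) (rk (ls b s)).
Fixpoint pathmx (K : pzRingType) s h : 'M[K]_d :=
  if h is b :: h' then stepmx K b s *m pathmx K (cstep b s) h' else 1%:M.

Lemma pathmx_cat (K : pzRingType) s h h' :
  pathmx K s (h ++ h') = pathmx K s h *m pathmx K (crun s h) h'.
Proof. by elim: h s => [|b h IH] s /=; rewrite ?mul1mx // IH mulmxA. Qed.

Lemma pathmx_rcons (K : pzRingType) s h b :
  pathmx K s (rcons h b) = pathmx K s h *m stepmx K b (crun s h).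
Proof. by rewrite -cats1 pathmx_cat /= mulmx1. Qed.

Lemma pathmx_intr s h : pathmx R s h = map_mx intr (pathmx int s h).
Proof.
elim: h s => [|b h IH] s /=; first by rewrite map_mx1.
by rewrite IH map_mxM /stepmx map_mxD map_mx1 map_delta_mx.
Qed.

Definition rvec q : 'rV[R]_d := \row_i q (enum_val i).

Lemma rvecE q a : rvec q 0 (rk a) = q a.
Proof. by rewrite mxE enum_rankK. Qed.

Lemma mul_stepmx (K : pzRingType) m b s (M : 'M[K]_(m, d)) i j :
  (M *m stepmx K b s) i j = M i j + (j == rk (ls b s))%:R * M i (rk (wn b s)).
Proof.
rewrite /stepmx mulmxDr mulmx1 mxE; congr (_ + _); rewrite mxE.
rewrite (bigD1 (rk (wn b s))) //= big1 ?addr0.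
  by rewrite mxE eqxx /=; case: eqP => _; rewrite ?mulr0 ?mul0r // mulr1 mul1r.
by move=> k /negbTE nk; rewrite mxE nk mulr0.
Qed.

Lemma rvec_step b s q : rvec (qstep x0 b s q) = rvec q *m stepmx R b s.
Proof.
apply/rowP => j; rewrite mul_stepmx rvecE !mxE /qstep.
have -> : (j == rk (ls b s)) = (enum_val j == ls b s).
  by apply/eqP/eqP => [->|<-]; rewrite ?enum_rankK ?enum_valK.
by case: ifP; rewrite ?mul1r ?mul0r ?addr0.
Qed.

Lemma rvec_run s q h : rvec (qrun x0 s q h) = rvec q *m pathmx R s h.
Proof. by elim: h s q => [|b h IH] s q /=; rewrite ?mulmx1 // IH rvec_step mulmxA. Qed.

Lemma qrunE s q h c : qrun x0 s q h c = \sum_a q a * pathmx R s h (rk a) (rk c).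
Proof.
rewrite -rvecE rvec_run mxE (reindex rk) /=; last first.
  by exists enum_val => i _; rewrite ?enum_rankK ?enum_valK.
by apply: eq_bigr => a _; rewrite rvecE.
Qed.

Lemma stepmx_ge0 b s i j : 0 <= stepmx R b s i j.
Proof. by rewrite !mxE addr_ge0. Qed.

Lemma pathmx_ge0 s h i j : 0 <= pathmx R s h i j.
Proof.
elim: h s i j => [|b h IH] s i j /=; rewrite mxE //.
by apply: sumr_ge0 => k _; rewrite mulr_ge0 // stepmx_ge0.
Qed.

Lemma pathmx_rcons_ge s h b i j : pathmx R s h i j <= pathmx R s (rcons h b) i j.
Proof. by rewrite pathmx_rcons mul_stepmx lerDl mulr_ge0 // pathmx_ge0. Qed.

Lemma pathmx_cat_ge s h h' i j : pathmx R s h i j <= pathmx R s (h ++ h') i j.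
Proof.
elim/last_ind: h' => [|h' b IH]; first by rewrite cats0.
by rewrite -rcons_cat; apply: le_trans IH (pathmx_rcons_ge _ _ _ _ _).
Qed.

Lemma pathmx_diag s h i : 1 <= pathmx R s h i i.
Proof.
have -> : 1 = pathmx R s [::] i i by rewrite /= mxE eqxx.
exact: (pathmx_cat_ge s [::] h).
Qed.

Lemma det_stepmx b s : good s -> \det (stepmx R b s) = 1.
Proof.
move=> gs; set w := wn b s; set l := ls b s.
have wl : rk w != rk l.
  apply/eqP => /enum_rank_inj E; have := winner_neq_loser x0 b gs _ d2.
  by case/and3P: gs => _ _ ->; rewrite -/w -/l E eqxx => /(_ isT).
(* The row of the winner is a sum of two unit rows, the second of which repeats the row of the
   loser. *)
have E : \det (stepmx R b s) = \det (1%:M : 'M[R]_d).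
  have nl k : (lift (rk w) k == rk w) = false by rewrite eq_sym (negbTE (neq_lift _ _)).
  have := @determinant_multilinear R d (stepmx R b s) 1%:M
     (\matrix_(i, j) (if i == rk w then (j == rk l)%:R else (i == j)%:R)) (rk w) 1 1.
  move=> ->.
  - rewrite !mul1r [X in _ + X](@determinant_alternate R d _ (rk w) (rk l)) ?addr0 //.
    by move=> j; rewrite !mxE eqxx [rk l == rk w]eq_sym (negbTE wl) eq_sym.
  - apply/rowP => j; rewrite !mxE eqxx /= !mul1r; congr (_ + _).
  - by apply/matrixP => i j; rewrite !mxE -/w nl /= addr0.
  - by apply/matrixP => i j; rewrite !mxE -/w nl /= addr0.
by rewrite E det1.
Qed.

Lemma det_pathmx s h : good s -> \det (pathmx R s h) = 1.
Proof.
elim: h s => [|b h IH] s gs /=; first by rewrite det1.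
by rewrite det_mulmx det_stepmx // IH ?mulr1 //; apply: good_step.
Qed.

Lemma minors_pathmx_ge1 p s h : good s -> (p <= d)%N -> 1 <= minors p (pathmx R s h).
Proof.
by move=> gs pd; rewrite pathmx_intr; apply: minors_int_ge1; rewrite // -pathmx_intr det_pathmx.
Qed.

Fixpoint winners s h : seq A :=
  if h is b :: h' then wn b s :: winners (cstep b s) h' else [::].

Lemma winners_cat s h h' : winners s (h ++ h') = winners s h ++ winners (crun s h) h'.
Proof. by elim: h s => //= b h IH s; rewrite IH. Qed.

Lemma positive_loop s : good s -> exists g, [/\ crun s g = s,
  forall i j, 1 <= pathmx R s g i j & forall a, a \in winners s g].
Proof.
move=> gs; have [N1 H1] := fsupp_full x0 gs d2.
have [N2 H2] : exists N, forall n a, (N <= n)%N -> a \in winners s (mkseq (fbit x0 s) n).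
  apply: (evfin (Q := fun a n => a \in winners s (mkseq (fbit x0 s) n))) => a.
  have [n _ wa] := fair_io x0 gs d2 a 0; exists n.+1 => m nm.
  rewrite -(subnKC nm); elim: (m - n.+1)%N => [|k IH].
    by rewrite addn0 mkseqS -cats1 winners_cat mem_cat /= -fs_run -wa mem_seq1 eqxx orbT.
  by rewrite addnS mkseqS -cats1 winners_cat mem_cat IH.
have supp n a c : c \in fsupp x0 s a n -> 1 <= pathmx R s (mkseq (fbit x0 s) n) (rk a) (rk c).
  elim: n a c => [|n IH] a c.
    by rewrite /= inE => /eqP ->; rewrite mxE eqxx.
  have -> : fsupp x0 s a n.+1 = if fw x0 s n \in fsupp x0 s a n
    then fl x0 s n |: fsupp x0 s a n else fsupp x0 s a n by [].
  rewrite mkseqS; case: ifP => [wS|_]; last first.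
    by move=> /IH H; apply: le_trans H (pathmx_rcons_ge _ _ _ _ _).
  rewrite inE => /orP [|/IH H]; last by apply: le_trans H (pathmx_rcons_ge _ _ _ _ _).
  rewrite inE => /eqP ->; rewrite pathmx_rcons mul_stepmx -fs_run eqxx mul1r.
  by apply: le_trans (IH _ _ wS) _; rewrite lerDr pathmx_ge0.
pose n := maxn N1 N2; have [g2 E2] := crun_return x0 (mkseq (fbit x0 s) n) gs.
exists (mkseq (fbit x0 s) n ++ g2); split.
- by rewrite crun_cat.
- move=> i j; apply: le_trans (pathmx_cat_ge _ _ _ _ _).
  rewrite -(enum_valK i) -(enum_valK j); apply: supp.
  by rewrite H1 ?inE // leq_maxl.
- by move=> a; rewrite winners_cat mem_cat H2 // leq_maxr.
Qed.

End PathMatrices.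

(** * First-return words *)

Section Words.
Variables (R : realType) (A : finType) (x0 : A).
Hypothesis d2 : (1 < #|A|)%N.
Local Notation d := #|A|.
Variables (s0 : cst A) (gam : seq bool).
Hypothesis gs0 : good s0.
Hypothesis gamE : crun x0 s0 gam = s0.
Hypothesis gam_pos : forall i j, 1 <= pathmx x0 R s0 gam i j.
Local Notation St := (crun x0 s0).
Local Notation Q := (qrun x0 s0).
Local Notation cpl := (cpl x0 s0 gam).
Local Notation word := (seq bool).
Implicit Types (q : A -> R) (h w : seq bool) (g : word -> \bar R) (s : seq word)
  (F : seq word -> \bar R).
Local Open Scope ereal_scope.

(** Runs over the continuations of [h] by exactly [n] bits that are complete for the first time at
    their end; an earlier completion contributes 0. *)
Fixpoint wsum g n h : \bar R :=
  if cpl h then (if n is 0%N then g h else 0)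
  else if n is m.+1 then wsum g m (rcons h true) + wsum g m (rcons h false) else 0.

(* Sum over all first-return words: paths ending with their first
   occurrence of the loop gam based at s0. *)
Definition Sw g : \bar R := \sum_(n <oo) wsum g n [::].

Definition wge0 g := forall w, cpl w -> 0 <= g w.

Lemma wsum_ge0 g n h : wge0 g -> 0 <= wsum g n h.
Proof.
by move=> g0; elim: n h => [|n IH] h /=; case: ifP => // ch; [exact: g0|rewrite adde_ge0].
Qed.

Lemma le_wsum g g' n h : (forall w, cpl w -> g w <= g' w) -> wsum g n h <= wsum g' n h.
Proof.
by move=> H; elim: n h => [|n IH] h /=; case: ifP => // ch; [exact: H|rewrite leeD].
Qed.

Lemma eq_wsum g g' n h : (forall w, cpl w -> g w = g' w) -> wsum g n h = wsum g' n h.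
Proof.
by move=> H; elim: n h => [|n IH] h /=; case: ifP => // ch; [exact: H|rewrite !IH].
Qed.

Lemma wsumD g g' n h : wsum (fun w => g w + g' w) n h = wsum g n h + wsum g' n h.
Proof.
elim: n h => [|n IH] h /=; case: ifP => // ch; rewrite ?adde0 //.
by rewrite !IH addeACA.
Qed.

Lemma wsumZ (r : R) g n h : wge0 g -> wsum (fun w => r%:E * g w) n h = r%:E * wsum g n h.
Proof.
move=> g0; elim: n h => [|n IH] h /=; case: ifP => // ch; rewrite ?mule0 //.
by rewrite !IH ge0_muleDr // wsum_ge0.
Qed.

Lemma Sw_ge0 g : wge0 g -> 0 <= Sw g.
Proof. by move=> g0; apply: nneseries_ge0 => n _ _; apply: wsum_ge0. Qed.

Lemma le_Sw g g' : wge0 g -> (forall w, cpl w -> g w <= g' w) -> Sw g <= Sw g'.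
Proof.
move=> g0 H; apply: lee_nneseries => n _; last exact: le_wsum.
by move=> _; apply: wsum_ge0.
Qed.

Lemma eq_Sw g g' : (forall w, cpl w -> g w = g' w) -> Sw g = Sw g'.
Proof. by move=> H; apply: eq_eseriesr => n _; apply: eq_wsum. Qed.

Lemma SwD g g' : wge0 g -> wge0 g' -> Sw (fun w => g w + g' w) = Sw g + Sw g'.
Proof.
move=> g0 g0'; rewrite /Sw -nneseriesD; first by apply: eq_eseriesr => n _; apply: wsumD.
  by move=> n _ _; apply: wsum_ge0.
by move=> n _ _; apply: wsum_ge0.
Qed.

Lemma SwZ (r : R) g : wge0 g -> Sw (fun w => r%:E * g w) = r%:E * Sw g.
Proof.
move=> g0; rewrite /Sw -nneseriesZl; first by apply: eq_eseriesr => n _; apply: wsumZ.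
by move=> n _; apply: wsum_ge0.
Qed.

Lemma nneseries_le (u : nat -> \bar R) (c : \bar R) : (forall n, 0 <= u n) ->
  (forall N, \sum_(0 <= n < N) u n <= c) -> \sum_(n <oo) u n <= c.
Proof.
move=> u0 H; apply: lime_le; first by apply: is_cvg_nneseries.
by apply: nearW => N; apply: H.
Qed.

Lemma Sw_vol q : qpos q -> Sw (fun w => (vol (Q q w))%:E) <= (vol q)%:E.
Proof.
move=> qp; have v0 h : (0 <= vol (Q q h))%R by rewrite ltW // vol_gt0 //; apply: qrun_pos.
apply: nneseries_le => [n|N]; first by apply: wsum_ge0 => w _; rewrite lee_fin.
suff H h : \sum_(0 <= n < N) wsum (fun w => (vol (Q q w))%:E) n h <= (vol (Q q h))%:E by apply: H.
elim: N h => [|N IH] h; first by rewrite big_geq // lee_fin.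
rewrite big_nat_recl //=; case: ifP => ch.
  by rewrite big1 ?adde0.
rewrite add0e big_split /= -(vol_children x0 gs0 h qp) EFinD.
exact: leeD.
Qed.

Lemma mom_ge0 kap q N h : qpos q -> (0 <= mom x0 s0 gam kap q N h)%R.
Proof.
move=> qp; have v0 h' : (0 <= vol (Q q h') * tot (Q q h') `^ kap)%R.
  by rewrite mulr_ge0 ?powR_ge0 // ltW // vol_gt0 //; apply: qrun_pos.
by elim: N h => [|N IH] h /=; case: ifP => // _; rewrite addr_ge0.
Qed.

Lemma Sw_mom kap q N h : qpos q ->
  \sum_(0 <= n < N) wsum (fun w => (vol (Q q w) * tot (Q q w) `^ kap)%:E) n h <=
  (mom x0 s0 gam kap q N h)%:E.
Proof.
move=> qp; elim: N h => [|N IH] h; first by rewrite big_geq // lee_fin mom_ge0.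
rewrite big_nat_recl //=; case: ifP => ch.
  by rewrite big1 ?adde0.
by rewrite add0e big_split /= EFinD; apply: leeD.
Qed.

Definition gmax : R := nrm (pathmx x0 R s0 gam).
Definition bal q := qpos q /\ forall a b, (q a <= gmax * q b)%R.

Lemma gmax_ge1 : (1 <= gmax)%R.
Proof.
apply: le_trans (gam_pos (enum_rank x0) (enum_rank x0)) _.
by apply: le_trans (ler_norm _) _; apply: nrm_entry.
Qed.

Lemma bal_one : bal (fun=> 1%R).
Proof. by split=> [a|a b]; rewrite ?ltr01 // mulr1 gmax_ge1. Qed.

(** A complete word ends with [gam], whose entries lie between 1 and [gmax]: whatever the row before
    [gam], each coordinate after it lies between the total of that row and [gmax] times this
    total. *)
Lemma bal_word q w : qpos q -> cpl w -> bal (Q q w).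
Proof.
move=> qp /cplP [g -> Sg]; rewrite qrun_cat Sg; have gp := @qrun_pos _ _ x0 s0 q g qp.
move: (Q q g) gp => r rp; split=> [|a b]; first exact: qrun_pos.
have gE (i j : 'I_d) : (pathmx x0 R s0 gam i j <= gmax)%R.
  by apply: le_trans (ler_norm _) (nrm_entry _ _ _).
apply: (@le_trans _ _ (gmax * tot r)%R).
  rewrite qrunE /tot big_distrr; apply: ler_sum => c _ /=.
  by rewrite mulrC ler_wpM2r // ltW.
rewrite ler_pM2l; last by apply: lt_le_trans gmax_ge1.
rewrite qrunE /tot; apply: ler_sum => c _; rewrite ler_peMr // ltW //.
Qed.

(** [moment_bound] concerns the total of the row after the word. For balanced [q] this is at least a
    constant times [tot q] times the norm of the word matrix, which frees the moment from [q]. *)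
Lemma word_moment : exists kap H : R, [/\ (0 < kap)%R, (1 <= H)%R & forall q, bal q ->
  Sw (fun w => (vol (Q q w) * nrm (pathmx x0 R s0 w) `^ kap)%:E) <= (H * vol q)%:E].
Proof.
have [kap [H [kap0 H1 Hm]]] := moment_bound R x0 d2 gs0 gam.
pose B : R := (d%:R * gmax)%R.
have B1 : (1 <= B)%R by rewrite -[1%R]mulr1 ler_pM // ?gmax_ge1 // ler1n (leq_trans _ d2).
have B0 : (0 < B)%R by apply: lt_le_trans B1.
have Bk : (1 <= B `^ kap)%R.
  have := @ge0_ler_powR R kap (ltW kap0) 1%R B; rewrite powR1; apply; rewrite ?nnegrE //.
  exact: ltW.
exists kap, (H * B `^ kap)%R; split => //; first by rewrite -[1%R]mulr1 ler_pM.
move=> q [qp qb]; have t0 := tot_gt0 x0 qp.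
have tk0 : (0 < tot q `^ kap)%R by apply: powR_gt0.
have v0 h : (0 < vol (Q q h))%R by rewrite vol_gt0 //; apply: qrun_pos.
have le w : (nrm (pathmx x0 R s0 w) `^ kap <= B `^ kap / tot q `^ kap * tot (Q q w) `^ kap)%R.
  have tQ : (0 <= tot (Q q w))%R by rewrite ltW // tot_gt0 //; apply: qrun_pos.
  have tq : (0 <= tot q)%R by apply: ltW.
  have B0' : (0 <= B)%R by apply: ltW.
  suff le0 : (nrm (pathmx x0 R s0 w) * tot q <= B * tot (Q q w))%R.
    have := @ge0_ler_powR R kap (ltW kap0) (nrm (pathmx x0 R s0 w) * tot q)%R (B * tot (Q q w))%R.
    rewrite !nnegrE => /(_ (mulr_ge0 (nrm_ge0 _) tq) (mulr_ge0 B0' tQ) le0).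
    by rewrite !powRM ?nrm_ge0 // => H2; rewrite mulrAC ler_pdivlMr.
    rewrite /nrm big_distrl /=.
    have -> : tot (Q q w) = (\sum_a \sum_c q a * pathmx x0 R s0 w (enum_rank a) (enum_rank c))%R.
      by rewrite /tot exchange_big; apply: eq_bigr => c _; rewrite qrunE.
    rewrite (reindex (@enum_rank A)) /=; last first.
      by exists enum_val => i _; rewrite ?enum_rankK ?enum_valK.
    rewrite [leRHS]big_distrr; apply: ler_sum => a _ /=.
    rewrite (reindex (@enum_rank A)) /=; last first.
      by exists enum_val => i _; rewrite ?enum_rankK ?enum_valK.
    rewrite big_distrl [leRHS]big_distrr; apply: ler_sum => c _ /=.
    rewrite ger0_norm ?pathmx_ge0 // mulrCA mulrA mulrC ler_wpM2r ?pathmx_ge0 //.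
    apply: (@le_trans _ _ (\sum_(b in A) gmax * q a)%R).
      by apply: ler_sum => b _; apply: qb.
    by rewrite sumr_const /B -[leLHS]mulr_natl mulrA [leRHS]mulrC.
have key : Sw (fun w => (B `^ kap / tot q `^ kap)%:E * (vol (Q q w) * tot (Q q w) `^ kap)%:E) <=
    (H * B `^ kap * vol q)%:E.
  have g0 : wge0 (fun w => (vol (Q q w) * tot (Q q w) `^ kap)%:E).
    by move=> w _; rewrite lee_fin mulr_ge0 ?powR_ge0 // ltW.
  rewrite SwZ //.
  have -> : (H * B `^ kap * vol q = (B `^ kap / tot q `^ kap) * (H * (vol q * tot q `^ kap)))%R.
    by field; rewrite lt0r_neq0.
  rewrite [leRHS]EFinM lee_pmul2l ?lte_fin ?divr_gt0 ?powR_gt0 //.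
  apply: nneseries_le => [n|N]; first exact: wsum_ge0.
  by apply: le_trans (Sw_mom _ _ _ qp) _; rewrite lee_fin; apply: Hm.
apply: le_trans key; apply: le_Sw => [w _|w _].
  by rewrite lee_fin mulr_ge0 ?powR_ge0 // ltW.
by rewrite -EFinM lee_fin mulrCA ler_pM2l.
Qed.

Fixpoint It n F : \bar R := if n is m.+1 then Sw (fun w => It m (fun s => F (w :: s))) else F [::].

Definition words n s := (size s == n) && all cpl s.

Lemma It_ge0 n F : (forall s, words n s -> 0 <= F s) -> 0 <= It n F.
Proof.
elim: n F => [|n IH] F F0 /=; first exact: F0.
by apply: Sw_ge0 => w cw; apply: IH => s /andP [sn sa]; apply: F0; rewrite /words /= eqSS sn cw.
Qed.

Lemma le_It n F F' : (forall s, words n s -> 0 <= F s) -> (forall s, words n s -> F s <= F' s) ->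
  It n F <= It n F'.
Proof.
elim: n F F' => [|n IH] F F' F0 H /=; first exact: H.
have wc w s : cpl w -> words n s -> words n.+1 (w :: s).
  by move=> cw /andP [sn sa]; rewrite /words /= eqSS sn cw.
apply: le_Sw => w cw; first by apply: It_ge0 => s ws; apply/F0/wc.
by apply: IH => s ws; [apply/F0/wc|apply/H/wc].
Qed.

Lemma eq_It n F F' : (forall s, words n s -> F s = F' s) -> It n F = It n F'.
Proof.
elim: n F F' => [|n IH] F F' H /=; first exact: H.
apply: eq_Sw => w cw; apply: IH => s /andP [sn sa]; apply: H.
by rewrite /words /= eqSS sn cw.
Qed.

Lemma ItD n F F' : (forall s, words n s -> 0 <= F s) -> (forall s, words n s -> 0 <= F' s) ->
  It n (fun s => F s + F' s) = It n F + It n F'.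
Proof.
elim: n F F' => [|n IH] F F' F0 F0' //=.
have wc w s : cpl w -> words n s -> words n.+1 (w :: s).
  by move=> cw /andP [sn sa]; rewrite /words /= eqSS sn cw.
rewrite -SwD; first by apply: eq_Sw => w cw; apply: IH => s ws; [apply/F0/wc|apply/F0'/wc].
  by move=> w cw; apply: It_ge0 => s ws; apply/F0/wc.
by move=> w cw; apply: It_ge0 => s ws; apply/F0'/wc.
Qed.

Lemma ItZ n (r : R) F : (forall s, words n s -> 0 <= F s) ->
  It n (fun s => r%:E * F s) = r%:E * It n F.
Proof.
elim: n F => [|n IH] F F0 //=.
have wc w s : cpl w -> words n s -> words n.+1 (w :: s).
  by move=> cw /andP [sn sa]; rewrite /words /= eqSS sn cw.
rewrite -SwZ; first by apply: eq_Sw => w cw; apply: IH => s ws; apply/F0/wc.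
by move=> w cw; apply: It_ge0 => s ws; apply/F0/wc.
Qed.

Lemma It_add n m F : It (n + m) F = It n (fun s => It m (fun s' => F (s ++ s'))).
Proof. by elim: n F => [|n IH] F //=; apply: eq_Sw => w cw; rewrite IH. Qed.

Definition qw q s : A -> R := foldl (fun r w => Q r w) q s.

Lemma qw_cat q s s' : qw q (s ++ s') = qw (qw q s) s'.
Proof. exact: foldl_cat. Qed.

Lemma qw_pos q s : qpos q -> qpos (qw q s).
Proof. by elim: s q => //= w s IH q qp; apply: IH; apply: qrun_pos. Qed.

Lemma qw_bal q s : bal q -> all cpl s -> bal (qw q s).
Proof.
elim: s q => //= w s IH q bq /andP [cw cs]; apply: IH => //.
by apply: bal_word => //; case: bq.
Qed.

Lemma qw_le (t : R) q q' s : (forall a, (q' a <= t * q a)%R) -> forall a, (qw q' s a <= t * qw q s a)%R.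
Proof.
elim: s q q' => //= w s IH q q' H; apply: IH => a.
rewrite !qrunE big_distrr; apply: ler_sum => c _ /=.
by rewrite mulrA ler_wpM2r // pathmx_ge0.
Qed.

(** An unnormalised expectation, to be compared with the mass [vol q]. Conditioning on a prefix [s]
    amounts to restarting from [qw q s]. *)
Definition Ex n q F : \bar R := It n (fun s => (vol (qw q s))%:E * F s).

Lemma vol_qw_ge0 q s : qpos q -> (0 <= vol (qw q s))%R.
Proof. by move=> qp; rewrite ltW // vol_gt0 //; apply: qw_pos. Qed.

Lemma Ex_ge0 n q F : qpos q -> (forall s, words n s -> 0 <= F s) -> 0 <= Ex n q F.
Proof.
by move=> qp F0; apply: It_ge0 => s ws; rewrite mule_ge0 ?lee_fin ?vol_qw_ge0 // F0.
Qed.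

Lemma le_Ex n q F F' : qpos q -> (forall s, words n s -> 0 <= F s) ->
  (forall s, words n s -> F s <= F' s) -> Ex n q F <= Ex n q F'.
Proof.
move=> qp F0 H; apply: le_It => s ws; first by rewrite mule_ge0 ?lee_fin ?vol_qw_ge0 // F0.
by rewrite lee_wpmul2l ?lee_fin ?vol_qw_ge0 // H.
Qed.

Lemma ExD n q F F' : qpos q -> (forall s, words n s -> 0 <= F s) ->
  (forall s, words n s -> 0 <= F' s) -> Ex n q (fun s => F s + F' s) = Ex n q F + Ex n q F'.
Proof.
move=> qp F0 F0'; rewrite /Ex -ItD.
- by apply: eq_It => s ws; rewrite ge0_muleDr ?F0 ?F0'.
- by move=> s ws; rewrite mule_ge0 ?lee_fin ?vol_qw_ge0 // F0.
- by move=> s ws; rewrite mule_ge0 ?lee_fin ?vol_qw_ge0 // F0'.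
Qed.

Lemma ExZ n q (r : R) F : qpos q -> (forall s, words n s -> 0 <= F s) ->
  Ex n q (fun s => r%:E * F s) = r%:E * Ex n q F.
Proof.
move=> qp F0; rewrite /Ex -ItZ; first by apply: eq_It => s ws; rewrite muleCA.
by move=> s ws; rewrite mule_ge0 ?lee_fin ?vol_qw_ge0 // F0.
Qed.

Lemma Ex_add n m q F : Ex (n + m) q F = It n (fun s => Ex m (qw q s) (fun s' => F (s ++ s'))).
Proof. by rewrite /Ex It_add; apply: eq_It => s _; apply: eq_It => s' _; rewrite qw_cat. Qed.

Lemma Ex_cst n q : qpos q -> Ex n q (fun=> 1) <= (vol q)%:E.
Proof.
elim: n q => [|n IH] q qp; first by rewrite /Ex /= mule1.
rewrite -add1n Ex_add /=; apply: le_trans (Sw_vol qp); apply: le_Sw => w cw.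
  by apply: Ex_ge0 => //; apply: (@qw_pos q [:: w]).
by apply: IH; apply: qrun_pos.
Qed.

Lemma Ex_cond n m q F (c : seq word -> R) : qpos q ->
  (forall s, words (n + m)%N s -> 0 <= F s) ->
  (forall s, words n s -> Ex m (qw q s) (fun s' => F (s ++ s')) <= (c s * vol (qw q s))%:E) ->
  Ex (n + m) q F <= Ex n q (fun s => (c s)%:E).
Proof.
move=> qp F0 H; rewrite Ex_add; apply: le_It => s ws.
  apply: Ex_ge0 => [|s' /andP [/eqP sm sa]]; first exact: qw_pos.
  case/andP: ws => /eqP sn sa'; apply: F0.
  by rewrite /words size_cat sn sm eqxx all_cat sa sa'.
by rewrite -EFinM mulrC; apply: H.
Qed.

Lemma Ex_le_cst n q F (c : R) : qpos q -> (0 <= c)%R -> (forall s, words n s -> 0 <= F s) ->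
  (forall s, words n s -> F s <= c%:E) -> Ex n q F <= (c * vol q)%:E.
Proof.
move=> qp c0 F0 H; apply: (@le_trans _ _ (c%:E * Ex n q (fun=> 1))).
  rewrite -ExZ //; apply: le_Ex => // s ws; rewrite mule1; exact: H.
by rewrite EFinM lee_wpmul2l ?lee_fin ?Ex_cst.
Qed.

(** The source of near independence: the comparison of starting rows carries over to the masses of
    all futures, with a constant that does not depend on [n]. *)
Lemma Ex_compare n q q' F (t : R) : qpos q -> qpos q' -> (forall a, (q' a <= t * q a)%R) ->
  (forall s, words n s -> 0 <= F s) -> Ex n q F <= (t ^+ d)%:E * Ex n q' F.
Proof.
move=> qp qp' H F0; rewrite /Ex -ItZ; last first.
  by move=> s ws; rewrite mule_ge0 ?lee_fin ?vol_qw_ge0 // F0.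
apply: le_It => s ws; first by rewrite mule_ge0 ?lee_fin ?vol_qw_ge0 // F0.
rewrite muleA -EFinM; apply: lee_wpmul2r; first exact: F0.
rewrite lee_fin; apply: (vol_scale x0) => //; try exact: qw_pos.
exact: qw_le.
Qed.

End Words.

(** * Growth rates of subadditive functionals *)

Section Growth.
Variables (R : realType) (A : finType) (x0 : A).
Hypothesis d2 : (1 < #|A|)%N.
Local Notation d := #|A|.
Variables (s0 : cst A) (gam : seq bool).
Hypothesis gs0 : good s0.
Hypothesis gam_pos : forall i j, 1 <= pathmx x0 R s0 gam i j.
Local Notation Q := (qrun x0 s0).
Local Notation cpl := (cpl x0 s0 gam).
Local Notation word := (seq bool).
Local Notation words := (words x0 s0 gam).
Local Notation Ex := (Ex x0 s0 gam).
Local Notation It := (It x0 s0 gam).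
Local Notation qw := (qw x0 s0).
Local Notation bal := (bal x0 s0 gam).
Local Notation Sw := (Sw x0 s0 gam).
Implicit Types (q : A -> R) (w : word) (s : seq word).

(** In the application [f] is the logarithm of the sum of minors of a product of words, and [u w]
    its value on the single word [w]. [f [::]] need not vanish, since minors of the identity are
    counted with multiplicity. *)
Variables (f : seq word -> R) (u : word -> R) (kap H : R).
Hypothesis kap0 : 0 < kap.
Hypothesis H1 : 1 <= H.
Hypothesis f_ge0 : forall s, all cpl s -> 0 <= f s.
Hypothesis f_cat : forall s s', all cpl s -> all cpl s' -> f (s ++ s') <= f s + f s'.
Hypothesis f_cons : forall w s, cpl w -> all cpl s -> f (w :: s) <= u w + f s.
Hypothesis u_ge0 : forall w, cpl w -> 0 <= u w.
Hypothesis u_mom : forall q, bal q ->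
  (Sw (fun w => (vol (Q q w) * expR (kap * u w))%:E) <= (H * vol q)%:E)%E.

Lemma words_all n s : words n s -> all cpl s.
Proof. by case/andP. Qed.

Lemma bal_pos q : bal q -> qpos q. Proof. by case. Qed.

Lemma bal_step q w : bal q -> cpl w -> bal (Q q w).
Proof. by move=> [qp _] cw; apply: bal_word. Qed.

Lemma Ex1_le n q (F : seq word -> R) (c : word -> R) : bal q ->
  (forall s, words n.+1 s -> 0 <= F s) ->
  (forall w, cpl w -> (Ex n (Q q w) (fun s => (F (w :: s))%:E) <= (c w * vol (Q q w))%:E)%E) ->
  (Ex n.+1 q (fun s => (F s)%:E) <= Sw (fun w => (vol (Q q w) * c w)%:E))%E.
Proof.
move=> bq F0 Hc; have qp := bal_pos bq.
rewrite -add1n Ex_add /=; apply: le_Sw => [w cw|w cw]; last by rewrite mulrC; apply: Hc.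
apply: Ex_ge0 => [|s ws]; first exact: qrun_pos.
rewrite lee_fin; apply: F0; case/andP: ws => /eqP sn sa.
by rewrite /words /= sn eqxx cw.
Qed.

Lemma exp_moment n q : bal q ->
  (Ex n q (fun s => (expR (kap * f s))%:E) <= (expR (kap * f [::]) * H ^+ n * vol q)%:E)%E.
Proof.
elim: n q => [|n IH] q bq; first by rewrite /Ex /= mulr1 -EFinM mulrC.
apply: le_trans (Ex1_le (c := fun w => expR (kap * f [::]) * H ^+ n * expR (kap * u w)) bq _ _) _.
- by move=> s _; apply: expR_ge0.
- move=> w cw; have bw := bal_step bq cw; have qp := bal_pos bw.
  apply: (@le_trans _ _ ((expR (kap * u w))%:E * Ex n (Q q w) (fun s => (expR (kap * f s))%:E))%E).
    rewrite -ExZ //; try by move=> s _; rewrite lee_fin expR_ge0.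
    apply: le_Ex => // s /words_all sa; try by rewrite lee_fin expR_ge0.
    by rewrite -EFinM lee_fin -expRD -mulrDr ler_expR ler_pM2l // f_cons.
  apply: le_trans (lee_wpmul2l _ (IH _ bw)) _; try by rewrite lee_fin expR_ge0.
  by rewrite -EFinM lee_fin le_eqVlt; apply/orP; left; apply/eqP; ring.
apply: (@le_trans _ _ ((expR (kap * f [::]) * H ^+ n)%:E * (H * vol q)%:E)%E); last first.
  by rewrite -EFinM lee_fin exprSr !mulrA.
apply: le_trans (lee_wpmul2l _ (u_mom bq)); last first.
  by rewrite lee_fin mulr_ge0 ?expR_ge0 // exprn_ge0 // (le_trans _ H1).
rewrite -SwZ; last first.
  by move=> w _; rewrite lee_fin mulr_ge0 ?expR_ge0 // ltW // vol_gt0 //; apply: qrun_pos; apply: bal_pos.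
apply: le_Sw => w cw.
  rewrite lee_fin !mulr_ge0 ?expR_ge0 ?exprn_ge0 ?(le_trans _ H1) //.
  by rewrite ltW // vol_gt0 //; apply: qrun_pos; apply: bal_pos.
by rewrite -EFinM lee_fin le_eqVlt; apply/orP; left; apply/eqP; ring.
Qed.

(** A bound for the worst mean over all balanced starting rows, relative to their mass;
    [mean_bound_ex] shows that such bounds exist. *)
Definition mean_bound n (a : R) :=
  0 <= a /\ forall q, bal q -> (Ex n q (fun s => (f s)%:E) <= (a * vol q)%:E)%E.
Definition mean n : R := inf (mean_bound n).

Lemma le_expkap (x : R) : x <= kap^-1 * expR (kap * x).
Proof.
rewrite -ler_pdivrMl ?invr_gt0 // invrK; apply: le_trans (expR_ge1Dx _); by rewrite lerDr.
Qed.

Lemma mean_bound_ex n : mean_bound n (kap^-1 * (expR (kap * f [::]) * H ^+ n)).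
Proof.
have Hn : 0 <= H ^+ n by rewrite exprn_ge0 // (le_trans _ H1).
split; first by rewrite !mulr_ge0 ?invr_ge0 ?expR_ge0 // ltW.
move=> q bq; have qp := bal_pos bq.
apply: (@le_trans _ _ ((kap^-1)%:E * Ex n q (fun s => (expR (kap * f s))%:E))%E).
  rewrite -ExZ //; try by move=> s _; rewrite lee_fin expR_ge0.
  apply: le_Ex => // s ws; first by rewrite lee_fin f_ge0 // (words_all ws).
  by rewrite -EFinM lee_fin le_expkap.
apply: le_trans (lee_wpmul2l _ (exp_moment n bq)) _; first by rewrite lee_fin invr_ge0 ltW.
by rewrite -EFinM lee_fin !mulrA.
Qed.

Lemma mean_has_inf n : has_inf (mean_bound n).
Proof.
by split; [exists (kap^-1 * (expR (kap * f [::]) * H ^+ n)); apply: mean_bound_ex|exists 0 => a []].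
Qed.

Lemma meanP n : mean_bound n (mean n).
Proof.
have hi := mean_has_inf n; split; first by apply: lb_le_inf => [|a []]; case: hi.
move=> q bq; apply/lee_addgt0Pr => e e0.
have v0 : 0 < vol q by apply: vol_gt0; apply: bal_pos.
have [a [a0 Ha] lt] := inf_adherent (divr_gt0 e0 v0) hi.
apply: le_trans (Ha q bq) _; rewrite -EFinD lee_fin.
have -> : mean n * vol q + e = (mean n + e / vol q) * vol q by field; rewrite lt0r_neq0.
by rewrite ler_pM2r // ltW.
Qed.

Lemma mean_le n a : mean_bound n a -> mean n <= a.
Proof. by move=> Ha; apply: ge_inf => //; exists 0 => b []. Qed.

Lemma mean_ge0 n : 0 <= mean n. Proof. by case: (meanP n). Qed.

(* The limit of mean n / n, by Fekete's lemma. *)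
Definition chi : R := inf [set mean n.+1 / n.+1%:R | n in [set: nat]].

Lemma chi_has_inf : has_inf [set mean n.+1 / n.+1%:R | n in [set: nat]].
Proof.
split; first by exists (mean 1 / 1%:R); exists 0%N.
by exists 0 => _ [n _ <-]; rewrite divr_ge0 ?mean_ge0.
Qed.

Lemma chi_ge0 : 0 <= chi.
Proof. by apply: lb_le_inf => [|_ [n _ <-]]; [case: chi_has_inf|rewrite divr_ge0 ?mean_ge0]. Qed.

Lemma chi_mean n : chi * n%:R <= mean n.
Proof.
case: n => [|n]; first by rewrite mulr0 mean_ge0.
rewrite -ler_pdivlMr ?ltr0n //; apply: ge_inf; last by exists n.
by case: chi_has_inf.
Qed.

Lemma chi_approx e : 0 < e -> exists2 m, (0 < m)%N & mean m <= (chi + e) * m%:R.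
Proof.
move=> e0; have [_ [n _ <-] lt] := inf_adherent e0 chi_has_inf.
by exists n.+1 => //; rewrite -ler_pdivrMr ?ltr0n // ltW.
Qed.

Lemma exp_quadratic (x : R) : 0 <= x -> expR x <= 1 + x + x ^+ 2 * expR x.
Proof.
move=> x0'; have E0 := expR_gt0 x; have := expR_ge1Dx (- x); rewrite expRN => h.
have : (1 - x) * expR x <= 1 by rewrite -ler_pdivlMr // mul1r.
nra.
Qed.

Lemma sqr_le_exp (x : R) : 0 <= x -> x ^+ 2 <= 4 * expR x.
Proof.
move=> x0'; have h : 1 + x / 2 <= expR (x / 2) by apply: expR_ge1Dx.
have -> : expR x = expR (x / 2) ^+ 2 by rewrite -expRM_natl mulrC divfK.
by nra.
Qed.

(* Exponential upper bound: split into blocks on which the mean is close to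
   chi and use exp x <= 1 + x + x^2 exp x. *)
Lemma upper_growth e : 0 < e -> exists t C : R, [/\ 0 < t, t <= kap, 0 < C & forall q n, bal q ->
  (Ex n q (fun s => (expR (t * f s))%:E) <= (C * expR (t * (chi + e) * n%:R) * vol q)%:E)%E].
Proof.
move=> e0; have [m m0 Hm] := chi_approx (divr_gt0 e0 (ltr0n R 2)).
have mR : 0 < m%:R :> R by rewrite ltr0n.
pose K n := expR (kap * f [::]) * H ^+ n.
have K0 n : 0 < K n by rewrite mulr_gt0 ?expR_gt0 // exprn_gt0 // (lt_le_trans _ H1).
(* The constant [16 / kap ^+ 2] bounds [f^2 exp (t f)] by [exp (kap f)] for [t <= kap / 2], through
   [sqr_le_exp] at [kap * f / 2]; [K m] is the exponential moment of a block. *)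
pose C2 := 16 / kap ^+ 2 * K m.
have C20 : 0 < C2 by rewrite mulr_gt0 ?divr_gt0 ?exprn_gt0.
(* Small enough for the quadratic term [t * C2] to fit into the half of the margin [e * m] left by
   [Hm]. *)
pose t := Num.min (kap / 2) (e / 2 * m%:R / C2).
have t0 : 0 < t by rewrite lt_min !divr_gt0 //= mulr_gt0 // divr_gt0.
have tk : t <= kap / 2 by rewrite ge_min lexx.
have tC : t * C2 <= e / 2 * m%:R by rewrite -ler_pdivlMr // ge_min lexx orbT.
have tk' : t <= kap by lra.
exists t, (K m); split => //.
have block q : bal q -> (Ex m q (fun s => (expR (t * f s))%:E) <=
    (expR (t * (chi + e) * m%:R) * vol q)%:E)%E.
  move=> bq; have qp := bal_pos bq; have v0 : 0 < vol q by apply: vol_gt0.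
  apply: (@le_trans _ _ (Ex m q (fun s => (1 + t%:E * (f s)%:E) +
      (t ^+ 2 * (16 / kap ^+ 2))%:E * (expR (kap * f s))%:E)%E)).
    apply: le_Ex => // s ws; try by rewrite lee_fin expR_ge0.
    have fs := f_ge0 (words_all ws).
    have tf : 0 <= t * f s by rewrite mulr_ge0 // ltW.
    rewrite -!EFinM -!EFinD lee_fin; apply: le_trans (exp_quadratic tf) _.
    rewrite lerD2l exprMn -mulrA -[leRHS]mulrA; apply: ler_wpM2l; first exact: sqr_ge0.
    have A2 : expR (t * f s) <= expR (kap * f s / 2) by rewrite ler_expR; nra.
    have : (kap * f s / 2) ^+ 2 <= 4 * expR (kap * f s / 2).
      by apply: sqr_le_exp; rewrite divr_ge0 // mulr_ge0 // ltW.
    have -> : expR (kap * f s) = expR (kap * f s / 2) ^+ 2.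
      by rewrite -expRM_natl; congr expR; field.
    move=> A1; rewrite [leRHS]mulrAC ler_pdivlMr ?exprn_gt0 //; move: A1.
    have -> : (kap * f s / 2) ^+ 2 = kap ^+ 2 * f s ^+ 2 / 4 by field.
    have E0 := expR_gt0 (t * f s); have E1 := expR_gt0 (kap * f s / 2).
    move: (expR (t * f s)) (expR (kap * f s / 2)) A2 E0 E1 => E X A2 E0 E1 A1.
    have A3 : kap ^+ 2 * f s ^+ 2 <= 16 * X by lra.
    have A4 : 0 <= kap ^+ 2 * f s ^+ 2 by rewrite mulr_ge0 // sqr_ge0.
    have -> : f s ^+ 2 * E * kap ^+ 2 = (kap ^+ 2 * f s ^+ 2) * E by ring.
    have -> : 16 * X ^+ 2 = 16 * X * X by ring.
    exact: ler_pM A4 (ltW E0) A3 A2.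
  have t2 : 0 <= t ^+ 2 * (16 / kap ^+ 2).
    by apply: mulr_ge0; [apply: sqr_ge0|apply: divr_ge0 => //; apply: sqr_ge0].
  rewrite ExD //; first last.
  - by move=> s _; rewrite -EFinM lee_fin; apply: mulr_ge0 => //; apply: expR_ge0.
  - move=> s ws; rewrite -EFinM -EFinD lee_fin addr_ge0 // mulr_ge0 ?(ltW t0) //.
    by apply: f_ge0; apply: words_all ws.
  rewrite ExD //; try by move=> s ws; rewrite -EFinM lee_fin mulr_ge0 ?(ltW t0) // f_ge0 // (words_all ws).
  rewrite ExZ //; try by move=> s ws; rewrite lee_fin f_ge0 // (words_all ws).
  rewrite ExZ //; try by move=> s ws; rewrite lee_fin expR_ge0.
  apply: (@le_trans _ _ ((vol q)%:E + t%:E * (mean m * vol q)%:E +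
     (t ^+ 2 * (16 / kap ^+ 2))%:E * (K m * vol q)%:E)%E).
    apply: leeD; first apply: leeD; first exact: Ex_cst.
      by rewrite lee_wpmul2l ?lee_fin ?(ltW t0) //; case: (meanP m) => _; apply.
    by rewrite lee_wpmul2l ?lee_fin // exp_moment.
  rewrite -!EFinM -!EFinD lee_fin.
  have -> : vol q + t * (mean m * vol q) + t ^+ 2 * (16 / kap ^+ 2) * (K m * vol q) =
    (1 + (t * mean m + t * (t * C2))) * vol q by rewrite /C2; ring.
  rewrite ler_pM2r //; apply: le_trans (expR_ge1Dx _) _; rewrite ler_expR -!mulrDr -!mulrA ler_pM2l //.
  lra.
move=> q n bq; rewrite (divn_eq n m).
have r_lt : (n %% m <= m)%N by rewrite ltnW // ltn_mod.
move: (n %/ m)%N (n %% m)%N r_lt => b r r_lt {n}.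
have ce0 : 0 <= t * (chi + e) by rewrite mulr_ge0 ?(ltW t0) // addr_ge0 ?chi_ge0 // ltW.
(* The last block has at most [m] words and is absorbed in the constant [K m]. *)
suff : (Ex (b * m + r) q (fun s => (expR (t * f s))%:E) <=
    (K m * expR (t * (chi + e) * (b * m)%:R) * vol q)%:E)%E.
  move/le_trans; apply; rewrite lee_fin ler_wpM2r //; first by rewrite ltW // vol_gt0 //; apply: bal_pos.
  by rewrite ler_pM2l // ler_expR ler_wpM2l // ler_nat leq_addr.
elim: b q bq => [|b IH] q bq; have qp := bal_pos bq; have v0 : 0 < vol q by apply: vol_gt0.
  rewrite mul0n add0n mulr0 expR0 mulr1.
  apply: (@le_trans _ _ (Ex r q (fun s => (expR (kap * f s))%:E))).
    apply: le_Ex => // s ws; try by rewrite lee_fin expR_ge0.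
    by rewrite lee_fin ler_expR ler_wpM2r // f_ge0 // (words_all ws).
  apply: le_trans (exp_moment r bq) _; rewrite lee_fin ler_pM2r // ler_pM2l ?expR_gt0 //.
  by rewrite ler_weXn2l.
rewrite mulSn -addnA.
apply: le_trans (Ex_cond (c := fun s => K m * expR (t * (chi + e) * (b * m)%:R) * expR (t * f s)) qp _ _) _.
- by move=> s _; rewrite lee_fin expR_ge0.
- move=> s ws; have sa := words_all ws; have bs : bal (qw q s) by apply: qw_bal.
  have qs := bal_pos bs.
  apply: (@le_trans _ _ ((expR (t * f s))%:E *
      Ex (b * m + r) (qw q s) (fun s' => (expR (t * f s'))%:E))%E).
    rewrite -ExZ //; try by move=> s' _; rewrite lee_fin expR_ge0.
    apply: le_Ex => // s' ws'; try by rewrite lee_fin expR_ge0.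
    by rewrite -EFinM lee_fin -expRD ler_expR -mulrDr ler_pM2l // f_cat // (words_all ws').
  apply: le_trans (lee_wpmul2l _ (IH _ bs)) _; try by rewrite lee_fin expR_ge0.
  by rewrite -EFinM lee_fin le_eqVlt; apply/orP; left; apply/eqP; ring.
under eq_fun do rewrite EFinM.
have M0 : 0 <= K m * expR (t * (chi + e) * (b * m)%:R) by rewrite mulr_ge0 ?expR_ge0 // ltW.
rewrite ExZ //; try by move=> s _; rewrite lee_fin expR_ge0.
apply: le_trans (lee_wpmul2l _ (block q bq)) _; first by rewrite lee_fin.
have -> : t * (chi + e) * (m + b * m)%:R = t * (chi + e) * m%:R + t * (chi + e) * (b * m)%:R.
  by rewrite natrD; ring.
rewrite -EFinM lee_fin expRD le_eqVlt; apply/orP; left; apply/eqP; ring.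
Qed.

Section Lower.
Variable c : R.
Hypothesis c0 : 0 <= c.
Hypothesis c_lt : c < chi.

Definition above s := all (fun n => c * n%:R < f (take n s)) (iota 1 (size s)).

Lemma aboveP s : reflect (forall n, (0 < n <= size s)%N -> c * n%:R < f (take n s)) (above s).
Proof.
apply: (iffP allP) => Ha n.
  by move=> /andP [n0 ns]; apply: Ha; rewrite mem_iota n0 add1n ltnS.
by rewrite mem_iota add1n ltnS; apply: Ha.
Qed.

(** Bounds the increase of [hmax] when the word [w] is put in front: 0 unless the new sequence is
    [above]. *)
Definition phi s : R := if s is w :: _ then (above s)%:R * (u w + c) else 0.
Fixpoint gain s : R := if s is w :: s' then phi s + gain s' else 0.
Fixpoint hmax s : R :=
  if s is w :: s' then Num.max (f s - c * (size s)%:R) (hmax s') else f [::].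

Lemma hmax_drop s n : f (drop n s) - c * (size (drop n s))%:R <= hmax s.
Proof.
elim: s n => [|w s IH] [|n]; rewrite /= ?mulr0 ?subr0 //.
  by rewrite le_max lexx.
by rewrite le_max IH orbT.
Qed.

Lemma phi_ge0 s : all cpl s -> 0 <= phi s.
Proof. by case: s => //= w s /andP [cw _]; rewrite mulr_ge0 ?addr_ge0 ?u_ge0. Qed.

Lemma gain_ge0 s : all cpl s -> 0 <= gain s.
Proof.
elim: s => //= w s IH /andP [cw cs]; apply: addr_ge0; last exact: IH.
by apply: (@phi_ge0 (w :: s)); rewrite /= cw.
Qed.

(* A Pliss-type argument: the maximum of f - c*size over the suffixes only
   increases at those suffixes whose prefixes all grow faster than c. *)
Lemma hmax_gain s : all cpl s -> hmax s <= f [::] + gain s.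
Proof.
elim: s => [|w s IH] /=; first by rewrite addr0.
case/andP=> cw cs; have IHs := IH cs.
have p0 : 0 <= phi (w :: s) by apply: phi_ge0; rewrite /= cw.
rewrite ge_max; apply/andP; split; last by apply: le_trans IHs _; rewrite lerD2l lerDr.
have [le|lt] := leP (f (w :: s) - c * (size (w :: s))%:R) (hmax s).
  by apply: le_trans le _; apply: le_trans IHs _; rewrite lerD2l lerDr.
have ab : above (w :: s).
  apply/aboveP => -[//|n] /andP [_ ns]; have := hmax_drop s n => hd.
  have fc := f_cat (s := take n.+1 (w :: s)) (s' := drop n.+1 (w :: s)).
  have : all cpl (w :: s) by rewrite /= cw.
  rewrite -[in X in X -> _](cat_take_drop n.+1 (w :: s)) all_cat => /andP [a1 a2].
  have := fc a1 a2.
  rewrite cat_take_drop; move: lt hd.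
  have -> : (size (w :: s))%:R = n.+1%:R + (size (drop n s))%:R :> R.
    by rewrite size_drop -natrD /= addSn subnKC.
  by rewrite mulrDr /=; lra.
rewrite /phi ab mul1r.
have h2 : f s <= f [::] + gain s + c * (size s)%:R.
  by have := hmax_drop s 0; rewrite drop0; lra.
rewrite lerBlDr; apply: le_trans (f_cons cw cs) _.
have -> : c * (size (w :: s))%:R = c * (size s)%:R + c by rewrite /= -natr1 mulrDr mulr1.
apply: le_trans (lerD (lexx (u w)) h2) _; rewrite -subr_ge0.
rewrite (_ : _ - _ = c + c); last by ring.
by rewrite addr_ge0.
Qed.

Lemma f_gain s : all cpl s -> f s <= c * (size s)%:R + f [::] + gain s.
Proof.
by move=> sa; have := hmax_gain sa; have := hmax_drop s 0; rewrite drop0; lra.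
Qed.

Lemma bal_ratio q q' : bal q -> bal q' -> exists t t' : R, [/\ 0 < t, 0 < t',
  t * t' = gmax R x0 s0 gam ^+ 4 & (forall a, q' a <= t * q a) /\ (forall a, q a <= t' * q' a)].
Proof.
move=> [qp qb] [qp' qb']; set G := gmax R x0 s0 gam.
have G0 : 0 < G by apply: lt_le_trans (gmax_ge1 gam_pos).
have key (r r' : A -> R) a : qpos r -> qpos r' -> (forall a b, r a <= G * r b) ->
    (forall a b, r' a <= G * r' b) -> r' a <= G ^+ 2 * (r' x0 / r x0) * r a.
  move=> rp rp' rb rb'; apply: le_trans (rb' a x0) _.
  rewrite expr2 -!mulrA ler_pM2l // mulrCA ler_peMr //; first exact: ltW.
  by rewrite mulrA [G * _]mulrC -mulrA ler_pdivlMl ?mulr1 //; apply: rb.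
exists (G ^+ 2 * (q' x0 / q x0)), (G ^+ 2 * (q x0 / q' x0)); split.
- by rewrite mulr_gt0 ?exprn_gt0 // divr_gt0.
- by rewrite mulr_gt0 ?exprn_gt0 // divr_gt0.
- by field; rewrite !lt0r_neq0.
- by split=> a; apply: key.
Qed.

(** Balanced rows are proportional up to bounded factors. The proportionality constant cancels
    against the normalisation by [vol], because [t * t'] in [bal_ratio] is a fixed power of
    [gmax]. *)
Lemma Ex_bal n q q' (F : seq word -> \bar R) (b : R) : bal q -> bal q' ->
  (forall s, words n s -> (0 <= F s)%E) -> 0 <= b -> (Ex n q F <= (b * vol q)%:E)%E ->
  (Ex n q' F <= ((gmax R x0 s0 gam ^+ 4) ^+ d * b * vol q')%:E)%E.
Proof.
move=> bq bq' F0 b0 Hq; have qp := bal_pos bq; have qp' := bal_pos bq'.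
have [t [t' [t0 t0' <- [h1 h2]]]] := bal_ratio bq bq'.
apply: le_trans (Ex_compare (t := t') qp' qp h2 F0) _.
apply: le_trans (lee_wpmul2l _ Hq) _; first by rewrite lee_fin exprn_ge0 // ltW.
rewrite -EFinM lee_fin.
have := vol_scale x0 qp qp' h1 => vs.
rewrite exprMn; have -> : t ^+ d * t' ^+ d * b * vol q' = t' ^+ d * (b * (t ^+ d * vol q')) by ring.
rewrite ler_pM2l ?exprn_gt0 //; exact: ler_wpM2l.
Qed.

(** Splits [u w] at the threshold [4 / (dl * kap ^+ 2)], beyond which [sqr_le_exp] puts it below
    [dl * exp (kap * u w)]. Thus a small mass of [above] makes the mean of [phi] small. *)
Lemma phi_le s : all cpl s -> forall dl : R, 0 < dl ->
  phi s <= (2 * (4 / (dl * kap ^+ 2)) + c) * (above s)%:R +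
    dl * (if s is w :: _ then expR (kap * u w) else 0).
Proof.
case: s => [_ dl dl0|w s /= /andP [cw cs] dl dl0].
  rewrite mulr0 addr0 mulr_ge0 // addr_ge0 // mulr_ge0 // divr_ge0 // mulr_ge0 ?sqr_ge0 //.
  exact: ltW.
set B := 4 / (dl * kap ^+ 2); have B0 : 0 < B by rewrite divr_gt0 // mulr_gt0 // exprn_gt0.
have e0 := expR_gt0 (kap * u w); have u0 := u_ge0 cw.
have de : 0 < dl * expR (kap * u w) by rewrite mulr_gt0.
case: (above _); last by rewrite mul0r mulr0 add0r ltW.
rewrite mul1r mulr1.
suff : u w <= B + dl * expR (kap * u w) by lra.
have [le|lt] := leP (u w) B; first by lra.
have : (kap * u w) ^+ 2 <= 4 * expR (kap * u w) by apply: sqr_le_exp; rewrite mulr_ge0 // ltW.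
move=> h; suff : u w <= dl * expR (kap * u w) by lra.
have {}h : dl * (kap ^+ 2 * u w ^+ 2) <= 4 * (dl * expR (kap * u w)) by rewrite -exprMn; nra.
have BE : B * (dl * kap ^+ 2) = 4 by rewrite /B divfK // lt0r_neq0 // mulr_gt0 // exprn_gt0.
have k0 : 0 < dl * kap ^+ 2 by rewrite mulr_gt0 // exprn_gt0.
have : 4 * u w <= u w * (u w * (dl * kap ^+ 2)).
  by rewrite mulrC ler_wpM2l // -BE ler_pM2r // ltW.
have -> : u w * (u w * (dl * kap ^+ 2)) = dl * (kap ^+ 2 * u w ^+ 2) by ring.
lra.
Qed.

End Lower.

Lemma head_moment n q : bal q ->
  (Ex n q (fun s => (if s is w :: _ then expR (kap * u w) else 0)%:E) <= (H * vol q)%:E)%E.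
Proof.
move=> bq; have qp := bal_pos bq; case: n => [|n].
  by rewrite /Ex /= mule0 lee_fin mulr_ge0 ?(le_trans _ H1) // ltW // vol_gt0.
apply: le_trans (u_mom bq).
apply: (Ex1_le (F := fun s => if s is w :: _ then expR (kap * u w) else 0) (c := fun w => expR (kap * u w)) bq).
  by case=> // w s _; apply: expR_ge0.
have {}qp w : qpos (Q q w) by apply: qrun_pos.
by move=> w cw; apply: Ex_le_cst => //; rewrite ?expR_ge0 // => s _; rewrite lee_fin expR_ge0.
Qed.

(** If [above] had relative mass below [eta] for one length [m] and one row, it would be rare for
    all balanced rows by [Ex_bal], and for all longer sequences since it passes to prefixes; the
    mean of [phi] would then be at most [b]. Summing over suffixes gives [mean n <= (c + b) * n + K]
    with [c + b < chi], against [chi_mean]. *)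
Lemma lower_growth c : 0 <= c -> c < chi -> exists2 eta : R, 0 < eta <= 1 & forall q m, bal q ->
  ((eta * vol q)%:E <= Ex m q (fun s => ((above c s)%:R)%:E))%E.
Proof.
move=> c0 c_lt; apply: contrapT => no.
pose b := (chi - c) / 2; have b0 : 0 < b by rewrite divr_gt0 // subr_gt0.
have H0 : 0 < H by apply: lt_le_trans H1.
(* Half of [b] is reserved for the exponential tail, [dl * H = b / 2], and half for the mass of
   [above], [B * (G * eta) <= b / 2]. *)
pose dl := b / (2 * H); have dl0 : 0 < dl by rewrite divr_gt0 // mulr_gt0.
pose B := 2 * (4 / (dl * kap ^+ 2)) + c.
have B0 : 0 < B by rewrite ltr_pwDl // mulr_gt0 // divr_gt0 // mulr_gt0 // exprn_gt0.
pose G := (gmax R x0 s0 gam ^+ 4) ^+ d.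
have G1 : 1 <= G by rewrite !exprn_ege1 // (gmax_ge1 gam_pos).
have G0 : 0 < G by apply: lt_le_trans G1.
pose eta := Num.min 1 (b / (2 * B * G)).
have eta0 : 0 < eta by rewrite lt_min ltr01 divr_gt0 // mulr_gt0 // mulr_gt0.
have eta1 : eta <= 1 by rewrite ge_min lexx.
have etaB : B * (G * eta) <= b / 2.
  have : eta <= b / (2 * B * G) by rewrite ge_min lexx orbT.
  by rewrite ler_pdivlMr ?mulr_gt0 //; lra.
have [q1 [m [bq1 lt1]]] : exists q m, bal q /\ (Ex m q (fun s => ((above c s)%:R)%:E) < (eta * vol q)%:E)%E.
  apply: contrapT => h; apply: no; exists eta; first by rewrite eta0.
  by move=> q m bq; rewrite leNgt; apply/negP => lt; apply: h; exists q, m.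
have m0 : (0 < m)%N.
  rewrite lt0n; apply/eqP => m0; move: lt1; rewrite m0 /Ex /= mule1.
  by rewrite lte_fin ltNge ler_piMl // ltW // vol_gt0 //; apply: bal_pos.
have abo n s : words n s -> (0 <= ((above c s)%:R)%:E :> \bar R)%E by rewrite lee_fin.
have small q : bal q -> (Ex m q (fun s => (phi c s)%:E) <= (b * vol q)%:E)%E.
  move=> bq; have qp := bal_pos bq; have v0 := vol_gt0 qp.
  have hd s : (0 <= (if s is w :: _ then expR (kap * u w) else 0)%:E)%E.
    by case: s => // w s; rewrite lee_fin expR_ge0.
  apply: (@le_trans _ _ (Ex m q (fun s => B%:E * ((above c s)%:R)%:E +
      dl%:E * (if s is w :: _ then expR (kap * u w) else 0)%:E)%E)).
    apply: le_Ex => // s ws; have sa := words_all ws; first by rewrite lee_fin phi_ge0.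
    by rewrite -!EFinM -EFinD lee_fin; apply: phi_le.
  rewrite ExD //; first last.
  - by move=> s _; apply: mule_ge0; [rewrite lee_fin ltW|exact: hd].
  - by move=> s ws; rewrite mule_ge0 ?lee_fin ?(ltW B0) ?(abo m).
  rewrite ExZ //; try by move=> s ws; apply: abo ws.
  rewrite ExZ //.
  apply: (@le_trans _ _ (B%:E * (G * eta * vol q)%:E + dl%:E * (H * vol q)%:E)%E).
    apply: leeD; apply: lee_wpmul2l; rewrite ?lee_fin ?(ltW B0) ?(ltW dl0) ?head_moment //.
    by apply: (Ex_bal bq1 bq) => //; try exact: abo; apply: ltW.
  rewrite -!EFinM -EFinD lee_fin.
  have -> : B * (G * eta * vol q) + dl * (H * vol q) = (B * (G * eta) + dl * H) * vol q by ring.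
  rewrite ler_pM2r //; have -> : dl * H = b / 2 by rewrite /dl; field; rewrite lt0r_neq0.
  lra.
have phi0 n s : words n s -> (0 <= (phi c s)%:E)%E.
  by move=> /words_all sa; rewrite lee_fin phi_ge0.
have smallk q k : bal q -> (m <= k)%N -> (Ex k q (fun s => (phi c s)%:E) <= (b * vol q)%:E)%E.
  move=> bq mk; rewrite -(subnKC mk); have qp := bal_pos bq.
  apply: le_trans (small q bq).
  apply: le_trans (Ex_cond (c := phi c) qp _ _) _ => //; first exact: phi0.
  move=> s ws; have sa := words_all ws; apply: Ex_le_cst; rewrite ?phi_ge0 //.
  - by apply: qw_pos.
  - by move=> s' ws'; rewrite lee_fin phi_ge0 // all_cat sa (words_all ws').
  move=> s' ws'; rewrite lee_fin; case: s ws sa => [|w s] ws sa /=.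
    by case/andP: ws => /eqP /= E; move: m0; rewrite -E.
  have u0 : 0 <= u w + c by rewrite addr_ge0 // u_ge0 //; case/andP: sa.
  rewrite ler_wpM2r //; case: (boolP (above c (w :: s ++ s'))) => // ab.
  suff -> : above c (w :: s) by [].
  apply/aboveP => n /andP [n0 ns]; have := aboveP _ _ ab n; rewrite n0.
  rewrite -cat_cons size_cat (leq_trans ns (leq_addr _ _)) => /(_ isT).
  by rewrite takel_cat.
pose U := kap^-1 * H + c.
have U0 : 0 <= U by rewrite addr_ge0 // mulr_ge0 ?invr_ge0 ?ltW.
have phiU q k : bal q -> (Ex k q (fun s => (phi c s)%:E) <= (U * vol q)%:E)%E.
  move=> bq; have qp := bal_pos bq; have v0 := vol_gt0 qp.
  have hd s : (0 <= (if s is w :: _ then expR (kap * u w) else 0)%:E)%E.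
    by case: s => // w s; rewrite lee_fin expR_ge0.
  have ik : 0 <= kap^-1 by rewrite invr_ge0 ltW.
  apply: (@le_trans _ _ (Ex k q (fun s =>
      (kap^-1)%:E * (if s is w :: _ then expR (kap * u w) else 0)%:E + c%:E)%E)).
    apply: le_Ex => // s ws; first exact: phi0 ws.
    rewrite -EFinM -EFinD lee_fin; case: s ws => [|w s] ws /=; first by rewrite mulr0 add0r.
    have uw : 0 <= u w by apply: u_ge0; case/andP: (words_all ws).
    have := le_expkap (u w); case: (above c _); rewrite ?mul1r ?mul0r; lra.
  rewrite ExD //; last by move=> s _; apply: mule_ge0; [rewrite lee_fin|exact: hd].
  rewrite ExZ // /U mulrDl EFinD; apply: leeD; last exact: Ex_le_cst.
  by rewrite -mulrA EFinM; apply: lee_wpmul2l; rewrite ?lee_fin // head_moment.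
have gain0 n s : words n s -> (0 <= (gain c s)%:E)%E.
  by move=> /words_all sa; rewrite lee_fin gain_ge0.
(* The at most [m] short suffixes, which [smallk] does not cover, get the crude bound [U]. *)
have gainE n q : bal q -> (Ex n q (fun s => (gain c s)%:E) <=
    (((minn n m)%:R * U + n%:R * b) * vol q)%:E)%E.
  elim: n q => [|n IH] q bq; have qp := bal_pos bq; have v0 := vol_gt0 qp.
    by rewrite /Ex /= mule0 min0n !mul0r addr0 mul0r.
  have bh0 s : words n.+1 s -> (0 <= (gain c (behead s))%:E)%E.
    case: s => [|w s] /words_all /= sa; rewrite lee_fin //; apply: gain_ge0 => //.
    by case/andP: sa.
  apply: (@le_trans _ _ (Ex n.+1 q (fun s => (phi c s)%:E + (gain c (behead s))%:E)%E)).
    apply: le_Ex => // s ws; first exact: gain0 ws.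
    by case: s ws => [|w s] ws; rewrite -EFinD lee_fin /= ?addr0.
  rewrite ExD //; last by move=> s; apply: phi0.
  have IH2 : (Ex n.+1 q (fun s => (gain c (behead s))%:E) <=
      (((minn n m)%:R * U + n%:R * b) * vol q)%:E)%E.
    have C0 : 0 <= (minn n m)%:R * U + n%:R * b by rewrite addr_ge0 // mulr_ge0 // ltW.
    apply: le_trans (Ex1_le (F := fun s => gain c (behead s))
       (c := fun=> (minn n m)%:R * U + n%:R * b) bq _ _) _.
    - by move=> s ws; have := bh0 s ws; rewrite lee_fin.
    - by move=> w cw; apply: IH; apply: bal_step.
    have w0 w : (0 <= (vol (Q q w))%:E)%E.
      by rewrite lee_fin ltW // vol_gt0 //; apply: qrun_pos.
    rewrite (eq_Sw (g' := fun w => (((minn n m)%:R * U + n%:R * b)%:E * (vol (Q q w))%:E)%E)); last first.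
      by move=> w _; rewrite -EFinM mulrC.
    rewrite SwZ // EFinM; apply: lee_wpmul2l; first by rewrite lee_fin.
    exact: Sw_vol.
  have [nm|mn] := leqP n.+1 m.
    have E : minn n m = n by apply/minn_idPl; apply: ltnW.
    apply: le_trans (leeD (phiU q n.+1 bq) IH2) _; rewrite E -EFinD lee_fin -mulrDl ler_pM2r //.
    by rewrite -!natr1 !mulrDl !mul1r; lra.
  have E : minn n m = m by apply/minn_idPr.
  apply: le_trans (leeD (smallk q n.+1 bq (ltnW mn)) IH2) _; rewrite E -EFinD lee_fin -mulrDl ler_pM2r //.
  by rewrite -!natr1 !mulrDl !mul1r; lra.
pose K := f [::] + m%:R * U.
have f00 : 0 <= f [::] by apply: f_ge0.
have mU : 0 <= m%:R * U by rewrite mulr_ge0.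
have meanK n : mean n <= (c + b) * n%:R + K.
  have nb : 0 <= n%:R * b by rewrite mulr_ge0 // ltW.
  have nc : 0 <= c * n%:R by rewrite mulr_ge0.
  apply: mean_le; split; first by rewrite mulrDl /K; lra.
  move=> q bq; have qp := bal_pos bq; have v0 := vol_gt0 qp.
  apply: (@le_trans _ _ (Ex n q (fun s => (c * n%:R + f [::])%:E + (gain c s)%:E)%E)).
    apply: le_Ex => // s ws; have sa := words_all ws; first by rewrite lee_fin f_ge0.
    case/andP: ws => /eqP <- _; rewrite -EFinD lee_fin; exact: f_gain.
  have cf : 0 <= c * n%:R + f [::] by rewrite addr_ge0.
  rewrite ExD //; last exact: gain0.
  apply: le_trans (leeD (Ex_le_cst (c := c * n%:R + f [::]) gs0 qp cf _ _) (gainE n q bq)) _ => //.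
  rewrite -EFinD lee_fin -mulrDl ler_pM2r // /K.
  have : (minn n m)%:R * U <= m%:R * U by rewrite ler_wpM2r // ler_nat geq_minr.
  lra.
have K0 : 0 <= K by rewrite addr_ge0.
have := meanK (Num.bound (K / b)); have := chi_mean (Num.bound (K / b)).
have := archi_boundP (divr_ge0 K0 (ltW b0)); rewrite ltr_pdivrMr // /b.
move: (_%:R : R) => N; nra.
Qed.

End Growth.

(** * The deterministic splitting *)

Section LinearAlgebra.
Variable R : realType.

Lemma fin_argmax (T : finType) (F : T -> R) (t0 : T) : exists t, forall t', F t' <= F t.
Proof.
have [t _ Ht] := @Order.TotalTheory.arg_maxP _ R T t0 xpredT F isT.
by exists t => t'; apply: Ht.
Qed.

Lemma mul_invmx_det p (N : 'M[R]_p) (v : 'rV[R]_p) j : N \in unitmx ->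
  (v *m invmx N) 0 j * \det N = \det (\matrix_(i, k) if i == j then v 0 k else N i k).
Proof.
move=> uN; rewrite /invmx uN -scalemxAr mxE mulrC mulrA divrr ?mul1r; last by rewrite -unitmxE.
rewrite mxE (expand_det_row _ j); apply: eq_bigr => k _; rewrite !mxE eqxx; congr (_ * _).
rewrite /cofactor; congr (_ * \det _); apply/matrixP => i l; rewrite !mxE.
by rewrite eq_sym (negbTE (neq_lift _ _)).
Qed.

Lemma mul_invmx_det_col p (N : 'M[R]_p) (v : 'cV[R]_p) j : N \in unitmx ->
  (invmx N *m v) j 0 * \det N = \det (\matrix_(i, k) if k == j then v i 0 else N i k).
Proof.
move=> uN; have uNT : N^T \in unitmx by rewrite unitmx_tr.
have := mul_invmx_det v^T j uNT; rewrite det_tr -trmx_inv -trmx_mul mxE => ->.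
rewrite -det_tr; congr (\det _); apply/matrixP => i k; rewrite !mxE.
by case: ifP.
Qed.

(** If the minor on [f], [g] is largest among those with columns [g], this shows that all entries of
    the normalised columns are at most 1 in absolute value. *)
Lemma cramer_rows p n m (M : 'M[R]_(n, m)) (f : 'I_p -> 'I_n) (g : 'I_p -> 'I_m) i j :
  mxsub f g M \in unitmx ->
  (colsub g M *m invmx (mxsub f g M)) i j * \det (mxsub f g M) =
  \det (mxsub (fun k => if k == j then i else f k) g M).
Proof.
move=> uN; have := mul_invmx_det (row i (colsub g M)) j uN.
rewrite -row_mul mxE => ->; congr (\det _); apply/matrixP => k l; rewrite !mxE.
by case: ifP.
Qed.

Lemma cramer_cols p n m (M : 'M[R]_(n, m)) (f : 'I_p -> 'I_n) (g : 'I_p -> 'I_m) i j :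
  mxsub f g M \in unitmx ->
  (invmx (mxsub f g M) *m rowsub f M) j i * \det (mxsub f g M) =
  \det (mxsub f (fun k => if k == j then i else g k) M).
Proof.
move=> uN.
have -> : (invmx (mxsub f g M) *m rowsub f M) j i =
    (invmx (mxsub f g M) *m col i (rowsub f M)) j 0.
  by rewrite [in RHS]colE mulmxA -colE [RHS]mxE.
rewrite mul_invmx_det_col //; congr (\det _); apply/matrixP => k l; rewrite !mxE.
by case: ifP.
Qed.

Lemma det_schur p (N : 'M[R]_p) (u : 'M[R]_(p, 1)) (v : 'M[R]_(1, p)) (s : 'M[R]_1) :
  N \in unitmx -> \det (block_mx s v u N) = (s - v *m invmx N *m u) 0 0 * \det N.
Proof.
move=> uN.
have -> : block_mx s v u N = block_mx (s - v *m invmx N *m u) (v *m invmx N) 0 1%:M *m block_mx 1%:M 0 u N.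
  by rewrite mulmx_block !mulmx1 !mulmx0 ?mul0mx !mul1mx !add0r mulmxKV // subrK.
by rewrite det_mulmx det_ublock det_lblock !det1 mulr1 mul1r det_mx11.
Qed.

(** By the adjugate formula: the cofactors are minors of order [p] of a product, so they are
    controlled by those of [S], as [F] and [G] have bounded entries. *)
Lemma inverse_bound p n : exists2 C : R, 0 < C & forall (S : 'M[R]_n) (F : 'M[R]_(p.+1, n))
  (G : 'M[R]_(n, p.+1)), (forall i j, `|F i j| <= 1) -> (forall i j, `|G i j| <= 1) ->
  F *m S *m G \in unitmx ->
  nrm (invmx (F *m S *m G)) * `|\det (F *m S *m G)| <= C * minors p S.
Proof.
have [C1 C10 H1] := minors_bound R p p.+1 n; have [C2 C20 H2] := minors_bound R p n p.+1.
exists ((p.+1 * p.+1)%:R * (C1 * C2)); first by rewrite !mulr_gt0 // ltr0n.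
move=> S F G F1 G1 uA; set A := F *m S *m G in uA *.
have mF := H1 F 1 ler01 F1; have mG := H2 G 1 ler01 G1; rewrite expr1n !mulr1 in mF mG.
have mA : minors p A <= C1 * C2 * minors p S.
  apply: le_trans (minors_mul _ _ _) _.
  apply: (@le_trans _ _ ((C1 * minors p S) * C2)); last by rewrite mulrAC.
  apply: ler_pM; rewrite ?minors_ge0 //; apply: le_trans (minors_mul _ _ _) _.
  by rewrite ler_wpM2r ?minors_ge0.
have d0 : 0 < `|\det A| by rewrite normr_gt0; move: uA; rewrite unitmxE unitfE.
rewrite -ler_pdivlMr // -[leRHS]mulrA -[leRHS]mulrA; apply: nrm_bound => i j.
rewrite mulrA ler_pdivlMr // -normrM /invmx uA mxE mulrC mulrA divrr ?unitmxE // mul1r mxE.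
rewrite /cofactor normrM normrX normrN1 expr1n mul1r; apply: le_trans mA.
have -> : row' j (col' i A) = mxsub (lift j) (lift i) A by apply/matrixP => x y; rewrite !mxE.
exact: minor_le.
Qed.

(** Bordering [F *m S *m G] with row [i] and column [j] of [S] gives a determinant of order one
    more, which [det_schur] identifies with entry [i], [j] of the Schur complement times the inner
    determinant. *)
Lemma schur_bound p n : exists2 C : R, 0 < C & forall (S : 'M[R]_n) (F : 'M[R]_(p, n))
  (G : 'M[R]_(n, p)), (forall i j, `|F i j| <= 1) -> (forall i j, `|G i j| <= 1) ->
  F *m S *m G \in unitmx ->
  nrm (S - S *m G *m invmx (F *m S *m G) *m F *m S) * `|\det (F *m S *m G)| <= C * minors p.+1 S.
Proof.
have [C1 C10 H1] := minors_bound R p.+1 p.+1 n; have [C2 C20 H2] := minors_bound R p.+1 n p.+1.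
exists ((n * n)%:R * (C1 * C2) + 1); first by rewrite ltr_wpDl // !mulr_ge0 // ltW.
move=> S F G F1 G1 uA; set A := F *m S *m G in uA *.
have d0 : 0 < `|\det A| by rewrite normr_gt0; move: uA; rewrite unitmxE unitfE.
apply: (@le_trans _ _ ((n * n)%:R * (C1 * C2 * minors p.+1 S))); last first.
  by rewrite mulrDl mul1r mulrA lerDl minors_ge0.
rewrite -ler_pdivlMr // -[leRHS]mulrA; apply: nrm_bound => i j.
rewrite ler_pdivlMr // -normrM.
pose F' : 'M[R]_(1 + p, n) := col_mx (row i 1%:M) F.
pose G' : 'M[R]_(n, 1 + p) := row_mx (col j 1%:M) G.
have b1 (x y : 'I_n) : `|(x == y)%:R : R| <= 1 by case: (x == y); rewrite ?normr1 ?normr0.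
have F'1 x y : `|F' x y| <= 1.
  by rewrite /F'; case: (split_ordP x) => k ->; rewrite ?col_mxEu ?col_mxEd // !mxE.
have G'1 x y : `|G' x y| <= 1.
  by rewrite /G'; case: (split_ordP y) => k ->; rewrite ?row_mxEl ?row_mxEr // !mxE.
have mF := H1 F' 1 ler01 F'1; have mG := H2 G' 1 ler01 G'1; rewrite expr1n !mulr1 in mF mG.
have E : F' *m S *m G' = block_mx (row i S *m col j 1%:M) (row i S *m G) (F *m S *m col j 1%:M) A.
  by rewrite /F' /G' mul_col_mx mul_col_row -row_mul mul1mx.
have -> : (S - S *m G *m invmx A *m F *m S) i j * \det A = \det (F' *m S *m G').
  rewrite E det_schur //; congr (_ * _).
  have -> : row i S *m col j 1%:M - row i S *m G *m invmx A *m (F *m S *m col j 1%:M) =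
     row i (S - S *m G *m invmx A *m F *m S) *m col j 1%:M.
    by rewrite linearB /= mulmxBl !mulmxA !row_mul.
  by rewrite [col j 1%:M]colE mul1mx -colE !mxE.
have -> : F' *m S *m G' = mxsub id id (F' *m S *m G') by rewrite mxsub_id.
apply: le_trans (@minor_le R p.+1 _ _ (F' *m S *m G') id id) _.
apply: le_trans (minors_mul _ _ _) _.
apply: (@le_trans _ _ ((C1 * minors p.+1 S) * C2)); last by rewrite mulrAC.
apply: ler_pM; rewrite ?minors_ge0 //; apply: le_trans (minors_mul _ _ _) _.
by rewrite ler_wpM2r ?minors_ge0.
Qed.

Lemma prod_perturb (I : Type) (r : seq I) (a b : I -> R) (B e : R) : 0 <= B -> 0 <= e <= 1 ->
  (forall i, `|a i| <= B) -> (forall i, `|b i| <= e) ->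
  `|\prod_(i <- r) (a i + b i) - \prod_(i <- r) a i| <= (size r)%:R * (B + 1) ^+ size r * e.
Proof.
move=> B0 /andP [e0 e1] Ha Hb.
have B1 : 0 <= B + 1 by apply: addr_ge0.
have Pa s : `|\prod_(i <- s) a i| <= (B + 1) ^+ size s.
  elim: s => [|i s IH]; first by rewrite big_nil normr1.
  rewrite big_cons normrM exprS ler_pM //; apply: le_trans (Ha i) _; by rewrite lerDl.
elim: r => [|i r IH]; first by rewrite !big_nil subrr normr0 /= !mul0r.
rewrite !big_cons.
set x := \prod_(j <- r) (a j + b j) in IH *; set y := \prod_(j <- r) a j in IH *.
have -> : (a i + b i) * x - a i * y = (a i + b i) * (x - y) + b i * y by ring.
apply: le_trans (ler_normD _ _) _; rewrite !normrM.
have ab : `|a i + b i| <= B + 1.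
  by apply: le_trans (ler_normD _ _) _; apply: lerD => //; apply: le_trans (Hb i) e1.
have h1 := ler_pM (normr_ge0 _) (normr_ge0 _) ab IH.
have h2 := ler_pM (normr_ge0 _) (normr_ge0 _) (Hb i) (Pa r); rewrite -/y in h2.
apply: le_trans (lerD h1 h2) _.
rewrite /= exprS -natr1; set X := (B + 1) ^+ size r.
have X0 : 0 <= X by rewrite exprn_ge0.
have -> : ((size r)%:R + 1) * ((B + 1) * X) * e =
  (B + 1) * ((size r)%:R * X * e) + (e * X + B * (e * X)) by ring.
by rewrite lerD2l lerDl !mulr_ge0.
Qed.

Lemma det_perturb p (P E : 'M[R]_p) (B e : R) : 0 <= B -> 0 <= e <= 1 ->
  (forall i j, `|P i j| <= B) -> (forall i j, `|E i j| <= e) ->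
  `|\det (P + E) - \det P| <= (p`!)%:R * (p%:R * (B + 1) ^+ p * e).
Proof.
move=> B0 e01 HP HE; rewrite /determinant -sumrB.
apply: le_trans (ler_norm_sum _ _ _) _.
apply: (@le_trans _ _ (\sum_(s : 'S_p) (p%:R * (B + 1) ^+ p * e))); last first.
  by rewrite sumr_const card_Sn [leRHS]mulr_natl.
apply: ler_sum => s _; rewrite -mulrBr normrM normrX normrN1 expr1n mul1r.
have enumE (F : 'I_p -> R) : \prod_i F i = \prod_(i <- enum 'I_p) F i by rewrite big_enum.
under eq_bigr do rewrite mxE; rewrite !enumE -[in leRHS](size_enum_ord p).
by apply: (@prod_perturb _ _ (fun i => P i (s i)) (fun i => E i (s i))).
Qed.

(** The limit is the supremum of the values [x l] minus the geometric tail at [l]; each of these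
    lies below every [x m] plus the tail at [m]. *)
Lemma geometric_limit (x : nat -> R) (K r : R) : 0 <= K -> 0 <= r < 1 ->
  (forall l, `|x l.+1 - x l| <= K * r ^+ l) ->
  exists L, forall l, `|L - x l| <= K / (1 - r) * r ^+ l.
Proof.
move=> K0 /andP [r0 r1] H; have r1' : 0 < 1 - r by rewrite subr_gt0.
have step l m : `|x (l + m)%N - x l| <= K / (1 - r) * r ^+ l * (1 - r ^+ m).
  elim: m => [|m IH]; first by rewrite addn0 subrr normr0 expr0 subrr mulr0.
  have -> : x (l + m.+1)%N - x l = (x (l + m).+1 - x (l + m)%N) + (x (l + m)%N - x l).
    by rewrite addnS; ring.
  apply: le_trans (ler_normD _ _) _; apply: le_trans (lerD (H _) IH) _.
  rewrite exprD exprS le_eqVlt; apply/orP; left; apply/eqP; field; exact: lt0r_neq0.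
have step2 l m : (l <= m)%N -> `|x m - x l| <= K / (1 - r) * r ^+ l.
  move=> lm; rewrite -(subnKC lm); apply: le_trans (step _ _) _.
  rewrite ler_piMr //; first by rewrite mulr_ge0 ?exprn_ge0 // divr_ge0 // ltW.
  by rewrite gerBl exprn_ge0.
have K1 : 0 <= K / (1 - r) by rewrite divr_ge0 // ltW.
have ord l m : x l - K / (1 - r) * r ^+ l <= x m + K / (1 - r) * r ^+ m.
  have [pl pm] : 0 <= K / (1 - r) * r ^+ l /\ 0 <= K / (1 - r) * r ^+ m.
    by split; rewrite mulr_ge0 ?exprn_ge0.
  have [lm|/ltnW ml] := leqP l m.
    by have := step2 _ _ lm; rewrite ler_norml => /andP [h1 h2]; lra.
  by have := step2 _ _ ml; rewrite ler_norml => /andP [h1 h2]; lra.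
pose D := [set x l - K / (1 - r) * r ^+ l | l in [set: nat]].
have D0 : D !=set0 by exists (x 0%N - K / (1 - r) * r ^+ 0), 0%N.
exists (sup D) => l; rewrite ler_norml; apply/andP; split.
  rewrite lerBrDl; apply: ub_le_sup; last by exists l; rewrite // addrC.
  by exists (x 0%N + K / (1 - r) * r ^+ 0) => _ [m _ <-]; apply: ord.
rewrite lerBlDl; apply: ge_sup => // _ [m _ <-]; exact: ord.
Qed.

Lemma mx_geometric_limit m n (x : nat -> 'M[R]_(m, n)) (K r : R) : 0 <= K -> 0 <= r < 1 ->
  (forall l, nrm (x l.+1 - x l) <= K * r ^+ l) ->
  exists L, forall l, nrm (L - x l) <= (m * n)%:R * (K / (1 - r) * r ^+ l).
Proof.
move=> K0 r01 H.
have ex (ij : 'I_m * 'I_n) : exists L : R, forall l, `|L - x l ij.1 ij.2| <= K / (1 - r) * r ^+ l.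
  apply: geometric_limit => // l; apply: le_trans (H l).
  by have := nrm_entry (x l.+1 - x l) ij.1 ij.2; rewrite !mxE.
have [L HL] := choice ex.
exists (\matrix_(i, j) L (i, j)) => l; apply: nrm_bound => i j; rewrite !mxE; exact: (HL (i, j)).
Qed.

Lemma geometric_small (e K r : R) : 0 <= r < 1 -> (forall l, e <= K * r ^+ l) -> e <= 0.
Proof.
move=> /andP [r0 r1] H; rewrite leNgt; apply/negP => e0.
have [r00|rn0] := eqVneq r 0.
  by have := H 1%N; rewrite r00 expr1 mulr0 leNgt e0.
have rp : 0 < r by rewrite lt_neqAle eq_sym rn0.
pose h := r^-1 - 1; have h0 : 0 < h by rewrite subr_gt0 invf_gt1.
have bern l : 1 + l%:R * h <= r^-1 ^+ l.
  elim: l => [|l IH]; first by rewrite mul0r addr0 expr0.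
  have rE : r^-1 = 1 + h by rewrite /h addrC subrK.
  rewrite exprS [X in _ <= X * _]rE.
  have lh : 0 <= l%:R * h by rewrite mulr_ge0 // ltW.
  have := ler_wpM2l (ltW (addr_gt0 ltr01 h0)) IH; rewrite -natr1 => h1.
  apply: le_trans h1; have := mulr_ge0 lh (ltW h0); lra.
have K0 : 0 < K by have := H 0%N; rewrite expr0 mulr1; apply: lt_le_trans.
have key l : e * (1 + l%:R * h) <= K.
  have := H l; rewrite -ler_pdivrMr ?exprn_gt0 // -exprVn; apply: le_trans.
  by rewrite ler_pM2l.
have := archi_boundP (ltW (divr_gt0 K0 (mulr_gt0 e0 h0))); rewrite ltr_pdivrMr ?mulr_gt0 //.
by have := key (Num.bound (K / (e * h))); move: (_%:R : R) => N; nra.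
Qed.

Lemma expR_rate (x : R) : x < 0 -> 0 <= expR x < 1.
Proof. by move=> x0; rewrite expR_ge0 /= -[ltRHS](@expR0 R) ltr_expR. Qed.

Lemma expRnat (x : R) l : expR (x * l%:R) = expR x ^+ l.
Proof. by rewrite mulrC expRM_natl. Qed.

End LinearAlgebra.

(** * Splitting off the non-contracted directions from growth rates of minors *)

Section Splitting.
Variable R : realType.

(** Rate at most [x] over the time from [k] to [l], with an error proportional to [l]: this is the
    uniformity in [k] that Borel-Cantelli provides. For [x = 0] it means subexponential in [l]. *)
Definition tame (x : R) (F : nat -> nat -> R) := forall e : R, 0 < e ->
  exists2 C : R, 0 < C & forall k l, (k <= l)%N ->
    F k l <= C * expR (x * (l%:R - k%:R) + e * l%:R).
Definition tame0 (x : R) (f : nat -> R) := forall e : R, 0 < e ->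
  exists2 C : R, 0 < C & forall l, f l <= C * expR (x * l%:R + e * l%:R).

Lemma tameM x y F G : (forall k l, (k <= l)%N -> 0 <= F k l) ->
  (forall k l, (k <= l)%N -> 0 <= G k l) -> tame x F -> tame y G ->
  tame (x + y) (fun k l => F k l * G k l).
Proof.
move=> F0 G0 HF HG e e0; have e2 : 0 < e / 2 by rewrite divr_gt0.
have [C1 C10 H1] := HF _ e2; have [C2 C20 H2] := HG _ e2.
exists (C1 * C2) => [|k l kl]; first exact: mulr_gt0.
apply: le_trans (ler_pM (F0 _ _ kl) (G0 _ _ kl) (H1 _ _ kl) (H2 _ _ kl)) _.
rewrite mulrACA -expRD le_eqVlt; apply/orP; left; apply/eqP; congr (_ * expR _).
by field.
Qed.

Lemma tame_le x F G : (forall k l, (k <= l)%N -> F k l <= G k l) -> tame x G -> tame x F.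
Proof.
move=> FG HG e e0; have [C C0 H] := HG e e0; exists C => // k l kl.
by apply: le_trans (FG _ _ kl) (H _ _ kl).
Qed.

Lemma tame_mono x y F : x <= y -> tame x F -> tame y F.
Proof.
move=> xy HF e e0; have [C C0 H] := HF e e0; exists C => // k l kl.
apply: le_trans (H _ _ kl) _; rewrite ler_pM2l // ler_expR lerD2r ler_wpM2r //.
by rewrite subr_ge0 ler_nat.
Qed.

Lemma tame_cst (c : R) : tame 0 (fun _ _ => c).
Proof.
move=> e e0; exists (`|c| + 1) => [|k l _]; first by rewrite ltr_wpDl.
apply: (@le_trans _ _ (`|c| + 1)); first by apply: le_trans (ler_norm _) _; rewrite lerDl.
rewrite ler_peMr ?addr_ge0 // -[leLHS](@expR0 R) ler_expR mul0r add0r mulr_ge0 //; exact: ltW.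
Qed.

Lemma tame0_of x F : tame x F -> tame0 x (F 0%N).
Proof.
move=> HF e e0; have [C C0 H] := HF e e0; exists C => // l.
by have := H 0%N l (leq0n _); rewrite subr0.
Qed.

Lemma tame0M x y f g : (forall l, 0 <= f l) -> (forall l, 0 <= g l) ->
  tame0 x f -> tame0 y g -> tame0 (x + y) (fun l => f l * g l).
Proof.
move=> F0 G0 HF HG e e0; have e2 : 0 < e / 2 by rewrite divr_gt0.
have [C1 C10 H1] := HF _ e2; have [C2 C20 H2] := HG _ e2.
exists (C1 * C2) => [|l]; first exact: mulr_gt0.
apply: le_trans (ler_pM (F0 _) (G0 _) (H1 _) (H2 _)) _.
rewrite mulrACA -expRD le_eqVlt; apply/orP; left; apply/eqP; congr (_ * expR _).
by field.
Qed.

Lemma tame0_le x f g : (forall l, f l <= g l) -> tame0 x g -> tame0 x f.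
Proof.
by move=> fg Hg e e0; have [C C0 H] := Hg e e0; exists C => // l; apply: le_trans (fg l) (H l).
Qed.

Lemma tame0S x f : tame0 x f -> tame0 x (fun l => f l.+1).
Proof.
move=> Hf e e0; have [C C0 H] := Hf e e0; exists (C * expR (x + e)) => [|l].
  by rewrite mulr_gt0 // expR_gt0.
apply: le_trans (H _) _; rewrite -mulrA -expRD ler_pM2l // ler_expR -natr1; lra.
Qed.

Lemma tame0Z x f (c : R) : 0 < c -> tame0 x f -> tame0 x (fun l => c * f l).
Proof.
move=> c0 Hf e e0; have [C C0 H] := Hf e e0; exists (c * C) => [|l]; first exact: mulr_gt0.
by rewrite -mulrA ler_pM2l.
Qed.

Lemma tame0_geometric x f : x < 0 -> tame0 x f ->
  exists K r : R, [/\ 0 < K, 0 < r, r < 1 & forall l, f l <= K * r ^+ l].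
Proof.
move=> x0 Hf; have e0 : 0 < - x / 2 by rewrite divr_gt0 // oppr_gt0.
have [C C0 H] := Hf _ e0; exists C, (expR (x / 2)); split => //.
- exact: expR_gt0.
- by rewrite -[ltRHS](@expR0 R) ltr_expR; lra.
- move=> l; apply: le_trans (H l) _; rewrite -expRnat ler_pM2l // ler_expR; lra.
Qed.

(** If the three rates are exact, [b - a] is the exponent of index [p + 1] and [c - b] the next one:
    [a <= b] and [c < b] place the cut between a nonnegative and a negative exponent. *)
Variables (n p : nat) (i0 : 'I_n) (S : nat -> nat -> 'M[R]_n) (a b c : R).
Hypothesis Scat : forall k l m, (k <= l)%N -> (l <= m)%N -> S l m *m S k l = S k m.
Hypothesis Ha : tame a (fun k l => minors p (S k l)).
Hypothesis Hb : tame b (fun k l => minors p.+1 (S k l)).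
Hypothesis Hc : tame c (fun k l => minors p.+2 (S k l)).
Hypothesis Hl : forall e : R, 0 < e -> exists2 C : R, 0 < C &
  forall l, C * expR (b * l%:R - e * l%:R) <= minors p.+1 (S 0%N l).
Hypothesis Hx : tame 0 (fun _ l => nrm (S l l.+1)).
Hypotheses (ab : a <= b) (cb : c < b).

Lemma Sp_gt0 l : 0 < minors p.+1 (S 0%N l).
Proof.
have [C C0 H] := Hl ltr01; apply: lt_le_trans (H l); by rewrite mulr_gt0 // expR_gt0.
Qed.

Definition minor_count : R := (#|{ffun 'I_p.+1 -> 'I_n}| * #|{ffun 'I_p.+1 -> 'I_n}|)%:R.

Lemma minor_count_gt0 : 0 < minor_count.
Proof.
rewrite ltr0n muln_gt0 andbb; apply/card_gt0P; by exists [ffun=> i0].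
Qed.

Lemma argmax_minor (M : 'M[R]_n) : exists fg : ('I_p.+1 -> 'I_n) * ('I_p.+1 -> 'I_n),
  (forall f' g' : 'I_p.+1 -> 'I_n, `|\det (mxsub f' g' M)| <= `|\det (mxsub fg.1 fg.2 M)|) /\
  minors p.+1 M <= minor_count * `|\det (mxsub fg.1 fg.2 M)|.
Proof.
pose T := ({ffun 'I_p.+1 -> 'I_n} * {ffun 'I_p.+1 -> 'I_n})%type.
have [[f g] H] := @fin_argmax R T (fun fg => `|\det (mxsub fg.1 fg.2 M)|)
  ([ffun=> i0], [ffun=> i0]).
exists (f : _ -> _, g : _ -> _) => /=; split.
  move=> f' g'; have := H (finfun f', finfun g') => /=.
  have -> // : mxsub (finfun f') (finfun g') M = mxsub f' g' M.
  by apply/matrixP => i j; rewrite !mxE !ffunE.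
apply: (@le_trans _ _ (\sum_(f' : {ffun 'I_p.+1 -> 'I_n}) \sum_(g' : {ffun 'I_p.+1 -> 'I_n})
   `|\det (mxsub f g M)|)).
  by apply: ler_sum => f' _; apply: ler_sum => g' _; apply: (H (f', g')).
by rewrite sumr_const sumr_const -mulrnA [leRHS]mulr_natl.
Qed.

Lemma cauchy_binet_le (X Y : 'M[R]_n) (f g : 'I_p.+1 -> 'I_n) (v : R) :
  (forall h, `|\det (mxsub h g Y)| <= v) -> `|\det (mxsub f g (X *m Y))| <= minors p.+1 X * v.
Proof.
move=> Hv; have v0 : 0 <= v by apply: le_trans (Hv f).
have -> : mxsub f g (X *m Y) = rowsub f X *m colsub g Y.
  by apply/matrixP => i j; rewrite !mxE; apply: eq_bigr => l _; rewrite !mxE.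
apply: (@le_trans _ _ `|(p.+1`!)%:R * \det (rowsub f X *m colsub g Y)|).
  by rewrite normrM ler_peMl // normr_nat ler1n fact_gt0.
rewrite -cauchy_binet; apply: le_trans (ler_norm_sum _ _ _) _.
apply: (@le_trans _ _ (\sum_(h : {ffun 'I_p.+1 -> 'I_n}) `|\det (mxsub f h X)| * v)).
  by apply: ler_sum => h _; rewrite normrM -!mxsub_comp ler_wpM2l //; apply: Hv.
rewrite -big_distrl ler_wpM2r //= /minors.
have -> : \sum_(h : {ffun 'I_p.+1 -> 'I_n}) `|\det (mxsub f h X)| =
    \sum_(h : {ffun 'I_p.+1 -> 'I_n}) `|\det (mxsub (finfun f) h X)|.
  apply: eq_bigr => h _; congr `|\det _|; apply/matrixP => i j; by rewrite !mxE ffunE.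
by rewrite [leRHS](bigD1 (finfun f)) //= lerDl; apply: sumr_ge0 => h _; apply: sumr_ge0.
Qed.

Definition selr (f : 'I_p.+1 -> 'I_n) : 'M[R]_(p.+1, n) := rowsub f 1%:M.
Definition selc (g : 'I_p.+1 -> 'I_n) : 'M[R]_(n, p.+1) := colsub g 1%:M.

Lemma selrE f m (M : 'M[R]_(n, m)) : selr f *m M = rowsub f M.
Proof. by rewrite /selr mul_rowsub_mx mul1mx. Qed.

Lemma selcE g m (M : 'M[R]_(m, n)) : M *m selc g = colsub g M.
Proof. by rewrite /selc mulmx_colsub mulmx1. Qed.

Lemma selr_selc f g (M : 'M[R]_n) : selr f *m M *m selc g = mxsub f g M.
Proof. by rewrite selrE selcE -mxsub_comp. Qed.

Lemma selr_le f i j : `|selr f i j| <= 1.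
Proof. by rewrite !mxE; case: eqP; rewrite ?normr1 ?normr0. Qed.

Lemma selc_le f i j : `|selc f i j| <= 1.
Proof. by rewrite !mxE; case: eqP; rewrite ?normr1 ?normr0. Qed.

(* The rows spanning the most expanded p+1 directions of S 0 m converge, so a
   fixed set of columns carries a definite share of the maximal minor. *)
Lemma good_columns : exists (g : 'I_p.+1 -> 'I_n) m0, forall m, (m0 <= m)%N ->
  exists f, minors p.+1 (S 0%N m) <= 2 * minor_count * `|\det (mxsub f g (S 0%N m))|.
Proof.
have [fg Hfg] := choice (fun m => argmax_minor (S 0%N m)).
pose f m := (fg m).1; pose g m := (fg m).2.
pose N m := mxsub (f m) (g m) (S 0%N m); pose dl m := `|\det (N m)|.
have Hmax m (f' g' : 'I_p.+1 -> 'I_n) : `|\det (mxsub f' g' (S 0%N m))| <= dl m by case: (Hfg m) => H _; apply: H.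
have HK m : minors p.+1 (S 0%N m) <= minor_count * dl m by case: (Hfg m).
have dl0 m : 0 < dl m.
  by have := lt_le_trans (Sp_gt0 m) (HK m); rewrite pmulr_rgt0 // minor_count_gt0.
have uN m : N m \in unitmx by rewrite unitmxE unitfE -normr_gt0 dl0.
have NE m : selr (f m) *m S 0%N m *m selc (g m) = N m by rewrite selr_selc.
have tinv : tame0 (- b) (fun m => (dl m)^-1).
  move=> e e0; have [C C0 H] := Hl e0; exists (minor_count / C) => [|l]; first by rewrite divr_gt0 // minor_count_gt0.
  have := le_trans (H l) (HK l) => h.
  have -> : - b * l%:R + e * l%:R = - (b * l%:R - e * l%:R) by ring.
  rewrite expRN -[leLHS]mul1r ler_pdivrMr //; move: h (expR_gt0 (b * l%:R - e * l%:R)).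
  move: (expR _) => E h E0.
  have -> : minor_count / C / E * dl l = minor_count * dl l / (C * E) by field; rewrite !lt0r_neq0.
  by rewrite ler_pdivlMr ?mulr_gt0 // mul1r.
have [C1 C10 Hinv] := inverse_bound R p n; have [C2 C20 Hsch] := schur_bound R p.+1 n.
have ti0 l : 0 <= (dl l)^-1 by rewrite invr_ge0 ltW.
have tN : tame0 0 (fun m => nrm (invmx (N m))).
  have t1 : tame0 (a - b) (fun m => C1 * (minors p (S 0%N m) * (dl m)^-1)).
    apply: tame0Z => //; apply: tame0M => //; first by move=> l; apply: minors_ge0.
    exact: (tame0_of Ha).
  apply: (@tame0_le 0 _ (fun m => C1 * (minors p (S 0%N m) * (dl m)^-1))).
    move=> m; rewrite mulrA ler_pdivlMr //.
    by have := Hinv (S 0%N m) _ _ (selr_le (f m)) (selc_le (g m)); rewrite NE; apply.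
  move=> e e0; have [C C0 H] := t1 e e0; exists C => // l; apply: le_trans (H l) _.
  by rewrite ler_pM2l // ler_expR lerD2r ler_wpM2r // subr_le0.
pose Res m := S 0%N m - S 0%N m *m selc (g m) *m invmx (N m) *m selr (f m) *m S 0%N m.
have tR : tame0 (c - b) (fun m => nrm (Res m)).
  have t1 : tame0 (c - b) (fun m => C2 * (minors p.+2 (S 0%N m) * (dl m)^-1)).
    apply: tame0Z => //; apply: tame0M => //; first by move=> l; apply: minors_ge0.
    exact: (tame0_of Hc).
  apply: tame0_le t1 => m; rewrite mulrA ler_pdivlMr // /Res /dl.
  by have := Hsch (S 0%N m) _ _ (selr_le (f m)) (selc_le (g m)); rewrite NE; apply.
pose X m := S m m.+1.
have SS m : S 0%N m.+1 = X m *m S 0%N m by rewrite Scat.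
(* The chosen rows, normalised to be the identity on the columns [g m]; by Cramer's rule and
   maximality all entries are at most 1. A time step multiplies [Psi] by [T m], up to an error [E m]
   that contains the Schur complement [Res m] and therefore decays. *)
pose Psi m := invmx (N m) *m selr (f m) *m S 0%N m.
pose E m := invmx (N m.+1) *m selr (f m.+1) *m X m *m Res m.
pose T m := invmx (N m.+1) *m selr (f m.+1) *m X m *m S 0%N m *m selc (g m).
have PsiS m : Psi m.+1 = T m *m Psi m + E m.
  rewrite /E /Res mulmxBr /T /Psi !mulmxA addrC subrK.
  by rewrite SS !mulmxA.
have PsiG m : Psi m *m selc (g m) = 1%:M.
  by rewrite /Psi -!mulmxA (mulmxA (selr _)) NE mulVmx.
have Psi_le m i j : `|Psi m i j| <= 1.
  have := @cramer_cols R p.+1 n n (S 0%N m) (f m) (g m) j i (uN m).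
  rewrite -selrE mulmxA => h; rewrite -(ler_pM2r (dl0 m)) mul1r -normrM.
  by rewrite /Psi h.
have tE : tame0 (c - b) (fun m => nrm (E m)).
  have [C3 C30 Hs] : exists2 C : R, 0 < C & forall f', nrm (selr f') <= C.
    exists ((p.+1 * n)%:R * 1 + 1); first by rewrite ltr_wpDl // mulr_ge0.
    by move=> f'; apply: ler_wpDr => //; apply: nrm_bound => i j; apply: selr_le.
  have t1 : tame0 (0 + (0 + (c - b)))
      (fun m => nrm (invmx (N m.+1)) * (C3 * nrm (X m) * nrm (Res m))).
    apply: tame0M; rewrite ?nrm_ge0 //.
    - by move=> l; apply: nrm_ge0.
    - by move=> l; rewrite !mulr_ge0 ?nrm_ge0 // ltW.
    - exact: (tame0S tN).
    apply: tame0M => //; [by move=> l; rewrite mulr_ge0 ?nrm_ge0 // ltW|by move=> l; apply: nrm_ge0|].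
    by apply: tame0Z => //; apply: (tame0_of Hx).
  rewrite !add0r in t1; apply: tame0_le t1 => m.
  rewrite /E -!mulmxA; apply: le_trans (nrmM _ _) _; rewrite ler_wpM2l ?nrm_ge0 //.
  apply: le_trans (nrmM _ _) _; rewrite -mulrA; apply: ler_pM; rewrite ?nrm_ge0 //.
  exact: nrmM.
have [K [r [K1 r0 r1 HE]]] : exists K r : R, [/\ 0 < K, 0 < r, r < 1 &
    forall l, nrm (E l) <= K * r ^+ l].
  by apply: tame0_geometric tE; rewrite subr_lt0.
have r01 : 0 < 1 - r by rewrite subr_gt0.
(* The minor in columns [h] relative to the largest one: at most 1, with equality for [h = g m]. *)
pose v m h := `|\det (colsub h (Psi m))|.
have vE m h : v m h * dl m = `|\det (mxsub (f m) h (S 0%N m))|.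
  rewrite /v /dl -normrM -selcE /Psi -!mulmxA (mulmxA (selr _)) selr_selc det_mulmx det_inv.
  by rewrite mulrAC mulVr ?mul1r // -unitmxE.
have v1 m h : v m h <= 1 by rewrite -(ler_pM2r (dl0 m)) vE mul1r.
have vg m : v m (g m) = 1 by rewrite /v -selcE PsiG det1 normr1.
pose B : R := p.+1%:R * 2; have B0 : 0 <= B by rewrite mulr_ge0.
pose Kp : R := (p.+1`!)%:R * (p.+1%:R * (B + 1) ^+ p.+1).
have Kp0 : 0 < Kp.
  by rewrite !mulr_gt0 ?exprn_gt0 ?ltr0n ?fact_gt0 // ltr_wpDl.
have pert m h : nrm (E m) <= 1 ->
    `|\det (colsub h (Psi m.+1)) - \det (T m) * \det (colsub h (Psi m))| <= Kp * nrm (E m).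
  move=> E1; have -> : colsub h (Psi m.+1) = T m *m colsub h (Psi m) + colsub h (E m).
    by rewrite PsiS -!selcE mulmxDl -mulmxA.
  rewrite -det_mulmx; apply: le_trans (det_perturb (B := B) (e := nrm (E m)) B0 _ _ _) _.
  - by rewrite nrm_ge0.
  - have Tle i j : `|T m i j| <= 2.
      have -> : T m = (Psi m.+1 - E m) *m selc (g m).
        by rewrite PsiS addrK -mulmxA PsiG mulmx1.
      rewrite selcE mxE mxE [X in _ + X]mxE; apply: le_trans (ler_normB _ _) _.
      have := Psi_le m.+1 i (g m j); have := le_trans (nrm_entry (E m) i (g m j)) E1; lra.
    move=> i j; rewrite mxE; apply: le_trans (ler_norm_sum _ _ _) _.
    apply: (@le_trans _ _ (\sum_(k < p.+1) 2 * 1)).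
      apply: ler_sum => k _; rewrite normrM ler_pM //; rewrite mxE; exact: Psi_le.
    by rewrite sumr_const card_ord mulr1 /B [leRHS]mulr_natl.
  - by move=> i j; rewrite mxE; apply: nrm_entry.
  by rewrite /Kp !mulrA.
(* The columns [g m.+1] have relative minor 1 at time [m.+1] and at most 1 at time [m], so the
   determinant of [T m] is at least [1 - Kp * nrm (E m)] in absolute value: no relative minor drops
   by more than the error. *)
have step m h : nrm (E m) <= 1 -> v m h - 2 * Kp * nrm (E m) <= v m.+1 h.
  move=> E1; have h1 := pert m h E1; have h2 := pert m (g m.+1) E1.
  have h3 := ler_distD 0 (\det (T m) * \det (colsub h (Psi m))) (\det (colsub h (Psi m.+1))).
  have a1 : `|\det (T m)| * v m h - Kp * nrm (E m) <= v m.+1 h.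
    rewrite lerBlDr /v -normrM; rewrite distrC in h1.
    have := ler_normD (\det (T m) * \det (colsub h (Psi m)) - \det (colsub h (Psi m.+1)))
      (\det (colsub h (Psi m.+1))); rewrite subrK => h4.
    by apply: le_trans h4 _; rewrite addrC lerD2l.
  have a2 : 1 - Kp * nrm (E m) <= `|\det (T m)|.
    rewrite lerBlDr -[leLHS](vg m.+1) /v.
    have := ler_normD (\det (colsub (g m.+1) (Psi m.+1)) - \det (T m) * \det (colsub (g m.+1) (Psi m)))
      (\det (T m) * \det (colsub (g m.+1) (Psi m))); rewrite subrK => h4.
    apply: le_trans h4 _; rewrite addrC; apply: lerD => //.
    by rewrite normrM ler_piMr //; apply: v1.
  have v0 : 0 <= v m h by rewrite /v.
  have k0 : 0 <= Kp * nrm (E m) by rewrite mulr_ge0 ?nrm_ge0 // ltW.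
  have a3 := ler_wpM2r v0 a2; have := v1 m h.
  have := ler_wpM2l k0 (v1 m h); rewrite mulr1; lra.
pose K2 := 2 * Kp * K / (1 - r).
have K20 : 0 < K2 by apply: divr_gt0 => //; apply: mulr_gt0 => //; apply: mulr_gt0.
(* Beyond [m0] the losses sum to at most 1/2, so the columns [g m0] keep half of the maximal minor
   forever. *)
have [m0 Hm0] : exists m0, K * r ^+ m0 <= 1 /\ K2 * r ^+ m0 <= 2^-1.
  apply: contrapT => no.
  pose K3 := Num.max K (2 * K2).
  have : (1 : R) <= 0.
    apply: (@geometric_small R 1 K3 r); first by rewrite (ltW r0).
    move=> l; rewrite leNgt; apply/negP => lt; apply: no; exists l.
    have rl : 0 < r ^+ l by rewrite exprn_gt0.
    have l1 : K * r ^+ l <= K3 * r ^+ l by rewrite ler_pM2r // le_max lexx.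
    have l2 : 2 * K2 * r ^+ l <= K3 * r ^+ l by rewrite ler_pM2r // le_max lexx orbT.
    by split; lra.
  by rewrite ler10.
have [m01 m02] := Hm0.
have small m : (m0 <= m)%N -> nrm (E m) <= 1.
  move=> le; apply: le_trans (HE m) _; apply: le_trans m01; rewrite ler_pM2l //.
  by apply: ler_wiXn2l => //; apply: ltW.
have low j : 1 - K2 * r ^+ m0 * (1 - r ^+ j) <= v (m0 + j)%N (g m0).
  elim: j => [|j IH]; first by rewrite addn0 vg expr0 subrr mulr0 subr0.
  rewrite addnS; apply: le_trans (step _ _ (small _ (leq_addr _ _))).
  have := HE (m0 + j)%N; rewrite exprD => h.
  have : 2 * Kp * nrm (E (m0 + j)%N) <= K2 * r ^+ m0 * (r ^+ j - r ^+ j.+1).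
    have -> : K2 * r ^+ m0 * (r ^+ j - r ^+ j.+1) = 2 * Kp * (K * (r ^+ m0 * r ^+ j)).
      by rewrite /K2 exprS; field; rewrite lt0r_neq0.
    by rewrite ler_pM2l // mulr_gt0.
  lra.
exists (g m0), m0 => m le; exists (f m); rewrite -(subnKC le).
have := low (m - m0)%N; rewrite subnKC // => lo.
have rj : 0 <= r ^+ (m - m0) by rewrite exprn_ge0 // ltW.
have vhalf : 2^-1 <= v m (g m0).
  have : K2 * r ^+ m0 * (1 - r ^+ (m - m0)) <= K2 * r ^+ m0.
    by rewrite ler_piMr ?gerBl // mulr_ge0 ?exprn_ge0 // ltW.
  lra.
rewrite -vE; apply: le_trans (HK m) _; rewrite [2 * minor_count]mulrC -mulrA ler_pM2l ?minor_count_gt0 //.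
have := ler_wpM2r (ltW (dl0 m)) vhalf; move: (dl m) (v m (g m0)) => x y; lra.
Qed.

Lemma nrm0_eq m1 m2 (M : 'M[R]_(m1, m2)) : nrm M <= 0 -> M = 0.
Proof.
move=> M0; apply/matrixP => i j; rewrite mxE; apply/eqP; rewrite -normr_le0.
exact: le_trans (nrm_entry _ _ _) M0.
Qed.

Lemma tame_snd f : tame0 0 f -> tame 0 (fun _ l => f l).
Proof.
move=> Hf e e0; have [C C0 H] := Hf e e0; exists C => // k l _.
by have := H l; rewrite !mul0r.
Qed.

Hypothesis Sid : forall k, S k k = 1%:M.

(* Psi k is the limit of A(k,l)^-1 F_l S(k,l), where F_l selects p+1 rows carrying
   the largest minor of S 0 l; the increments are controlled by Schur complements,
   of rate c - b. *)
Lemma splitting : exists (Psi : nat -> 'M[R]_(p.+1, n)) (G : nat -> 'M[R]_(n, p.+1))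
    (A : nat -> nat -> 'M[R]_p.+1),
  [/\ (forall k, Psi k *m G k = 1%:M) /\ (forall k i j, `|G k i j| <= 1),
      forall k l, (k <= l)%N -> A k l \in unitmx /\ Psi l *m S k l = A k l *m Psi k,
      tame 0 (fun k l => nrm (invmx (A k l))), tame0 0 (fun k => nrm (Psi k)) &
      tame (c - b) (fun k l => nrm ((1%:M - G l *m Psi l) *m S k l))].
Proof.
have [g [m0 Hg]] := good_columns.
have [f Hf] : exists f : nat -> 'I_p.+1 -> 'I_n, forall l (f' : 'I_p.+1 -> 'I_n),
    `|\det (mxsub f' g (S 0%N l))| <= `|\det (mxsub (f l) g (S 0%N l))|.
  have ex l : exists f0 : {ffun 'I_p.+1 -> 'I_n}, forall f' : {ffun 'I_p.+1 -> 'I_n},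
      `|\det (mxsub f' g (S 0%N l))| <= `|\det (mxsub f0 g (S 0%N l))|.
    exact: (fin_argmax (fun f0 : {ffun 'I_p.+1 -> 'I_n} => `|\det (mxsub f0 g (S 0%N l))|)
      [ffun=> i0]).
  have [f Hf] := choice ex; exists f => l f'.
  have -> : mxsub f' g (S 0%N l) = mxsub (finfun f') g (S 0%N l) by apply/matrixP => i j; rewrite !mxE ffunE.
  exact: Hf.
pose N l := mxsub (f l) g (S 0%N l); pose dl l := `|\det (N l)|.
have Hdl l (f' : 'I_p.+1 -> 'I_n) : `|\det (mxsub f' g (S 0%N l))| <= dl l by apply: Hf.
have dl_ge0 l : 0 <= dl l by apply: normr_ge0.
(* The columns [g] are good only from [m0] on; for [l < m0], Cauchy-Binet bounds the minor at time
   [m0] by the one at time [l], at the price of a constant. *)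
have [K4 K40 HK4] : exists2 K4 : R, 0 < K4 & forall l, minors p.+1 (S 0%N (maxn l m0)) <= K4 * dl l.
  have [Cb Cb0 HCb] := Hb ltr01.
  have E0 := expR_ge0 ((`|b| + 1) * m0%:R).
  exists (2 * minor_count + 2 * minor_count * (Cb * expR ((`|b| + 1) * m0%:R))).
    rewrite ltr_pwDl ?mulr_gt0 ?minor_count_gt0 // !mulr_ge0 ?ltW // ?minor_count_gt0 //.
  move=> l; have [f' Hf'] := Hg (maxn l m0) (leq_maxr _ _); apply: le_trans Hf' _.
  have [ml|lm] := leqP m0 l.
    rewrite [leRHS]mulrDl; apply: ler_wpDr; first by rewrite !mulr_ge0 // ltW // minor_count_gt0.
    by rewrite ler_pM2l ?mulr_gt0 ?minor_count_gt0 // Hdl.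
  rewrite [leRHS]mulrDl; apply: ler_wpDl; first by rewrite !mulr_ge0 // ltW // minor_count_gt0.
  rewrite -[leRHS]mulrA ler_pM2l ?mulr_gt0 ?minor_count_gt0 //.
  rewrite -(Scat (leq0n l) (ltnW lm)); apply: le_trans (cauchy_binet_le _ _ (Hdl l)) _.
  rewrite ler_wpM2r //; apply: le_trans (HCb _ _ (ltnW lm)) _; rewrite ler_pM2l // ler_expR.
  have lm' : (l%:R : R) <= m0%:R by rewrite ler_nat ltnW.
  have l0 : 0 <= (l%:R : R) by [].
  have h : b * (m0%:R - l%:R) <= `|b| * (m0%:R - l%:R).
    by rewrite ler_wpM2r ?subr_ge0 // ler_norm.
  have h2 : 0 <= `|b| * l%:R by rewrite mulr_ge0.
  lra.
have dl0 l : 0 < dl l.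
  by have := lt_le_trans (Sp_gt0 (maxn l m0)) (HK4 l); rewrite pmulr_rgt0.
have uN l : N l \in unitmx by rewrite unitmxE unitfE -normr_gt0 dl0.
have tinv : tame0 (- b) (fun l => (dl l)^-1).
  move=> e e0; have [C C0 H] := Hl e0.
  have E1 := expR_gt0 (`|b - e| * m0%:R).
  exists (K4 * expR (`|b - e| * m0%:R) / C) => [|l]; first by rewrite divr_gt0 // mulr_gt0.
  have h : C * expR (b * l%:R - e * l%:R) <= K4 * dl l * expR (`|b - e| * m0%:R).
    apply: le_trans (ler_wpM2r (ltW E1) (le_trans (H _) (HK4 l))).
    rewrite -mulrA -expRD ler_pM2l // ler_expR -!mulrBl.
    have [ml|lm] := leqP m0 l.
      by rewrite lerDl mulr_ge0.
    have lm' : (l%:R : R) <= m0%:R by rewrite ler_nat ltnW.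
    have l0 : 0 <= (l%:R : R) by [].
    have h1 := ler_norm (b - e); have h2 := lerNnormlW (lexx `|b - e|).
    have : (b - e) * (l%:R - m0%:R) <= `|b - e| * m0%:R.
      have h3 : (- (b - e)) * (m0%:R - l%:R) <= `|b - e| * (m0%:R - l%:R).
        by rewrite ler_wpM2r ?subr_ge0 // -normrN ler_norm.
      have h4 : 0 <= `|b - e| * l%:R by rewrite mulr_ge0.
      lra.
    lra.
  have -> : - b * l%:R + e * l%:R = - (b * l%:R - e * l%:R) by ring.
  rewrite expRN -[leLHS]mul1r ler_pdivrMr //.
  move: h (expR_gt0 (b * l%:R - e * l%:R)) E1.
  move: (expR (`|b - e| * _)) (expR _) => E' E h E0 E1.
  have -> : K4 * E' / C / E * dl l = K4 * dl l * E' / (C * E) by field; rewrite !lt0r_neq0.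
  by rewrite ler_pdivlMr ?mulr_gt0 // mul1r.
have tdl : tame0 b dl.
  by apply: tame0_le (tame0_of Hb) => l; apply: minor_le.
have tquo : tame (- b) (fun k l => dl k / dl l).
  move=> e e0; have e2 : 0 < e / 2 by rewrite divr_gt0.
  have [C1 C10 H1] := tdl _ e2; have [C2 C20 H2] := tinv _ e2.
  exists (C1 * C2) => [|k l kl]; first exact: mulr_gt0.
  apply: le_trans (ler_pM (ltW (dl0 k)) _ (H1 k) (H2 l)) _; first by rewrite invr_ge0.
  rewrite mulrACA -expRD ler_pM2l ?mulr_gt0 // ler_expR.
  have kl' : (k%:R : R) <= l%:R by rewrite ler_nat.
  have := ler_wpM2l (ltW e2) kl'; lra.
(* The columns of [G l] span the image under [S 0 l] of the coordinate directions [g], normalised by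
   [F l *m G l = 1]; [A k l] is [S k l] read in these bases. *)
pose G l := colsub g (S 0%N l) *m invmx (N l).
pose A k l := N l *m invmx (N k).
pose F l := selr (f l).
pose C k l := (1%:M - G l *m F l) *m S k l.
have uA k l : A k l \in unitmx by rewrite unitmx_mul unitmx_inv !uN.
have Acat k l m : A l m *m A k l = A k m by rewrite /A mulmxA mulmxKV.
have Aid k : A k k = 1%:M by rewrite /A mulmxV.
have AV k m : invmx (A k m) = A m k by rewrite -[LHS]mul1mx -(Aid k) -(Acat k m k) mulmxK.
have Ainv k l m : invmx (A k m) = invmx (A k l) *m invmx (A l m) by rewrite !AV Acat.
have FG l : F l *m G l = 1%:M.
  by rewrite /F /G -selcE !mulmxA selr_selc mulmxV //; apply: uN.
have SG k l : (k <= l)%N -> S k l *m G k = G l *m A k l.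
  move=> kl; rewrite /G /A !mulmxA mulmxKV; last exact: uN.
  by congr (_ *m _); rewrite -!selcE mulmxA Scat.
have AE k l : (k <= l)%N -> F l *m S k l *m G k = A k l.
  by move=> kl; rewrite -mulmxA SG // mulmxA FG mul1mx.
have G_le l i j : `|G l i j| <= 1.
  have h := @cramer_rows R p.+1 n n (S 0%N l) (f l) g i j (uN l).
  rewrite -(ler_pM2r (dl0 l)) mul1r -normrM /G h; exact: Hdl.
have detA k l : `|\det (A k l)| = dl l / dl k by rewrite det_mulmx det_inv normrM normrV // -unitmxE.
clearbody A.
have [C1 C10 Hinv] := inverse_bound R p n; have [C2 C20 Hsch] := schur_bound R p.+1 n.
(* By [inverse_bound] the rate is [a], from the smaller minors, minus [b], from the determinant of
   [A k l], and [a - b <= 0]. *)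
have tA : tame 0 (fun k l => nrm (invmx (A k l))).
  apply: (@tame_mono (a + - b)); first by rewrite subr_le0.
  apply: (@tame_le _ _ (fun k l => (C1 * minors p (S k l)) * (dl k / dl l))).
    move=> k l kl; rewrite -[dl k / _]invf_div ler_pdivlMr ?divr_gt0 // -detA -AE //.
    by apply: Hinv; [apply: selr_le|apply: G_le|rewrite AE].
  apply: tameM => //; first by move=> k l _; rewrite mulr_ge0 ?minors_ge0 // ltW.
    by move=> k l _; rewrite divr_ge0.
  rewrite -[a]add0r; apply: tameM => //; first by move=> k l _; rewrite ltW.
    by move=> k l _; apply: minors_ge0.
  exact: tame_cst.
have tC : tame (c - b) (fun k l => nrm (C k l)).
  apply: (@tame_le _ _ (fun k l => (C2 * minors p.+2 (S k l)) * (dl k / dl l))).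
    move=> k l kl; rewrite -[dl k / _]invf_div ler_pdivlMr ?divr_gt0 // -detA -AE //.
    have := @Hsch (S k l) (F l) (G k) (@selr_le _) (@G_le k); rewrite AE // => /(_ (uA _ _)).
    by rewrite SG // (mulmxK (uA _ _)) /C mulmxBl mul1mx.
  apply: tameM => //; first by move=> k l _; rewrite mulr_ge0 ?minors_ge0 // ltW.
    by move=> k l _; rewrite divr_ge0.
  rewrite -[c]add0r; apply: tameM => //; first by move=> k l _; rewrite ltW.
    by move=> k l _; apply: minors_ge0.
  exact: tame_cst.
pose KF : R := (p.+1 * n)%:R * 1; have KF0 : 0 <= KF by rewrite mulr_ge0.
have HF l : nrm (F l) <= KF by apply: nrm_bound => i j; apply: selr_le.
have HG l : nrm (G l) <= (n * p.+1)%:R * 1 by apply: nrm_bound => i j; apply: G_le.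
clearbody G.
pose x k j := invmx (A k (k + j)%N) *m F (k + j)%N *m S k (k + j)%N.
(* The part of [S k l] along [G l] contributes equally to two successive approximations, so only the
   residual [C k l] remains. *)
have incr k j : x k j.+1 - x k j =
    invmx (A k (k + j).+1) *m F (k + j).+1 *m S (k + j)%N (k + j).+1 *m C k (k + j)%N.
  rewrite /x addnS; set l := (k + j)%N.
  have -> : invmx (A k l) = invmx (A k l.+1) *m A l l.+1 by rewrite !AV Acat.
  rewrite -!mulmxA -mulmxBr; congr (_ *m _).
  rewrite /C mulmxBl mul1mx !mulmxBr; congr (_ - _).
    by rewrite Scat // leq_addr.
  by rewrite -(AE _ _ (leqnSn l)) !mulmxA.
have incr_le : forall e, 0 < e -> e <= (b - c) / 2 -> exists2 K, 0 < K &
    forall k j, nrm (x k j.+1 - x k j) <= K * expR (e * k%:R) * expR (- ((b - c) / 2)) ^+ j.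
  move=> e e0 eb.
  have t1 : tame (0 + (0 + (c - b)))
      (fun k l => nrm (invmx (A k l.+1)) * ((KF * nrm (S l l.+1)) * nrm (C k l))).
    apply: tameM; [by move=> *; apply: nrm_ge0|by move=> *; rewrite !mulr_ge0 ?nrm_ge0| |].
      move=> e' e'0; have [K K_0 H] := tA e' e'0; exists (K * expR e') => [|k l kl].
        by rewrite mulr_gt0 // expR_gt0.
      apply: le_trans (H k l.+1 (leqW kl)) _; rewrite -mulrA -expRD ler_pM2l // ler_expR -natr1.
      lra.
    apply: tameM => //; [by move=> *; rewrite mulr_ge0 ?nrm_ge0|by move=> *; apply: nrm_ge0|].
    rewrite -(addr0 (0 : R)); apply: tameM => //; first by move=> *; apply: nrm_ge0.
    exact: tame_cst.
  rewrite !add0r in t1; have [K K_0 H] := t1 e e0; exists K => // k j.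
  rewrite incr; apply: le_trans (le_trans (H k (k + j)%N (leq_addr _ _)) _).
    rewrite -!mulmxA; apply: le_trans (nrmM _ _) _; rewrite ler_wpM2l ?nrm_ge0 //.
    apply: le_trans (nrmM _ _) _; rewrite -mulrA; apply: ler_pM; rewrite ?nrm_ge0 ?HF //.
    exact: nrmM.
  rewrite -mulrA -expRnat -expRD ler_pM2l // ler_expR natrD.
  have := ler_wpM2r (ler0n R j) eb; lra.
have r01 : 0 <= expR (- ((b - c) / 2)) < 1.
  by apply: expR_rate; rewrite oppr_lt0 divr_gt0 // subr_gt0.
have ebc : 0 < (b - c) / 2 by rewrite divr_gt0 // subr_gt0.
have lim_ex k : exists L, exists K : R, forall j, nrm (L - x k j) <= K * expR (- ((b - c) / 2)) ^+ j.
  have [K K_0 H] := incr_le _ ebc (lexx _).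
  have [|L HL] := mx_geometric_limit _ r01 (H k); first by rewrite mulr_ge0 ?expR_ge0 // ltW.
  by exists L; eexists => j; apply: le_trans (HL j) _; rewrite mulrA.
have [Psi HPsi] := choice lim_ex.
have lim_eq m1 m2 (L : 'M[R]_(m1, m2)) : (exists K : R, forall j, nrm L <= K * expR (- ((b - c) / 2)) ^+ j) ->
    L = 0.
  by move=> [K H]; apply: nrm0_eq; apply: geometric_small r01 H.
have PsiG k : Psi k *m G k = 1%:M.
  apply/subr0_eq; apply: lim_eq; have [K HK] := HPsi k.
  exists (K * nrm (G k)) => j.
  have -> : Psi k *m G k - 1%:M = (Psi k - x k j) *m G k.
    by rewrite mulmxBl /x -!mulmxA [F _ *m _]mulmxA AE ?leq_addr // mulVmx.
  apply: le_trans (nrmM _ _) _; rewrite mulrAC; by rewrite ler_wpM2r ?nrm_ge0.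
(* The approximation of index 0 is [F k], of bounded norm, and the increments sum to a constant
   times [exp (e' k)]; keeping [e'] below half the gap [b - c] leaves a convergent series. *)
have tPsi : tame0 0 (fun k => nrm (Psi k)).
  move=> e e0; pose e' := Num.min e ((b - c) / 2).
  have [e'0 e'b e'e] : [/\ 0 < e', e' <= (b - c) / 2 & e' <= e].
    by rewrite /e' lt_min e0 ebc !ge_min !lexx orbT.
  have [K K_0 H] := incr_le _ e'0 e'b.
  pose K1 : R := (p.+1 * n)%:R * (K / (1 - expR (- ((b - c) / 2)))).
  have K10 : 0 <= K1.
    have /andP [_ /ltW r1] := r01.
    by rewrite mulr_ge0 // divr_ge0 ?subr_ge0 // ltW.
  exists (K1 + K1 + KF + 1); first by rewrite ltr_wpDl // !addr_ge0.
  move=> k; have [|L HL] := mx_geometric_limit _ r01 (H k); first by rewrite mulr_ge0 ?expR_ge0 // ltW.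
  have [K' HK'] := HPsi k; set ek := expR (e' * k%:R) in H HL.
  have ek1 : 1 <= ek by rewrite -[leLHS](@expR0 R) ler_expR mulr_ge0 // ltW.
  have HL' j : nrm (L - x k j) <= K1 * ek.
    have -> : K1 * ek = (p.+1 * n)%:R * (K * ek / (1 - expR (- ((b - c) / 2)))) by rewrite /K1 -!mulrA; congr (_ * (_ * _)); rewrite mulrC.
    apply: le_trans (HL j) _; have /andP [r0 /ltW r1] := r01.
    apply: ler_wpM2l => //; apply: ler_piMr; last exact: exprn_ile1.
    by apply: divr_ge0; rewrite ?subr_ge0 // mulr_ge0 ?expR_ge0 // ltW.
  have x0 : x k 0%N = F k by rewrite /x addn0 Aid invmx1 mul1mx Sid mulmx1.
  have PL : Psi k - L = 0.
    apply: lim_eq; exists (K' + K1 * ek + (p.+1 * n)%:R * (K * ek / (1 - expR (- ((b - c) / 2))))) => j.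
    have -> : Psi k - L = (Psi k - x k j) - (L - x k j) by rewrite opprB addrA subrK.
    apply: le_trans (nrmD _ _) _; rewrite nrmN; apply: le_trans (lerD (HK' j) (HL j)) _.
    rewrite [X in _ + X]mulrA -mulrDl; apply: ler_wpM2r.
      by apply: exprn_ge0; case/andP: r01.
    by rewrite -addrA lerD2l lerDr; apply: mulr_ge0 => //; apply: expR_ge0.
  apply: (@le_trans _ _ ((K1 + K1 + KF + 1) * ek)); last first.
    rewrite ler_wpM2l ?addr_ge0 // ler_expR mul0r add0r ler_wpM2r //.
  have -> : Psi k = (L - x k 0%N) + F k by rewrite x0 subrK; apply/subr0_eq.
  apply: le_trans (nrmD _ _) _; have h1 := HL' 0%N; have h2 := HF k.
  have h3 : KF <= KF * ek by rewrite ler_peMr.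
  have h4 : 0 <= K1 * ek by rewrite mulr_ge0 // expR_ge0.
  move: h1 h2 h3 h4 ek1; rewrite !mulrDl mul1r.
  move: (K1 * ek) (KF * ek) (nrm _) (nrm _) => *; lra.
exists Psi, G, A; split=> //.
- move=> k l kl; split => //; apply/subr0_eq; apply: lim_eq.
  have [K HK] := HPsi k; have [K' HK'] := HPsi l.
  exists (K' * nrm (S k l) + nrm (A k l) * (K * expR (- ((b - c) / 2)) ^+ (l - k))) => j.
  have -> : Psi l *m S k l - A k l *m Psi k =
      (Psi l - x l j) *m S k l - A k l *m (Psi k - x k ((l - k) + j)%N).
    have e1 : x l j *m S k l = A k l *m x k (l - k + j)%N.
      rewrite /x addnA subnKC // -!mulmxA Scat ?leq_addr // (Ainv k l) -!mulmxA.
      by rewrite (mulKVmx (uA _ _)).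
    by rewrite mulmxBl mulmxBr e1 opprB addrA subrK.
  apply: le_trans (nrmD _ _) _; rewrite nrmN mulrDl; apply: lerD.
    apply: le_trans (nrmM _ _) _; rewrite mulrAC; by rewrite ler_wpM2r ?nrm_ge0.
  apply: le_trans (nrmM _ _) _; rewrite -mulrA -mulrA -exprD; by rewrite ler_wpM2l ?nrm_ge0.
- have tG : tame 0 (fun _ l => nrm (1%:M - G l *m Psi l)).
    apply: tame_snd; apply: (@tame0_le _ _ (fun l => nrm (1%:M : 'M[R]_n) + (n * p.+1)%:R * 1 * nrm (Psi l))).
      move=> l; apply: le_trans (nrmD _ _) _; rewrite nrmN lerD2l; apply: le_trans (nrmM _ _) _.
      by rewrite ler_wpM2r ?nrm_ge0.
    move=> e e0; have [K K_0 H] := tPsi e e0.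
    exists (nrm (1%:M : 'M[R]_n) + (n * p.+1)%:R * 1 * K + 1) => [|l].
      by rewrite ltr_wpDl // addr_ge0 ?nrm_ge0 // mulr_ge0 // ltW.
    have E1 : 1 <= expR (0 * l%:R + e * l%:R).
      by rewrite -[leLHS](@expR0 R) ler_expR mul0r add0r mulr_ge0 // ltW.
    have := ler_wpM2l (mulr_ge0 (ler0n R (n * p.+1)) ler01) (H l).
    have := ler_wpM2l (nrm_ge0 (1%:M : 'M[R]_n)) E1.
    by move: (nrm _) (nrm _) (expR _) E1 => u v w E1; move: (_%:R : R) => N'; nra.
  (* The complementary projection kills [G l], so [S k l] may be replaced by the residual
     [C k l]. *)
  apply: (@tame_le _ _ (fun k l => nrm (1%:M - G l *m Psi l) * nrm (C k l))).
    move=> k l kl; suff -> : (1%:M - G l *m Psi l) *m S k l = (1%:M - G l *m Psi l) *m C k l by apply: nrmM.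
    have -> : C k l = S k l - G l *m F l *m S k l by rewrite /C mulmxBl mul1mx.
    rewrite mulmxBr -[LHS]subr0; congr (_ - _); rewrite mulmxBl mul1mx !mulmxA.
    by rewrite -(mulmxA (G l) (Psi l)) PsiG mulmx1 subrr.
  by rewrite -(add0r (c - b)); apply: tameM => // *; apply: nrm_ge0.
Qed.

End Splitting.

(** * Null sets and cylinders *)

Section OuterVolume.
Variables (R : realType) (A : finType) (x0 : A).
Local Notation d := #|A|.
Implicit Types (S : set (A -> R)).
Local Open Scope ereal_scope.

Definition box (a b : A -> R) : set (A -> R) := [set v | forall x, (a x <= v x <= b x)%R].

Definition covers S (a b : nat -> A -> R) :=
  (forall n x, (a n x <= b n x)%R) /\ S `<=` \bigcup_n box (a n) (b n).

(** An outer volume built from countable covers by closed boxes, to match the form of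
    [lebesgue_null]. *)
Definition ov S : \bar R := ereal_inf [set c | exists a b : nat -> A -> R, covers S a b /\
  c = \sum_(n <oo) (box_vol (a n) (b n))%:E].

Lemma box_vol_ge0 (a b : A -> R) : (forall x, (a x <= b x)%R) -> (0 <= box_vol a b)%R.
Proof. by move=> ab; apply: prodr_ge0 => x _; rewrite subr_ge0. Qed.

Lemma box_vol_id (a : A -> R) : box_vol a a = 0%R.
Proof. by rewrite /box_vol (bigD1 x0) //= subrr mul0r. Qed.

Lemma ov_ge0 S : 0 <= ov S.
Proof.
apply: le_ereal_inf_tmp => _ [a [b [[ab _] ->]]].
by apply: nneseries_ge0 => n _ _; rewrite lee_fin box_vol_ge0.
Qed.

Lemma le_ov S S' : S `<=` S' -> ov S <= ov S'.
Proof.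
move=> SS; apply: ereal_inf_le_tmp => _ [a [b [[ab c] ->]]]; exists a, b; split=> //.
by split=> // v /SS /c.
Qed.

Lemma ov_bigcup (F : nat -> set (A -> R)) : ov (\bigcup_n F n) <= \sum_(n <oo) ov (F n).
Proof.
have [[i ioo]|] := pselect (exists i, ov (F i) = +oo).
  rewrite (eseries_pinfty _ _ ioo) ?leey // => n _.
  by rewrite -ltNye (lt_le_trans _ (ov_ge0 _)).
rewrite -forallNE => Aoo; apply/lee_addgt0Pr => e e0.
apply: le_trans (epsilon_trick _ (fun n => ov_ge0 (F n)) (ltW e0)).
pose P n (G : (nat -> A -> R) * (nat -> A -> R)) := covers (F n) G.1 G.2 /\
  \sum_(k <oo) (box_vol (G.1 k) (G.2 k))%:E <= ov (F n) + (e / (2 ^ n.+1)%:R)%:E.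
have /choice [G PG] : forall n, exists G, P n G.
  move=> n; have en : (0 < e / (2 ^ n.+1)%:R)%R.
    by rewrite divr_gt0 // ltr0n expn_gt0.
  have fin : ov (F n) \is a fin_num.
    by rewrite ge0_fin_numE ?ov_ge0 // ltey; apply/eqP/Aoo.
  have [x [a [b [cab ->]]] xS] := lb_ereal_inf_adherent en fin.
  by exists (a, b); split => //=; apply: ltW.
pose vo (ij : nat * nat) : \bar R := (box_vol ((G ij.1).1 ij.2) ((G ij.1).2 ij.2))%:E.
have vo0 ij : 0 <= vo ij by rewrite lee_fin; apply: box_vol_ge0; case: (PG ij.1) => [[]].
have /card_esym/ppcard_eqP[f] := card_nat2.
apply: (@le_trans _ _ (\sum_(i <oo) \sum_(j <oo) vo (i, j))).
  apply: ereal_inf_lbound; exists (fun n => (G (f n).1).1 (f n).2), (fun n => (G (f n).1).2 (f n).2).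
  split; first split.
  - by move=> n x; case: (PG (f n).1) => [[]].
  - move=> v [n _ Fv]; have [[_ /(_ v Fv) [m _ Gv]] _] := PG n.
    by exists (f^-1%FUN (n, m)) => //=; rewrite invK //; apply: mem_set.
  have -> : \sum_(n <oo) (box_vol ((G (f n).1).1 (f n).2) ((G (f n).1).2 (f n).2))%:E =
      \sum_(n <oo) vo (f n) by [].
  rewrite [RHS]nneseries_esumT; last by move=> n; apply: vo0.
  rewrite -(@reindex_esum _ _ _ [set: nat] [set: nat * nat] f vo); last exact: bij.
  rewrite nneseries_esumT; last by move=> n; apply: nneseries_ge0.
  have -> : [set: nat * nat] = [set: nat] `*`` (fun=> [set: nat]) by apply/seteqP; split.
  rewrite -(@esum_esum _ _ _ [set: nat] (fun=> [set: nat]) (fun i j => vo (i, j))) //.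
    by apply: eq_esum => i _; rewrite nneseries_esumT.
apply: lee_nneseries => n _; first by move=> _; apply: nneseries_ge0.
by case: (PG n).
Qed.

Lemma ov_box (a b : A -> R) : (forall x, (a x <= b x)%R) -> ov (box a b) <= (box_vol a b)%:E.
Proof.
move=> ab; apply: ereal_inf_lbound.
exists (fun=> a), (fun n => if n is 0%N then b else a); split; first split.
- by case.
- by move=> v bv; exists 0%N.
rewrite (nneseries_split 0 1%N) /=; last by move=> [|n] _; rewrite ?box_vol_id // lee_fin box_vol_ge0.
by rewrite big_nat1 eseries0 ?adde0 // => -[|n] //= _ _; rewrite box_vol_id.
Qed.

Lemma ov0 : ov set0 = 0.
Proof.
apply/eqP; rewrite eq_le ov_ge0 andbT; have := ov_box (fun x => lexx ((fun=> 0%R) x)).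
by rewrite box_vol_id; apply: le_trans; apply: le_ov.
Qed.

Lemma ovU S S' : ov (S `|` S') <= ov S + ov S'.
Proof.
rewrite -bigcup2E; apply: le_trans (ov_bigcup _) _.
rewrite (nneseries_split 0 2%N) /=; last by move=> n _; apply: ov_ge0.
rewrite eseries0 ?adde0; last by move=> [|[|n]] //= _ _; rewrite ov0.
by rewrite !big_nat_recr //= big_geq // add0e.
Qed.

Lemma ov_big (T : finType) (F : T -> set (A -> R)) :
  ov [set v | exists t, F t v] <= \sum_t ov (F t).
Proof.
have : forall r : seq T, ov [set v | exists2 t, t \in r & F t v] <= \sum_(t <- r) ov (F t).
  elim=> [|t r IH]; first by rewrite big_nil -ov0; apply: le_ov => v [].
  rewrite big_cons; apply: le_trans (leeD2l _ IH); apply: le_trans (ovU _ _); apply: le_ov.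
  move=> v [t' /[!inE] /orP [/eqP -> | ht] Fv]; [by left|by right; exists t'].
move=> /(_ (index_enum T)); apply: le_trans; apply: le_ov => v [t Ft]; exists t => //.
Qed.

Lemma ov_countable (T : countType) (F : T -> set (A -> R)) :
  (forall t, ov (F t) = 0) -> ov [set v | exists t, F t v] = 0.
Proof.
move=> F0; apply/eqP; rewrite eq_le ov_ge0 andbT.
pose G n := if unpickle n is Some t then F t else set0.
apply: (@le_trans _ _ (ov (\bigcup_n G n))).
  by apply: le_ov => v [t Ft]; exists (pickle t) => //; rewrite /G pickleK.
apply: le_trans (ov_bigcup _) _; rewrite eseries0 // => n _ _.
by rewrite /G; case: (unpickle n) => [t|]; rewrite ?ov0.
Qed.

Lemma ov0_null S : ov S = 0 -> lebesgue_null S.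
Proof.
move=> S0 e e0; have fin : ov S \is a fin_num by rewrite S0.
have [x [a [b [[ab c] ->]]] xS] := lb_ereal_inf_adherent e0 fin.
exists a, b; split=> //; split=> // M; rewrite -lee_fin.
rewrite -/(ov S) S0 add0e in xS; apply: le_trans (ltW xS); rewrite -sumEFin.
rewrite -(big_mkord xpredT (fun n => (box_vol (a n) (b n))%:E)).
by apply: nneseries_lim_ge => n _ _; rewrite lee_fin box_vol_ge0.
Qed.

Definition shear (w l : A) (t : R) (v : A -> R) : A -> R :=
  fun a => if a == w then (v a + t * v l)%R else v a.

(** The box is cut into [n.+1] slabs along coordinate [l]; on each of them the displacement of
    coordinate [w] is known up to [|t|] times the thickness. *)
Lemma shear_slice w l t (a b : A -> R) (n : nat) : w != l -> (forall x, (a x <= b x)%R) ->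
  ov (shear w l t @` box a b) <=
  ((b w - a w + `|t| * ((b l - a l) / n.+1%:R)) * ((b l - a l) *
     \prod_(x | (x != w) && (x != l)) (b x - a x)))%:E.
Proof.
move=> wl ab; pose D : R := ((b l - a l) / n.+1%:R)%R.
have D0 : (0 <= D)%R by rewrite divr_ge0 // subr_ge0.
pose c (i : 'I_n.+1) : R := (a l + D * i%:R)%R.
pose a' i : A -> R := fun x => if x == l then c i else
  if x == w then (a w + Num.min (t * c i) (t * (c i + D)))%R else a x.
pose b' i : A -> R := fun x => if x == l then (c i + D)%R else
  if x == w then (b w + Num.max (t * c i) (t * (c i + D)))%R else b x.
have a'b' i x : (a' i x <= b' i x)%R.
  rewrite /a' /b'; case: ifP => _; first by rewrite lerDl.
  by case: ifP => _ //; rewrite lerD // ge_min !le_max lexx.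
apply: (@le_trans _ _ (ov [set v | exists i, box (a' i) (b' i) v])).
  apply: le_ov => _ [v bv <-].
  have [i /andP [i1 i2]] : exists i : 'I_n.+1, (c i <= v l <= c i + D)%R.
    have /andP [l1 l2] := bv l.
    have : forall k : nat, (k <= n)%N -> (v l <= a l + D * k.+1%:R)%R ->
        exists i : 'I_n.+1, (c i <= v l <= c i + D)%R.
      elim=> [|k IH] kn hk.
        exists ord0; rewrite /c mulr0 addr0 l1 /=; by rewrite mulr1 in hk.
      have [h|h] := leP (v l) (a l + D * k.+1%:R)%R; first by apply: IH => //; apply: ltnW.
      have kn' : (k.+1 < n.+1)%N by [].
      exists (Ordinal kn'); rewrite /c /= (ltW h) /=; move: hk; rewrite -[k.+2%:R]natr1; lra.
    apply; first exact: leqnn.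
    by rewrite /D divfK ?pnatr_eq0 // addrC subrK.
  exists i => x; rewrite /a' /b' /shear; have [->|xl] := eqVneq x l.
    by rewrite eq_sym (negbTE wl) i1 i2.
  case: ifP => [/eqP ->|_]; last exact: bv.
  have /andP [w1 w2] := bv w.
  have [t0|t0] := leP 0%R t.
    have h1 : (t * c i <= t * v l)%R by rewrite ler_wpM2l.
    have h2 : (t * v l <= t * (c i + D))%R by rewrite ler_wpM2l.
    by rewrite !lerD // ?ge_min ?le_max ?h1 ?h2 ?orbT.
  have h1 : (t * v l <= t * c i)%R by rewrite ler_wnM2l // ltW.
  have h2 : (t * (c i + D) <= t * v l)%R by rewrite ler_wnM2l // ltW.
  by rewrite !lerD // ?ge_min ?le_max ?h1 ?h2 ?orbT.
apply: le_trans (ov_big _) _.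
apply: (@le_trans _ _ (\sum_(i < n.+1) (box_vol (a' i) (b' i))%:E)).
  by apply: lee_sum => i _; apply: ov_box.
rewrite sumEFin lee_fin.
have E i : box_vol (a' i) (b' i) = ((b w - a w + `|t| * D) * (D *
     \prod_(x | (x != w) && (x != l)) (b x - a x)))%R.
  rewrite /box_vol (bigD1 w) //= (bigD1 l) //=; last by rewrite eq_sym.
  rewrite /a' /b' eqxx (negbTE wl); congr (_ * (_ * _))%R.
  - have [t0|t0] := leP 0%R t.
      have h : (t * c i <= t * (c i + D))%R by rewrite ler_wpM2l // lerDl.
      by rewrite (min_l h) (max_r h) ger0_norm //; ring.
    have h : (t * (c i + D) <= t * c i)%R by rewrite ler_wnM2l ?(ltW t0) // lerDl.
    by rewrite (min_r h) (max_l h) ltr0_norm //; ring.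
  - by rewrite eqxx; ring.
  - by apply: eq_bigr => x /andP [/negbTE -> /negbTE ->].
rewrite (eq_bigr _ (fun i _ => E i)).
have Dn : (b l - a l = D * n.+1%:R)%R by rewrite /D divfK // pnatr_eq0.
rewrite sumr_const card_ord -/D -mulr_natr [(b l - a l)%R]Dn le_eqVlt; apply/orP; left; apply/eqP; ring.
Qed.

(** The excess in [shear_slice] is of order [1 / n] and disappears as the slabs become thin. *)
Lemma ov_shear w l t S : w != l -> ov (shear w l t @` S) <= ov S.
Proof.
move=> wl; apply: le_ereal_inf_tmp => _ [a [b [[ab cS] ->]]].
apply: (@le_trans _ _ (ov (\bigcup_n (shear w l t @` box (a n) (b n))))).
  by apply: le_ov => _ [v /cS [n _ bv] <-]; exists n => //; exists v.
apply: le_trans (ov_bigcup _) _; apply: lee_nneseries => n _; first by move=> _; apply: ov_ge0.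
pose P := (\prod_(x | (x != w) && (x != l)) (b n x - a n x))%R.
have P0 : (0 <= P)%R by apply: prodr_ge0 => x _; rewrite subr_ge0.
have -> : box_vol (a n) (b n) = ((b n w - a n w) * ((b n l - a n l) * P))%R.
  by rewrite /box_vol (bigD1 w) //= (bigD1 l) //= eq_sym.
apply/lee_addgt0Pr => e e0.
pose K := (`|t| * (b n l - a n l) * ((b n l - a n l) * P))%R.
have K0 : (0 <= K)%R by rewrite !mulr_ge0 // subr_ge0.
have := archi_boundP (divr_ge0 K0 (ltW e0)); rewrite ltr_pdivrMr // => hK.
move: hK; move: (Num.bound _) => N hK.
apply: le_trans (shear_slice t N wl (ab n)) _.
rewrite -EFinD lee_fin -/P mulrDl lerD2l.
have -> : (`|t| * ((b n l - a n l) / N.+1%:R) * ((b n l - a n l) * P) =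
  K / N.+1%:R)%R by rewrite /K; ring.
rewrite ler_pdivrMr // mulrC; apply: le_trans (ltW hK) _.
by rewrite ler_wpM2r ?ltW // ltr_nat.
Qed.

(* A hyperplane is the image of a coordinate hyperplane under shears. *)
Lemma ov_hyperplane (c : A -> R) : (exists a, c a != 0%R) ->
  ov [set v : A -> R | (\sum_a c a * v a)%R = 0%R] = 0.
Proof.
move=> [w cw]; apply/eqP; rewrite eq_le ov_ge0 andbT.
pose Z := [set v : A -> R | v w = 0%R].
have Z0 : ov Z <= 0.
  pose B n : set (A -> R) := box (fun a => if a == w then 0%R else - n%:R)%R
    (fun a => if a == w then 0%R else n%:R)%R.
  apply: (@le_trans _ _ (ov (\bigcup_n B n))).
    apply: le_ov => v vw; pose n := Num.bound (\sum_a `|v a|)%R.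
    exists n => // a; case: ifP => [/eqP ->|_]; first by rewrite vw lexx.
    rewrite -ler_norml; have : (\sum_a `|v a| < n%:R)%R by apply: archi_boundP; apply: sumr_ge0.
    move=> /ltW; apply: le_trans; rewrite (bigD1 a) //= lerDl; exact: sumr_ge0.
  apply: le_trans (ov_bigcup _) _; rewrite eseries0 // => n _ _.
  apply/eqP; rewrite eq_le ov_ge0 andbT; apply: le_trans (ov_box _) _.
    by move=> a; case: ifP => // _; rewrite lerNl (le_trans _ (ler0n _ n)) // oppr_le0.
  by rewrite /box_vol (bigD1 w) //= eqxx subrr mul0r.
pose tr (r : seq A) v := foldr (fun l v => shear w l (- c l / c w)%R v) v r.
have trw r v a : a != w -> tr r v a = v a.
  by move=> aw; elim: r => //= l r IH; rewrite /shear (negbTE aw).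
have ovtr r : w \notin r -> ov (tr r @` Z) <= 0.
  elim: r => [|l r IH] /=.
    by move=> _; apply: le_trans Z0; apply: le_ov => _ [v Zv <-].
  rewrite inE negb_or => /andP [wl wr].
  apply: le_trans (IH wr); apply: le_trans (ov_shear (- c l / c w) _ wl).
  by apply: le_ov => _ [v Zv <-]; exists (tr r v) => //; exists v.
have trE r v : w \notin r -> uniq r -> tr r v w = (v w - (\sum_(l <- r) c l * v l) / c w)%R.
  elim: r => [|l r IH] /=; first by rewrite big_nil mul0r subr0.
  rewrite inE negb_or => /andP [wl wr] /andP [_ ur].
  rewrite /shear eqxx IH // trw 1?eq_sym // big_cons; by field.
apply: le_trans (ovtr [seq l <- enum A | l != w] _); last by rewrite mem_filter eqxx.
apply: le_ov => v hv; exists (fun a => if a == w then 0%R else v a); first by rewrite /Z /= eqxx.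
apply/funext => a; have [->|aw] := eqVneq a w; last by rewrite trw // (negbTE aw).
have hn : w \notin [seq l <- enum A | l != w] by rewrite mem_filter eqxx.
have hq : uniq [seq l <- enum A | l != w] by rewrite filter_uniq // enum_uniq.
rewrite (trE _ _ hn hq) eqxx add0r.
apply: (mulIf cw); rewrite mulNr divfK //.
have := hv; rewrite /= (bigD1 w) //= mulrC => /eqP; rewrite addr_eq0 => /eqP ->.
congr (- _)%R; rewrite big_filter big_enum_cond /=; apply: eq_bigr => l /negbTE -> //.
Qed.

End OuterVolume.

(** * Cylinders of length data, and almost sure statements about their words *)

Section Cylinders.
Variables (R : realType) (A : finType) (x0 : A).
Hypothesis d2 : (1 < #|A|)%N.
Local Notation d := #|A|.
Local Notation wn := (winner x0).
Local Notation ls := (loser x0).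
Local Notation cstep := (cstep x0).
Local Notation crun := (crun x0).
Local Notation qrun := (qrun x0).
Local Notation ov := (@ov R A).
Implicit Types (s : cst A) (v q : A -> R) (h g : seq bool) (b : bool).

Definition lstep b s v : A -> R := fun a => if a == wn b s then v a + v (ls b s) else v a.
Fixpoint lrun s h v : A -> R :=
  if h is b :: h' then lstep b s (lrun (cstep b s) h' v) else v.

(* Length data whose Rauzy-Veech path starts with h (boundaries included). *)
Definition cyl s h : set (A -> R) := [set v | exists2 u, (forall a, 0 <= u a) & v = lrun s h u].

Lemma lrun_cat s h g v : lrun s (h ++ g) v = lrun s h (lrun (crun s h) g v).
Proof. by elim: h s => //= b h IH s; rewrite IH. Qed.

(** Rows and columns are acted on by the same path matrix. With [q = 1] this expresses the original
    total length through the induced lengths. *)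
Lemma lrun_dual s h q v : \sum_a q a * lrun s h v a = \sum_a qrun s q h a * v a.
Proof.
elim: h s q => [|b h IH] s q //=; rewrite -IH /lstep /qstep.
set u := lrun _ _ _.
rewrite (bigD1 (wn b s)) //= eqxx [RHS](bigD1 (ls b s)) //= eqxx mulrDr mulrDl.
have -> : \sum_(i | i != wn b s) q i * (if i == wn b s then u i + u (ls b s) else u i) =
    \sum_(i | i != wn b s) q i * u i.
  by apply: eq_bigr => i /negbTE ->.
have -> : \sum_(i | i != ls b s) (if i == ls b s then q i + q (wn b s) else q i) * u i =
    \sum_(i | i != ls b s) q i * u i.
  by apply: eq_bigr => i /negbTE ->.
have T x : \sum_i q i * u i = q x * u x + \sum_(i | i != x) q i * u i by rewrite (bigD1 x).
by rewrite addrAC -T [RHS]addrAC -T.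
Qed.

Lemma ov_lrun s h (S : set (A -> R)) : good s -> (ov (lrun s h @` S) <= ov S)%E.
Proof.
elim: h s S => [|b h IH] s S gs /=.
  by apply: le_ov => _ [v Sv <-].
apply: le_trans (IH (cstep b s) S (good_step x0 b gs)).
have wl : wn b s != ls b s by apply: winner_neq_loser => //; case/and3P: gs.
apply: le_trans (ov_shear x0 1 _ wl); apply: le_ov => _ [v Sv <-].
exists (lrun (cstep b s) h v); first by exists v.
by apply/funext => a; rewrite /shear /lstep mul1r.
Qed.

Definition cube (K : R) : set (A -> R) := [set v | (forall a, 0 <= v a) /\ \sum_a v a <= K].

(** By [lrun_dual] the induced lengths [u] satisfy [q a * u a <= K] for each [a], so they lie in a
    box with sides [K / q a]; and [lrun] is a composition of shears. *)
Lemma ov_cyl s h K : good s -> 0 <= K ->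
  (ov (cyl s h `&` cube K) <= (K ^+ d * vol (qrun s (fun=> 1%R) h))%:E)%E.
Proof.
move=> gs K0; set q := qrun s (fun=> 1%R) h.
have qp : qpos q by apply: qrun_pos => a; apply: ltr01.
pose B := box (fun=> 0) (fun a => K / q a).
apply: (@le_trans _ _ (ov (lrun s h @` B))).
  apply: le_ov => _ [[u u0 ->] [_ HK]]; exists u => // a; rewrite u0 /=.
  rewrite ler_pdivlMr //; apply: le_trans HK.
  have -> : \sum_a lrun s h u a = \sum_a q a * u a.
    by rewrite -lrun_dual; apply: eq_bigr => c _; rewrite mul1r.
  rewrite (bigD1 a) //= mulrC lerDl; apply: sumr_ge0 => c _.
  by rewrite mulr_ge0 // ltW.
apply: le_trans (ov_lrun _ _ gs) _; apply: le_trans (ov_box x0 _) _.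
  by move=> a; rewrite divr_ge0 // ltW.
rewrite lee_fin /box_vol /vol -[X in K ^+ X](@eq_card _ predT) ?cardE; last by [].
rewrite le_eqVlt; apply/orP; left; apply/eqP.
under eq_bigr do rewrite subr0.
by rewrite big_split /= prodr_const cardT -cardE.
Qed.

Section Base.
Variables (s0 : cst A) (gam : seq bool).
Hypothesis gs0 : good s0.
Hypothesis gamE : crun s0 gam = s0.
Hypothesis gam_pos : forall i j, 1 <= pathmx x0 R s0 gam i j.
Local Notation cpl := (cpl x0 s0 gam).
Local Notation word := (seq bool).
Local Notation Q := (qrun s0).
Local Notation Sw := (Sw x0 s0 gam).
Local Notation It := (It x0 s0 gam).
Local Notation Ex := (Ex x0 s0 gam).
Local Notation qw := (qw x0 s0).
Local Notation bal := (bal x0 s0 gam).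
Local Notation words := (words x0 s0 gam).
Implicit Types (w : word) (ss : seq word).

Definition fr w := cpl w && [forall k : 'I_(size w), ~~ cpl (take k w)].

Lemma fr_cpl w : fr w -> cpl w. Proof. by case/andP. Qed.

Lemma ov_wsum (B : word -> set (A -> R)) n h :
  (ov [set v | exists g, [/\ size g = n, cpl (h ++ g),
     forall k, (k < n)%N -> ~~ cpl (h ++ take k g) & B (h ++ g) v]] <=
   wsum x0 s0 gam (fun w => ov (B w)) n h)%E.
Proof.
elim: n h => [|n IH] h /=.
  case: ifP => ch.
    by apply: le_ov => v [g [/size0nil -> _ _]]; rewrite cats0.
  rewrite -[X in (_ <= X)%E](ov0 R x0); apply: le_ov => v [g [/size0nil ->]].
  by rewrite cats0 ch.
case: ifP => ch.
  rewrite -[X in (_ <= X)%E](ov0 R x0); apply: le_ov => v [g [_ _ /(_ 0%N isT)]].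
  by rewrite take0 cats0 ch.
apply: le_trans (leeD (IH (rcons h true)) (IH (rcons h false))).
apply: le_trans (ovU x0 _ _); apply: le_ov => v [[|b g] [// [sg] cg ng Bg]].
have [] : (exists g', [/\ size g' = n, cpl (rcons h b ++ g'),
     forall k, (k < n)%N -> ~~ cpl (rcons h b ++ take k g') & B (rcons h b ++ g') v]).
  exists g; rewrite cat_rcons; split => // k kn; rewrite cat_rcons; exact: (ng k.+1).
by case: b {cg ng Bg} => g' Hg'; [left|right]; exists g'.
Qed.

Lemma ov_Sw (B : word -> set (A -> R)) :
  (ov [set v | exists2 w, fr w & B w v] <= Sw (fun w => ov (B w)))%E.
Proof.
apply: (@le_trans _ _ (ov (\bigcup_n [set v | exists g, [/\ size g = n, cpl ([::] ++ g),
     forall k, (k < n)%N -> ~~ cpl ([::] ++ take k g) & B ([::] ++ g) v]]))).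
  apply: le_ov => v [w /andP [cw /forallP nw] Bw]; exists (size w) => //; exists w; split => //.
  by move=> k kw; apply: (nw (Ordinal kw)).
apply: le_trans (ov_bigcup _) _; apply: lee_nneseries => n _ ; first by move=> _; apply: ov_ge0.
exact: ov_wsum.
Qed.

Lemma ov_It n (B : seq word -> set (A -> R)) :
  (ov [set v | exists ss, [/\ size ss = n, all fr ss & B ss v]] <= It n (fun ss => ov (B ss)))%E.
Proof.
elim: n B => [|n IH] B /=.
  by apply: le_ov => v [ss [/size0nil -> _ Bv]].
apply: (@le_trans _ _ (ov [set v | exists2 w, fr w & (fun w =>
    [set v | exists ss, [/\ size ss = n, all fr ss & B (w :: ss) v]]) w v])).
  apply: le_ov => v [[|w ss] [//= [sn] /andP [fw fss] Bv]]; exists w => //; exists ss; split => //.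
apply: le_trans (ov_Sw _) _; apply: le_Sw => w cw; first exact: ov_ge0.
exact: (IH (fun ss => B (w :: ss))).
Qed.

Lemma qw_flatten q ss : all cpl ss -> qw q ss = Q q (flatten ss) /\ crun s0 (flatten ss) = s0.
Proof.
elim: ss q => //= w ss IH q /andP [cw css]; have sw := cpl_St gamE cw.
rewrite crun_cat qrun_cat sw; exact: IH.
Qed.

Definition one : A -> R := fun=> 1.

Lemma vol_one : vol one = 1.
Proof. by rewrite /vol big1 // => a _; rewrite invr1. Qed.

(* ws is the sequence of first-return words of length data v. *)
Definition dec v (ws : nat -> word) := forall n, fr (ws n) /\ cyl s0 (flatten (mkseq ws n)) v.

(** Quantifies over every decoding of [v], since points on boundaries of cylinders may have several;
    cubes are used because cylinders have finite volume only in bounded regions. *)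
Definition almost (P : (nat -> word) -> Prop) := forall K : nat,
  ov [set v | cube K%:R v /\ exists2 ws, dec v ws & ~ P ws] = 0.

Lemma ov_event K n (E : pred (seq word)) :
  (ov [set v | cube K%:R v /\ exists2 ws, dec v ws & E (mkseq ws n)] <=
   (K%:R ^+ d)%:E * Ex n one (fun ss => ((E ss)%:R)%:E))%E.
Proof.
pose B ss : set (A -> R) := if E ss then cyl s0 (flatten ss) `&` cube K%:R else set0.
apply: (@le_trans _ _ (ov [set v | exists ss, [/\ size ss = n, all fr ss & B ss v]])).
  apply: le_ov => v [cv [ws dv Ev]]; exists (mkseq ws n); split; rewrite ?size_mkseq //.
    by apply/allP => _ /mapP [i _ ->]; case: (dv i).
  by rewrite /B Ev; split => //; case: (dv n).
apply: le_trans (ov_It _ _) _; rewrite /Ex -ItZ; last first.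
  by move=> ss wss; rewrite mule_ge0 ?lee_fin // vol_qw_ge0 // => a; apply: ltr01.
apply: le_It => ss /andP [_ css]; first exact: ov_ge0.
rewrite /B; case: ifP => Ess; last by rewrite ov0 // mule0 mule0.
by rewrite mule1 (qw_flatten _ css).1 -EFinM; apply: ov_cyl.
Qed.

Lemma ov_null_le (S : set (A -> R)) (C : R) : (forall e, 0 < e -> (ov S <= (C * e)%:E)%E) -> ov S = 0.
Proof.
move=> H; apply/eqP; rewrite eq_le ov_ge0 andbT; apply/lee_addgt0Pr => e e0; rewrite add0e.
have C1 : 0 < `|C| + 1 by rewrite ltr_wpDl.
apply: le_trans (H (e / (`|C| + 1)) (divr_gt0 e0 C1)) _; rewrite lee_fin mulrA ler_pdivrMr //.
by rewrite mulrC ler_pM2l // (le_trans (ler_norm _)) // lerDl.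
Qed.

Lemma borel_cantelli (E : nat -> pred (seq word)) (C r : R) : 0 <= r < 1 ->
  (forall n, (Ex n one (fun ss => ((E n ss)%:R)%:E) <= (C * r ^+ n)%:E)%E) ->
  almost (fun ws => exists N, forall n, (N <= n)%N -> ~~ E n (mkseq ws n)).
Proof.
move=> /andP [r0 r1] HE K.
have C0 : 0 <= C.
  have := le_trans (Ex_ge0 _ _) (HE 0%N); rewrite expr0 mulr1 lee_fin; apply.
    by move=> a; apply: ltr01.
  by move=> ss _; rewrite lee_fin.
have r01 : 0 < 1 - r by rewrite subr_gt0.
apply: (@ov_null_le _ (K%:R ^+ d * C / (1 - r))) => e e0.
have [N HN] : exists N, r ^+ N <= e.
  apply: contrapT => no; have : e <= 0; last by rewrite leNgt e0.
  apply: (@geometric_small R e 1 r) => [|l]; first by rewrite r0.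
  by rewrite mul1r leNgt; apply/negP => /ltW le; apply: no; exists l.
apply: (@le_trans _ _ (ov (\bigcup_n [set v | cube K%:R v /\
    exists2 ws, dec v ws & E (N + n)%N (mkseq ws (N + n)%N)]))).
  apply: le_ov => v [cv [ws dv nP]]; apply: contrapT => no; apply: nP; exists N => n Nn.
  apply/negP => En; apply: no; exists (n - N)%N => //; split => //; exists ws => //.
  by rewrite subnKC.
apply: le_trans (ov_bigcup _) _.
apply: nneseries_le => [n|M]; first exact: ov_ge0.
apply: (@le_trans _ _ (\sum_(0 <= n < M) (K%:R ^+ d * C * r ^+ N * r ^+ n)%:E)%E).
  apply: lee_sum => n _; apply: le_trans (ov_event _ _ _) _.
  apply: le_trans (lee_wpmul2l _ (HE _)) _; first by rewrite lee_fin exprn_ge0.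
  by rewrite -EFinM lee_fin exprD !mulrA.
rewrite sumEFin lee_fin -mulr_sumr.
have geo : \sum_(0 <= i < M) r ^+ i <= (1 - r)^-1.
  rewrite -[leRHS]mul1r ler_pdivlMr // mulrC big_mkord.
  have -> : (1 - r) * (\sum_(i < M) r ^+ i) = 1 - r ^+ M by rewrite -opprB mulNr -subrX1 opprB.
  by rewrite gerBl exprn_ge0.
apply: le_trans (ler_wpM2l _ geo) _; first by rewrite !mulr_ge0 ?exprn_ge0.
by rewrite mulrAC ler_wpM2l // divr_ge0 ?mulr_ge0 ?exprn_ge0 // ltW.
Qed.

Section Restart.
Variables (f : seq word -> R) (c eta : R).
Local Notation ab := (above f c).
Hypothesis eta01 : 0 < eta <= 1.
Hypothesis ab_eta : forall q m, bal q -> ((eta * vol q)%:E <= Ex m q (fun ss => ((ab ss)%:R)%:E))%E.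

Definition fails ss := [&& (0 < size ss)%N, ab (take (size ss).-1 ss) & ~~ ab ss].

Lemma above_take n ss : ab ss -> ab (take n ss).
Proof.
move=> /aboveP H; apply/aboveP => k; rewrite size_take_min => /andP [k0].
rewrite leq_min => /andP [kn ks]; rewrite take_takel //; apply: H; by rewrite k0.
Qed.

Lemma one_pos : qpos one. Proof. by move=> a; apply: ltr01. Qed.

(** [fails] marks the first length at which [ab] breaks, [ab] being inherited by prefixes; so
    failures at different lengths and survival up to [N] share the mass. *)
Lemma fails_sum q N : bal q ->
  (\sum_(0 <= n < N.+1) Ex n q (fun ss => ((fails ss)%:R)%:E) +
    Ex N q (fun ss => ((ab ss)%:R)%:E) <= (vol q)%:E)%E.
Proof.
move=> bq; have qp : qpos q by case: bq.
have ge n ss : words n ss -> (0 <= ((fails ss)%:R : R)%:E)%E by move=> _; rewrite lee_fin.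
have ge' n ss : words n ss -> (0 <= ((ab ss)%:R : R)%:E)%E by move=> _; rewrite lee_fin.
elim: N => [|N IH].
  rewrite big_nat1 /Ex /= mule0 add0e mule1 //.
rewrite big_nat_recr //= -addeA; apply: le_trans IH; apply: leeD2l.
rewrite -ExD //; try exact: (ge N.+1); try exact: (ge' N.+1).
apply: (@le_trans _ _ (Ex (N + 1) q (fun ss => ((ab (take N ss))%:R)%:E))).
  rewrite addn1; apply: le_Ex => // ss; first by move=> _; rewrite lee_fin addr_ge0.
  move=> /andP [/eqP sN _]; rewrite -EFinD lee_fin /fails sN /= -natrD ler_nat.
  by have := @above_take N ss; case: (ab ss) => [/(_ isT) ->|]; case: (ab _).
apply: Ex_cond => // ss ws.
have sN : size ss = N by case/andP: ws => /eqP.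
apply: Ex_le_cst => //; first exact: qw_pos.
by move=> t _; rewrite take_size_cat.
Qed.

Lemma fails_lt q : bal q ->
  (\sum_(n <oo) Ex n q (fun ss => ((fails ss)%:R)%:E) <= ((1 - eta) * vol q)%:E)%E.
Proof.
move=> bq; have qp : qpos q by case: bq.
have g0 n : (0 <= Ex n q (fun ss => ((fails ss)%:R)%:E))%E.
  by apply: Ex_ge0 => // ss _; rewrite lee_fin.
apply: nneseries_le => // N.
apply: (@le_trans _ _ (\sum_(0 <= n < N.+1) Ex n q (fun ss => ((fails ss)%:R)%:E))%E).
  by rewrite big_nat_recr //= leeDl.
rewrite mulrBl mul1r EFinB leeBrDr //; apply: le_trans (fails_sum N bq).
by apply: leeD2l; apply: ab_eta.
Qed.

Definition restarts K r (p : seq word) : set (A -> R) := [set v | cube K%:R v /\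
  exists t : seq (seq word), [/\ size t = r, all (all fr) t, all fails t &
    cyl s0 (flatten (p ++ flatten t)) v]].

Lemma fr_all ss : all fr ss -> all cpl ss.
Proof. by apply: sub_all => w; apply: fr_cpl. Qed.

(** After a failed stretch of words the row is again balanced, so [fails_lt] applies from there and
    yields one more factor [1 - eta]. *)
Lemma ov_restarts (K : nat) r p : all fr p ->
  (ov (restarts K r p) <= (K%:R ^+ d * (1 - eta) ^+ r * vol (qw one p))%:E)%E.
Proof.
have e1 : 0 <= 1 - eta by rewrite subr_ge0; case/andP: eta01.
elim: r p => [|r IH] p fp.
  rewrite expr0 mulr1 (qw_flatten _ (fr_all fp)).1; apply: le_trans (ov_cyl _ gs0 _) => //.
  by apply: le_ov => v [cv [t [/size0nil -> _ _]]]; rewrite cats0.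
pose B n : set (A -> R) := [set v | exists ss, [/\ size ss = n, all fr ss &
  (if fails ss && all fr ss then restarts K r (p ++ ss) else set0) v]].
apply: (@le_trans _ _ (ov (\bigcup_n B n))).
  apply: le_ov => v [cv [[|ss t] [// [st] /= /andP [fss ft] /andP [gss gt] cvt]]].
  exists (size ss) => //; exists ss; rewrite gss fss; split => //; split => //; exists t; split => //.
  by rewrite -catA.
apply: le_trans (ov_bigcup _) _.
have bp : bal (qw one p) by apply: qw_bal (fr_all fp) => //; apply: bal_one.
have qp : qpos (qw one p) by case: bp.
pose C : R := K%:R ^+ d * (1 - eta) ^+ r; have C0 : 0 <= C by rewrite mulr_ge0 ?exprn_ge0.
apply: (@le_trans _ _ (\sum_(n <oo) (C%:E * Ex n (qw one p) (fun ss => ((fails ss)%:R)%:E)))%E).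
  apply: lee_nneseries => n _; first by move=> _; apply: ov_ge0.
  apply: le_trans (ov_It _ _) _; rewrite /Ex -ItZ; last first.
    by move=> ss _; rewrite -EFinM lee_fin mulr_ge0 // vol_qw_ge0.
  apply: le_It => ss _; first exact: ov_ge0.
  case: ifP => [/andP [gss fss]|_]; last first.
    by rewrite (ov0 R x0) -!EFinM lee_fin mulr_ge0 // mulr_ge0 // vol_qw_ge0.
  apply: le_trans (IH _ _) _; first by rewrite all_cat fp.
  by rewrite gss mule1 qw_cat -EFinM.
have g0 n : (0 <= Ex n (qw one p) (fun ss => ((fails ss)%:R)%:E))%E.
  by apply: Ex_ge0 => // ss _; rewrite lee_fin.
rewrite nneseriesZl //; apply: le_trans (lee_wpmul2l _ (fails_lt bp)) _; first by rewrite lee_fin.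
by rewrite -EFinM exprSr !mulrA.
Qed.

(* Restart at each failure: infinitely many independent failures have measure 0. *)
Lemma restart : almost (fun ws => exists k, forall n, ab (mkseq (fun i => ws (k + i)%N) n)).
Proof.
have e1 : 0 <= 1 - eta < 1.
  by case/andP: eta01 => h1 h2; rewrite subr_ge0 h2 ltrBlDr ltrDl.
move=> K; apply: (@ov_null_le _ (K%:R ^+ d)) => e e0.
have [r Hr] : exists r, (1 - eta) ^+ r <= e.
  apply: contrapT => no; have : e <= 0; last by rewrite leNgt e0.
  apply: (@geometric_small R e 1 _ e1) => l.
  by rewrite mul1r leNgt; apply/negP => /ltW le; apply: no; exists l.
apply: le_trans (le_trans (@ov_restarts K r [::] isT) _); last first.
  by rewrite vol_one mulr1 lee_fin ler_wpM2l // exprn_ge0.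
apply: le_ov => v [cv [ws dv no]]; split => //.
have ex k : exists n, ~~ ab (mkseq (fun i => ws (k + i)%N) n).
  apply: contrapT => nn; apply: no; exists k => n; apply: contrapT => /negP na.
  by apply: nn; exists n.
suff [t [st ft gt [k Hk]]] : exists t, [/\ size t = r, all (all fr) t, all fails t &
    exists k, flatten t = mkseq ws k].
  by exists t; split => //; rewrite cat0s Hk; case: (dv k).
elim: r {Hr} => [|r [t [st ft gt [k Hk]]]]; first by exists [::]; split => //; exists 0%N.
case: (ex_minnP (ex k)) => n nab nmin.
exists (rcons t (mkseq (fun i => ws (k + i)%N) n)); split.
- by rewrite size_rcons st.
- by rewrite all_rcons ft andbT; apply/allP => _ /mapP [i _ ->]; case: (dv (k + i)%N).
- rewrite all_rcons gt andbT /fails size_mkseq nab andbT.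
  case: n nab nmin => [|n] nab nmin /=; first by [].
  have -> : take n (mkseq (fun i => ws (k + i)%N) n.+1) = mkseq (fun i => ws (k + i)%N) n.
    by rewrite /mkseq -addn1 iotaD map_cat take_size_cat // size_map size_iota.
  by apply: contrapT => /negP /nmin; rewrite ltnn.
- exists (k + n)%N; rewrite flatten_rcons Hk /mkseq iotaD map_cat add0n; congr (_ ++ _).
  by rewrite -[in RHS](addn0 k) iotaDl -map_comp.
Qed.

End Restart.

Section Incomplete.
Variable q : A -> R.
Hypothesis qp : qpos q.

Fixpoint inc N h : R := if cpl h then 0 else
  if N is n.+1 then inc n (rcons h true) + inc n (rcons h false) else vol (Q q h).

Lemma inc_ge0 N h : 0 <= inc N h.
Proof.
by elim: N h => [|N IH] h /=; case: ifP => // _; rewrite ?addr_ge0 // ltW // vol_gt0 //; apply: Qpos.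
Qed.

Lemma tot_size (m : R) h : (forall a, m <= q a) -> (size h)%:R * m <= tot (Q q h).
Proof.
move=> mq; elim/last_ind: h => [|h b IH].
  by rewrite mul0r; apply: sumr_ge0 => a _; apply: ltW; apply: qp.
rewrite size_rcons qrun_rcons tot_step -natr1 mulrDl mul1r; apply: lerD => //.
by apply: le_trans (mq _) (qrun_ge _ _ _ _ _).
Qed.

(** Markov's inequality: each step adds at least [m] to the total, so a long incomplete path weighs
    heavily in [mom]. *)
Lemma inc_mom (m kap : R) N h : 0 < m -> 0 <= kap -> (forall a, m <= q a) ->
  inc N h * ((size h + N)%:R * m) `^ kap <= mom x0 s0 gam kap q N h.
Proof.
move=> m0 k0 mq; elim: N h => [|N IH] h /=.
  case: ifP => _; rewrite ?mul0r; first by rewrite mulr_ge0 ?powR_ge0 // ltW // vol_gt0 //; apply: Qpos.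
  rewrite addn0; apply: ler_wpM2l; first by rewrite ltW // vol_gt0 //; apply: Qpos.
  apply: ge0_ler_powR; rewrite ?nnegrE ?mulr_ge0 ?(ltW m0) ?tot_size //.
  by apply: sumr_ge0 => a _; apply/ltW/Qpos.
case: ifP => _; first by rewrite mul0r mulr_ge0 ?powR_ge0 // ltW // vol_gt0 //; apply: Qpos.
by rewrite mulrDl; apply: lerD; have := IH (rcons h true); have := IH (rcons h false);
  rewrite !size_rcons !addSn !addnS.
Qed.

End Incomplete.

Definition no_cpl L g := size g = L /\ forall k, (k <= L)%N -> ~~ cpl (take k g).

Lemma ov_incomplete K p q N h : 0 <= K -> crun s0 p = s0 -> q = Q one p ->
  (ov (cube K `&` [set v | exists g, [/\ size g = N,
     forall k, (k <= N)%N -> ~~ cpl (h ++ take k g) & cyl s0 (p ++ h ++ g) v]]) <=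
   (K ^+ d * inc q N h)%:E)%E.
Proof.
move=> K0 sp qE; elim: N h => [|N IH] h /=.
  case: ifP => ch.
    rewrite mulr0 -[X in (_ <= X)%E](ov0 R x0); apply: le_ov => v [_ [g [_ /(_ 0%N isT)]]].
    by rewrite take0 cats0 ch.
  have -> : Q q h = Q one (p ++ h) by rewrite qrun_cat sp qE.
  apply: le_trans (ov_cyl _ gs0 K0); apply: le_ov.
  by move=> v [cv [g [/size0nil -> _]]]; rewrite cats0.
case: ifP => ch.
  rewrite mulr0 -[X in (_ <= X)%E](ov0 R x0); apply: le_ov => v [_ [g [_ /(_ 0%N isT)]]].
  by rewrite take0 cats0 ch.
rewrite mulrDr EFinD; apply: le_trans (leeD (IH (rcons h true)) (IH (rcons h false))).
apply: le_trans (ovU x0 _ _); apply: le_ov => v [cv [[|b g] [// [sg] ng cg]]].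
have H : (cube K `&` [set v | exists g, [/\ size g = N,
   forall k, (k <= N)%N -> ~~ cpl (rcons h b ++ take k g) & cyl s0 (p ++ rcons h b ++ g) v]]) v.
  split => //; exists g; rewrite cat_rcons; split => // k kn; rewrite cat_rcons; exact: (ng k.+1).
by case: b H {cg ng} => H; [left|right].
Qed.

Lemma ov_no_word K ss : all fr ss ->
  ov (cube K%:R `&` [set v | forall L, exists2 g, no_cpl L g & cyl s0 (flatten ss ++ g) v]) = 0.
Proof.
move=> fss; set p := flatten ss; pose q := Q one p.
have qp : qpos q by apply: qrun_pos; apply: one_pos.
have sp : crun s0 p = s0 by case: (qw_flatten one (fr_all fss)).
have [m m0 mq] := pos_lower x0 qp.
have [kap [H [k0 H1 Hm]]] := moment_bound R x0 d2 gs0 gam.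
pose T := H * (vol q * tot q `^ kap).
have T0 : 0 <= T by rewrite !mulr_ge0 ?powR_ge0 //; [exact: le_trans H1|exact/ltW/vol_gt0].
apply: (@ov_null_le _ (K%:R ^+ d * T)) => e e0.
pose L := Num.bound ((e^-1 `^ kap^-1) / m).
have HL : e^-1 <= (L%:R * m) `^ kap.
  have : (e^-1 `^ kap^-1) / m < L%:R by apply: archi_boundP; rewrite divr_ge0 ?powR_ge0 // ltW.
  rewrite ltr_pdivrMr // => /ltW h.
  have -> : e^-1 = (e^-1 `^ kap^-1) `^ kap.
    by rewrite -powRrM mulVf ?powRr1 ?gt_eqF // invr_ge0 ltW.
  by apply: ge0_ler_powR; rewrite ?nnegrE ?powR_ge0 ?mulr_ge0 // ltW.
have e'0 : 0 < e^-1 by rewrite invr_gt0.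
have HI : inc q L [::] <= T * e.
  have := inc_mom qp L [::] m0 (ltW k0) mq; rewrite add0n => h.
  rewrite -ler_pdivrMr //; apply: le_trans (le_trans h (Hm q L [::] qp)).
  by rewrite ler_wpM2l // inc_ge0.
apply: le_trans (le_trans (ov_incomplete L [::] (ler0n R K) sp (erefl q)) _).
  by apply: le_ov => v [cv /(_ L) [g [sg ng] cg]]; split => //; exists g.
by rewrite lee_fin -mulrA ler_wpM2l // exprn_ge0.
Qed.

Definition decb (b : nat -> bool) (ws : nat -> word) := forall n, fr (ws n) /\
  flatten (mkseq ws n) = mkseq b (size (flatten (mkseq ws n))).

(** If reading the words greedily gets stuck, it does so after one of countably many finite lists of
    words, and [ov_no_word] handles each list. Otherwise [T n] is the position where the [n]-th word
    starts. *)
Lemma almost_dec (K : nat) : ov [set v | cube K%:R v /\ exists b : nat -> bool,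
  (forall n, cyl s0 (mkseq b n) v) /\ ~ exists ws, decb b ws] = 0.
Proof.
apply/eqP; rewrite eq_le ov_ge0 andbT.
rewrite -(ov_countable x0 (F := fun ss => if all fr ss then cube K%:R `&`
  [set v | forall L, exists2 g, no_cpl L g & cyl s0 (flatten ss ++ g) v] else set0)).
  apply: le_ov => v [cv [b [cb nws]]]; apply: contrapT => no; apply: nws.
  pose pre (ss : seq word) N := all fr ss /\ flatten ss = mkseq b N.
  have ex ss N : pre ss N -> exists w, fr w /\ w = mkseq (fun i => b (N + i)%N) (size w).
    move=> [fss fE]; apply: contrapT => nw; apply: no; exists ss; rewrite fss; split => //= L.
    have sub k : (k <= L)%N -> take k (mkseq (fun i => b (N + i)%N) L) = mkseq (fun i => b (N + i)%N) k.
      by move=> kL; rewrite /mkseq -map_take take_iota (minn_idPl kL).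
    exists (mkseq (fun i => b (N + i)%N) L); last first.
      have := cb (N + L)%N; rewrite fE /mkseq iotaD map_cat add0n.
      by rewrite -[in X in X -> _](addn0 N) iotaDl -map_comp addn0.
    split; first by rewrite size_mkseq.
    move=> k kL; rewrite sub //; apply/negP => ck; apply: nw.
    case: (@ex_minnP (fun k => cpl (mkseq (fun i => b (N + i)%N) k))); first by exists k.
    move=> j cj jmin; exists (mkseq (fun i => b (N + i)%N) j); rewrite size_mkseq; split => //.
    rewrite /fr cj /=; apply/forallP => -[i /=]; rewrite size_mkseq => ij.
    have -> : take i (mkseq (fun i => b (N + i)%N) j) = mkseq (fun i => b (N + i)%N) i.
      by rewrite /mkseq -map_take take_iota (minn_idPl (ltnW ij)).
    by apply/negP => /jmin; rewrite leqNgt ij.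
  have /choice [W HW] : forall N, exists w, forall ss, pre ss N ->
      fr w /\ w = mkseq (fun i => b (N + i)%N) (size w).
    move=> N; have [[ss Hss]|nss] := pselect (exists ss, pre ss N).
      by have [w Hw] := ex _ _ Hss; exists w.
    by exists [::] => ss Hss; case: nss; exists ss.
  pose T n := iter n (fun N => N + size (W N))%N 0%N.
  have HT n : pre (mkseq (fun i => W (T i)) n) (T n).
    elim: n => [|n [IH1 IH2]]; first by [].
    have [fw wE] := HW _ _ (conj IH1 IH2).
    rewrite /pre /mkseq -addn1 iotaD map_cat all_cat flatten_cat -/(mkseq _ _) IH1 IH2 /= add0n fw.
    split => //; rewrite cats0 {1}wE addn1 /= iotaD map_cat add0n; congr (_ ++ _).
    by rewrite -[in RHS](addn0 (T n)) iotaDl -map_comp addn0.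
  exists (fun n => W (T n)) => n; have [h1 h2] := HT n.
  by split; [case: (HW _ _ (HT n))|rewrite h2 size_mkseq].
by move=> ss; case: ifP => [fss|_]; [exact: ov_no_word|rewrite (ov0 R x0)].
Qed.

End Base.
End Cylinders.

(** * Almost sure growth rates of minors *)

Section Rates.
Variables (R : realType) (A : finType) (x0 : A).
Hypothesis d2 : (1 < #|A|)%N.
Local Notation d := #|A|.
Variables (s0 : cst A) (gam : seq bool).
Hypothesis gs0 : good s0.
Hypothesis gamE : crun x0 s0 gam = s0.
Hypothesis gam_pos : forall i j, 1 <= pathmx x0 R s0 gam i j.
Local Notation word := (seq bool).
Local Notation cpl := (cpl x0 s0 gam).
Local Notation Q := (qrun x0 s0).
Local Notation Sw := (Sw x0 s0 gam).
Local Notation Ex := (Ex x0 s0 gam).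
Local Notation qw := (qw x0 s0).
Local Notation bal := (bal x0 s0 gam).
Local Notation words := (words x0 s0 gam).
Local Notation almost := (almost R x0 s0 gam).
Local Notation one := (one R (A := A)).
Implicit Types (w : word) (ss : seq word) (ws : nat -> word).

Lemma almost_and (P : nat -> (nat -> word) -> Prop) :
  (forall i, almost (P i)) -> almost (fun ws => forall i, P i ws).
Proof.
move=> HP K; apply/eqP; rewrite eq_le ov_ge0 andbT.
rewrite -(ov_countable x0 (fun i => HP i K)); apply: le_ov => v [cv [ws dv no]].
apply: contrapT => nn; apply: no => i; apply: contrapT => nPi; apply: nn.
by exists i; split => //; exists ws.
Qed.

Lemma almost_sub (P P' : (nat -> word) -> Prop) :
  (forall ws, (forall n, fr x0 s0 gam (ws n)) -> P ws -> P' ws) -> almost P -> almost P'.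
Proof.
move=> PP HP K; apply/eqP; rewrite eq_le ov_ge0 andbT -(HP K).
apply: le_ov => v [cv [ws dv no]]; split => //; exists ws => // Pws; apply: no; apply: PP Pws.
by move=> n; case: (dv n).
Qed.

Definition slice ws k l := mkseq (fun i => ws (k + i)%N) (l - k).

Lemma size_slice ws k l : size (slice ws k l) = (l - k)%N. Proof. exact: size_mkseq. Qed.

Lemma slice_cat ws k l m : (k <= l)%N -> (l <= m)%N -> slice ws k l ++ slice ws l m = slice ws k m.
Proof.
move=> kl lm; rewrite /slice /mkseq.
have -> : (m - k = (l - k) + (m - l))%N by move: kl lm; clear; lia.
rewrite iotaD map_cat add0n; congr (_ ++ _); rewrite -[in RHS](addn0 (l - k)%N) iotaDl -map_comp.
by apply: eq_map => i /=; rewrite addnA subnKC.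
Qed.

Lemma slice0 ws n : slice ws 0 n = mkseq ws n.
Proof. by rewrite /slice subn0. Qed.

Lemma drop_slice ws k n : (k <= n)%N -> drop k (mkseq ws n) = slice ws k n.
Proof.
move=> kn; rewrite -!slice0 -(slice_cat ws (leq0n k) kn) drop_size_cat //.
by rewrite size_slice subn0.
Qed.

Definition wmx ss := pathmx x0 R s0 (flatten ss).

Lemma wmx_cat ss ss' : all cpl ss -> wmx (ss ++ ss') = wmx ss *m wmx ss'.
Proof.
by move=> css; rewrite /wmx flatten_cat pathmx_cat (qw_flatten gamE one css).2.
Qed.

Section Order.
Variable p : nat.
Hypotheses (p0 : (0 < p)%N) (pd : (p <= d)%N).

Definition lnm ss := ln (minors p (wmx ss)).

Lemma wmx_minors ss : 1 <= minors p (wmx ss).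
Proof. exact: minors_pathmx_ge1. Qed.

Lemma lnm_ge0 ss : 0 <= lnm ss. Proof. by rewrite ln_ge0 // wmx_minors. Qed.

Lemma lnm_cat ss ss' : all cpl ss -> all cpl ss' -> lnm (ss ++ ss') <= lnm ss + lnm ss'.
Proof.
move=> css _; have gt s : 0 < minors p (wmx s) by apply: lt_le_trans (wmx_minors s).
rewrite /lnm -lnM ?posrE // ler_ln ?posrE ?mulr_gt0 // wmx_cat //; exact: minors_mul.
Qed.

(** Minors of order [p] are at most a constant times the [p]-th power of the norm, so the exponent
    of [word_moment] is divided by [p]. *)
Lemma lnm_moment : exists kap H : R, [/\ 0 < kap, 1 <= H & forall q, bal q ->
  (Sw (fun w => (vol (Q q w) * expR (kap * lnm [:: w]))%:E) <= (H * vol q)%:E)%E].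
Proof.
have [kap [H [k0 H1 Hm]]] := word_moment d2 gs0 gam_pos.
have [C C0 HC] := minors_bound R p d d.
have p0' : 0 < (p%:R : R) by rewrite ltr0n.
have kp0 : 0 < kap / p%:R by rewrite divr_gt0.
pose C' := C + 1; have C'0 : 0 < C' by rewrite addr_gt0.
pose D := C' `^ (kap / p%:R).
have D0 : 0 < D by rewrite powR_gt0.
exists (kap / p%:R), (D * H + 1); split => //.
  by rewrite lerDr mulr_ge0 ?(ltW D0) // (le_trans ler01).
move=> q bq; have qp : qpos q by case: bq.
apply: (@le_trans _ _ (Sw (fun w => D%:E * (vol (Q q w) * nrm (pathmx x0 R s0 w) `^ kap)%:E)%E)).
  have vq w : 0 < vol (Q q w) by apply: vol_gt0; apply: qrun_pos.
  apply: le_Sw => w cw; first by rewrite lee_fin mulr_ge0 ?expR_ge0 // ltW.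
  rewrite -EFinM lee_fin mulrCA ler_pM2l //.
  set M := pathmx x0 R s0 w; have M0 := nrm_ge0 M.
  have mM : minors p (wmx [:: w]) <= C' * nrm M ^+ p.
    rewrite /wmx /= cats0 -/M; apply: le_trans (HC M (nrm M) M0 _) _; first exact: nrm_entry.
    by rewrite ler_wpM2r ?exprn_ge0 // lerDl.
  have m0 : 0 < minors p (wmx [:: w]) by apply: lt_le_trans (wmx_minors _).
  have -> : expR (kap / p%:R * lnm [:: w]) = minors p (wmx [:: w]) `^ (kap / p%:R).
    by rewrite /powR gt_eqF.
  apply: le_trans (ge0_ler_powR (ltW kp0) _ _ mM) _; rewrite ?nnegrE ?(ltW m0) //.
    by rewrite mulr_ge0 ?exprn_ge0 // ltW.
  rewrite powRM ?exprn_ge0 ?(ltW C'0) // -powR_mulrn // -powRrM.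
  have -> : p%:R * (kap / p%:R) = kap by rewrite mulrC divfK // gt_eqF.
  exact: lexx.
rewrite SwZ; last first.
  by move=> w _; rewrite lee_fin mulr_ge0 ?powR_ge0 // ltW // vol_gt0 //; apply: qrun_pos.
apply: le_trans (lee_wpmul2l _ (Hm q bq)) _; first by rewrite lee_fin ltW.
by rewrite -EFinM lee_fin mulrA ler_wpM2r ?(ltW (vol_gt0 qp)) // lerDl.
Qed.

Definition rate : R := chi x0 s0 gam lnm.

Lemma lnm_cons w ss : cpl w -> all cpl ss -> lnm (w :: ss) <= lnm [:: w] + lnm ss.
Proof. by move=> cw css; rewrite -cat1s; apply: lnm_cat => //=; rewrite cw. Qed.

Lemma rate_ge0 : 0 <= rate.
Proof.
have [kap [H [k0 H1 Hm]]] := lnm_moment.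
by apply: (chi_ge0 gam_pos k0 H1 (fun ss _ => lnm_ge0 ss) lnm_cons Hm).
Qed.

Lemma Ex_sum n m q (F : nat -> seq word -> \bar R) : qpos q ->
  (forall i ss, (0 <= F i ss)%E) ->
  Ex n q (fun ss => (\sum_(i < m) F i ss)%E) = (\sum_(i < m) Ex n q (F i))%E.
Proof.
move=> qp F0; elim: m => [|m IH].
  rewrite big_ord0; have -> : (fun ss => \sum_(i < 0) F i ss)%E = (fun=> 0%:E * 1)%E :> (seq word -> _).
    by apply/funext => ss; rewrite big_ord0 mul0e.
  by rewrite ExZ // mul0e.
rewrite big_ord_recr /= -IH -ExD //; last by move=> ss _; apply: sume_ge0.
by congr (Ex n q _); apply/funext => ss; rewrite big_ord_recr.
Qed.

(** By the exponential moment, the estimate fails for a given pair with mass of order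
    [exp (- t e l)]. The margin [e * l] thus pays for the [l.+1] values of [k], using half of the
    exponent, and still leaves a geometric series in [l]. *)
Lemma almost_upper e : 0 < e -> almost (fun ws => exists C, forall k l, (k <= l)%N ->
  lnm (slice ws k l) <= (rate + e) * (l - k)%:R + e * l%:R + C).
Proof.
move=> e0; have [kap [H [k0 H1 Hm]]] := lnm_moment.
have [t [C [t0 tk C0 HC]]] :=
  upper_growth gs0 gam_pos k0 H1 (fun ss _ => lnm_ge0 ss) lnm_cat lnm_cons Hm e0.
rewrite -/rate in HC.
pose bad l k ss := (rate + e) * (l - k)%:R + e * l%:R < lnm (drop k ss).
pose E l : pred (seq word) := fun ss => [exists k : 'I_l.+1, bad l k ss].
have onep : qpos one by move=> a; apply: ltr01.
have Hbad l k : (k <= l)%N ->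
    (Ex l one (fun ss => ((bad l k ss)%:R)%:E) <= (C * expR (- (t * e) * l%:R))%:E)%E.
  move=> kl; rewrite -{1}(subnKC kl).
  apply: le_trans (Ex_cond (c := fun=> C * expR (- (t * e) * l%:R)) onep _ _) _.
  - by move=> ss _; rewrite lee_fin.
  - move=> ss ws; have sk : size ss = k by case/andP: ws => /eqP.
    have bq : bal (qw one ss) by apply: qw_bal (proj2 (andP ws)) => //; apply: bal_one.
    have qp : qpos (qw one ss) by case: bq.
    pose G := expR (- (t * ((rate + e) * (l - k)%:R + e * l%:R))).
    apply: (@le_trans _ _ (Ex (l - k) (qw one ss) (fun ss' => (G%:E * (expR (t * lnm ss'))%:E)%E))).
      apply: le_Ex => // ss' _; rewrite -EFinM lee_fin -expRD.
      rewrite /bad drop_size_cat //; case: ltP => h; last exact: expR_ge0.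
      rewrite -[leLHS](@expR0 R) ler_expR addrC subr_ge0 ler_pM2l //; exact: ltW.
    rewrite ExZ //; apply: le_trans (lee_wpmul2l _ (HC _ (l - k)%N bq)) _.
      by rewrite lee_fin expR_ge0.
    rewrite -EFinM lee_fin mulrA ler_wpM2r ?(ltW (vol_gt0 qp)) // mulrCA ler_pM2l //.
    by rewrite -expRD ler_expR le_eqVlt; apply/orP; left; apply/eqP; ring.
  - have c0 : 0 <= C * expR (- (t * e) * l%:R) by rewrite mulr_ge0 ?expR_ge0 // ltW.
    apply: le_trans (Ex_le_cst (c := C * expR (- (t * e) * l%:R)) gs0 onep c0 _ _) _ => //.
    by rewrite vol_one mulr1.
pose r := expR (- (t * e / 2)).
have te0 : 0 < t * e / 2 by rewrite divr_gt0 ?mulr_gt0.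
have r01 : 0 <= r < 1 by apply: expR_rate; rewrite oppr_lt0.
have HE l : (Ex l one (fun ss => ((E l ss)%:R)%:E) <= ((C * (2 / (t * e)) * expR (t * e / 2)) * r ^+ l)%:E)%E.
  apply: (@le_trans _ _ (Ex l one (fun ss => (\sum_(k < l.+1) ((bad l k ss)%:R)%:E)%E))).
    apply: le_Ex => // ss _; rewrite sumEFin lee_fin /E.
    case: existsP => [[k Hk]|_]; last by apply: sumr_ge0.
    by rewrite (bigD1 k) //= Hk lerDl sumr_ge0.
  rewrite (Ex_sum l l.+1 (F := fun k ss => ((bad l k ss)%:R)%:E) onep); last by move=> i ss; rewrite lee_fin.
  apply: (@le_trans _ _ (\sum_(k < l.+1) (C * expR (- (t * e) * l%:R))%:E)%E).
    by apply: lee_sum => k _; apply: Hbad; rewrite -ltnS.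
  rewrite sumEFin lee_fin sumr_const card_ord -[leLHS]mulr_natr.
  have h1 : t * e / 2 * l.+1%:R <= expR (t * e / 2 * l.+1%:R) by apply: le_trans (expR_ge1Dx _); rewrite lerDr.
  have h2 : l.+1%:R <= 2 / (t * e) * expR (t * e / 2 * l.+1%:R).
    have -> : 2 / (t * e) = (t * e / 2)^-1 by rewrite invf_div.
    by rewrite -ler_pdivrMl ?invr_gt0 // invrK.
  have -> : C * (2 / (t * e)) * expR (t * e / 2) * r ^+ l =
      C * (expR (- (t * e) * l%:R) * (2 / (t * e) * expR (t * e / 2 * l.+1%:R))).
    rewrite /r -expRnat; move: (2 / (t * e)) => X.
    have -> : expR (- (t * e) * l%:R) * (X * expR (t * e / 2 * l.+1%:R)) =
        X * (expR (- (t * e) * l%:R) * expR (t * e / 2 * l.+1%:R)) by rewrite mulrCA.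
    rewrite -[LHS]mulrA -[LHS]mulrA -!expRD; congr (C * (X * expR _)); rewrite -natr1; by field.
  by rewrite -[leLHS]mulrA ler_pM2l // ler_wpM2l ?expR_ge0.
apply: almost_sub (borel_cantelli d2 gs0 gamE r01 HE) => ws frw [N HN].
(* Covers the finitely many pairs with [l < N]. *)
pose S := \sum_(l < N) \sum_(k < N) `|lnm (slice ws k l)|.
have S0 : 0 <= S by apply: sumr_ge0 => l _; apply: sumr_ge0.
have r0 := rate_ge0.
exists S => k l kl; have [Nl|lN] := leqP N l.
  have := HN l Nl; rewrite negb_exists => /forallP; have kl' : (k < l.+1)%N by [].
  move=> /(_ (Ordinal kl')); rewrite /bad /= -leNgt drop_slice // => h.
  by apply: le_trans h _; rewrite lerDl.
apply: (@le_trans _ _ S); last by rewrite lerDr addr_ge0 // mulr_ge0 // ?addr_ge0 // ltW.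
rewrite /S (bigD1 (Ordinal lN)) //= (bigD1 (Ordinal (leq_ltn_trans kl lN))) //=.
rewrite -!addrA; apply: le_trans (ler_norm _) _; rewrite lerDl addr_ge0 //; first by apply: sumr_ge0.
by apply: sumr_ge0 => i _; apply: sumr_ge0.
Qed.

Lemma almost_lower e : 0 < e -> almost (fun ws => exists k, forall n,
  (rate - e) * n%:R <= lnm (slice ws k (k + n))).
Proof.
move=> e0; have [re|re] := leP rate e.
  move=> K; rewrite -[RHS](ov0 R x0); congr ov; apply/seteqP; split => // v [_ [ws _]]; apply.
  exists 0%N => n; apply: le_trans (lnm_ge0 _); rewrite mulr_le0_ge0 // subr_le0 //.
have [kap [H [k0 H1 Hm]]] := lnm_moment.
have c0 : 0 <= rate - e by rewrite subr_ge0 ltW.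
have c1 : rate - e < chi x0 s0 gam lnm by rewrite ltrBlDr ltrDl.
have [eta eta01 Heta] := lower_growth gs0 gam_pos k0 H1 (fun ss _ => lnm_ge0 ss) lnm_cat lnm_cons
  (fun w _ => lnm_ge0 [:: w]) Hm c0 c1.
apply: almost_sub (restart d2 gs0 gamE gam_pos eta01 Heta) => ws _ [k Hk].
exists k => -[|n]; first by rewrite mulr0 lnm_ge0.
have /aboveP /(_ n.+1) := Hk n.+1; rewrite size_mkseq ltnSn => /(_ isT) /ltW.
by rewrite take_oversize ?size_mkseq // /slice addKn.
Qed.

Lemma almost_rate : almost (fun ws =>
  (forall e, 0 < e -> exists C, forall k l, (k <= l)%N ->
    lnm (slice ws k l) <= (rate + e) * (l - k)%:R + e * l%:R + C) /\
  (forall e, 0 < e -> exists k, forall n, (rate - e) * n%:R <= lnm (slice ws k (k + n)))).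
Proof.
have e0 i : 0 < (i.+1%:R^-1 : R) by rewrite invr_gt0.
have small e : 0 < e -> exists i : nat, i.+1%:R^-1 <= e :> R.
  move=> e1; exists (Num.bound e^-1); rewrite -[leRHS]invrK lef_pV2 ?posrE ?invr_gt0 //.
  have /ltW h := archi_boundP (ltW (etrans (invr_gt0 e) e1)); apply: le_trans h _.
  by rewrite ler_nat.
apply: almost_sub (almost_and (P := fun i ws => (exists C, forall k l, (k <= l)%N ->
    lnm (slice ws k l) <= (rate + i.+1%:R^-1) * (l - k)%:R + i.+1%:R^-1 * l%:R + C) /\
    exists k, forall n, (rate - i.+1%:R^-1) * n%:R <= lnm (slice ws k (k + n))) _).
  move=> ws _ Hws; split => e /small [i ie]; have [[C HC] [k Hk]] := Hws i.
    exists C => k' l kl; apply: le_trans (HC _ _ kl) _; rewrite lerD2r.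
    by apply: lerD; rewrite ler_wpM2r // lerD2l.
  by exists k => n; apply: le_trans (Hk n); rewrite ler_wpM2r // lerD2l lerN2.
move=> i; apply: almost_sub (almost_and (P := fun b ws => if b is 0%N then (exists C, forall k l,
    (k <= l)%N -> lnm (slice ws k l) <= (rate + i.+1%:R^-1) * (l - k)%:R + i.+1%:R^-1 * l%:R + C)
    else exists k, forall n, (rate - i.+1%:R^-1) * n%:R <= lnm (slice ws k (k + n))) _).
  by move=> ws _ H; split; [exact: (H 0%N)|exact: (H 1%N)].
by move=> [|b]; [apply: almost_upper|apply: almost_lower].
Qed.

End Order.
End Rates.

(** * The Keane property *)

Section Keane.
Variables (R : realType) (A : finType).
Local Notation d := #|A|.
Variables (pi0 pi1 : A -> 'I_d).
Hypotheses (bij0 : bijective pi0) (bij1 : bijective pi1).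
Hypothesis adm : admissible pi0 pi1.
Local Notation p0 := (fun a => nat_of_ord (pi0 a)).
Local Notation p1 := (fun a => nat_of_ord (pi1 a)).

Lemma admissible_neq k : (0 < k < d)%N -> ~ (forall a, (pi0 a < k)%N = (pi1 a < k)%N).
Proof.
move=> /andP [k0 kd] H; have kd1 : (k <= d.-1)%N by lia.
by move: (adm k0 kd1) => /eqP; apply; apply/seteqP; split => a /=; rewrite H.
Qed.

Lemma card_lt_bij (p : A -> 'I_d) k : bijective p -> (k <= d)%N -> #|[pred a | (p a < k)%N]| = k.
Proof.
move=> bp kd; rewrite -sum1_card -[RHS]muln1 -[X in (X * 1)%N](card_ord k) -sum_nat_const.
rewrite -(big_ord_narrow (F := fun=> 1%N) kd) [RHS](reindex p) //; exact: onW_bij.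
Qed.

Lemma start_le (p : A -> nat) (lam : A -> R) x y : (forall a, 0 < lam a) -> (p x < p y)%N ->
  start p lam x + lam x <= start p lam y.
Proof.
move=> lp xy; rewrite /start addrC [X in _ <= X](bigD1 x) //= lerD2l.
rewrite big_mkcond [leRHS]big_mkcond; apply: ler_sum => b _.
have [bx|bx] := boolP (p b < p x)%N.
  by rewrite (ltn_trans bx xy) /=; have [E|//] := eqVneq b x; move: bx; rewrite E ltnn.
by case: ifP => // _; apply: ltW.
Qed.

Section Orbit.
Variable lam : A -> R.
Hypothesis lp : forall a, 0 < lam a.
Hypothesis indep : forall c : A -> int, \sum_a (c a)%:~R * lam a = 0 -> forall a, c a = 0.
Local Notation T := (iem p0 p1 lam).
Local Notation st0 := (start p0 lam).
Local Notation st1 := (start p1 lam).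

Lemma start_iem a b m : iter m T (st0 a) = st0 b ->
  exists f : nat -> A, [/\ f 0%N = a, f m = b &
    st0 b = st0 a + \sum_(j < m) (st1 (f j) - st0 (f j))].
Proof.
move=> E; have st_in c : (st0 c <= st0 c) && (st0 c < st0 c + lam c) by rewrite lexx ltrDl lp.
have st_lt x y : (p0 x < p0 y)%N -> st0 x < st0 y.
  by move=> /(@start_le p0 lam _ _ lp); apply: lt_le_trans; rewrite ltrDl.
have iem_none x : [pick c | (st0 c <= x) && (x < st0 c + lam c)] = None -> T x = x.
  by move=> h; rewrite /iem h.
have some j : (j < m)%N -> exists c, [/\ st0 c <= iter j T (st0 a), iter j T (st0 a) < st0 c + lam c &
    iter j.+1 T (st0 a) = iter j T (st0 a) - st0 c + st1 c].
  move=> jm; set x := iter j T (st0 a); rewrite iterS -/x.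
  case E' : [pick c | (st0 c <= x) && (x < st0 c + lam c)] => [c|].
    exists c; move: E'; case: pickP => // c' /andP [h1 h2] [cc]; rewrite -cc; split => //.
    rewrite /iem; case: pickP => [c'' /andP [h3 h4]|/(_ c')]; last by rewrite h1 h2.
    suff -> : c'' = c' by [].
    apply: (bij_inj bij0); apply: ord_inj.
    case: (ssrnat.ltngtP (pi0 c'') (pi0 c')) => // lt; have h := @start_le p0 lam _ _ lp lt.
      by have := lt_le_trans h4 (le_trans h h1); rewrite ltxx.
    by have := lt_le_trans h2 (le_trans h h3); rewrite ltxx.
  (* By the default value of [iem], a point in no interval is fixed, so its orbit could not reach
     [st0 b], which lies in one. *)
  have fixx n : iter n T x = x by elim: n => // n IH; rewrite iterS IH iem_none.
  have : iter m T (st0 a) = x by rewrite -(subnK (ltnW jm)) iterD fixx.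
  rewrite E => bx; move: E'; case: pickP => // /(_ b); by rewrite -bx st_in.
have ex j : exists c, (j < m)%N -> [/\ st0 c <= iter j T (st0 a), iter j T (st0 a) < st0 c + lam c &
    iter j.+1 T (st0 a) = iter j T (st0 a) - st0 c + st1 c].
  by case: (ltnP j m) => [/some [c Hc]|_]; [exists c|exists a].
have [f Hf] := choice ex; exists (fun j => if j == m then b else if j == 0%N then a else f j).
have f0 : (0 < m)%N -> f 0%N = a.
  move=> m0; have [h1 h2 _] := Hf _ m0; apply: (bij_inj bij0); apply: ord_inj; rewrite /= in h1 h2.
  case: (ssrnat.ltngtP (pi0 (f 0%N)) (pi0 a)) => // lt.
    by have := lt_le_trans h2 (@start_le p0 lam _ _ lp lt); rewrite ltxx.
  by have := lt_le_trans (st_lt _ _ lt) h1; rewrite ltxx.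
split; rewrite ?eqxx //.
  case: eqP => // m0; move: E; rewrite -m0 /= => h; apply: (bij_inj bij0); apply: ord_inj.
  by case: (ssrnat.ltngtP (pi0 a) (pi0 b)) => // /st_lt; rewrite h ltxx.
rewrite -E; have : forall n, (n <= m)%N -> iter n T (st0 a) =
    st0 a + \sum_(j < n) (st1 (f j) - st0 (f j)).
  elim=> [|n IH] nm; first by rewrite big_ord0 addr0.
  have [_ _ ->] := Hf n nm; rewrite IH 1?ltnW // big_ord_recr /=; ring.
move=> -> //; congr (_ + _); apply: eq_bigr => j _; rewrite (ltn_eqF (ltn_ord j)).
by case: eqP => // j0; rewrite j0 f0 // (leq_ltn_trans (leq0n j)).
Qed.

(* A connection would give, by independence, equality of the counts N1 and N0
   below; their zero sets are final segments for p1 and p0, contradicting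
   admissibility. *)
Lemma keane_indep : keane p0 p1 lam.
Proof.
move=> [a [b [m [b0 [m1 E]]]]]; have [f [f0 fm Hf]] := start_iem E.
pose ind (p : A -> nat) (c x : A) : int := (p c < p x)%N.
have stE (p : A -> nat) x : start p lam x = \sum_c (ind p c x)%:~R * lam c.
  rewrite /start big_mkcond; apply: eq_bigr => c _; rewrite /ind.
  by case: ifP => _; rewrite ?mul1r ?mul0r.
have rel c : ind p0 c b = ind p0 c a + \sum_(j < m) (ind p1 c (f j) - ind p0 c (f j)).
  apply/eqP; rewrite -subr_eq0; apply/eqP; move: c; apply: indep.
  rewrite [LHS](_ : _ = st0 b - (st0 a + \sum_(j < m) (st1 (f j) - st0 (f j)))); last first.
    rewrite (eq_bigr (fun j : 'I_m => \sum_c ((ind p1 c (f j))%:~R * lam c - (ind p0 c (f j))%:~R * lam c))); last first.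
      by move=> j _; rewrite !stE -sumrB.
    rewrite !stE exchange_big /= -big_split -sumrB; apply: eq_bigr => c _ /=.
    rewrite rmorphB rmorphD rmorph_sum /= mulrBl mulrDl; congr (_ - (_ + _)).
    by rewrite mulr_suml; apply: eq_bigr => j _; rewrite rmorphB mulrBl.
  by rewrite Hf subrr.
pose N1 c := (\sum_(j < m) (p1 c < p1 (f j)))%N.
pose N0 c := (\sum_(j < m) (p0 c < p0 (f j.+1)))%N.
have NN c : N1 c = N0 c.
  have := rel c; rewrite sumrB -f0 -fm => h.
  have h2 : \sum_(j < m) ind p0 c (f j.+1) = \sum_(j < m) ind p0 c (f j) + ind p0 c (f m) - ind p0 c (f 0%N).
    rewrite -(big_ord_recr m (fun j => ind p0 c (f j))) big_ord_recl /=; ring.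
  have h3 : \sum_(j < m) ind p1 c (f j) = \sum_(j < m) ind p0 c (f j.+1).
    by rewrite h2 h; ring.
  by apply/eqP; rewrite -eqz_nat -[(N1 c)%:Z]/(Posz _) /N1 /N0 !(big_morph Posz PoszD erefl); apply/eqP.
pose k1 := (\max_(j < m) p1 (f j))%N; pose k0 := (\max_(j < m) p0 (f j.+1))%N.
have z1 c : (N1 c == 0%N) = (k1 <= p1 c)%N.
  rewrite /N1 sum_nat_eq0; apply/forallP/bigmax_leqP => H j; have := H j; rewrite /= ?implyTb.
    by rewrite eqb0 -leqNgt.
  by move=> /(_ isT) h; rewrite eqb0 -leqNgt.
have z0 c : (N0 c == 0%N) = (k0 <= p0 c)%N.
  rewrite /N0 sum_nat_eq0; apply/forallP/bigmax_leqP => H j; have := H j; rewrite /= ?implyTb.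
    by rewrite eqb0 -leqNgt.
  by move=> /(_ isT) h; rewrite eqb0 -leqNgt.
have same c : (p0 c < k0)%N = (p1 c < k1)%N by rewrite !ltnNge -z0 -z1 NN.
have k0d : (k0 < d)%N.
  have d0 : (0 < d)%N by apply/card_gt0P; exists a.
  by rewrite -(prednK d0) ltnS; apply/bigmax_leqP => j _; rewrite -ltnS prednK.
have k1d : (k1 < d)%N.
  have d0 : (0 < d)%N by apply/card_gt0P; exists a.
  by rewrite -(prednK d0) ltnS; apply/bigmax_leqP => j _; rewrite -ltnS prednK.
(* This is where [0 < p0 b] enters, since [f m = b]. *)
have k00 : (0 < k0)%N.
  apply: leq_trans b0 _; case: m m1 fm {E Hf rel N1 N0 NN k1 z1 z0 same k1d} @k0 k0d => // m _ fm k0 _.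
  by rewrite -fm; apply: (leq_bigmax (ord_max : 'I_m.+1)).
have kk : k0 = k1.
  rewrite -(card_lt_bij bij0 (ltnW k0d)) -(card_lt_bij bij1 (ltnW k1d)).
  by apply: eq_card => c; rewrite !inE same.
by apply: (@admissible_neq k0); rewrite ?k00 // => c; rewrite same kk.
Qed.

End Orbit.
End Keane.

(** * Rauzy-Veech induction as a path *)

Section Link.
Variables (R : realType) (A : finType) (x0 : A).
Hypothesis d2 : (1 < #|A|)%N.
Local Notation d := #|A|.
Variables (pi0 pi1 : A -> 'I_d) (lam : A -> R).
Hypotheses (bij0 : bijective pi0) (bij1 : bijective pi1).
Hypothesis adm : admissible pi0 pi1.
Local Notation state := (rv_state pi0 pi1 lam).

Definition mkpos (p : A -> nat) : posmap A := [ffun a => inord (p a)].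
Definition cs n : cst A := (mkpos (rp0 (state n)), mkpos (rp1 (state n))).
(** [true] means that the top row wins; the strict inequality sends ties to [false], as in
    [rv_step]. *)
Definition bit n : bool := rlam (state n) (lastl x0 (cs n).2) < rlam (state n) (lastl x0 (cs n).1).

Lemma mkposE p a : (p a < d)%N -> mkpos p a = p a :> nat.
Proof. by move=> pa; rewrite ffunE inordK // ltnW. Qed.

Lemma pick_last p : (forall a, (p a < d)%N) -> vrow (mkpos p) ->
  [pick a | p a == d.-1] = Some (lastl x0 (mkpos p)).
Proof.
move=> pd vp; case: pickP => [a /eqP pa|/(_ (lastl x0 (mkpos p)))].
  by congr Some; apply: lastl_uniq => //; rewrite mkposE.
by rewrite -mkposE // lastlE // eqxx.
Qed.

Lemma newpos_lt (p : A -> nat) w a : (forall c, (p c < d)%N) -> vrow (mkpos p) -> (newpos p w a < d)%N.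
Proof.
move=> pd vp; have := vrow_lt (vrow_updr w vp) a; rewrite updrE //.
suff -> : newpos (fun c => mkpos p c : nat) w a = newpos p w a by [].
by rewrite /newpos !mkposE.
Qed.

Lemma mkpos_newpos (p : A -> nat) w : (forall c, (p c < d)%N) -> vrow (mkpos p) ->
  mkpos (newpos p w) = updr (mkpos p) w.
Proof.
move=> pd vp; apply/ffunP => a; apply: ord_inj; rewrite updrE // mkposE ?newpos_lt //.
by rewrite /newpos !mkposE.
Qed.

Lemma good_start : good (cs 0).
Proof.
have v (p : A -> 'I_d) : bijective p -> vrow (mkpos (fun a => p a : nat)).
  move=> bp; apply/andP; split.
    apply/injectiveP => a b /(congr1 val) /=; rewrite !mkposE // => h.
    by apply: (bij_inj bp); apply: ord_inj.
  by apply/forallP => a; rewrite mkposE.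
apply/and3P; split; [exact: v|exact: v|].
apply/forallP => k; apply/implyP => k0; apply/forallP => H.
apply: (admissible_neq adm (k := k)); first by rewrite k0 ltn_ord.
by move=> a; move: (H a); rewrite /cs /= !mkposE // => /eqP.
Qed.

Definition wf n := [/\ good (cs n), forall a, (rp0 (state n) a < d)%N &
  forall a, (rp1 (state n) a < d)%N].

(** Ties are not excluded here, so lengths are propagated only as nonnegative, in accordance with
    the closed cylinders. *)
Lemma rv_stepE n : wf n -> [/\ cs n.+1 = cstep x0 (bit n) (cs n),
  rv_data pi0 pi1 lam n.+1 = Some (winner x0 (bit n) (cs n), loser x0 (bit n) (cs n)),
  rlam (state n) = lstep x0 (bit n) (cs n) (rlam (state n.+1)),
  (forall a, 0 <= rlam (state n) a) -> forall a, 0 <= rlam (state n.+1) a & wf n.+1].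
Proof.
move=> [gs h0 h1]; have vn0 : vrow (cs n).1 by case/and3P: gs.
have vn1 : vrow (cs n).2 by case/and3P: gs.
have wl := winner_neq_loser x0 (bit n) gs (proj2 (andP (proj2 (andP gs)))) d2.
suff [E1 E2 E3 E4 [E5 E6]] : [/\ cs n.+1 = cstep x0 (bit n) (cs n),
  rv_data pi0 pi1 lam n.+1 = Some (winner x0 (bit n) (cs n), loser x0 (bit n) (cs n)),
  rlam (state n) = lstep x0 (bit n) (cs n) (rlam (state n.+1)),
  (forall a, 0 <= rlam (state n) a) -> forall a, 0 <= rlam (state n.+1) a &
  (forall a, (rp0 (state n.+1) a < d)%N) /\ (forall a, (rp1 (state n.+1) a < d)%N)].
  by split => //; split => //; rewrite E1; apply: good_step.
have sE : state n.+1 = (rv_step (state n)).1 by [].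
rewrite /rv_data -[n.+1.-1]/n /cs /bit /cs !sE.
move: wl; rewrite /bit; move: gs h0 h1 vn0 vn1; rewrite /cs; move: (state n).
case=> q0 q1 lm /= gs h0 h1 v0 v1 wl.
rewrite /rv_step !pick_last //; case: ltP wl => hlt /= wl; split => //=.
- by rewrite /cstep /= mkpos_newpos.
- apply/funext => a; move: wl; rewrite /lstep /loser /= => wl.
  by case: eqP => [->|//]; rewrite eq_sym (negbTE wl) subrK.
- by move=> l0 a; case: ifP => // _; rewrite subr_ge0 ltW.
- by split => // a; apply: newpos_lt.
- by rewrite /cstep /= mkpos_newpos.
- apply/funext => a; move: wl; rewrite /lstep /loser /= => wl.
  by case: eqP => [->|//]; rewrite eq_sym (negbTE wl) subrK.
- by move=> l0 a; case: ifP => // _; rewrite subr_ge0.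
- by split => // a; apply: newpos_lt.
Qed.

Lemma wf_all n : wf n.
Proof.
elim: n => [|n /rv_stepE [] //].
by split; [exact: good_start|move=> a /=|move=> a /=].
Qed.

Lemma cs_run n : cs n = crun x0 (cs 0) (mkseq bit n).
Proof.
elim: n => [|n IH] //; have [-> _ _ _ _] := rv_stepE (wf_all n).
by rewrite IH /mkseq -addn1 iotaD map_cat add0n crun_cat.
Qed.

Lemma lam_cyl n : (forall a, 0 <= lam a) -> cyl x0 (cs 0) (mkseq bit n) lam.
Proof.
move=> l0; exists (rlam (state n)).
  elim: n => [|n IH] //; have [_ _ _ H _] := rv_stepE (wf_all n); exact: H.
elim: n => [|n IH] //; have [_ _ E _ _] := rv_stepE (wf_all n).
by rewrite {1}IH E /mkseq -addn1 iotaD map_cat add0n lrun_cat /= -cs_run.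
Qed.

Lemma Vmx_step n : Vmx pi0 pi1 lam n.+1 = stepmx x0 R (bit n) (cs n).
Proof. by have [_ E _ _ _] := rv_stepE (wf_all n); rewrite /Vmx E. Qed.

Lemma rv_nameE n : rv_name pi0 pi1 lam n.+1 = Some (winner x0 (bit n) (cs n)).
Proof. by have [_ E _ _ _] := rv_stepE (wf_all n); rewrite /rv_name E. Qed.

(* The product of the elementary matrices of the steps m+1, ..., n. *)
Definition timemx m n := pathmx x0 R (cs m) (mkseq (fun i => bit (m + i)%N) (n - m)).

Lemma timemxE m k : prodmx [seq Vmx pi0 pi1 lam i | i <- iota m.+1 k] = timemx m (m + k).
Proof.
rewrite /timemx addKn; elim: k m => [|k IH] m //=.
rewrite IH Vmx_step addn0; congr (_ *m _).
have [<- _ _ _ _] := rv_stepE (wf_all m); congr (pathmx _ _ _ _).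
by rewrite -[1%N]add1n iotaDl -map_comp /mkseq; apply: eq_map => i /=; rewrite addSnnS.
Qed.

Lemma cs_shift m k : cs (m + k) = crun x0 (cs m) (mkseq (fun i => bit (m + i)%N) k).
Proof.
rewrite cs_run /mkseq iotaD map_cat crun_cat -cs_run add0n; congr crun.
by rewrite -[in LHS](addn0 m) iotaDl -map_comp.
Qed.

Lemma timemx_mul m n p : (m <= n)%N -> (n <= p)%N -> timemx m n *m timemx n p = timemx m p.
Proof.
move=> mn np; rewrite /timemx.
have -> : (p - m = (n - m) + (p - n))%N by lia.
rewrite /mkseq iotaD map_cat pathmx_cat add0n; congr (_ *m _).
rewrite -/(mkseq _ _) -cs_shift subnKC //; congr (pathmx _ _ _ _).
by rewrite -[in RHS](addn0 (n - m)%N) iotaDl -map_comp; apply: eq_map => i /=; rewrite addnA subnKC.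
Qed.

Lemma timemx_ge0 m n i j : 0 <= timemx m n i j. Proof. exact: pathmx_ge0. Qed.
Lemma timemx_diag m n i : 1 <= timemx m n i i. Proof. exact: pathmx_diag. Qed.
Lemma det_timemx m n : \det (timemx m n) = 1.
Proof. by apply: det_pathmx => //; case: (wf_all m). Qed.
Lemma timemx_id m : timemx m m = 1%:M. Proof. by rewrite /timemx subnn. Qed.

End Link.

(** * Roth type conditions *)

Section RothSplit.
Variables (R : realType) (A : finType) (pi0 pi1 : A -> 'I_#|A|) (lam : A -> R).
Local Notation d := #|A|.
Local Notation Q := (Qmx pi0 pi1 lam).
Local Notation S := (Sop pi0 pi1 lam).
Local Notation Gs := (Gamma_s pi0 pi1 lam).

Definition vec (v : A -> R) : 'cV[R]_d := \col_i v (enum_val i).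
Definition unvec (u : 'cV[R]_d) : A -> R := fun a => u (enum_rank a) 0.

Lemma unvecK u : vec (unvec u) = u.
Proof. by apply/matrixP => i j; rewrite mxE /unvec enum_valK [j]ord1. Qed.

Lemma vec_Sop k l v : vec (S k l v) = (Q k l)^T *m vec v.
Proof.
apply/matrixP => i j; rewrite !mxE /Sop enum_valK.
rewrite (reindex (enum_val : 'I_d -> A)) /=; last by apply: onW_bij; apply: enum_val_bij.
by apply: eq_bigr => b _; rewrite !mxE enum_valK.
Qed.

Lemma vnormE v : vnorm v = nrm (vec v).
Proof.
rewrite /vnorm /nrm (reindex (enum_val : 'I_d -> A)) /=; last by apply: onW_bij; apply: enum_val_bij.
by apply: eq_bigr => i _; rewrite big_ord1 mxE.
Qed.

Lemma vecD v w : vec (fun a => v a + w a) = vec v + vec w.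
Proof. by apply/matrixP => i j; rewrite !mxE. Qed.

(* The empty case is covered by sup set0 = 0. *)
Lemma opnorm_le (P : set (A -> R)) f (c : R) : 0 <= c ->
  (forall v, P v -> vnorm v <= 1 -> vnorm (f v) <= c) -> opnorm P f <= c.
Proof.
move=> c0 H; rewrite /opnorm; set X := [set _ | _ in _].
have [->|X0] := eqVneq X set0; first by rewrite sup0.
by apply: ge_sup; [exact/set0P|move=> _ [v [Pv v1] <-]; exact: H].
Qed.

Lemma Sop_le k l v : vnorm (S k l v) <= nrm (Q k l) * vnorm v.
Proof. by rewrite !vnormE vec_Sop -(nrm_tr (Q k l)) nrmM. Qed.

Lemma opnorm_le_nrm P k l : opnorm P (S k l) <= nrm (Q k l).
Proof.
apply: opnorm_le => [|v _ v1]; first exact: nrm_ge0.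
by apply: le_trans (Sop_le _ _ _) _; rewrite ler_piMr ?nrm_ge0.
Qed.

Lemma opnorm_ge k l : nrm (Q k l) <= d%:R * opnorm setT (S k l).
Proof.
rewrite /nrm [leRHS]mulr_natl -[in leRHS](card_ord d) -sumr_const; apply: ler_sum => i _.
pose v : A -> R := unvec (delta_mx i 0).
have -> : \sum_j `|Q k l i j| = vnorm (S k l v).
  rewrite vnormE vec_Sop unvecK -colE /nrm; apply: eq_bigr => j _.
  by rewrite big_ord1 !mxE.
apply: ub_le_sup; last first.
  exists v => //; split => //; rewrite vnormE unvecK /nrm.
  rewrite (bigD1 i) //= big_ord1 mxE !eqxx normr1 big1 ?addr0 // => j /negbTE ji.
  by rewrite big_ord1 mxE ji normr0.
exists (nrm (Q k l)) => _ [w [_ w1] <-].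
by apply: le_trans (Sop_le _ _ _) _; rewrite ler_piMr ?nrm_ge0.
Qed.

Lemma vnorm_ge0 (v : A -> R) : 0 <= vnorm v. Proof. by apply: sumr_ge0. Qed.

Lemma qnorm_le (G : set (A -> R)) v w : G w -> qnorm G v <= vnorm (fun a => v a + w a).
Proof.
move=> Gw; apply: ge_inf; last by exists w.
by exists 0 => _ [u _ <-]; apply: vnorm_ge0.
Qed.

Lemma qnorm_ge (G : set (A -> R)) v (c : R) : G !=set0 ->
  (forall w, G w -> c <= vnorm (fun a => v a + w a)) -> c <= qnorm G v.
Proof.
move=> [w Gw] H; apply: lb_le_inf; first by exists (vnorm (fun a => v a + w a)), w.
by move=> _ [u Gu <-]; apply: H.
Qed.

Lemma flat_inv_norm_le k l (c : R) : 0 <= c ->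
  (forall v, qnorm (Gs l) (S k l v) <= 1 -> qnorm (Gs k) v <= c) ->
  flat_inv_norm pi0 pi1 lam k l <= c.
Proof.
move=> c0 H; rewrite /flat_inv_norm; set X := [set _ | _ in _].
have [->|X0] := eqVneq X set0; first by rewrite sup0.
by apply: ge_sup; [exact/set0P|move=> _ [v v1 <-]; exact: H].
Qed.

(** [idx k] will be the number of words completed at the [k]-th accelerated time, and [Psi], [G],
    [Am] the splitting at these times. [sg] is the contraction rate on the kernel of [Psi]; [K] and
    [bb] bound the growth of norms from above and below, so that exponentials in [idx] become powers
    of norms. *)
Variables (p : nat) (idx : nat -> nat) (Psi : nat -> 'M[R]_(p, d)) (G : nat -> 'M[R]_(d, p))
  (Am : nat -> nat -> 'M[R]_p) (sg K bb : R).
Hypothesis idx_mono : forall k l, (k <= l)%N -> (idx k <= idx l)%N.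
Hypothesis idx_unb : forall N, exists k, (N <= idx k)%N.
Hypothesis PsiG : forall k, Psi k *m G k = 1%:M.
Hypothesis AmU : forall k l, (k <= l)%N -> Am k l \in unitmx.
Hypothesis PsiS : forall k l, (k <= l)%N -> Psi l *m (Q k l)^T = Am k l *m Psi k.
Hypothesis Hpsi : forall e : R, 0 < e -> exists2 C, 0 < C & forall k, nrm (Psi k) <= C * expR (e * (idx k)%:R).
Hypothesis HG : forall e : R, 0 < e -> exists2 C, 0 < C & forall k, nrm (G k) <= C * expR (e * (idx k)%:R).
Hypothesis HA : forall e : R, 0 < e -> exists2 C, 0 < C & forall k l, (k <= l)%N ->
  nrm (invmx (Am k l)) <= C * expR (e * (idx l)%:R).
Hypothesis sg0 : 0 < sg.
Hypothesis Hres : forall e : R, 0 < e -> exists2 C, 0 < C & forall k l, (k <= l)%N ->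
  nrm ((1%:M - G l *m Psi l) *m (Q k l)^T) <= C * expR (- sg * ((idx l)%:R - (idx k)%:R) + e * (idx l)%:R).
Hypothesis K0 : 0 < K.
Hypothesis Hup : forall k, exists2 C, 0 < C & forall l, (k <= l)%N -> nrm (Q k l) <= C * expR (K * (idx l)%:R).
Hypothesis bb0 : 0 < bb.
Hypothesis Hlow : forall k, exists2 C, 0 < C & forall l, (k <= l)%N -> C * expR (bb * (idx l)%:R) <= nrm (Q k l).

Lemma d_gt0 k l : 0 < nrm (Q k l) -> (0 < (d%:R : R)).
Proof.
rewrite ltr0n lt0n; apply: contraTneq => d0; rewrite -leNgt.
have := @nrm_bound R d d (Q k l) 0; rewrite mulr0; apply => i; have := ltn_ord i; rewrite {2}d0 //.
Qed.

Lemma opnorm_low k : exists2 C, 0 < C & forall l, (k <= l)%N -> C * expR (bb * (idx l)%:R) <= opnorm setT (S k l).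
Proof.
have [C C0 H] := Hlow k.
have d0 : 0 < (d%:R : R).
  by apply: (@d_gt0 k k); apply: lt_le_trans (H k (leqnn k)); rewrite mulr_gt0 ?expR_gt0.
exists (C / d%:R); first by rewrite divr_gt0.
move=> l kl; rewrite mulrAC ler_pdivrMr // mulrC [_ * d%:R]mulrC.
by rewrite mulrC; apply: le_trans (opnorm_ge k l); exact: H.
Qed.

Lemma residual k l v : (k <= l)%N -> Psi k *m vec v = 0 ->
  vec (S k l v) = (1%:M - G l *m Psi l) *m (Q k l)^T *m vec v.
Proof.
move=> kl v0; rewrite vec_Sop -mulmxA mulmxBl mul1mx -!mulmxA (mulmxA (Psi l)) PsiS //.
by rewrite -[Am k l *m _ *m _]mulmxA v0 !mulmx0 subr0.
Qed.

(* Vectors outside the kernel of Psi decay at most subexponentially, since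
   Am k l has a subexponential inverse. *)
Lemma Gamma_sE k : Gs k = [set v | Psi k *m vec v = 0].
Proof.
apply/seteqP; split => v /=; last first.
  move=> v0; have [C C0 H] := Hres (divr_gt0 sg0 (ltr0n R 2)).
  have [Cu Cu0 Hu] := Hup k; have [Cl Cl0 Hop] := opnorm_low k.
  (* As norms grow at rate at most [K], their power [- sig] decays at rate at most [sg / 2]; the
     other half of [sg] pays for the error in [Hres]. *)
  pose sig := sg / (2 * K); have sig0 : 0 < sig by rewrite divr_gt0 ?mulr_gt0.
  exists sig, (C * expR (sg * (idx k)%:R) * Cu `^ sig); split => //; split.
    by rewrite !mulr_gt0 ?expR_gt0 ?powR_gt0.
  move=> l kl; have op0 : 0 < opnorm setT (S k l).
    by apply: lt_le_trans (Hop l kl); rewrite mulr_gt0 ?expR_gt0.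
  rewrite [vnorm (S _ _ _)]vnormE residual //; apply: le_trans (nrmM _ _) _.
  rewrite -vnormE ler_wpM2r ?vnorm_ge0 //; apply: le_trans (H k l kl) _.
  rewrite powRN ler_pdivlMr ?powR_gt0 //.
  apply: (@le_trans _ _ (C * expR (- sg * ((idx l)%:R - (idx k)%:R) + sg / 2 * (idx l)%:R) *
      (Cu * expR (K * (idx l)%:R)) `^ sig)).
    rewrite ler_wpM2l ?mulr_ge0 ?expR_ge0 ?(ltW C0) // ge0_ler_powR ?nnegrE ?(ltW sig0) ?(ltW op0) //.
      by rewrite mulr_ge0 ?expR_ge0 ?ltW.
    by apply: le_trans (opnorm_le_nrm _ _ _) (Hu _ kl).
  rewrite powRM ?expR_ge0 ?(ltW Cu0) // -expRM.
  have -> : K * (idx l)%:R * sig = sg / 2 * (idx l)%:R by rewrite /sig; field; rewrite gt_eqF.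
  set X := expR (_ + _); set Y := Cu `^ sig; set Z := expR (sg / 2 * _).
  have -> : C * X * (Y * Z) = C * (X * Z) * Y by ring.
  rewrite ler_wpM2r ?powR_ge0 // ler_pM2l // /X /Z -expRD ler_expR; lra.
move=> [sig [C [sig0 [C0 H]]]]; apply: nrm0_eq.
have [Cl Cl0 Hop] := opnorm_low k.
(* Two factors of rate [e] occur; together they use half of the decay rate [bb * sig]. *)
pose e := bb * sig / 4; have e0 : 0 < e by rewrite divr_gt0 ?mulr_gt0.
have [C1 C10 H1] := Hpsi e0; have [C2 C20 H2] := HA e0.
apply: (@geometric_small R _ (C2 * C1 * (C * (Cl `^ sig)^-1 * vnorm v)) (expR (- (bb * sig / 2)))).
  by apply: expR_rate; rewrite oppr_lt0 divr_gt0 ?mulr_gt0.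
move=> N; have [l0 Hl0] := idx_unb N; pose l := maxn k l0.
have kl : (k <= l)%N by apply: leq_maxl.
have Nl : (N <= idx l)%N by apply: leq_trans Hl0 _; apply: idx_mono; apply: leq_maxr.
have op0 : 0 < opnorm setT (S k l).
  by apply: lt_le_trans (Hop l kl); rewrite mulr_gt0 ?expR_gt0.
have -> : Psi k *m vec v = invmx (Am k l) *m (Psi l *m vec (S k l v)).
  by rewrite vec_Sop (mulmxA (Psi l)) PsiS // -!mulmxA mulKmx ?AmU.
apply: le_trans (nrmM _ _) _; apply: le_trans (ler_wpM2l (nrm_ge0 _) (nrmM _ _)) _.
rewrite -vnormE.
have h3 : vnorm (S k l v) <= C * (Cl `^ sig)^-1 * expR (- (bb * sig) * (idx l)%:R) * vnorm v.
  apply: le_trans (H l kl) _; rewrite ler_wpM2r ?vnorm_ge0 // -!mulrA ler_pM2l //.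
  rewrite powRN mulNr expRN -invfM lef_pV2 ?posrE ?mulr_gt0 ?powR_gt0 ?expR_gt0 //.
  have -> : expR (bb * sig * (idx l)%:R) = expR (bb * (idx l)%:R) `^ sig by rewrite -expRM mulrAC.
  rewrite -powRM ?expR_ge0 ?(ltW Cl0) // ge0_ler_powR ?nnegrE ?(ltW sig0) ?(ltW op0) ?Hop //.
  by rewrite mulr_ge0 ?expR_ge0 ?ltW.
have h4 := ler_pM (nrm_ge0 _) (vnorm_ge0 _) (H1 l) h3.
have h5 := ler_pM (nrm_ge0 _) (mulr_ge0 (nrm_ge0 _) (vnorm_ge0 _)) (H2 k l kl) h4.
apply: le_trans h5 _.
set E := expR (e * _); set F := expR (- (bb * sig) * _).
have -> : C2 * E * (C1 * E * (C / Cl `^ sig * F * vnorm v)) =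
   C2 * C1 * (C / Cl `^ sig * vnorm v) * (E * E * F) by ring.
rewrite ler_wpM2l ?mulr_ge0 ?invr_ge0 ?powR_ge0 ?vnorm_ge0 ?(ltW C20) ?(ltW C10) ?(ltW C0) //.
rewrite -expRnat /E /F -!expRD ler_expR /e.
have : bb * sig / 2 * N%:R <= bb * sig / 2 * (idx l)%:R by rewrite ler_wpM2l ?ler_nat // divr_ge0 ?mulr_ge0 ?ltW.
lra.
Qed.

Lemma le_Qpow e : 0 < e -> exists2 C, 0 < C & forall l, expR (bb * e * (idx l)%:R) <= C * mnorm (Q 0 l) `^ e.
Proof.
move=> e0; have [C C0 H] := Hlow 0; exists (C `^ e)^-1; first by rewrite invr_gt0 powR_gt0.
move=> l; rewrite -ler_pdivrMl ?invr_gt0 ?powR_gt0 // invrK.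
have -> : expR (bb * e * (idx l)%:R) = expR (bb * (idx l)%:R) `^ e by rewrite -expRM mulrAC.
rewrite -powRM ?expR_ge0 ?(ltW C0) // ge0_ler_powR ?nnegrE ?(ltW e0) ?mulr_ge0 ?expR_ge0 ?(ltW C0) //.
  exact: nrm_ge0.
exact: H.
Qed.

(** [Psi] identifies the quotient by the stable space with coordinates in which the cocycle is [Am],
    whose inverse is subexponential; on the stable space only the residual acts. [eps] is divided by
    3 for the factors coming from [G], the inverse of [Am], and [Psi]. *)
Lemma roth_split eps : 0 < eps -> exists C : R, forall k l : nat, (k <= l)%N ->
  flat_inv_norm pi0 pi1 lam k l <= C * (mnorm (Q 0 l)) `^ eps /\
  opnorm (Gs k) (S k l) <= C * (mnorm (Q 0 l)) `^ eps.
Proof.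
move=> eps0; pose e := bb * eps / 3; have e0 : 0 < e by rewrite divr_gt0 ?mulr_gt0.
have [C1 C10 H1] := Hpsi e0; have [C2 C20 H2] := HA e0; have [C3 C30 H3] := HG e0.
have [C4 C40 H4] := Hres e0; have [C5 C50 H5] := le_Qpow eps0.
have E1 l : 1 <= expR (e * (idx l)%:R) by rewrite -[leLHS](@expR0 R) ler_expR mulr_ge0 // ltW.
have E0 l : 0 <= expR (e * (idx l)%:R) by apply: expR_ge0.
have E3 l : expR (e * (idx l)%:R) * expR (e * (idx l)%:R) * expR (e * (idx l)%:R) <= C5 * mnorm (Q 0 l) `^ eps.
  by apply: le_trans (H5 l); rewrite -!expRD ler_expR /e; lra.
have Q0 l : 0 <= mnorm (Q 0 l) `^ eps by apply: powR_ge0.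
exists ((C3 * C2 * C1 + C4) * C5) => k l kl.
have ekl : expR (e * (idx k)%:R) <= expR (e * (idx l)%:R).
  by rewrite ler_expR ler_wpM2l ?(ltW e0) // ler_nat idx_mono.
have c1 : 0 <= C3 * C2 * C1 by rewrite !mulr_ge0 ?ltW.
have tot0 : 0 <= (C3 * C2 * C1 + C4) * C5 * mnorm (Q 0 l) `^ eps.
  exact: mulr_ge0 (mulr_ge0 (addr_ge0 c1 (ltW C40)) (ltW C50)) (Q0 l).
have tot1 : (C3 * C2 * C1 + C4) * (expR (e * (idx l)%:R) * expR (e * (idx l)%:R) * expR (e * (idx l)%:R)) <=
    (C3 * C2 * C1 + C4) * C5 * mnorm (Q 0 l) `^ eps.
  by rewrite -[leRHS]mulrA ler_wpM2l // addr_ge0 // ltW.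
apply: (fun H => conj (le_trans (proj1 H) tot1) (le_trans (proj2 H) tot1)).
set E := expR (e * (idx l)%:R) in E1 E0 tot1 ekl *; have e1 : 1 <= E by apply: E1.
have E2 : E <= E * E * E by nra.
have E30 : 0 <= E * E * E by rewrite !mulr_ge0 ?expR_ge0.
have tot2 : 0 <= (C3 * C2 * C1 + C4) * (E * E * E) by rewrite mulr_ge0 // addr_ge0 // ltW.
split; last first.
  apply: opnorm_le => // v; rewrite Gamma_sE => v0 v1; rewrite vnormE residual //.
  apply: le_trans (nrmM _ _) _.
  rewrite -vnormE; apply: (@le_trans _ _ (C4 * E * 1)).
    apply: ler_pM; rewrite ?nrm_ge0 ?vnorm_ge0 //; apply: le_trans (H4 k l kl) _.
    rewrite ler_pM2l // ler_expR gerDr mulNr oppr_le0 mulr_ge0 ?(ltW sg0) //.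
    by rewrite subr_ge0 ler_nat idx_mono.
  rewrite mulr1 mulrDl; apply: ler_wpDl; first exact: mulr_ge0.
  by rewrite ler_pM2l.
apply: flat_inv_norm_le => // v vl.
have N0 : 0 < C1 * E by rewrite mulr_gt0 ?expR_gt0.
have PS : nrm (Psi l *m vec (S k l v)) <= C1 * E.
  rewrite -[leRHS]mul1r -ler_pdivrMr //; apply: le_trans vl; apply: qnorm_ge.
    by exists (fun=> 0); rewrite Gamma_sE /=; apply/matrixP => i j; rewrite !mxE big1 // => c _; rewrite mxE mulr0.
  move=> w; rewrite Gamma_sE => Gw; rewrite ler_pdivrMr // vnormE vecD mulrC.
  have -> : Psi l *m vec (S k l v) = Psi l *m (vec (S k l v) + vec w) by rewrite mulmxDr Gw addr0.
  by apply: le_trans (nrmM _ _) _; rewrite ler_wpM2r ?nrm_ge0.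
(* Replaces [v] by the representative [G k *m (Psi k *m vec v)] of its class, whose norm depends on
   [Psi k *m vec v] alone. *)
pose w := unvec (G k *m (Psi k *m vec v) - vec v).
have Gw : Gs k w.
  by rewrite Gamma_sE /= unvecK mulmxBr (mulmxA (Psi k)) PsiG mul1mx subrr.
apply: le_trans (qnorm_le v Gw) _; rewrite vnormE vecD unvecK addrC subrK.
apply: le_trans (nrmM _ _) _.
have -> : Psi k *m vec v = invmx (Am k l) *m (Psi l *m vec (S k l v)).
  by rewrite vec_Sop (mulmxA (Psi l)) PsiS // -!mulmxA mulKmx ?AmU.
have h1 : nrm (G k) <= C3 * E by apply: le_trans (H3 k) _; rewrite ler_pM2l.
have h2 : nrm (invmx (Am k l) *m (Psi l *m vec (S k l v))) <= C2 * E * (C1 * E).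
  by apply: le_trans (nrmM _ _) _; apply: ler_pM; rewrite ?nrm_ge0 // H2.
apply: le_trans (ler_pM (nrm_ge0 _) (nrm_ge0 _) h1 h2) _.
have -> : C3 * E * (C2 * E * (C1 * E)) = C3 * C2 * C1 * (E * E * E) by ring.
by rewrite ler_wpM2r // lerDl ltW.
Qed.

End RothSplit.

(** * Unimodular and nonnegative matrices *)

Section PositiveMatrices.
Variable R : realType.

Lemma invmx_bound n : exists2 C : R, 0 < C & forall M : 'M[R]_n, \det M = 1 ->
  nrm (invmx M) <= C * nrm M ^+ n.-1.
Proof.
exists ((n * n)%:R * (n.-1`!)%:R + 1) => [|M dM]; first by rewrite ltr_wpDl // mulr_ge0.
have uM : M \in unitmx by rewrite unitmxE dM unitr1.
apply: (@le_trans _ _ ((n * n)%:R * ((n.-1`!)%:R * nrm M ^+ n.-1))); last first.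
  by rewrite mulrA ler_wpM2r ?exprn_ge0 ?nrm_ge0 // lerDl.
apply: nrm_bound => i j; rewrite /invmx uM dM invr1 scale1r mxE /cofactor normrM normrX normrN1 expr1n mul1r.
by apply: det_bound => a b; rewrite !mxE; apply: nrm_entry.
Qed.

Lemma nrm_le m n (M N : 'M[R]_(m, n)) : (forall i j, 0 <= M i j <= N i j) -> nrm M <= nrm N.
Proof.
move=> H; apply: ler_sum => i _; apply: ler_sum => j _; have /andP [h1 h2] := H i j.
by rewrite !ger0_norm // (le_trans h1 h2).
Qed.

Lemma mulmx_ge_l n (M N : 'M[R]_n) i j : (forall i j, 0 <= M i j) -> (forall i j, 0 <= N i j) ->
  (forall i, 1 <= N i i) -> M i j <= (M *m N) i j.
Proof.
move=> M0 N0 N1; rewrite mxE (bigD1 j) //=; apply: ler_wpDr.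
  by apply: sumr_ge0 => k _; rewrite mulr_ge0.
by rewrite ler_peMr.
Qed.

Lemma mulmx_ge_r n (M N : 'M[R]_n) i j : (forall i j, 0 <= M i j) -> (forall i j, 0 <= N i j) ->
  (forall i, 1 <= M i i) -> N i j <= (M *m N) i j.
Proof.
move=> M0 N0 M1; rewrite mxE (bigD1 i) //=; apply: ler_wpDr.
  by apply: sumr_ge0 => k _; rewrite mulr_ge0.
by rewrite ler_peMl.
Qed.

Lemma nrm_minors1 n : exists2 C : R, 0 < C & forall M : 'M[R]_n, nrm M <= C * minors 1 M.
Proof.
exists ((n * n)%:R + 1) => [|M]; first by rewrite ltr_wpDl.
apply: (@le_trans _ _ ((n * n)%:R * minors 1 M)); last by rewrite ler_wpM2r ?minors_ge0 // lerDl.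
apply: nrm_bound => i j; apply: le_trans (minor_le M (fun=> i) (fun=> j)).
by rewrite det_mx11 mxE.
Qed.

Lemma tame0X (f : nat -> R) n : (forall l, 0 <= f l) -> tame0 0 f -> tame0 0 (fun l => f l ^+ n).
Proof.
move=> f0 Hf; elim: n => [|n IH].
  move=> e e0; exists 1 => // l; rewrite expr0 mul1r -[leLHS](@expR0 R) ler_expR mul0r add0r.
  by rewrite mulr_ge0 // ltW.
have := tame0M f0 (fun l => exprn_ge0 n (f0 l)) Hf IH; rewrite addr0.
by apply: tame0_le => l; rewrite exprS.
Qed.

End PositiveMatrices.

(** * Accelerated times compared with word times *)

Section Accel.
Variables (R : realType) (A : finType) (x0 : A).
Hypothesis d2 : (1 < #|A|)%N.
Local Notation d := #|A|.
Variables (pi0 pi1 : A -> 'I_d) (lam : A -> R).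
Hypotheses (bij0 : bijective pi0) (bij1 : bijective pi1).
Hypothesis adm : admissible pi0 pi1.
Hypothesis lp : forall a, 0 < lam a.
Local Notation cs := (cs pi0 pi1 lam).
Local Notation s0 := (cs 0).
Local Notation bit := (bit x0 pi0 pi1 lam).
Local Notation timemx := (timemx x0 pi0 pi1 lam).
Local Notation few := (few_names pi0 pi1 lam).
Local Notation n_acc := (n_acc pi0 pi1 lam).
Local Notation Z := (Zmx pi0 pi1 lam).
Local Notation Q := (Qmx pi0 pi1 lam).
Variables (gam : seq bool) (ws : nat -> seq bool).
Hypothesis gs0 : good s0.
Hypothesis gamE : crun x0 s0 gam = s0.
Hypothesis gam_pos : forall i j, 1 <= pathmx x0 R s0 gam i j.
Hypothesis gam_win : forall a, a \in winners x0 s0 gam.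
Hypothesis Hws : decb x0 s0 gam bit ws.
Local Notation cpl := (cpl x0 s0 gam).
Local Notation W k l := (wmx R x0 s0 (slice ws k l)).

Definition word_time n := size (flatten (mkseq ws n)).

Lemma ws_cpl n : cpl (ws n). Proof. by case: (Hws n) => /fr_cpl. Qed.

Lemma slice_all k l : all cpl (slice ws k l).
Proof. by apply/allP => _ /mapP [i _ ->]; apply: ws_cpl. Qed.

Lemma mkseqS (X : Type) (f : nat -> X) n : mkseq f n.+1 = rcons (mkseq f n) (f n).
Proof. by rewrite /mkseq -addn1 iotaD map_cat /= cats1. Qed.

Lemma cs_T n : cs (word_time n) = s0.
Proof.
rewrite (cs_run x0 d2 lam bij0 bij1 adm) /word_time; case: (Hws n) => _ <-.
have := (qw_flatten gamE (fun=> 1 : R) (slice_all 0 n)).2; by rewrite slice0.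
Qed.

Lemma bit_slice k l : (k <= l)%N ->
  mkseq (fun i => bit (word_time k + i)%N) (word_time l - word_time k) = flatten (slice ws k l).
Proof.
move=> kl; have E n : flatten (slice ws 0 n) = mkseq bit (word_time n).
  by rewrite slice0; case: (Hws n).
have := E l; rewrite -(slice_cat ws (leq0n k) kl) flatten_cat E.
have -> : (word_time l = word_time k + (word_time l - word_time k))%N.
  have := congr1 size (E l); rewrite -(slice_cat ws (leq0n k) kl) flatten_cat E size_cat !size_mkseq; lia.
rewrite [in RHS]/mkseq iotaD map_cat add0n -[in iota (word_time k)](addn0 (word_time k)) iotaDl -map_comp => /eqP.
rewrite eqseq_cat ?size_mkseq ?size_map ?size_iota // => /andP [_ /eqP ->].
by rewrite addKn; apply: eq_map => i /=.
Qed.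

Lemma timemx_W k l : (k <= l)%N -> timemx (word_time k) (word_time l) = W k l.
Proof. by move=> kl; rewrite /timemx bit_slice // cs_T. Qed.

Lemma winners_bit m k a : a \in winners x0 (cs m) (mkseq (fun i => bit (m + i)%N) k) ->
  exists2 j, (j < k)%N & winner x0 (bit (m + j)%N) (cs (m + j)) = a.
Proof.
elim: k => [|k IH] //; rewrite mkseqS -cats1 winners_cat mem_cat => /orP [/IH [j jk E]|].
  by exists j => //; apply: leqW.
rewrite -(cs_shift x0 d2 lam bij0 bij1 adm) /= inE => /eqP ->; by exists k.
Qed.

Lemma word_winner n a : exists j, [/\ (word_time n <= j)%N, (j < word_time n.+1)%N & winner x0 (bit j) (cs j) = a].
Proof.
have [|j jk E] := @winners_bit (word_time n) (word_time n.+1 - word_time n) a; last first.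
  exists (word_time n + j)%N; split; rewrite ?leq_addr //; move: jk; clear; lia.
rewrite bit_slice // cs_T /slice subSnn /= addn0 cats0.
by have [g -> sg] := cplP (ws_cpl n); rewrite winners_cat sg mem_cat gam_win orbT.
Qed.

Lemma T_lt n : (word_time n < word_time n.+1)%N.
Proof. by have [j [h1 h2 _]] := word_winner n x0; apply: leq_ltn_trans h2. Qed.

Lemma T_mono k l : (k <= l)%N -> (word_time k <= word_time l)%N.
Proof.
move=> /subnKC <-; elim: (l - k)%N => [|j IH]; first by rewrite addn0.
by rewrite addnS; apply: leq_trans IH (ltnW (T_lt _)).
Qed.

Lemma T_ge n : (n <= word_time n)%N.
Proof. by elim: n => // n IH; apply: leq_ltn_trans IH (T_lt n). Qed.

(* Every letter wins during each word, so a word never fits in an accelerated step. *)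
Lemma few_lt m i N : (m <= word_time i)%N -> few m N -> (N < word_time i.+1)%N.
Proof.
move=> mi; rewrite ltnNge /few_names; apply: contraTN => TN.
have -> : names_between pi0 pi1 lam m N = [set: A]%SET.
  apply/setP => a; rewrite !inE; have [j [j1 j2 ja]] := word_winner i a.
  have jN : (j.+1 < N.+1)%N by rewrite ltnS (leq_trans j2).
  apply/existsP; exists (Ordinal jN) => /=; rewrite ltnS (leq_trans mi) //=.
  by rewrite (rv_nameE x0 d2 lam bij0 bij1 adm) ja.
by rewrite cardsT -ltnNge; move: d2; case: (d).
Qed.

Lemma next_nP m : few m (next_n pi0 pi1 lam m) /\ (m < next_n pi0 pi1 lam m)%N.
Proof.
have B : exists B, forall N, few m N -> (N <= B)%N.
  by exists (word_time m.+1) => N /(few_lt (T_ge m)) /ltnW.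
rewrite /next_n; case: pselect => [B'|//]; case: (cid B') => b Hb.
case: ex_maxnP => N fN HN; split => //; apply: HN.
rewrite /few_names; apply: (@leq_trans 1); last by move: d2; case: (d) => // -[].
rewrite -(cards1 (winner x0 (bit m) (cs m))); apply: subset_leq_card.
apply/fintype.subsetP => a; rewrite !inE => /existsP [[i im] /= /andP [mi /eqP E]].
have Ei : i = m.+1 by lia.
by move: E; rewrite Ei (rv_nameE x0 d2 lam bij0 bij1 adm) => -[->].
Qed.

Lemma n_acc_lt k : (n_acc k < n_acc k.+1)%N. Proof. exact: (next_nP (n_acc k)).2. Qed.
Lemma n_acc_mono k l : (k <= l)%N -> (n_acc k <= n_acc l)%N.
Proof.
move=> /subnKC <-; elim: (l - k)%N => [|j IH]; first by rewrite addn0.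
by rewrite addnS; apply: leq_trans IH (ltnW (n_acc_lt _)).
Qed.
Lemma n_acc_ge k : (k <= n_acc k)%N.
Proof. by elim: k => // k IH; apply: leq_ltn_trans IH (n_acc_lt k). Qed.

Lemma idx_ex t : exists i, (word_time i <= t < word_time i.+1)%N.
Proof.
elim: t => [|t [i /andP [h1 h2]]]; first by exists 0%N; apply: leq_ltn_trans (T_lt 0).
have [h|h] := ltnP t.+1 (word_time i.+1); first by exists i; rewrite h (leqW h1).
exists i.+1; rewrite h; apply: leq_ltn_trans (T_lt i.+1); exact: h2.
Qed.

Definition idx k := projT1 (cid (idx_ex (n_acc k))).
Lemma idx_le k : (word_time (idx k) <= n_acc k)%N.
Proof. by rewrite /idx; case: cid => i /= /andP []. Qed.
Lemma idx_gt k : (n_acc k < word_time (idx k).+1)%N.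
Proof. by rewrite /idx; case: cid => i /= /andP []. Qed.

Lemma idx_mono k l : (k <= l)%N -> (idx k <= idx l)%N.
Proof.
move=> kl; rewrite leqNgt; apply/negP => /T_mono h.
by have := leq_trans (leq_ltn_trans (n_acc_mono kl) (idx_gt l)) h; rewrite ltnNge idx_le.
Qed.

Lemma idx_unb N : exists k, (N <= idx k)%N.
Proof.
exists (word_time N); rewrite leqNgt; apply/negP => /T_mono h.
by have := leq_trans (idx_gt (word_time N)) h; rewrite ltnNge n_acc_ge.
Qed.

(** An accelerated step starting inside word [idx k] cannot contain the whole following word. *)
Lemma n_acc_next k : (n_acc k.+1 < word_time (idx k).+2)%N.
Proof. by apply: few_lt (ltnW (idx_gt k)) _; case: (next_nP (n_acc k)). Qed.

Lemma ZE k : Z k.+1 = timemx (n_acc k) (n_acc k.+1).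
Proof. by rewrite /Zmx (timemxE x0 d2 lam bij0 bij1 adm) subnKC // ltnW // n_acc_lt. Qed.

Lemma QE k l : (k <= l)%N -> Q k l = timemx (n_acc k) (n_acc l).
Proof.
move=> kl; rewrite /Qmx -[in RHS](subnKC kl); move: (l - k)%N => j {kl}; elim: j k => [|j IH] k /=.
  by rewrite addn0 timemx_id.
by rewrite IH ZE (timemx_mul x0 d2 lam bij0 bij1 adm) ?addSnnS // n_acc_mono // ?leq_addr // addnS ltnS leq_addr.
Qed.

(** The extra factors are nonnegative with diagonal entries at least 1. *)
Lemma time_le m n p q i j : (p <= m)%N -> (m <= n)%N -> (n <= q)%N -> timemx m n i j <= timemx p q i j.
Proof.
move=> pm mn nq; rewrite -(timemx_mul x0 d2 lam bij0 bij1 adm pm (leq_trans mn nq)).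
rewrite -(timemx_mul x0 d2 lam bij0 bij1 adm mn nq).
apply: (@le_trans _ _ ((timemx m n *m timemx n q) i j)).
  by apply: mulmx_ge_l => *; [apply: timemx_ge0|apply: timemx_ge0|apply: timemx_diag].
apply: mulmx_ge_r => *; [apply: timemx_ge0| |apply: timemx_diag].
by rewrite (timemx_mul x0 d2 lam bij0 bij1 adm mn nq); apply: timemx_ge0.
Qed.

Lemma nrm_time_le m n p q : (p <= m)%N -> (m <= n)%N -> (n <= q)%N -> nrm (timemx m n) <= nrm (timemx p q).
Proof. by move=> pm mn nq; apply: nrm_le => i j; rewrite timemx_ge0 time_le. Qed.

Lemma W_cat k l m : (k <= l)%N -> (l <= m)%N -> W k l *m W l m = W k m.
Proof. by move=> kl lm; rewrite -(wmx_cat R gamE) ?slice_all // slice_cat. Qed.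

Lemma word_ge1 n i j : 1 <= W n n.+1 i j.
Proof.
rewrite /slice subSnn /wmx /= addn0 cats0.
have [g -> sg] := cplP (ws_cpl n); rewrite pathmx_cat sg; apply: le_trans (gam_pos i j) _.
by apply: mulmx_ge_r => *; [apply: pathmx_ge0|apply: pathmx_ge0|apply: pathmx_diag].
Qed.

(** A word matrix has all entries at least 1, so each word multiplies the smallest row sum by at
    least [d >= 2]. *)
Lemma nrm_W_ge k l : (k <= l)%N -> 2 ^+ (l - k) <= nrm (W k l).
Proof.
move=> kl; have W0 a b i j : 0 <= W a b i j by apply: pathmx_ge0.
have row m i : (m <= l)%N -> 2 ^+ m <= \sum_j W (l - m) l i j.
  elim: m i => [|m IH] i ml.
    rewrite expr0 subn0 (bigD1 i) //= -timemx_W // timemx_id mxE eqxx lerDl.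
    by apply: sumr_ge0 => j _; rewrite mxE.
  rewrite -(W_cat (l := l - m)); last by rewrite leq_subr. 
    have -> : \sum_j (W (l - m.+1) (l - m) *m W (l - m) l) i j =
        \sum_k W (l - m.+1) (l - m) i k * \sum_j W (l - m) l k j.
      under eq_bigr do rewrite mxE; rewrite exchange_big /=; apply: eq_bigr => c _.
      by rewrite mulr_sumr.
    apply: (@le_trans _ _ (\sum_(k < d) 2 ^+ m)); last first.
      apply: ler_sum => c _; rewrite -[leLHS]mul1r ler_pM ?exprn_ge0 ?IH // ?(ltnW ml) //.
      have -> : (l - m = (l - m.+1).+1)%N by move: ml; clear; lia.
      exact: word_ge1.
    by rewrite sumr_const card_ord exprS -[leRHS]mulr_natl ler_wpM2r ?exprn_ge0 // ler_nat.
  by move: ml; clear; lia.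
have := row (l - k)%N (enum_rank x0) (leq_subr _ _); rewrite subKn // => h.
apply: le_trans h _; rewrite /nrm [leRHS](bigD1 (enum_rank x0)) //=; apply: ler_wpDr.
  by apply: sumr_ge0 => i _; apply: sumr_ge0.
by apply: ler_sum => j _; apply: ler_norm.
Qed.

Section Norms.
Variable chi1 : R.
Hypothesis chi1_ge0 : 0 <= chi1.
Hypothesis HW : tame chi1 (fun k l => nrm (W k l)).

Lemma tame_word : tame0 0 (fun i => nrm (W i i.+1)).
Proof.
move=> e e0; have [C C0 H] := HW e0; exists (C * expR (chi1 + e)) => [|l].
  by rewrite mulr_gt0 ?expR_gt0.
apply: le_trans (H l l.+1 (leqnSn l)) _; rewrite -mulrA -expRD ler_pM2l // ler_expR -natr1; lra.
Qed.

Definition bb : R := ln 2.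
Lemma bb_gt0 : 0 < bb. Proof. by rewrite ln_gt0 // ltr1n. Qed.
Lemma exp_bb n : expR (bb * n%:R) = 2 ^+ n.
Proof. by rewrite expRnat /bb lnK // posrE. Qed.

Lemma Q_up k : exists2 C, 0 < C & forall l, (k <= l)%N ->
  nrm (Q k l) <= C * expR ((chi1 + 1) * (idx l)%:R).
Proof.
have [C C0 H] := HW ltr01; exists (C * expR (chi1 + 1)) => [|l kl]; first by rewrite mulr_gt0 ?expR_gt0.
rewrite QE //; apply: le_trans (nrm_time_le (leq0n _) (n_acc_mono kl) (ltnW (idx_gt l))) _.
have -> : timemx 0 (word_time (idx l).+1) = W 0 (idx l).+1 by rewrite -timemx_W.
apply: le_trans (H _ _ (leq0n _)) _; rewrite -mulrA -expRD ler_pM2l // ler_expR subr0 -natr1; lra.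
Qed.

Lemma Q_low k : exists2 C, 0 < C & forall l, (k <= l)%N ->
  C * expR (bb * (idx l)%:R) <= nrm (Q k l).
Proof.
exists (expR (- bb * (idx k).+1%:R)) => [|l kl]; first exact: expR_gt0.
rewrite -expRD QE //; have [h|h] := leqP (idx k).+1 (idx l).
  apply: le_trans (nrm_time_le (ltnW (idx_gt k)) (T_mono h) (idx_le l)).
  rewrite timemx_W //; apply: le_trans (nrm_W_ge h); rewrite -exp_bb ler_expR natrB //; lra.
apply: (@le_trans _ _ 1).
  rewrite -[leRHS](@expR0 R) ler_expR mulNr addrC subr_le0 ler_pM2l ?bb_gt0 // ler_nat; exact: ltnW.
apply: le_trans (nrm_entry _ (enum_rank x0) (enum_rank x0)).
by rewrite ger0_norm ?timemx_ge0 // timemx_diag.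
Qed.

(* The part of the current word completed at the acceleration time. *)
Definition Pk k := timemx (word_time (idx k)) (n_acc k).

Lemma Pk_le k : nrm (Pk k) <= nrm (W (idx k) (idx k).+1).
Proof. by rewrite -timemx_W // nrm_time_le // ?idx_le // ltnW // idx_gt. Qed.

Lemma Pk_unit k : Pk k \in unitmx.
Proof. by rewrite unitmxE (det_timemx x0 d2 lam bij0 bij1 adm) unitr1. Qed.

Lemma Q_word k l : (k <= l)%N -> Q k l = invmx (Pk k) *m W (idx k) (idx l) *m Pk l.
Proof.
move=> kl; rewrite -(timemx_W (idx_mono kl)) -mulmxA (timemx_mul x0 d2 lam bij0 bij1 adm) ?idx_le ?T_mono ?idx_mono //.
rewrite -(timemx_mul x0 d2 lam bij0 bij1 adm (idx_le k) (n_acc_mono kl)) QE //.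
by rewrite mulKmx ?Pk_unit.
Qed.

(** [Pk k] is dominated entrywise by the matrix of a single word, which is subexponential; its
    inverse is bounded by cofactors because the determinant is 1. *)
Lemma Pk_tame e : 0 < e -> exists2 C, 0 < C & forall k,
  nrm (Pk k) <= C * expR (e * (idx k)%:R) /\ nrm (invmx (Pk k)) <= C * expR (e * (idx k)%:R).
Proof.
move=> e0; have [C1 C10 H1] := tame_word e0; have [C2 C20 H2] := invmx_bound R d.
have [C3 C30 H3] := tame0X d.-1 (fun l => nrm_ge0 (W l l.+1)) tame_word e0.
exists (C1 + C2 * C3) => [|k]; first by rewrite addr_gt0 ?mulr_gt0.
have E0 := expR_ge0 (e * (idx k)%:R); split.
  rewrite mulrDl; apply: ler_wpDr; first by rewrite !mulr_ge0 // ltW.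
  by apply: le_trans (Pk_le k) _; apply: le_trans (H1 _) _; rewrite mul0r add0r.
rewrite mulrDl; apply: ler_wpDl; first by rewrite mulr_ge0 // ltW.
apply: le_trans (H2 _ (det_timemx x0 d2 lam bij0 bij1 adm _ _)) _; rewrite -mulrA ler_pM2l //.
apply: le_trans (le_trans (H3 (idx k)) _); last by rewrite mul0r add0r.
by rewrite lerXn2r ?nnegrE ?nrm_ge0 // Pk_le.
Qed.

Lemma roth_a eps : 0 < eps -> exists C : R, forall k,
  mnorm (Z k.+1) <= C * mnorm (Q 0 k) `^ eps.
Proof.
move=> eps0; pose e := bb * eps / 2; have e0 : 0 < e by rewrite divr_gt0 ?mulr_gt0 ?bb_gt0.
have [C C0 H] := tame_word e0; have [C5 C50 H5] := le_Qpow Q_low eps0.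
exists (C * C * expR e * C5) => k.
have -> : mnorm (Z k.+1) = nrm (Z k.+1) by [].
rewrite ZE; apply: le_trans (nrm_time_le (idx_le k) (ltnW (n_acc_lt k)) (ltnW (n_acc_next k))) _.
rewrite timemx_W; last by rewrite leqW.
rewrite -(W_cat (leqnSn (idx k)) (leqnSn _)); apply: le_trans (nrmM _ _) _.
apply: le_trans (ler_pM (nrm_ge0 _) (nrm_ge0 _) (H _) (H _)) _.
rewrite -[leRHS]mulrA; apply: le_trans (ler_wpM2l _ (H5 k)); last by rewrite !mulr_ge0 ?expR_ge0 ?ltW.
rewrite mulrACA -[leRHS]mulrA ler_pM2l ?mulr_gt0 // -!expRD ler_expR !mul0r !add0r -natr1 /e; lra.
Qed.

(** Conjugation by the transposes of [Pk k] carries the splitting from word times to accelerated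
    times with subexponential losses. *)
Lemma roth_c p (Psi0 : nat -> 'M[R]_(p, d)) (G0 : nat -> 'M[R]_(d, p)) (A0 : nat -> nat -> 'M[R]_p) sg :
  0 < sg -> (forall k, Psi0 k *m G0 k = 1%:M) -> (forall k i j, `|G0 k i j| <= 1) ->
  (forall k l, (k <= l)%N -> A0 k l \in unitmx /\ Psi0 l *m (W k l)^T = A0 k l *m Psi0 k) ->
  tame 0 (fun k l => nrm (invmx (A0 k l))) -> tame0 0 (fun k => nrm (Psi0 k)) ->
  tame (- sg) (fun k l => nrm ((1%:M - G0 l *m Psi0 l) *m (W k l)^T)) ->
  forall eps, 0 < eps -> exists C : R, forall k l : nat, (k <= l)%N ->
    flat_inv_norm pi0 pi1 lam k l <= C * (mnorm (Q 0 l)) `^ eps /\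
    opnorm (Gamma_s pi0 pi1 lam k) (Sop pi0 pi1 lam k l) <= C * (mnorm (Q 0 l)) `^ eps.
Proof.
move=> sg0 PsiG0 G01 A0P tA tPsi tR.
pose Psi k := Psi0 (idx k) *m (invmx (Pk k))^T; pose G k := (Pk k)^T *m G0 (idx k).
have PV k : (invmx (Pk k))^T *m (Pk k)^T = 1%:M by rewrite -trmx_mul mulmxV ?Pk_unit // trmx1.
have QT k l : (k <= l)%N -> (Q k l)^T = (Pk l)^T *m (W (idx k) (idx l))^T *m (invmx (Pk k))^T.
  by move=> kl; rewrite Q_word // !trmx_mul mulmxA.
have K0 : 0 < chi1 + 1 by rewrite ltr_wpDl.
have C0 : 0 <= ((d * p)%:R * 1 : R) by rewrite mulr_ge0.
apply: (@roth_split R A pi0 pi1 lam p idx Psi G (fun k l => A0 (idx k) (idx l)) sg (chi1 + 1) bb) => //.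
- exact: idx_mono.
- exact: idx_unb.
- by move=> k; rewrite /Psi /G -mulmxA (mulmxA (invmx _)^T) PV mul1mx.
- by move=> k l kl; case: (A0P _ _ (idx_mono kl)).
- move=> k l kl; have [_ E] := A0P _ _ (idx_mono kl).
  by rewrite QT // /Psi -!mulmxA (mulmxA (invmx _)^T) PV mul1mx (mulmxA (Psi0 _)) E mulmxA.
- move=> e e0; have e2 : 0 < e / 2 by rewrite divr_gt0.
  have [C1 C10 H1] := tPsi _ e2; have [C2 C20 H2] := Pk_tame e2.
  exists (C1 * C2) => [|k]; first exact: mulr_gt0.
  apply: le_trans (nrmM _ _) _; rewrite nrm_tr.
  apply: le_trans (ler_pM (nrm_ge0 _) (nrm_ge0 _) (H1 _) (proj2 (H2 _))) _.
  rewrite mulrACA -expRD ler_pM2l ?mulr_gt0 // ler_expR; lra.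
- move=> e e0; have [C2 C20 H2] := Pk_tame e0.
  exists (C2 * ((d * p)%:R * 1 + 1)) => [|k]; first by rewrite mulr_gt0 // ltr_wpDl.
  apply: le_trans (nrmM _ _) _; rewrite nrm_tr mulrAC.
  apply: ler_pM; rewrite ?nrm_ge0 //; first exact: (proj1 (H2 k)).
  by apply: ler_wpDr => //; apply: nrm_bound => i j; apply: G01.
- move=> e e0; have [C C_0 H] := tA e e0; exists C => // k l kl.
  by apply: le_trans (H _ _ (idx_mono kl)) _; rewrite mul0r add0r.
- move=> e e0; have e3 : 0 < e / 3 by rewrite divr_gt0.
  have [C1 C10 H1] := tR _ e3; have [C2 C20 H2] := Pk_tame e3.
  exists (C2 * C1 * C2) => [|k l kl]; first by rewrite !mulr_gt0.
  have -> : (1%:M - G l *m Psi l) *m (Q k l)^T =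
      (Pk l)^T *m ((1%:M - G0 (idx l) *m Psi0 (idx l)) *m (W (idx k) (idx l))^T) *m (invmx (Pk k))^T.
    rewrite QT // !mulmxBl !mulmxBr !mul1mx mulmxBl !mulmxA; congr (_ - _).
    by rewrite /G /Psi -!mulmxA (mulmxA (invmx (Pk l))^T) PV mul1mx !mulmxA.
  apply: le_trans (nrmM _ _) _; rewrite nrm_tr.
  have h1 : nrm ((Pk l)^T *m ((1%:M - G0 (idx l) *m Psi0 (idx l)) *m (W (idx k) (idx l))^T)) <=
      C2 * expR (e / 3 * (idx l)%:R) * (C1 * expR (- sg * ((idx l)%:R - (idx k)%:R) + e / 3 * (idx l)%:R)).
    apply: le_trans (nrmM _ _) _; rewrite nrm_tr; apply: ler_pM; rewrite ?nrm_ge0 //.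
      exact: (proj1 (H2 l)).
    exact: H1 (idx_mono kl).
  apply: le_trans (ler_pM (nrm_ge0 _) (nrm_ge0 _) h1 (proj2 (H2 k))) _.
  have kl' : ((idx k)%:R : R) <= (idx l)%:R by rewrite ler_nat idx_mono.
  have := ler_wpM2l (ltW e3) kl'; move: ((idx k)%:R : R) ((idx l)%:R : R) => a b ab.
  have -> : C2 * expR (e / 3 * b) * (C1 * expR (- sg * (b - a) + e / 3 * b)) * (C2 * expR (e / 3 * a)) =
    C2 * C1 * C2 * (expR (e / 3 * b) * expR (- sg * (b - a) + e / 3 * b) * expR (e / 3 * a)) by ring.
  rewrite ler_pM2l ?mulr_gt0 // -!expRD ler_expR; lra.
- exact: Q_up.
- exact: bb_gt0.
- exact: Q_low.
Qed.

Lemma qrun_lin s (x y : R) (u v : A -> R) h c :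
  qrun x0 s (fun a => x * u a + y * v a) h c = x * qrun x0 s u h c + y * qrun x0 s v h c.
Proof.
rewrite !(qrunE x0) !mulr_sumr -big_split; apply: eq_bigr => a _ /=; ring.
Qed.

Lemma qrun_ge0 s (u : A -> R) h : (forall a, 0 <= u a) -> forall a, 0 <= qrun x0 s u h a.
Proof. by move=> u0 a; rewrite (qrunE x0); apply: sumr_ge0 => b _; rewrite mulr_ge0 // pathmx_ge0. Qed.

Definition between (lo hi : R) (q y : A -> R) := forall a, lo * q a <= y a <= hi * q a.

Lemma between_run s lo hi q y h : between lo hi q y -> between lo hi (qrun x0 s q h) (qrun x0 s y h).
Proof.
move=> H a; have h1 := @qrun_ge0 s (fun a => 1 * y a + (- lo) * q a) h.
have h2 := @qrun_ge0 s (fun a => hi * q a + (- 1) * y a) h.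
have /h1 /(_ a) : forall a, 0 <= 1 * y a + - lo * q a.
  by move=> b; have /andP [] := H b; rewrite mul1r mulNr subr_ge0.
have /h2 /(_ a) : forall a, 0 <= hi * q a + - 1 * y a.
  by move=> b; have /andP [] := H b; rewrite mulN1r subr_ge0.
by rewrite !qrun_lin mulN1r subr_ge0 mul1r mulNr subr_ge0 => -> ->.
Qed.

(* Along gam every coordinate receives a definite share of every other one, so
   the oscillation of the ratios contracts. *)
Lemma between_word n lo hi q y : qpos q -> between lo hi q y ->
  exists lo' hi', between lo' hi' (qrun x0 s0 q (ws n)) (qrun x0 s0 y (ws n)) /\
    hi' - lo' = (hi - lo) * (1 - (gmax R x0 s0 gam + 1)^-1).
Proof.
move=> qp H; have [g -> sg] := cplP (ws_cpl n); rewrite !qrun_cat sg.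
have := between_run s0 g H; have : qpos (qrun x0 s0 q g) by apply: qrun_pos.
move: (qrun x0 s0 q g) (qrun x0 s0 y g) => {H qp}q {}y qp H.
pose g1 := gmax R x0 s0 gam + 1.
have g10 : 0 < g1 by rewrite ltr_wpDl // nrm_ge0.
pose t := tot q; have t0 : 0 < t by apply: tot_gt0 x0 _ qp.
pose U := \sum_a (y a - lo * q a); pose V := \sum_a (hi * q a - y a).
have UV : U + V = (hi - lo) * t.
  by rewrite /U /V /t /tot mulr_sumr -big_split; apply: eq_bigr => a _ /=; ring.
have u0 a : 0 <= y a - lo * q a by rewrite subr_ge0; case/andP: (H a).
have v0 a : 0 <= hi * q a - y a by rewrite subr_ge0; case/andP: (H a).
have U0 : 0 <= U by apply: sumr_ge0.
have V0 : 0 <= V by apply: sumr_ge0.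
have sum_le (u : A -> R) c : (forall a, 0 <= u a) -> \sum_a u a <= qrun x0 s0 u gam c.
  by move=> uu; rewrite (qrunE x0); apply: ler_sum => a _; rewrite ler_peMr.
have q_le c : qrun x0 s0 q gam c <= g1 * t.
  rewrite (qrunE x0) /t /tot mulr_sumr; apply: ler_sum => a _; rewrite mulrC ler_pM2r //.
  apply: le_trans (ler_norm _) _; apply: le_trans (nrm_entry _ _ _) _; by rewrite lerDl.
have gt0 : 0 < g1 * t by rewrite mulr_gt0.
exists (lo + U / (g1 * t)), (hi - V / (g1 * t)); split.
  move=> c; have hU := sum_le (fun a => 1 * y a + (- lo) * q a) c.
  have hV := sum_le (fun a => hi * q a + (- 1) * y a) c.
  have qc : 0 <= qrun x0 s0 q gam c by apply: qrun_ge0 => a; apply: ltW.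
  have Uq : U / (g1 * t) * qrun x0 s0 q gam c <= U.
    by rewrite mulrAC ler_pdivrMr // ler_wpM2l.
  have Vq : V / (g1 * t) * qrun x0 s0 q gam c <= V.
    by rewrite mulrAC ler_pdivrMr // ler_wpM2l.
  have eU : \sum_a (1 * y a + - lo * q a) = U by apply: eq_bigr => a _; rewrite mul1r mulNr.
  have eV : \sum_a (hi * q a + - 1 * y a) = V by apply: eq_bigr => a _; rewrite mulN1r.
  rewrite eU qrun_lin mul1r mulNr in hU; rewrite eV qrun_lin mulN1r in hV.
  have {}hU : U <= qrun x0 s0 y gam c - lo * qrun x0 s0 q gam c.
    by apply: hU => a; rewrite mul1r mulNr.
  have {}hV : V <= hi * qrun x0 s0 q gam c - qrun x0 s0 y gam c.
    by apply: hV => a; rewrite mulN1r.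
  by rewrite mulrDl mulrBl; apply/andP; split; lra.
have -> : hi - V / (g1 * t) - (lo + U / (g1 * t)) = (hi - lo) - (U + V) / (g1 * t) by ring.
by rewrite -/g1 UV; field; rewrite !gt_eqF.
Qed.

Lemma oscillation (v : A -> R) i : (forall a, `|v a| <= 1) ->
  exists lo hi, between lo hi (qrun x0 s0 (fun=> 1) (mkseq bit (word_time i))) (qrun x0 s0 v (mkseq bit (word_time i))) /\
    hi - lo = 2 * (1 - (gmax R x0 s0 gam + 1)^-1) ^+ i.
Proof.
move=> v1; have E n : mkseq bit (word_time n) = flatten (mkseq ws n) by case: (Hws n).
elim: i => [|i [lo [hi [H D]]]].
  exists (- 1), 1; split; last by rewrite expr0; ring.
  by move=> a /=; rewrite mulr1 mul1r -ler_norml.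
have sT : crun x0 s0 (flatten (mkseq ws i)) = s0 by rewrite -E -(cs_run x0 d2 lam bij0 bij1 adm) cs_T.
have qp : qpos (qrun x0 s0 (fun=> 1 : R) (mkseq bit (word_time i))) by apply: qrun_pos => a; apply: ltr01.
have [lo' [hi' [H' D']]] := between_word i qp H.
exists lo', hi'; split; last by rewrite D' D exprSr mulrA.
by rewrite !E mkseqS flatten_rcons !qrun_cat sT -E.
Qed.

Lemma Sop_qrun k v a : Sop pi0 pi1 lam 0 k v a = qrun x0 s0 v (mkseq bit (n_acc k)) a.
Proof.
rewrite /Sop QE // (qrunE x0); apply: eq_bigr => b _.
by rewrite mulrC /timemx subn0.
Qed.

Lemma roth_b : exists theta C : R, 0 < theta /\ 0 < C /\ forall k : nat,
  opnorm (Gamma_star lam) (Sop pi0 pi1 lam 0 k) <= C * (mnorm (Q 0 k)) `^ (1 - theta).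
Proof.
pose r : R := 1 - (gmax R x0 s0 gam + 1)^-1.
have g0 : 1 < gmax R x0 s0 gam + 1.
  by rewrite ltrDr (lt_le_trans ltr01) // gmax_ge1.
have r0 : 0 < r by rewrite subr_gt0 invf_lt1 // (lt_trans ltr01).
have r1 : r < 1 by rewrite ltrBlDr ltrDl invr_gt0 (lt_trans ltr01).
have [Cu Cu0 Hu] := Q_up 0; have K0 : 0 < chi1 + 1 by rewrite ltr_wpDl.
(* Norms grow at rate at most [chi1 + 1] per word and oscillations shrink by [r] per word, so
   [r ^+ idx k] is at most a constant times the power [- th] of the norm. *)
pose th := - ln r / (chi1 + 1).
have th0 : 0 < th by rewrite divr_gt0 // oppr_gt0 ln_lt0 // r0.
exists th, (2 * Cu `^ th); split => //; split; first by rewrite mulr_gt0 ?powR_gt0.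
move=> k; have Q0 : 0 < mnorm (Q 0 k).
  have [C C0 H] := Q_low 0; apply: lt_le_trans (H k (leq0n k)).
  by rewrite mulr_gt0 ?expR_gt0.
apply: opnorm_le; first by rewrite !mulr_ge0 ?powR_ge0.
move=> v Gv v1; have va a : `|v a| <= 1.
  by apply: le_trans v1; rewrite /vnorm (bigD1 a) //= lerDl sumr_ge0.
have [lo [hi [H D]]] := oscillation (idx k) va.
set h := mkseq bit (n_acc k).
have [mu mu0 lamE] := lam_cyl x0 d2 bij0 bij1 adm (n_acc k) (fun a => ltW (lp a)).
pose q := qrun x0 s0 (fun=> 1 : R) h; pose y := qrun x0 s0 v h.
have Hn : between lo hi q y.
  rewrite /q /y /h -(subnKC (idx_le k)) /mkseq iotaD map_cat !qrun_cat.
  exact: between_run.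
(* [mu] are the induced lengths, and pairing with them is invariant: it gives the sum of
   [lam a * v a] for [y] and the positive total length for [q]. Hence [lo <= 0 <= hi]. *)
have sy : \sum_a y a * mu a = 0.
  have Gv' : \sum_a lam a * v a = 0 := Gv.
  by rewrite -lrun_dual -lamE -[RHS]Gv'; apply: eq_bigr => a _; rewrite mulrC.
have sq : 0 < \sum_a q a * mu a.
  rewrite -lrun_dual -lamE (bigD1 x0) //= mul1r ltr_pwDl ?lp //.
  by apply: sumr_ge0 => a _; rewrite mul1r ltW.
have q0 a : 0 <= q a by apply: qrun_ge0.
have lo0 : lo <= 0.
  have : lo * (\sum_a q a * mu a) <= 0; last by rewrite pmulr_lle0.
  rewrite -[leRHS]sy big_distrr; apply: ler_sum => a _ /=.
  by rewrite mulrA ler_wpM2r //; case/andP: (Hn a).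
have hi0 : 0 <= hi.
  have : 0 <= hi * (\sum_a q a * mu a); last by rewrite pmulr_lge0.
  rewrite -[leLHS]sy big_distrr; apply: ler_sum => a _ /=.
  by rewrite mulrA ler_wpM2r //; case/andP: (Hn a).
have yq a : `|y a| <= 2 * r ^+ idx k * q a.
  rewrite -D ler_norml; have /andP [h1 h2] := Hn a; have qa := q0 a.
  have h3 := mulr_le0_ge0 lo0 qa; have h4 := mulr_ge0 hi0 qa.
  by rewrite mulrBl; apply/andP; split; lra.
have totq : \sum_a q a = mnorm (Q 0 k).
  rewrite /mnorm QE // exchange_big /= (reindex (enum_val : 'I_d -> A)) /=; last by apply: onW_bij; apply: enum_val_bij.
  apply: eq_bigr => j _; rewrite /q (qrunE x0) (reindex (enum_val : 'I_d -> A)) /=; last by apply: onW_bij; apply: enum_val_bij.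
  by apply: eq_bigr => i _; rewrite mul1r !enum_valK ger0_norm ?timemx_ge0 // /timemx subn0.
apply: (@le_trans _ _ (2 * r ^+ idx k * mnorm (Q 0 k))).
  rewrite -totq mulr_sumr; apply: ler_sum => a _; rewrite Sop_qrun; exact: yq.
have -> : mnorm (Q 0 k) `^ (1 - th) = mnorm (Q 0 k) * (mnorm (Q 0 k) `^ th)^-1.
  have Qn : mnorm (Q 0 k) != 0 by rewrite gt_eqF.
  by rewrite powRD ?Qn ?implybT // -powRN powRr1 // ltW.
rewrite -!mulrA ler_pM2l // mulrCA [leLHS]mulrC ler_pM2l // ler_pdivlMr ?powR_gt0 //.
have : mnorm (Q 0 k) `^ th <= (Cu * expR ((chi1 + 1) * (idx k)%:R)) `^ th.
  by rewrite ge0_ler_powR ?nnegrE ?(ltW th0) ?(ltW Q0) ?mulr_ge0 ?expR_ge0 ?(ltW Cu0) //; exact: Hu.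
rewrite powRM ?expR_ge0 ?(ltW Cu0) // -expRM.
have -> : (chi1 + 1) * (idx k)%:R * th = - (ln r * (idx k)%:R) by rewrite /th; field; rewrite gt_eqF.
rewrite expRN expRnat lnK ?posrE // => hh.
apply: le_trans (ler_wpM2l _ hh) _; first by rewrite exprn_ge0 // ltW.
by rewrite mulrCA mulfV ?mulr1 // expf_neq0 // gt_eqF.
Qed.

End Norms.
End Accel.

(** * The exceptional set *)

Section Assembly.
Variables (R : realType) (A : finType) (x0 : A).
Hypothesis d2 : (1 < #|A|)%N.
Local Notation d := #|A|.
Variables (pi0 pi1 : A -> 'I_d).
Hypotheses (bij0 : bijective pi0) (bij1 : bijective pi1).
Hypothesis adm : admissible pi0 pi1.
Variable gam : seq bool.

Lemma minors_over n p (M : 'M[R]_n) : (n < p)%N -> minors p M = 0.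
Proof.
move=> np; apply: big1 => f _; apply: big1 => g _; apply/eqP; rewrite normr_eq0; apply/eqP.
have /injectivePn [i [j ij fij]] : ~~ injectiveb f.
  by apply/negP => /injectiveP /leq_card; rewrite !card_ord leqNgt np.
by apply: (determinant_alternate ij) => k; rewrite !mxE fij.
Qed.

Lemma minors0_bound n : exists C : R, forall M : 'M[R]_n, minors 0 M <= C.
Proof.
have [C C0 H] := minors_bound R 0 n n; exists C => M.
by have := H M (nrm M) (nrm_ge0 M) (nrm_entry M); rewrite expr0 mulr1.
Qed.

Section Lambda.
Variable lam : A -> R.
Hypothesis lp : forall a, 0 < lam a.
Hypothesis indep : forall c : A -> int, \sum_a (c a)%:~R * lam a = 0 -> forall a, c a = 0.
Local Notation s0 := (cs pi0 pi1 lam 0).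
Hypothesis gs0 : good s0.
Hypothesis gamE : crun x0 s0 gam = s0.
Hypothesis gam_pos : forall i j, 1 <= pathmx x0 R s0 gam i j.
Hypothesis gam_win : forall a, a \in winners x0 s0 gam.
Variable ws : nat -> seq bool.
Hypothesis Hws : decb x0 s0 gam (bit x0 pi0 pi1 lam) ws.
Local Notation W k l := (wmx R x0 s0 (slice ws k l)).
Variable chi : nat -> R.
Hypothesis chi_ge0 : forall p, 0 <= chi p.
Hypothesis rates : forall p, (0 < p)%N -> (p <= d)%N ->
  (forall e, 0 < e -> exists C, forall k l, (k <= l)%N ->
    ln (minors p (W k l)) <= (chi p + e) * (l - k)%:R + e * l%:R + C) /\
  (forall e, 0 < e -> exists k, forall n, (chi p - e) * n%:R <= ln (minors p (W k (k + n)))).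

Lemma W_minors_ge1 p k l : (p <= d)%N -> 1 <= minors p (W k l).
Proof. exact: minors_pathmx_ge1. Qed.

Lemma tame_minors p : (0 < p)%N -> (p <= d)%N -> tame (chi p) (fun k l => minors p (W k l)).
Proof.
move=> p0 pd e e0; have e2 : 0 < e / 2 by rewrite divr_gt0.
have [H _] := rates p0 pd; have [C HC] := H _ e2.
exists (expR C) => [|k l kl]; first exact: expR_gt0.
have m0 : 0 < minors p (W k l) by apply: lt_le_trans (W_minors_ge1 k l pd).
rewrite -[leLHS]lnK ?posrE // -expRD ler_expR; apply: le_trans (HC k l kl) _.
rewrite natrB //; have k0 : 0 <= (k%:R : R) by [].
have := mulr_ge0 (ltW e2) k0; lra.
Qed.

(** The lower bound in [rates] starts at some word [k]; the matrix [W 0 k] is fixed, and multiplying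
    by its inverse costs a constant. *)
Lemma low_minors p : (0 < p)%N -> (p <= d)%N -> forall e : R, 0 < e -> exists2 C : R, 0 < C &
  forall l, C * expR (chi p * l%:R - e * l%:R) <= minors p (W 0 l).
Proof.
move=> p0 pd e e0; have [_ H] := rates p0 pd; have [k Hk] := H e e0.
pose K := minors p (invmx (W 0 k)); have K0 : 0 <= K by apply: minors_ge0.
pose c := chi p - e; pose E := expR (- (`|c| * k%:R)); have E0 : 0 < E by apply: expR_gt0.
have K1 : 0 < K + 1 by rewrite ltr_wpDl.
exists (E / (K + 1)) => [|l]; first by rewrite divr_gt0.
rewrite -mulrBl -/c mulrAC ler_pdivrMr // /E -expRD.
have m1 := W_minors_ge1 0 l pd.
have c1 := ler_norm c; have c2 : - c <= `|c| by rewrite -normrN ler_norm.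
have k0 : 0 <= (k%:R : R) by []; have l0 : 0 <= (l%:R : R) by [].
have h1 := ler_wpM2r k0 c1; have h2 := ler_wpM2r k0 c2.
have [lk|kl] := leqP l k.
  apply: (@le_trans _ _ 1).
    rewrite -[leRHS](@expR0 R) ler_expR; have lk' : (l%:R : R) <= k%:R by rewrite ler_nat.
    have h3 := ler_wpM2l (normr_ge0 c) lk'; have h4 := ler_wpM2r l0 c1; lra.
  by apply: le_trans m1 _; rewrite ler_peMr ?minors_ge0 // lerDr.
have kl' := ltnW kl; have := Hk (l - k)%N; rewrite subnKC // -/c => hk.
have mkl : 0 < minors p (W k l) by apply: lt_le_trans (W_minors_ge1 k l pd).
have step : minors p (W k l) <= minors p (W 0 l) * (K + 1).
  have -> : W k l = invmx (W 0 k) *m W 0 l.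
    rewrite -(W_cat gamE Hws (leq0n k) kl') mulKmx // unitmxE.
    by rewrite /wmx (det_pathmx R x0 d2) ?unitr1.
  apply: le_trans (minors_mul _ _ _) _; rewrite mulrC ler_wpM2l ?minors_ge0 // lerDl //.
apply: le_trans step; rewrite -[leRHS]lnK ?posrE // ler_expR; apply: le_trans hk.
by rewrite natrB //; lra.
Qed.

Lemma tame_word_norm : tame (chi 1) (fun k l => nrm (W k l)).
Proof.
have [C C0 H] := nrm_minors1 R d.
apply: (@tame_le _ _ _ (fun k l => C * minors 1 (W k l))) => [k l _|]; first exact: H.
rewrite -[chi 1]add0r; apply: tameM => [k l _|k l _||].
- exact: ltW.
- exact: minors_ge0.
- exact: tame_cst.
- by apply: tame_minors => //; apply: ltnW.
Qed.

(** The last maximum is taken, because the rate must drop strictly at the next order for the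
    complement to be contracted. *)
Lemma split_order : exists p, [/\ (p < d)%N, (forall j, (j < d)%N -> chi j.+1 <= chi p.+1) &
  forall j, (p < j)%N -> (j < d)%N -> chi j.+1 < chi p.+1].
Proof.
pose P j := (j < d)%N && [forall i : 'I_d, chi i.+1 <= chi j.+1].
have exP : exists j, P j.
  have [i Hi] := fin_argmax (fun i : 'I_d => chi i.+1) (enum_rank x0).
  by exists i; rewrite /P ltn_ord; apply/forallP.
have ubP j : P j -> (j <= d)%N by case/andP => /ltnW.
case: (ex_maxnP exP ubP) => p /andP [pd /forallP Hp] pmax.
have Hp' j : (j < d)%N -> chi j.+1 <= chi p.+1 by move=> jd; apply: (Hp (Ordinal jd)).
exists p; split => // j pj jd; rewrite ltNge; apply/negP => h.
have : (j <= p)%N; last by rewrite leqNgt pj.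
apply: pmax; rewrite /P jd; apply/forallP => i; exact: le_trans (Hp i) h.
Qed.

Lemma roth_generic : roth_type pi0 pi1 lam.
Proof.
have tW := tame_word_norm; have c10 := chi_ge0 1.
split; first exact: keane_indep.
split; first by move=> eps eps0; apply: (roth_a d2 bij0 bij1 adm gs0 gamE gam_pos gam_win Hws tW).
split; first exact: (roth_b d2 bij0 bij1 adm lp gs0 gamE gam_pos gam_win Hws c10 tW).
have [p [pd pmax plt]] := split_order.
(* If [p.+1 = d], minors of order [p.+2] vanish and any rate below [chi p.+1] will do. *)
have [c [cb Hc]] : exists c, c < chi p.+1 /\ tame c (fun k l => minors p.+2 (W k l)^T).
  have [h|h] := leqP p.+2 d.
    exists (chi p.+2); split; first exact: plt.
    by apply: tame_le (tame_minors _ h) => // k l _; rewrite minors_tr.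
  exists (chi p.+1 - 1); split; first by rewrite ltrBlDr ltrDl.
  move=> e e0; exists 1 => // k l _; rewrite minors_over // mul1r; exact: expR_ge0.
(* For [p = 0], minors of order 0 are bounded, which gives the rate 0. *)
have [a [ab Ha]] : exists a, a <= chi p.+1 /\ tame a (fun k l => minors p (W k l)^T).
  case: p pd pmax plt {c cb Hc} => [|p] pd pmax plt.
    exists 0; split; first exact: chi_ge0.
    have [C H] := minors0_bound d; apply: tame_le (tame_cst C) => k l _; exact: H.
  exists (chi p.+1); split; first by apply: pmax; apply: ltnW.
  by apply: tame_le (tame_minors _ (ltnW pd)) => // k l _; rewrite minors_tr.
have Hb : tame (chi p.+1) (fun k l => minors p.+1 (W k l)^T).
  by apply: tame_le (tame_minors _ pd) => // k l _; rewrite minors_tr.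
have Hl e : 0 < e -> exists2 C : R, 0 < C & forall l,
    C * expR (chi p.+1 * l%:R - e * l%:R) <= minors p.+1 (W 0 l)^T.
  move=> e0; have [C C0 H] := low_minors (ltn0Sn p) pd e0; exists C => // l.
  by rewrite minors_tr.
have Hx : tame 0 (fun _ l => nrm (W l l.+1)^T).
  by apply: tame_le (tame_snd (tame_word tW)) => k l _; rewrite nrm_tr.
have Scat k l m : (k <= l)%N -> (l <= m)%N -> (W l m)^T *m (W k l)^T = (W k m)^T.
  by move=> kl lm; rewrite -trmx_mul (W_cat gamE Hws).
have Sid k : (W k k)^T = 1%:M by rewrite /slice subnn /wmx /= trmx1.
have [Psi [G [Am [[PsiG G1] AP tA tPsi tR]]]] :=
  splitting (enum_rank x0) Scat Ha Hb Hc Hl Hx ab cb Sid.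
rewrite -opprB in tR.
have sg0 : 0 < chi p.+1 - c by rewrite subr_gt0.
move=> eps eps0.
exact: (roth_c d2 bij0 bij1 adm gs0 gamE gam_pos gam_win Hws c10 tW sg0 PsiG G1 AP tA tPsi tR eps0).
Qed.

End Lambda.

Definition start_cst : cst A := (mkpos (fun a => pi0 a : nat), mkpos (fun a => pi1 a : nat)).
Hypothesis gs0 : good start_cst.
Hypothesis gamE : crun x0 start_cst gam = start_cst.
Hypothesis gam_pos : forall i j, 1 <= pathmx x0 R start_cst gam i j.
Hypothesis gam_win : forall a, a \in winners x0 start_cst gam.

Definition rated p (ws : nat -> seq bool) := (0 < p)%N -> (p <= d)%N ->
  (forall e, 0 < e -> exists C, forall k l, (k <= l)%N ->
    lnm R x0 start_cst p (slice ws k l) <= (rate R x0 start_cst gam p + e) * (l - k)%:R + e * l%:R + C) /\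
  (forall e, 0 < e -> exists k, forall n,
    (rate R x0 start_cst gam p - e) * n%:R <= lnm R x0 start_cst p (slice ws k (k + n))).

Lemma almost_rated : almost R x0 start_cst gam (fun ws => forall p, rated p ws).
Proof.
apply: almost_and => p; have [|np] := boolP ((0 < p) && (p <= d))%N; last first.
  move=> K; rewrite -[RHS](ov0 R x0); congr ov; apply/seteqP; split => // v [_ [ws _]]; apply.
  by move=> p0 pd; rewrite p0 pd in np.
move=> /andP [p0 pd]; apply: almost_sub (almost_rate d2 gs0 gamE gam_pos p0 pd) => ws _ H _ _.
exact: H.
Qed.

(** Three exceptional sets: data with a decoding whose rates are wrong, data having a path that
    cannot be cut into words, and data satisfying a rational relation. The first two are exhausted
    by cubes of integer size, the third by countably many hyperplanes. *)
Lemma roth_ae : exists N : set (A -> R), lebesgue_null N /\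
  forall lam : A -> R, (forall a, 0 < lam a) -> ~ N lam -> roth_type pi0 pi1 lam.
Proof.
pose N1 K : set (A -> R) := [set v | cube K%:R v /\
  exists2 ws, dec x0 start_cst gam v ws & ~ forall p, rated p ws].
pose N2 (K : nat) : set (A -> R) := [set v | cube K%:R v /\ exists b : nat -> bool,
  (forall n, cyl x0 start_cst (mkseq b n) v) /\ ~ exists ws, decb x0 start_cst gam b ws].
pose N3 (c : {ffun A -> int}) : set (A -> R) :=
  if [exists a, c a != 0] then [set v | \sum_a (c a)%:~R * v a = 0] else set0.
have n1 : ov [set v | exists K, N1 K v] = 0.
  by apply: (ov_countable x0) => K; apply: almost_rated.
have n2 : ov [set v | exists K, N2 K v] = 0.
  by apply: (ov_countable x0) => K; apply: almost_dec.
have n3 : ov [set v | exists c, N3 c v] = 0.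
  apply: (ov_countable x0) => c; rewrite /N3; case: existsP => [[a ca]|_]; last exact: (ov0 R x0).
  by apply: (ov_hyperplane x0); exists a; rewrite intr_eq0.
pose N := [set v | exists K, N1 K v] `|` ([set v | exists K, N2 K v] `|` [set v | exists c, N3 c v]).
exists N; split.
  apply: ov0_null; apply/eqP; rewrite eq_le ov_ge0 andbT.
  apply: le_trans (ovU x0 _ _) _; rewrite n1 add0e.
  by apply: le_trans (ovU x0 _ _) _; rewrite n2 n3 add0e.
move=> lam lp nN.
pose K := Num.bound (\sum_a lam a).
have cK : cube K%:R lam.
  split => [a|]; first exact: ltW.
  by apply/ltW/archi_boundP/sumr_ge0 => a _; apply: ltW.
have indep (c : A -> int) : \sum_a (c a)%:~R * lam a = 0 -> forall a, c a = 0.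
  move=> h a; apply/eqP; apply: contrapT => /negP ca; apply: nN; right; right.
  exists (finfun c); rewrite /N3; case: existsP => [_|nex]; last by case: nex; exists a; rewrite ffunE.
  by rewrite /= -[RHS]h; apply: eq_bigr => b _; rewrite ffunE.
have l0 a : 0 <= lam a by apply: ltW.
have [ws Hws] : exists ws, decb x0 start_cst gam (bit x0 pi0 pi1 lam) ws.
  apply: contrapT => no; apply: nN; right; left; exists K; split => //.
  by exists (bit x0 pi0 pi1 lam); split => // n; apply: (lam_cyl x0 d2 bij0 bij1 adm n l0).
have Hr : forall p, rated p ws.
  apply: contrapT => no; apply: nN; left; exists K; split => //; exists ws => // n.
  have [fw E] := Hws n; split => //; rewrite E; exact: (lam_cyl x0 d2 bij0 bij1 adm _ l0).
apply: (roth_generic lp indep gs0 gamE gam_pos gam_win Hws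
  (chi := fun p => if ((0 < p) && (p <= d))%N then rate R x0 start_cst gam p else 0)).
  by move=> p; case: ifP => // /andP [p0 pd]; apply: (rate_ge0 d2 gs0 gamE gam_pos p0 pd).
by move=> p p0 pd; rewrite p0 pd; apply: Hr.
Qed.

End Assembly.

Theorem theoremB (R : realType) (A : finType) (hd : (2 <= #|A|)%N)
  (pi0 pi1 : A -> 'I_#|A|) (bij0 : bijective pi0) (bij1 : bijective pi1)
  (adm : admissible pi0 pi1) :
  exists N : set (A -> R), lebesgue_null N /\
    forall lam : A -> R, (forall a, 0 < lam a) -> ~ N lam ->
      roth_type pi0 pi1 lam.
Proof.
have /card_gt0P [x0 _] : (0 < #|A|)%N by apply: leq_trans hd.
have gs0 : good (start_cst pi0 pi1) by apply: (good_start (fun=> 0 : R) bij0 bij1 adm).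
have [gam [gamE gam_pos gam_win]] := positive_loop R x0 hd gs0.
exact: (roth_ae hd bij0 bij1 adm gs0 gamE gam_pos gam_win).
Qed.
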